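(* Let $d\geqslant2$, $\frac12\leqslant\frac1q<\frac{d+1}4$ and $R>2$. Suppose that $f,g\in L^1(\mathbb{R}^d;\mathbb{C}^N)$ have Fourier support in the ball $\{|\xi|\leqslant R\}$. Then $$\sup_{|m|\leqslant1}\big\|\overline{\mathcal{U}_m(t)f}\,\mathcal{U}_m(t)g\big\|_{L^q_tL^2_x}\lesssim R^{\frac{3d}2-\frac1q}\|f\|_{L^1_x}\|g\|_{L^1_x}.$$
   Context: Spinors take values in $\mathbb{C}^N$ with Dirac matrices $\gamma^\mu\in\mathbb{C}^{N\times N}$, $\gamma^\mu\gamma^\nu+\gamma^\nu\gamma^\mu=2\eta^{\mu\nu}I$, $\eta=\mathrm{diag}(1,-1,\dots,-1)$ (standard representations for $d=2,3$); $\overline\varphi\psi=\varphi^\dagger\gamma^0\psi$ (a scalar). $\mathcal{H}_m=-i\gamma^0\gamma^j\partial_j+m\gamma^0$, $\mathcal{U}_m(t)=e^{-it\mathcal{H}_m}$. The implicit constant depends only on $d,q$. *)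

(* Defs.v *)
From HB Require Import structures.
From mathcomp Require Import all_boot all_order all_algebra.
From mathcomp Require Import all_classical all_reals all_analysis.
From mathcomp Require Import complex.
Set Implicit Arguments. Unset Strict Implicit. Unset Printing Implicit Defensive.
Import Order.TTheory GRing.Theory Num.Theory.
Import numFieldNormedType.Exports.
Local Open Scope ring_scope.
Local Open Scope classical_set_scope.
Local Open Scope complex_scope.

Section Defs.
Variable R : realType.

(* points of R^d are row vectors 'rV[R]_d ; open boxes generate the Borel sets *)
Definition open_boxes (n : nat) : set (set 'rV[R]_n) :=
  [set B | exists a b : 'rV[R]_n, B = [set x : 'rV[R]_n | forall i, a 0 i < x 0 i < b 0 i]].



Definition borel_measurable (n : nat) (F : 'rV[R]_n -> R) : Prop :=
  forall B : set R, measurable B -> <<s @open_boxes n >> (F @^-1` B).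

(* Lebesgue integral over R^d of a function with values in \bar R, written as
   the iterated integral dx_1 ... dx_d (Tonelli/Fubini) *)
Fixpoint iint (n : nat) : ('rV[R]_n -> \bar R) -> \bar R :=
  match n with
  | 0 => fun F => F 0
  | n'.+1 => fun F =>
      (\int[@lebesgue_measure R]_x iint (fun y : 'rV[R]_n' =>
          F (row_mx (\row_(_ < 1) x) y)))%E
  end.

Fixpoint riint (n : nat) : ('rV[R]_n -> R) -> R :=
  match n with
  | 0 => fun F => F 0
  | n'.+1 => fun F =>
      Rintegral (@lebesgue_measure R) setT (fun x => riint (fun y : 'rV[R]_n' =>
          F (row_mx (\row_(_ < 1) x) y)))
  end.

Definition ciint (n : nat) (F : 'rV[R]_n -> R[i]) : R[i] :=
  riint (fun x => complex.Re (F x)) +i* riint (fun x => complex.Im (F x)).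

Definition cconj (z : R[i]) : R[i] := complex.Re z +i* (- complex.Im z).
Definition cmod (z : R[i]) : R := Num.sqrt (complex.Re z ^+ 2 + complex.Im z ^+ 2).
Definition cexpi (th : R) : R[i] := cos th +i* sin th.

Definition vnorm (N : nat) (v : 'cV[R[i]]_N) : R :=
  Num.sqrt (\sum_(i < N) (complex.Re (v i 0) ^+ 2 + complex.Im (v i 0) ^+ 2)).

Definition adjmx (m n : nat) (A : 'M[R[i]]_(m, n)) : 'M[R[i]]_(n, m) :=
  \matrix_(i, j) cconj (A j i).

Definition dotv (n : nat) (x y : 'rV[R]_n) : R := \sum_(i < n) x 0 i * y 0 i.
Definition eucl (n : nat) (x : 'rV[R]_n) : R := Num.sqrt (dotv x x).

Definition L1norm (d N : nat) (f : 'rV[R]_d -> 'cV[R[i]]_N) : \bar R :=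
  iint (fun x => (vnorm (f x))%:E).

Definition in_L1 (d N : nat) (f : 'rV[R]_d -> 'cV[R[i]]_N) : Prop :=
  (forall i : 'I_N,
     borel_measurable (fun x => complex.Re (f x i 0)) /\
     borel_measurable (fun x => complex.Im (f x i 0))) /\
  (L1norm f < +oo)%E.

Definition fourier (d N : nat) (f : 'rV[R]_d -> 'cV[R[i]]_N) (xi : 'rV[R]_d)
  : 'cV[R[i]]_N :=
  \col_(i < N) ciint (fun x => cexpi (- dotv x xi) * f x i 0).

(* supp \hat f is contained in the closed ball {|xi| <= rho}
   (\hat f is continuous for f in L^1) *)
Definition fourier_supp_ball (d N : nat) (f : 'rV[R]_d -> 'cV[R[i]]_N) (rho : R)
  : Prop :=
  forall xi : 'rV[R]_d, rho < eucl xi -> fourier f xi = 0.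

Definition minkowski (d : nat) (mu nu : 'I_d.+1) : R :=
  if mu == nu then (if val mu == 0%N then 1 else -1) else 0.

Definition clifford (d N : nat) (gamma : 'I_d.+1 -> 'M[R[i]]_N) : Prop :=
  forall mu nu : 'I_d.+1,
    gamma mu *m gamma nu + gamma nu *m gamma mu
    = ((2 * minkowski mu nu)%:C) *: (1%:M : 'M[R[i]]_N).

Definition hermitian_gammas (d N : nat) (gamma : 'I_d.+1 -> 'M[R[i]]_N) : Prop :=
  adjmx (gamma ord0) = gamma ord0 /\
  forall j : 'I_d, adjmx (gamma (lift ord0 j)) = - gamma (lift ord0 j).

(* symbol of H_m = -i gamma^0 gamma^j d_j + m gamma^0 :
   H_m(xi) = gamma^0 gamma^j xi_j + m gamma^0 *)
Definition dirac_symbol (d N : nat) (gamma : 'I_d.+1 -> 'M[R[i]]_N) (m : R)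
  (xi : 'rV[R]_d) : 'M[R[i]]_N :=
  \sum_(j < d) (xi 0 j)%:C *: (gamma ord0 *m gamma (lift ord0 j))
  + m%:C *: gamma ord0.

Definition mpow (N : nat) (A : 'M[R[i]]_N) (k : nat) : 'M[R[i]]_N :=
  iter k (mulmx A) 1%:M.
Definition expm_partial (N : nat) (A : 'M[R[i]]_N) (n : nat) : 'M[R[i]]_N :=
  \sum_(k < n) (k`!%:R)^-1 *: mpow A k.
Definition expm (N : nat) (A : 'M[R[i]]_N) : 'M[R[i]]_N :=
  \matrix_(i, j) (limn (fun n => complex.Re (expm_partial A n i j))
                 +i* limn (fun n => complex.Im (expm_partial A n i j))).

Definition dirac_prop (d N : nat) (gamma : 'I_d.+1 -> 'M[R[i]]_N) (m t : R)
  (f : 'rV[R]_d -> 'cV[R[i]]_N) (x : 'rV[R]_d) : 'cV[R[i]]_N :=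
  \col_(i < N) (((2 * pi) ^- d)%:C *
     ciint (fun xi => cexpi (dotv x xi) *
        ((expm ((0 +i* (- t)) *: dirac_symbol gamma m xi) *m fourier f xi) i 0))).

(* \overline{phi} psi = phi^dagger gamma^0 psi *)
Definition dbar (d N : nat) (gamma : 'I_d.+1 -> 'M[R[i]]_N) (phi psi : 'cV[R[i]]_N)
  : R[i] :=
  (adjmx phi *m gamma ord0 *m psi) 0 0.

Definition LqL2 (d : nat) (q : R) (F : R -> 'rV[R]_d -> R[i]) : \bar R :=
  poweR (\int[@lebesgue_measure R]_t
           poweR (iint (fun x => ((cmod (F t x)) ^+ 2)%:E)) (q / 2))%E
        q^-1.

End Defs.

(* Main.v *)
(** Write [om xi] for the square root of [|xi|^2 + m^2]. The Dirac symbol squares to [om^2], so the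
    propagator splits into the two half-waves [exp (-+ i t om)] times spectral projections. The
    subordination (Cauchy-Schloemilch) formula expresses the kernel of the damped half-wave
    [exp (- z om)], [Re z > 0], as a superposition of Gaussians with complex parameter, whence
    its dispersive decay. On functions with Fourier support in a ball of radius [rho], expanding
    [(1 - exp (- eps om))^n] with [eps] of order [1 / rho] replaces the undamped half-wave by a
    combination of damped ones up to an error that is exponentially small in [n].

    Times are cut into dyadic blocks [2^k / rho <= |t| <= 2^(k+1) / rho]. In dimension [d >= 3]
    the sup bound of one factor and the L2 bound of the other suffice. In dimension [2] one more
    power of decay comes from the null structure: near the light cone the kernel of the damped
    half-wave pairs to leading order only with the null component [nullv] of the other factor,
    whose square is its flux through the cone, and this flux is controlled by integrating the
    conserved Dirac current against an arctangent of [t^2 - |x - y|^2]. Negative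
    times reduce to positive ones by changing [gamma^0] into [- gamma^0]. As [q <= 2], the blocks
    are summed using [u^(q/2) <= 1 + u] on each block, suitably rescaled, and a geometric series,
    which converges because [1 / q < (d + 1) / 4]. *)

Require Import Defs.
From HB Require Import structures.
From mathcomp Require Import all_boot all_order all_algebra.
From mathcomp Require Import all_classical all_reals all_analysis.
From mathcomp Require Import measurable_realfun complex.
From mathcomp Require Import ring lra.
Set Implicit Arguments. Unset Strict Implicit. Unset Printing Implicit Defensive.
Import Order.TTheory GRing.Theory Num.Theory.
Import numFieldNormedType.Exports.
Local Open Scope ring_scope.
Local Open Scope classical_set_scope.
Local Open Scope complex_scope.

(** * Lebesgue measure on R^d *)

(** Damping buys absolute convergence. The kernel of the undamped half-wave is only an oscillatory
    integral; for [Re z > 0] Fubini applies and the kernel is explicit, so no stationary phase is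
    needed. The price appears in the expansion: on block [k] it has [k %/ J + 1] terms, with
    coefficients of total size at most [2 ^ (k / J + 1)], against an error [2 ^ (- d k)]. This loss
    is an arbitrarily small power of time, and the strict inequality for [1 / q] absorbs it. With
    [1 / rho] as unit of time, the squared norm on a block must decay like [2 ^ (- k (d - 1) / 2)].
    Sup norm times L2 norm gives [2 ^ (- k (d - 1))] times the block length [2 ^ k], which is enough
    exactly when [d >= 3]; for [d = 2] it gives no decay at all, and [2 ^ (- k / 2)] has to be
    found. There the kernel is elementary, since it involves Macdonald functions of half-integer
    order, and splitting by the distance to the cone at a threshold [lam], optimised on each block,
    recovers the missing half power. The power of [rho] collects [rho ^ d] from the sup norm,
    [rho ^ (d / 2)] from the L2 norm and [rho ^ (- 1 / q)] from the unit of time. *)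

Section VecMeasure.
Context {R : realType}.

Definition leb : {sigma_finite_measure set (measurableTypeR R) -> \bar R} :=
  @lebesgue_measure R.

(** The sigma-algebra is that of [borel_measurable], so the hypotheses on [f] and [g] are
    measurability statements on this type as they stand. *)
Definition vec (n : nat) := g_sigma_algebraType (@open_boxes R n).

(** Spelled as in [iint] and [riint], so that unfolding an iterated integral yields [vcons] by
    conversion. *)
Definition vcons n (p : R * vec n) : vec n.+1 := row_mx (\row_(_ < 1) p.1) p.2.
Definition vhead n (v : vec n.+1) : R := v 0 ord0.
Definition vtail n (v : vec n.+1) : vec n := \row_j v 0 (lift ord0 j).

Lemma vcons0 n (p : R * vec n) : vcons p 0 ord0 = p.1.
Proof.
rewrite /vcons mxE; case: splitP => [j _|k /= ]; first by rewrite mxE.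
by rewrite add1n.
Qed.

Lemma vconsS n (p : R * vec n) j : vcons p 0 (lift ord0 j) = p.2 0 j.
Proof.
rewrite /vcons mxE; case: splitP => [[[]//]|k /= ].
by rewrite /bump leq0n => -[] jk; congr (p.2 0 _); apply/val_inj.
Qed.

Lemma vtail_vcons n (p : R * vec n) : vtail (vcons p) = p.2.
Proof. by apply/rowP => j; rewrite /vtail mxE vconsS. Qed.

Lemma measurable_vec_coord n (i : 'I_n) :
  measurable_fun [set: vec n] (fun v : vec n => v 0 i : R).
Proof.
apply: (measurability _ (@RGenOInfty.measurableE R)) => //.
move=> _ [_ [a ->] <-]; rewrite setTI.
(* A half-space is not a box; it is exhausted by boxes whose upper sides are all [k] and whose lower
   sides are [- k] in the other coordinates. *)
rewrite (_ : _ @^-1` _ = \bigcup_k [set v : 'rV[R]_n | forall j,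
    (\row_j (if j == i then a else - k%:R)) 0 j < v 0 j < (const_mx k%:R : 'rV[R]_n) 0 j]).
  apply: bigcup_measurable => k _; apply: sub_sigma_algebra.
  by exists (\row_j (if j == i then a else - k%:R)), (const_mx k%:R).
apply/seteqP; split => [v /=|v [k _] /= /(_ i)]; last first.
  by rewrite mxE eqxx in_itv/= andbT => /andP[].
rewrite in_itv/= andbT => av.
(* The sum of all [|v 0 j|] bounds every coordinate at once. *)
exists (Num.truncn (\sum_j `|v 0 j|)).+1 => //= j.
have : `|v 0 j| < (Num.truncn (\sum_j `|v 0 j|)).+1%:R.
  apply: le_lt_trans (truncnS_gt _).
  rewrite (bigD1 j)//= lerDl; exact: sumr_ge0.
rewrite ltr_norml !mxE => /andP[v1 v2]; rewrite v2 andbT.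
by case: eqP => [->|].
Qed.

Lemma measurable_to_vec d (T : measurableType d) n (f : T -> vec n) :
  (forall i, measurable_fun [set: T] (fun x => f x 0 i : R)) ->
  measurable_fun [set: T] f.
Proof.
move=> mf; apply: (@measurability _ _ _ _ setT f (@open_boxes R n)) => //.
move=> _ [_ [a [b ->]] <-]; rewrite setTI.
rewrite (_ : _ @^-1` _ = \bigcap_(i in [set: 'I_n])
   ((fun x => f x 0 i : R) @^-1` `]a 0 i, b 0 i[%classic)).
  apply: fin_bigcap_measurable => // i _.
  rewrite -[X in measurable X]setTI; exact: mf.
apply/seteqP; split => [x /= h i _ /=|x /= h i]; first by rewrite in_itv/= h.
by have := h i I; rewrite /= in_itv.
Qed.

Lemma measurable_vcons n : measurable_fun [set: measurableTypeR R * vec n] (@vcons n).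
Proof.
apply: measurable_to_vec => i; case: (unliftP ord0 i) => [j ->|->].
  under eq_fun do rewrite vconsS.
  by apply: (measurableT_comp (@measurable_vec_coord n j)).
under eq_fun do rewrite vcons0.
exact: measurable_fst.
Qed.

Lemma measurable_vcons1 n (x : R) :
  measurable_fun [set: vec n] (fun y : vec n => vcons (x, y)).
Proof.
apply: measurable_to_vec => i; case: (unliftP ord0 i) => [j ->|->].
  under eq_fun do rewrite vconsS.
  exact: measurable_vec_coord.
by rewrite (_ : (fun _ => _) = cst x)//; apply/funext => y; rewrite vcons0.
Qed.

Lemma measurable_vtail n : measurable_fun [set: vec n.+1] (@vtail n).
Proof.
apply: measurable_to_vec => i; under eq_fun do rewrite /vtail mxE.
exact: measurable_vec_coord.
Qed.

Section step.
Variables (n : nat) (m : {sigma_finite_measure set (vec n) -> \bar R}).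
Local Open Scope ereal_scope.

Definition vstep (A : set (vec n.+1)) : \bar R := (leb \x m) (@vcons n @^-1` A).

Let vstep0 : vstep set0 = 0.
Proof. by rewrite /vstep preimage_set0 measure0. Qed.

Let vstep_ge0 A : 0 <= vstep A.
Proof. by rewrite /vstep; exact: measure_ge0. Qed.

Let vstep_sigma_additive : semi_sigma_additive vstep.
Proof.
have mc := @measurable_vcons n.
move=> F mF tF mUF; rewrite /vstep preimage_bigcup.
apply: measure_semi_sigma_additive.
- by move=> k; rewrite -[X in measurable X]setTI; exact: mc.
- apply/trivIsetP => /= i j _ _ ij; rewrite -preimage_setI.
  by move/trivIsetP : tF => /(_ _ _ _ _ ij) ->//; rewrite preimage_set0.
- by rewrite -preimage_bigcup -[X in measurable X]setTI; exact: mc.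
Qed.

HB.instance Definition _ := isMeasure.Build _ _ _ vstep
  vstep0 vstep_ge0 vstep_sigma_additive.

Let vstep_sigma_finite : sigma_finite setT vstep.
Proof.
have /sigma_finiteP[F [TF ndF Foo]] := sigma_finiteT leb.
have /sigma_finiteP[G [TG ndG Goo]] := sigma_finiteT m.
exists (fun k => (fun v : vec n.+1 => (vhead v, vtail v)) @^-1` (F k `*` G k)).
  apply/seteqP; split => // v _.
  have : setT (vhead v) by []; rewrite TF => -[i _ Fi].
  have : setT (vtail v) by []; rewrite TG => -[j _ Gj].
  (* Both exhaustions increase, so one index serves the two factors. *)
  exists (maxn i j) => //; split => /=.
    by move: Fi; apply/subsetPset/ndF/leq_maxl.
  by move: Gj; apply/subsetPset/ndG/leq_maxr.
have mpre k : measurable ((fun v : vec n.+1 => (vhead v, vtail v)) @^-1` (F k `*` G k)).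
  rewrite -[X in measurable X]setTI; apply: measurable_fun_pair => //.
  - exact: measurable_vec_coord.
  - exact: measurable_vtail.
  - by apply: measurableX; [case: (Foo k)|case: (Goo k)].
move=> k; split => //.
have [mFk Fkoo] := Foo k; have [mGk Gkoo] := Goo k.
rewrite /vstep.
rewrite (_ : _ @^-1` _ = F k `*` G k).
  by rewrite product_measure1E// lte_mul_pinfty// ge0_fin_numE.
by apply/seteqP; split => -[x v] /=; rewrite /vhead vcons0 vtail_vcons.
Qed.

HB.instance Definition _ := Measure_isSigmaFinite.Build _ _ _ vstep
  vstep_sigma_finite.

Definition vstep_measure : {sigma_finite_measure set (vec n.+1) -> \bar R} := vstep.

End step.

Definition vec0_measure : {sigma_finite_measure set (vec 0) -> \bar R} :=
  @dirac _ (vec 0) (0 : 'rV[R]_0) R.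

(** Lebesgue measure in [n] variables, built by the same recursion as [iint]. As a single
    sigma-finite measure it makes Fubini and the convergence theorems available in all variables at
    once. *)
Fixpoint vmu (n : nat) : {sigma_finite_measure set (vec n) -> \bar R} :=
  match n with
  | 0 => vec0_measure
  | n'.+1 => vstep_measure (vmu n')
  end.

End VecMeasure.

(** * Iterated integrals as integrals for a product measure *)

Section IterInt.
Context {R : realType}.
Local Open Scope ereal_scope.

Lemma ge0_integral_vmuS n (F : vec n.+1 -> \bar R) : measurable_fun setT F ->
  (forall v, 0 <= F v) ->
  \int[vmu n.+1]_v F v = \int[leb]_x \int[vmu n]_y F (vcons (x, y)).
Proof.
move=> mF F0.
have mFc : measurable_fun [set: measurableTypeR R * vec n]%type (F \o @vcons R n).
  by apply: measurableT_comp mF _; exact: measurable_vcons.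
rewrite [LHS](_ : _ = \int[pushforward (leb \x vmu n) (@vcons R n)]_v F v)//.
rewrite (ge0_integral_pushforward (@measurable_vcons R n))//.
by rewrite preimage_setT fubini_tonelli1//=.
Qed.

Lemma integral_vmuS n (F : vec n.+1 -> \bar R) : (vmu n.+1).-integrable setT F ->
  \int[vmu n.+1]_v F v = \int[leb]_x \int[vmu n]_y F (vcons (x, y)).
Proof.
move=> iF.
have iFc : (leb \x vmu n).-integrable setT (F \o @vcons R n).
  have /integrableP[mF ltF] := iF; apply/integrableP; split.
    by apply: measurableT_comp mF _; exact: measurable_vcons.
  move: ltF; rewrite [X in X < _](_ : _ = \int[pushforward (leb \x vmu n) (@vcons R n)]_v `|F v|)//.
  rewrite (ge0_integral_pushforward (@measurable_vcons R n))//.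
  exact: measurableT_comp.
rewrite [LHS](_ : _ = \int[pushforward (leb \x vmu n) (@vcons R n)]_v F v)//.
rewrite (integral_pushforward (@measurable_vcons R n))//.
  by rewrite preimage_setT -integral12_prod_meas1.
by case/integrableP : iF.
Qed.

Lemma integrable_vmuS n (F : vec n.+1 -> \bar R) : (vmu n.+1).-integrable setT F ->
  (leb \x vmu n).-integrable setT (F \o @vcons R n).
Proof.
move=> /integrableP[mF ltF]; apply/integrableP; split.
  by apply: measurableT_comp mF _; exact: measurable_vcons.
move: ltF; rewrite [X in X < _](_ : _ = \int[pushforward (leb \x vmu n) (@vcons R n)]_v `|F v|)//.
rewrite (ge0_integral_pushforward (@measurable_vcons R n))//.
exact: measurableT_comp.
Qed.

Lemma iintE n (F : vec n -> \bar R) : measurable_fun setT F ->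
  (forall v, 0 <= F v) -> iint F = \int[vmu n]_v F v.
Proof.
elim: n F => [|n IH] F mF F0.
  by rewrite /= integral_dirac// ?diracT ?mul1e//=.
rewrite ge0_integral_vmuS//=; apply: eq_integral => x _.
rewrite IH// -/(vcons _).
by apply: (measurableT_comp mF); exact: measurable_vcons1.
Qed.

(** The inner integral is a difference of two Tonelli integrals, each measurable, and [fine] is
    measurable; parameters at which the inner integral diverges are covered as well. *)
Lemma measurable_Rintegral_param d1 d2 (T : measurableType d1) (U : measurableType d2)
    (m : {sigma_finite_measure set U -> \bar R}) (F : T -> U -> R) :
  measurable_fun [set: T * U] (fun p => F p.1 p.2) ->
  measurable_fun [set: T] (fun p => (\int[m]_u F p u)%R).
Proof.
move=> mF.
have mFE : measurable_fun [set: T * U] (fun p => (F p.1 p.2)%:E) by exact/measurable_EFinP.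
apply: measurableT_comp => //.
rewrite (_ : (fun p => _) = (fun p => \int[m]_u ((fun p => (F p.1 p.2)%:E)^\+ (p, u))
   - \int[m]_u ((fun p => (F p.1 p.2)%:E)^\- (p, u)))); last first.
  apply/funext => p; rewrite [LHS]integralE.
  by congr (_ - _); apply: eq_integral => u _; rewrite ?funeposE ?funenegE.
apply: emeasurable_funB.
  apply: (@measurable_fun_fubini_tonelli_F _ _ _ _ _ m (fun p => (F p.1 p.2)%:E)^\+) => //.
  exact: measurable_funepos.
apply: (@measurable_fun_fubini_tonelli_F _ _ _ _ _ m (fun p => (F p.1 p.2)%:E)^\-) => //.
exact: measurable_funeneg.
Qed.

Lemma measurable_riint n d (T : measurableType d) (F : T -> vec n -> R) :
  measurable_fun [set: T * vec n] (fun p => F p.1 p.2) ->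
  measurable_fun [set: T] (fun p => riint (F p)).
Proof.
elim: n d T F => [|n IH] d T F mF /=.
  rewrite (_ : (fun p => _) = (fun p => F p.1 p.2) \o (fun p : T => (p, 0%R : vec 0)))//.
  apply: (measurableT_comp mF); exact: measurable_pair2.
apply: (measurable_Rintegral_param leb).
apply: (IH _ (T * measurableTypeR R)%type (fun p y => F p.1 (vcons (p.2, y)))).
pose h (p : T * measurableTypeR R * vec n) := (p.1.1, vcons (p.1.2, p.2)).
apply: (measurableT_comp mF (g := h)).
apply: measurable_fun_pair.
  by apply: measurableT_comp => //; exact: measurable_fst.
apply: (measurableT_comp (@measurable_vcons R n)).
apply: measurable_fun_pair => //.
by apply: measurableT_comp => //; exact: measurable_fst.
Qed.

(** Slices of an integrable function are integrable only almost everywhere, so the induction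
    hypothesis applies to almost every slice. Measurability of the iterated integral comes
    separately, from [measurable_riint]. *)
Lemma riintE n (F : vec n -> R) : (vmu n).-integrable setT (EFin \o F) ->
  riint F = (\int[vmu n]_v F v)%R.
Proof.
elim: n F => [|n IH] F iF.
  rewrite /= /Rintegral integral_dirac ?diracT ?mul1e//=.
  by case/integrableP: iF.
have iFc := integrable_vmuS iF.
have mF : measurable_fun [set: measurableTypeR R * vec n] (fun p => F (vcons p)).
  by apply/measurable_EFinP; case/integrableP : iFc.
rewrite /= /Rintegral integral_vmuS//; congr fine.
apply: ae_eq_integral => //.
- apply/measurable_EFinP.
  exact: (@measurable_riint n _ (measurableTypeR R) (fun x y => F (vcons (x, y)))).
- exact: (measurable_fubini_F iFc).
- have := ae_integrable1 iFc.
  apply: filterS => x /= ix _.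
  rewrite -/(vcons _) (IH (fun y => F (vcons (x, y)))) //.
  by rewrite /Rintegral fineK//; exact: integrable_fin_num.
Qed.

End IterInt.

(** * Complex-valued functions and integrals *)

Section ComplexNumbers.
Context {R : realType}.
Implicit Types z w : R[i].

Lemma Re_add z w : complex.Re (z + w) = complex.Re z + complex.Re w.
Proof. by case: z w => a b [c d]. Qed.
Lemma Im_add z w : complex.Im (z + w) = complex.Im z + complex.Im w.
Proof. by case: z w => a b [c d]. Qed.
Lemma Re_opp z : complex.Re (- z) = - complex.Re z.
Proof. by case: z. Qed.
Lemma Im_opp z : complex.Im (- z) = - complex.Im z.
Proof. by case: z. Qed.
Lemma Re_mul z w : complex.Re (z * w) =
  complex.Re z * complex.Re w - complex.Im z * complex.Im w.
Proof. by case: z w => a b [c d]. Qed.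
Lemma Im_mul z w : complex.Im (z * w) =
  complex.Re z * complex.Im w + complex.Im z * complex.Re w.
Proof. by case: z w => a b [c d] /=. Qed.
Lemma Re_real (a : R) : complex.Re (a%:C) = a. Proof. by []. Qed.
Lemma Im_real (a : R) : complex.Im (a%:C) = 0. Proof. by []. Qed.
Lemma Re_conj z : complex.Re (cconj z) = complex.Re z. Proof. by []. Qed.
Lemma Im_conj z : complex.Im (cconj z) = - complex.Im z. Proof. by []. Qed.
Lemma Re_sum I (r : seq I) (P : pred I) (F : I -> R[i]) :
  complex.Re (\sum_(i <- r | P i) F i) = \sum_(i <- r | P i) complex.Re (F i).
Proof. by elim/big_rec2: _ => //= i x y _ <-; rewrite Re_add. Qed.

Definition ii : R[i] := 0 +i* 1.
Lemma Re_ii : complex.Re ii = 0. Proof. by []. Qed.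
Lemma Im_ii : complex.Im ii = 1. Proof. by []. Qed.

Definition ReImE := (Re_ii, Im_ii, Re_add, Im_add, Re_opp, Im_opp, Re_mul, Im_mul, Re_conj, Im_conj,
  Re_real, Im_real).

Lemma complex_eq z w : complex.Re z = complex.Re w -> complex.Im z = complex.Im w -> z = w.
Proof. by case: z w => a b [c d] /= -> ->. Qed.

Lemma cmod_ge0 z : 0 <= cmod z. Proof. exact: sqrtr_ge0. Qed.

Lemma cmod_sqr z : cmod z ^+ 2 = complex.Re z ^+ 2 + complex.Im z ^+ 2.
Proof. by rewrite sqr_sqrtr// addr_ge0// sqr_ge0. Qed.

Lemma cmodM z w : cmod (z * w) = cmod z * cmod w.
Proof.
rewrite /cmod -sqrtrM ?addr_ge0 ?sqr_ge0//; congr Num.sqrt.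
by rewrite !ReImE; ring.
Qed.

Lemma cmod_real (a : R) : cmod (a%:C) = `|a|.
Proof. by rewrite /cmod /= expr0n addr0 sqrtr_sqr. Qed.

Lemma cmod0 : cmod (0 : R[i]) = 0.
Proof. by rewrite -[0]/(0%:C) cmod_real normr0. Qed.

Lemma cmod1 : cmod (1 : R[i]) = 1.
Proof. by rewrite -[1]/(1%:C) cmod_real normr1. Qed.

Lemma cmod_conj z : cmod (cconj z) = cmod z.
Proof. by rewrite /cmod !ReImE sqrrN. Qed.

Lemma cmodN z : cmod (- z) = cmod z.
Proof. by rewrite /cmod !ReImE !sqrrN. Qed.

Lemma ler_Re_cmod z : `|complex.Re z| <= cmod z.
Proof. by rewrite -sqrtr_sqr ler_wsqrtr// lerDl sqr_ge0. Qed.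

Lemma ler_Im_cmod z : `|complex.Im z| <= cmod z.
Proof. by rewrite -sqrtr_sqr ler_wsqrtr// lerDr sqr_ge0. Qed.

Lemma cmod_eq0 z : (cmod z == 0) = (z == 0).
Proof.
apply/eqP/eqP => [z0|->]; last exact: cmod0.
have := ler_Re_cmod z; have := ler_Im_cmod z; rewrite z0 !normr_le0 => /eqP i0 /eqP r0.
exact: complex_eq.
Qed.

Lemma cmod_gt0 z : (0 < cmod z) = (z != 0).
Proof. by rewrite lt0r cmod_ge0 andbT cmod_eq0. Qed.

Lemma cconjM z w : cconj (z * w) = cconj z * cconj w.
Proof. by apply: complex_eq; rewrite !ReImE; ring. Qed.
Lemma cconjD z w : cconj (z + w) = cconj z + cconj w.
Proof. by apply: complex_eq; rewrite !ReImE; ring. Qed.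
Lemma cconjK z : cconj (cconj z) = z.
Proof. by apply: complex_eq; rewrite !ReImE// opprK. Qed.
Lemma cconj0 : cconj (0 : R[i]) = 0.
Proof. by apply: complex_eq => /=; rewrite ?oppr0. Qed.
Lemma cconj_sum I (r : seq I) (P : pred I) (F : I -> R[i]) :
  cconj (\sum_(i <- r | P i) F i) = \sum_(i <- r | P i) cconj (F i).
Proof. by elim/big_rec2: _ => [|i x y _ <-]; rewrite ?cconj0 ?cconjD. Qed.

Lemma mul_conj z : z * cconj z = ((cmod z) ^+ 2)%:C.
Proof. by apply: complex_eq; rewrite !ReImE ?cmod_sqr; ring. Qed.

Lemma cmodD z w : cmod (z + w) <= cmod z + cmod w.
Proof.
rewrite -(ler_pXn2r (n := 2)) ?nnegrE ?addr_ge0 ?cmod_ge0//.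
rewrite sqrrD !cmod_sqr -!cmodM.
(* Conjugating [w] keeps the modulus and turns the cross term into a real part. *)
have -> : cmod (z * w) = cmod (z * cconj w) by rewrite !cmodM cmod_conj.
have := le_trans (ler_norm _) (ler_Re_cmod (z * cconj w)).
by rewrite !ReImE => h; nra.
Qed.

Lemma cmod_sum I (r : seq I) (P : pred I) (F : I -> R[i]) :
  cmod (\sum_(i <- r | P i) F i) <= \sum_(i <- r | P i) cmod (F i).
Proof.
elim/big_rec2: _ => [|i x y _ h]; first by rewrite cmod0.
by apply: le_trans (cmodD _ _) _; rewrite lerD2l.
Qed.

Lemma cmod_le_ReIm z : cmod z <= `|complex.Re z| + `|complex.Im z|.
Proof.
rewrite -(ler_pXn2r (n := 2)) ?nnegrE ?addr_ge0 ?cmod_ge0//.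
rewrite sqrrD cmod_sqr !real_normK ?num_real//.
by rewrite lerD2r lerDl mulrn_wge0// mulr_ge0.
Qed.

Lemma cmod_prod I (r : seq I) (P : pred I) (F : I -> R[i]) :
  cmod (\prod_(i <- r | P i) F i) = \prod_(i <- r | P i) cmod (F i).
Proof. by elim/big_rec2: _ => [|i x y _ <-]; rewrite ?cmod1 ?cmodM. Qed.

Lemma cmodX z n : cmod (z ^+ n) = cmod z ^+ n.
Proof. by elim: n => [|n IH]; rewrite ?expr0 ?cmod1// !exprS cmodM IH. Qed.

Lemma cmodV z : cmod (z^-1) = (cmod z)^-1.
Proof.
have [->|z0] := eqVneq z 0; first by rewrite invr0 cmod0 invr0.
apply: (mulfI (x := cmod z)); first by rewrite cmod_eq0.
by rewrite -cmodM !divff ?cmod1 ?cmod_eq0.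
Qed.

Lemma cexpiD (a b : R) : cexpi (a + b) = cexpi a * cexpi b.
Proof. by apply: complex_eq; rewrite !ReImE /= ?cosD ?sinD; ring. Qed.
Lemma cexpi0 : cexpi (0 : R) = 1.
Proof. by rewrite /cexpi cos0 sin0. Qed.
Lemma cconj_cexpi (a : R) : cconj (cexpi a) = cexpi (- a).
Proof. by rewrite /cexpi /cconj /= cosN sinN. Qed.
Lemma cmod_cexpi (a : R) : cmod (cexpi a) = 1.
Proof. by rewrite /cmod /= cos2Dsin2 sqrtr1. Qed.

Lemma cmod_ii : cmod ii = 1.
Proof. by rewrite /cmod /= expr0n expr1n add0r sqrtr1. Qed.

(** Locked, since simplification would otherwise expand it into cosines and sines. *)
Definition cexp z : R[i] := locked ((expR (complex.Re z))%:C * cexpi (complex.Im z)).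

Lemma cexpE z : cexp z = (expR (complex.Re z))%:C * cexpi (complex.Im z).
Proof. by rewrite /cexp -lock. Qed.

Lemma cexpD z w : cexp (z + w) = cexp z * cexp w.
Proof.
by rewrite !cexpE !ReImE cexpiD expRD rmorphM/= mulrACA.
Qed.
Lemma cmod_cexp z : cmod (cexp z) = expR (complex.Re z).
Proof. by rewrite !cexpE cmodM cmod_cexpi mulr1 cmod_real ger0_norm// expR_ge0. Qed.
Lemma cexp0 : cexp 0 = 1.
Proof. by rewrite !cexpE /= expR0 cexpi0 mulr1. Qed.
Lemma cexp_real (a : R) : cexp (a%:C) = (expR a)%:C.
Proof. by rewrite !cexpE /= cexpi0 mulr1. Qed.
Lemma cexp_im (a : R) : cexp (ii * a%:C) = cexpi a.
Proof. by rewrite !cexpE !ReImE/= mul0r mulr0 subr0 mul0r mul1r add0r expR0 mul1r. Qed.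
Lemma cexp_neq0 z : cexp z != 0.
Proof. by rewrite -cmod_gt0 cmod_cexp expR_gt0. Qed.
Lemma cexp_sum I (r : seq I) (P : pred I) (F : I -> R[i]) :
  cexp (\sum_(i <- r | P i) F i) = \prod_(i <- r | P i) cexp (F i).
Proof. by elim/big_rec2: _ => [|i x y _ <-]; rewrite ?cexp0 ?cexpD. Qed.

End ComplexNumbers.

Section ComplexIntegral.
Context {R : realType}.

Definition mcfun d (T : measurableType d) (f : T -> R[i]) :=
  measurable_fun [set: T] (fun x => complex.Re (f x)) /\
  measurable_fun [set: T] (fun x => complex.Im (f x)).

Section mcfun.
Context d (T : measurableType d).
Implicit Types f g : T -> R[i].

Lemma mcfun_cst c : mcfun (fun _ : T => c).
Proof. by split; exact: measurable_cst. Qed.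

Lemma mcfunD f g : mcfun f -> mcfun g -> mcfun (fun x => f x + g x).
Proof.
move=> [f1 f2] [g1 g2]; split.
  by under eq_fun do rewrite Re_add; exact: measurable_funD.
by under eq_fun do rewrite Im_add; exact: measurable_funD.
Qed.

Lemma mcfunN f : mcfun f -> mcfun (fun x => - f x).
Proof.
move=> [f1 f2]; split.
  by under eq_fun do rewrite Re_opp; exact: measurable_funN.
by under eq_fun do rewrite Im_opp; exact: measurable_funN.
Qed.

Lemma mcfunM f g : mcfun f -> mcfun g -> mcfun (fun x => f x * g x).
Proof.
move=> [f1 f2] [g1 g2]; split.
  by under eq_fun do rewrite Re_mul; apply: measurable_funB; exact: measurable_funM.
by under eq_fun do rewrite Im_mul; apply: measurable_funD; exact: measurable_funM.
Qed.

Lemma mcfun_sum I (r : seq I) (P : pred I) (F : I -> T -> R[i]) :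
  (forall i, mcfun (F i)) -> mcfun (fun x => \sum_(i <- r | P i) F i x).
Proof.
move=> mF; elim: r => [|i r IH].
  by under eq_fun do rewrite big_nil; exact: mcfun_cst.
under eq_fun do rewrite big_cons; case: (P i) => //.
exact: mcfunD.
Qed.

Lemma mcfun_prod I (r : seq I) (P : pred I) (F : I -> T -> R[i]) :
  (forall i, mcfun (F i)) -> mcfun (fun x => \prod_(i <- r | P i) F i x).
Proof.
move=> mF; elim: r => [|i r IH].
  by under eq_fun do rewrite big_nil; exact: mcfun_cst.
under eq_fun do rewrite big_cons; case: (P i) => //.
exact: mcfunM.
Qed.

Lemma mcfun_conj f : mcfun f -> mcfun (fun x => cconj (f x)).
Proof. by move=> [f1 f2]; split => //=; exact: measurable_funN. Qed.

Lemma mcfun_real (f : T -> R) : measurable_fun [set: T] f -> mcfun (fun x => (f x)%:C).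
Proof. by move=> mf; split => //=; exact: measurable_cst. Qed.

Lemma mcfun_cexpi (f : T -> R) : measurable_fun [set: T] f -> mcfun (fun x => cexpi (f x)).
Proof.
move=> mf; split => /=; apply: measurableT_comp => //;
  apply: continuous_measurable_fun.
  exact: continuous_cos.
exact: continuous_sin.
Qed.

Lemma mcfun_cexp f : mcfun f -> mcfun (fun x => cexp (f x)).
Proof.
move=> [f1 f2]; under eq_fun do rewrite cexpE.
apply: mcfunM; last exact: mcfun_cexpi.
by apply: mcfun_real; exact: measurableT_comp.
Qed.

Lemma measurable_cmod f : mcfun f -> measurable_fun [set: T] (fun x => cmod (f x)).
Proof.
move=> [f1 f2]; apply: measurableT_comp => //.
  by apply: continuous_measurable_fun; exact: sqrt_continuous.
by apply: measurable_funD; exact: measurable_funX.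
Qed.

End mcfun.

Lemma mcfun_comp d1 d2 (T : measurableType d1) (U : measurableType d2)
  (f : U -> R[i]) (h : T -> U) : mcfun f -> measurable_fun [set: T] h ->
  mcfun (fun x => f (h x)).
Proof.
move=> [f1 f2] mh; split.
  exact: (measurableT_comp f1 mh).
exact: (measurableT_comp f2 mh).
Qed.

Definition rintegrable d (T : measurableType d) (mu : {measure set T -> \bar R})
  (f : T -> R) := mu.-integrable [set: T] (EFin \o f).

Definition cintegrable d (T : measurableType d) (mu : {measure set T -> \bar R})
  (f : T -> R[i]) := rintegrable mu (fun x => complex.Re (f x)) /\
                     rintegrable mu (fun x => complex.Im (f x)).

Definition cint d (T : measurableType d) (mu : {measure set T -> \bar R})
  (f : T -> R[i]) : R[i] :=
  (\int[mu]_x complex.Re (f x)) +i* (\int[mu]_x complex.Im (f x)).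

Section cint.
Context d (T : measurableType d) (mu : {measure set T -> \bar R}).
Implicit Types f g : T -> R[i].

Lemma rintegrable_le (f g : T -> R) : measurable_fun [set: T] f ->
  rintegrable mu g -> (forall x, `|f x| <= g x) -> rintegrable mu f.
Proof.
move=> mf ig fg; apply: le_integrable ig => //; first exact/measurable_EFinP.
by move=> x _ /=; rewrite lee_fin (le_trans (fg x))// ler_norm.
Qed.

Lemma eq_rintegrable (f g : T -> R) : (forall x, f x = g x) ->
  rintegrable mu f -> rintegrable mu g.
Proof. by move=> fg; rewrite (_ : f = g)//; apply/funext. Qed.

Lemma eq_cintegrable f g : (forall x, f x = g x) -> cintegrable mu f -> cintegrable mu g.
Proof. by move=> fg; rewrite (_ : f = g)//; apply/funext. Qed.

Lemma rintegrableD (f g : T -> R) : rintegrable mu f -> rintegrable mu g ->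
  rintegrable mu (fun x => f x + g x).
Proof. by move=> fi gi; have := integrableD measurableT fi gi; apply: eq_integrable. Qed.

Lemma rintegrableZ (f : T -> R) k : rintegrable mu f -> rintegrable mu (fun x => k * f x).
Proof. by move=> fi; have := integrableZl measurableT k fi; apply: eq_integrable. Qed.

Lemma rintegrable_measurable (f : T -> R) : rintegrable mu f -> measurable_fun [set: T] f.
Proof. by case/integrableP => /measurable_EFinP. Qed.

Lemma rintegrable_norm (f : T -> R) : rintegrable mu f -> rintegrable mu (fun x => `|f x|).
Proof. exact: integrable_norm. Qed.

Lemma cintegrable_mcfun f : cintegrable mu f -> mcfun f.
Proof. by move=> [/rintegrable_measurable ? /rintegrable_measurable ?]. Qed.

Lemma cintegrable_le f (g : T -> R) : mcfun f -> rintegrable mu g ->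
  (forall x, cmod (f x) <= g x) -> cintegrable mu f.
Proof.
move=> [m1 m2] ig fg; split; apply: (rintegrable_le _ ig) => // x.
  exact: le_trans (ler_Re_cmod _) (fg x).
exact: le_trans (ler_Im_cmod _) (fg x).
Qed.

Lemma rintegrable_cmod f : cintegrable mu f -> rintegrable mu (fun x => cmod (f x)).
Proof.
move=> fi; have [f1 f2] := fi.
apply: (@rintegrable_le _ (fun x => `|complex.Re (f x)| + `|complex.Im (f x)|)).
- exact/measurable_cmod/cintegrable_mcfun.
- by apply: rintegrableD; exact: rintegrable_norm.
- by move=> x; rewrite ger0_norm ?cmod_ge0// cmod_le_ReIm.
Qed.

Lemma cintegrableP f : mcfun f -> rintegrable mu (fun x => cmod (f x)) -> cintegrable mu f.
Proof. by move=> mf fi; apply: (cintegrable_le mf fi). Qed.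

Lemma cintegrableD f g : cintegrable mu f -> cintegrable mu g ->
  cintegrable mu (fun x => f x + g x).
Proof.
move=> [f1 f2] [g1 g2]; split.
  by under eq_fun do rewrite Re_add; exact: rintegrableD.
by under eq_fun do rewrite Im_add; exact: rintegrableD.
Qed.

Lemma cintegrableZ f (c : R[i]) : cintegrable mu f -> cintegrable mu (fun x => c * f x).
Proof.
move=> fi; apply: (@cintegrable_le _ (fun x => cmod c * cmod (f x))).
- by apply: mcfunM; [exact: mcfun_cst|exact: cintegrable_mcfun].
- exact/rintegrableZ/rintegrable_cmod.
- by move=> x; rewrite cmodM.
Qed.

Lemma cintegrable_bounded f g (M : R) : mcfun f -> (forall x, cmod (f x) <= M) ->
  cintegrable mu g -> cintegrable mu (fun x => f x * g x).
Proof.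
move=> mf fM gi; apply: (@cintegrable_le _ (fun x => M * cmod (g x))).
- by apply: mcfunM => //; exact: cintegrable_mcfun.
- exact/rintegrableZ/rintegrable_cmod.
- by move=> x; rewrite cmodM ler_wpM2r// cmod_ge0.
Qed.

Lemma cintegrable_sum I (r : seq I) (P : pred I) (F : I -> T -> R[i]) :
  (forall i, cintegrable mu (F i)) ->
  cintegrable mu (fun x => \sum_(i <- r | P i) F i x).
Proof.
move=> mF; elim: r => [|i r IH].
  under eq_fun do rewrite big_nil.
  by split; apply: (eq_integrable measurableT (cst 0%E)) => //; exact: integrable0.
under eq_fun do rewrite big_cons; case: (P i) => //.
exact: cintegrableD.
Qed.

Lemma cintD f g : cintegrable mu f -> cintegrable mu g ->
  cint mu (fun x => f x + g x) = cint mu f + cint mu g.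
Proof.
move=> [f1 f2] [g1 g2]; apply: complex_eq; rewrite !ReImE/= -RintegralD//.
  by apply: eq_Rintegral => x _; rewrite Re_add.
by apply: eq_Rintegral => x _; rewrite Im_add.
Qed.

Lemma cintZ f (c : R[i]) : cintegrable mu f -> cint mu (fun x => c * f x) = c * cint mu f.
Proof.
move=> [f1 f2]; apply: complex_eq; rewrite !ReImE/= -!RintegralZl//.
  rewrite -RintegralB//; try exact: rintegrableZ.
  by apply: eq_Rintegral => x _; rewrite Re_mul.
rewrite -RintegralD//; try exact: rintegrableZ.
by apply: eq_Rintegral => x _; rewrite Im_mul.
Qed.

Lemma cint_sum I (r : seq I) (P : pred I) (F : I -> T -> R[i]) :
  (forall i, cintegrable mu (F i)) ->
  cint mu (fun x => \sum_(i <- r | P i) F i x) = \sum_(i <- r | P i) cint mu (F i).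
Proof.
move=> mF; elim: r => [|i r IH].
  rewrite big_nil; under eq_fun do rewrite big_nil.
  by apply: complex_eq; rewrite /= /Rintegral integral0.
rewrite big_cons; under eq_fun do rewrite big_cons; case: (P i) => //.
by rewrite cintD// ?IH//; exact: cintegrable_sum.
Qed.

Lemma eq_cint f g : (forall x, f x = g x) -> cint mu f = cint mu g.
Proof. by move=> fg; rewrite (_ : f = g)//; apply/funext. Qed.

Lemma cint_conj f : cintegrable mu f -> cint mu (fun x => cconj (f x)) = cconj (cint mu f).
Proof.
move=> [f1 f2]; apply: complex_eq => //=.
by rewrite -mulN1r -RintegralZl//; apply: eq_Rintegral => x _; rewrite mulN1r.
Qed.

Lemma le_cmod_cint f : cintegrable mu f -> cmod (cint mu f) <= \int[mu]_x cmod (f x).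
Proof.
move=> fi; set I := cint mu f.
have [I0|I0] := eqVneq I 0.
  by rewrite I0 cmod0; apply: Rintegral_ge0 => x _; exact: cmod_ge0.
(* A unit rotation makes the integral real and nonnegative; then only the real part of the rotated
   integrand matters. *)
pose u := cconj I * ((cmod I)^-1)%:C.
have u1 : cmod u = 1.
  by rewrite cmodM cmod_conj cmod_real ger0_norm ?invr_ge0 ?cmod_ge0// divff ?cmod_eq0.
have -> : cmod I = complex.Re (u * I).
  rewrite /u mulrAC [_ * I]mulrC mul_conj -rmorphM/= expr2 -mulrA divff ?cmod_eq0//.
  by rewrite mulr1.
rewrite -cintZ//=; apply: le_Rintegral => //.
- by case: (cintegrableZ u fi).
- exact: rintegrable_cmod.
- move=> x _; apply: le_trans (ler_norm _) _.
  by apply: le_trans (ler_Re_cmod _) _; rewrite cmodM u1 mul1r.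
Qed.

Lemma le_cmod_cint_dom f (g : T -> R) : mcfun f -> rintegrable mu g ->
  (forall x, cmod (f x) <= g x) -> cmod (cint mu f) <= \int[mu]_x g x.
Proof.
move=> mf gi fg; have fi := cintegrable_le mf gi fg.
apply: le_trans (le_cmod_cint fi) _; apply: le_Rintegral => //.
exact: rintegrable_cmod.
Qed.

End cint.

Section fubini.
Context d1 d2 (T1 : measurableType d1) (T2 : measurableType d2).
Variables (m1 : {sigma_finite_measure set T1 -> \bar R}).
Variables (m2 : {sigma_finite_measure set T2 -> \bar R}).
Local Open Scope ereal_scope.

Lemma Rintegral12 (f : T1 * T2 -> R) : (m1 \x m2).-integrable setT (EFin \o f) ->
  (\int[m1]_x \int[m2]_y f (x, y) = \int[(m1 \x m2)%E]_z f z)%R.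
Proof.
move=> fi; rewrite /Rintegral -integral12_prod_meas1//; congr fine.
apply: ae_eq_integral => //.
- apply/measurable_EFinP; apply: (measurable_Rintegral_param m2 (F := fun x y => f (x, y))).
  have /integrableP[/measurable_EFinP mf _] := fi.
  by apply: eq_measurable_fun mf => -[].
- exact: (measurable_fubini_F fi).
- have := ae_integrable1 fi.
  apply: filterS => x /= ix _.
  by rewrite /Rintegral fineK//; exact: integrable_fin_num.
Qed.

Lemma Rintegral21 (f : T1 * T2 -> R) : (m1 \x m2).-integrable setT (EFin \o f) ->
  (\int[m2]_y \int[m1]_x f (x, y) = \int[(m1 \x m2)%E]_z f z)%R.
Proof.
move=> fi; rewrite /Rintegral -integral21_prod_meas1//; congr fine.
apply: ae_eq_integral => //.
- apply/measurable_EFinP; apply: (measurable_Rintegral_param m1 (F := fun y x => f (x, y))).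
  have /integrableP[/measurable_EFinP mf _] := fi.
  exact: (measurableT_comp mf (@measurable_swap _ _ _ _)).
- exact: (measurable_fubini_G fi).
- have := ae_integrable2 fi.
  apply: filterS => x /= ix _.
  by rewrite /Rintegral fineK//; exact: integrable_fin_num.
Qed.

Lemma cint_swap (f : T1 -> T2 -> R[i]) : mcfun (fun p : T1 * T2 => f p.1 p.2) ->
  \int[m1]_x \int[m2]_y (cmod (f x y))%:E < +oo ->
  (cint m1 (fun x => cint m2 (f x)) = cint m2 (fun y => cint m1 (f^~ y)))%R.
Proof.
move=> mf fin.
have [i1 i2] : cintegrable (m1 \x m2) (fun p => f p.1 p.2).
  apply: cintegrableP => //.
  apply/integrable12ltyP => /=.
    exact/measurable_EFinP/measurable_cmod.
  apply: le_lt_trans fin; rewrite le_eqVlt; apply/orP; left; apply/eqP.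
  apply: eq_integral => x _; apply: eq_integral => y _ /=.
  by rewrite ger0_norm ?cmod_ge0.
apply: complex_eq => /=.
  rewrite (Rintegral12 (f := fun p => complex.Re (f p.1 p.2)) i1).
  by rewrite (Rintegral21 (f := fun p => complex.Re (f p.1 p.2)) i1).
rewrite (Rintegral12 (f := fun p => complex.Im (f p.1 p.2)) i2).
by rewrite (Rintegral21 (f := fun p => complex.Im (f p.1 p.2)) i2).
Qed.

Lemma integrable_prodM (f : T1 -> R) (g : T2 -> R) : rintegrable m1 f -> rintegrable m2 g ->
  rintegrable (m1 \x m2) (fun p => f p.1 * g p.2)%R.
Proof.
move=> fi gi; apply/integrable12ltyP => /=.
  apply/measurable_EFinP; apply: measurable_funM.
    apply: (measurableT_comp (rintegrable_measurable fi)); exact: measurable_fst.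
  apply: (measurableT_comp (rintegrable_measurable gi)); exact: measurable_snd.
have mg : measurable_fun setT (fun y => `|g y|%:E).
  apply/measurable_EFinP; apply: measurableT_comp => //.
  exact: rintegrable_measurable gi.
have mf : measurable_fun setT (fun y => `|f y|%:E).
  apply/measurable_EFinP; apply: measurableT_comp => //.
  exact: rintegrable_measurable fi.
rewrite (eq_integral (fun x => `|f x|%:E * \int[m2]_y `|g y|%:E)); last first.
  move=> x _; rewrite -ge0_integralZl//.
  by apply: eq_integral => y _; rewrite -EFinM normrM.
rewrite ge0_integralZr//; last exact: integral_ge0.
case/integrableP: fi => _ f1; case/integrableP: gi => _ g1.
by rewrite lte_mul_pinfty// ?ge0_fin_numE// integral_ge0.
Qed.

Lemma mcfun_cint (f : T1 -> T2 -> R[i]) : mcfun (fun p : T1 * T2 => f p.1 p.2) ->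
  mcfun (fun x => cint m2 (f x)).
Proof.
by move=> [m1' m2']; split;
  [exact: (measurable_Rintegral_param m2 (F := fun x y => complex.Re (f x y)))|
   exact: (measurable_Rintegral_param m2 (F := fun x y => complex.Im (f x y)))].
Qed.

End fubini.

End ComplexIntegral.

(** * Differentiation, also under the integral sign *)

Section ComplexDerivative.
Context {R : realType}.

Definition cder (f : R -> R[i]) (t : R) (l : R[i]) :=
  is_derive t 1 (fun s => complex.Re (f s)) (complex.Re l) /\
  is_derive t 1 (fun s => complex.Im (f s)) (complex.Im l).

Lemma cder_eq (f g : R -> R[i]) t l l' : cder f t l -> (forall x, f x = g x) -> l = l' ->
  cder g t l'.
Proof. by move=> h fg <-; rewrite (_ : g = f)//; apply/funext. Qed.

Lemma cder_cst c t : cder (fun=> c) t 0.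
Proof. by split; exact: is_derive_cst. Qed.

Lemma cderD f g t a b : cder f t a -> cder g t b -> cder (fun s => f s + g s) t (a + b).
Proof.
move=> [f1 f2] [g1 g2]; split.
  by rewrite Re_add; under eq_fun do rewrite Re_add; exact: is_deriveD.
by rewrite Im_add; under eq_fun do rewrite Im_add; exact: is_deriveD.
Qed.

Lemma cderM f g t a b : cder f t a -> cder g t b ->
  cder (fun s => f s * g s) t (a * g t + f t * b).
Proof.
move=> [f1 f2] [g1 g2]; split.
  under eq_fun do rewrite Re_mul.
  apply: is_derive_eq.
  by rewrite !ReImE/= /GRing.scale/=; ring.
under eq_fun do rewrite Im_mul.
apply: is_derive_eq.
by rewrite !ReImE/= /GRing.scale/=; ring.
Qed.

Lemma cderZ f t a c : cder f t a -> cder (fun s => c * f s) t (c * a).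
Proof.
move=> h; apply: cder_eq (cderM (cder_cst c t) h) _ _ => //.
by rewrite mul0r add0r.
Qed.

Lemma cder_conj f t a : cder f t a -> cder (fun s => cconj (f s)) t (cconj a).
Proof. by move=> [f1 f2]; split => //=; exact: is_deriveN. Qed.

Lemma cder_sum I (r : seq I) (P : pred I) (F : I -> R -> R[i]) t (l : I -> R[i]) :
  (forall i, cder (F i) t (l i)) ->
  cder (fun s => \sum_(i <- r | P i) F i s) t (\sum_(i <- r | P i) l i).
Proof.
move=> mF; elim: r => [|i r IH].
  by rewrite big_nil; under eq_fun do rewrite big_nil; exact: cder_cst.
rewrite big_cons; under eq_fun do rewrite big_cons; case: (P i) => //.
exact: cderD.
Qed.

Lemma cder_real (f : R -> R) (t a : R) : is_derive t 1 f a -> cder (fun s => (f s)%:C) t (a%:C).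
Proof. by move=> fa; split => //=; exact: is_derive_cst. Qed.

Lemma cder_cexpi (f : R -> R) (t a : R) : is_derive t 1 f a ->
  cder (fun s => cexpi (f s)) t (ii * a%:C * cexpi (f t)).
Proof.
move=> fa; split => /=.
  apply: (is_derive_eq (is_derive1_comp (is_derive_cos (f t)) fa)).
  by ring.
apply: (is_derive_eq (is_derive1_comp (is_derive_sin (f t)) fa)).
by ring.
Qed.

Lemma cder_cexp f t a : cder f t a -> cder (fun s => cexp (f s)) t (a * cexp (f t)).
Proof.
move=> [f1 f2]; rewrite cexpE; under eq_fun do rewrite cexpE.
have h1 : is_derive t 1 (fun s => expR (complex.Re (f s)))
    (expR (complex.Re (f t)) * complex.Re a).
  by apply: (@is_derive1_comp _ expR).
apply: cder_eq (cderM (cder_real h1) (cder_cexpi f2)) _ _ => //.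
move: (expR _) (cexpi _) => c e.
case: a {f1 f2 h1} => a b; case: e => e1 e2.
apply: complex_eq; rewrite !ReImE/=.
  by ring.
by ring.
Qed.

Lemma cder0_cst f : (forall t, cder f t 0) -> forall x y, f x = f y.
Proof.
move=> h x y; apply: complex_eq.
  by apply: (@is_derive_0_is_cst _ (fun s => complex.Re (f s))) => t; case: (h t).
by apply: (@is_derive_0_is_cst _ (fun s => complex.Im (f s))) => t; case: (h t).
Qed.

Lemma is_derive_continuous (f : R -> R) (t a : R) : is_derive t 1 f a -> {for t, continuous f}.
Proof.
by move=> [df _]; exact/differentiable_continuous/derivable1_diffP.
Qed.

End ComplexDerivative.

Section ParamDerivative.
Context {R : realType} d (T : measurableType d) (mu : {measure set T -> \bar R}).

Lemma is_derive_Rintegral (f df : R -> T -> R) (G : T -> R) (a : R) :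
  (forall x, rintegrable mu (f x)) ->
  (forall (x : R) y, is_derive x 1 (f^~ y) (df x y)) ->
  rintegrable mu G -> (forall x y, `|df x y| <= G y) ->
  is_derive a 1 (fun x => \int[mu]_y f x y) (\int[mu]_y df a y).
Proof.
move=> fi fd Gi dG.
have G0 y : 0 <= G y by apply: le_trans (dG 0 y).
(* The majorant holds for every value of the parameter, so any interval around [a] will do. *)
have Ia : [set` `]a - 1, a + 1[%R] a by rewrite /= in_itv/= ltrBlDr ltrDl ltr01.
have E x y : partial1of2 f x y = df x y.
  by rewrite partial1of2E; case: (fd x y).
have H : forall x y, [set` `]a - 1, a + 1[%R] x -> [set: T] y -> derivable (f ^~ y) x 1.
  by move=> x y _ _; case: (fd x y).
have H2 : forall x y, [set` `]a - 1, a + 1[%R] x -> [set: T] y ->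
    `|partial1of2 f x y| <= G y by move=> x y _ _; rewrite E.
split.
  exact: (derivable_under_integral measurableT Ia (fun x _ => fi x) H G0 Gi H2).
rewrite -derive1E.
rewrite (differentiation_under_integral measurableT Ia (fun x _ => fi x) H G0 Gi H2).
by apply: eq_Rintegral => y _; rewrite E.
Qed.

(** The form in which Fourier integrals are differentiated: [lam] is the frequency conjugate to the
    parameter, and the modulus of the differentiated integrand does not depend on the parameter, so
    it is its own majorant. *)
Lemma cder_cint_cexpi (lam : T -> R) (u : T -> R[i]) (s : R) :
  measurable_fun [set: T] lam -> cintegrable mu u ->
  cintegrable mu (fun x => (lam x)%:C * u x) ->
  cder (fun s => cint mu (fun x => cexpi (s * lam x) * u x)) s
       (cint mu (fun x => cexpi (s * lam x) * (ii * ((lam x)%:C * u x)))).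
Proof.
move=> ml ui lui.
have mu' := cintegrable_mcfun ui.
have mE t : mcfun (fun x => cexpi (t * lam x)).
  by apply: mcfun_cexpi; exact: measurable_funM.
have fi t : cintegrable mu (fun x => cexpi (t * lam x) * u x).
  by apply: (@cintegrable_bounded _ _ _ _ _ _ 1) => // x; rewrite cmod_cexpi.
have dd t x : cder (fun s => cexpi (s * lam x) * u x) t
    (cexpi (t * lam x) * (ii * ((lam x)%:C * u x))).
  have h : is_derive t 1 (fun s => s * lam x) (lam x).
    by apply: is_derive_eq; rewrite /GRing.scale/=; ring.
  apply: cder_eq (cderM (cder_cexpi h) (cder_cst (u x) t)) _ _ => //.
  by ring.
have bd t x : cmod (cexpi (t * lam x) * (ii * ((lam x)%:C * u x))) <=
    cmod ((lam x)%:C * u x).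
  by rewrite cmodM cmod_cexpi mul1r cmodM cmod_ii mul1r.
split => /=.
  apply: (@is_derive_Rintegral (fun t x => complex.Re (cexpi (t * lam x) * u x))
    (fun t x => complex.Re (cexpi (t * lam x) * (ii * ((lam x)%:C * u x))))
    (fun x => cmod ((lam x)%:C * u x))).
  - by move=> t; case: (fi t).
  - by move=> t x; case: (dd t x).
  - exact: rintegrable_cmod.
  - by move=> t x; apply: le_trans (bd t x); exact: ler_Re_cmod.
apply: (@is_derive_Rintegral (fun t x => complex.Im (cexpi (t * lam x) * u x))
  (fun t x => complex.Im (cexpi (t * lam x) * (ii * ((lam x)%:C * u x))))
  (fun x => cmod ((lam x)%:C * u x))).
- by move=> t; case: (fi t).
- by move=> t x; case: (dd t x).
- exact: rintegrable_cmod.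
- by move=> t x; apply: le_trans (bd t x); exact: ler_Im_cmod.
Qed.

End ParamDerivative.

(** * Gaussian integrals with complex parameter *)

Section Substitution.
Context {R : realType}.
Local Notation mu := (@lebesgue_measure R).
Local Open Scope ereal_scope.

(** Substitution on [[- n, n]] followed by monotone convergence. The range is given as the union of
    the image intervals because it is the whole line in some uses and a half-line in another. *)
Lemma ge0_substitution (F dF G : R -> R) (U : set R) :
  (forall x : R, is_derive x 1%R F (dF x)) -> continuous dF -> (forall x, 0 < dF x)%R ->
  continuous G -> (forall x, 0 <= G x)%R ->
  \bigcup_n `[F (- n%:R)%R, F n%:R]%classic = U ->
  \int[mu]_(x in U) (G x)%:E = \int[mu]_x (G (F x) * dF x)%:E.
Proof.
move=> FdF cdF dF0 cG G0 UE.
have dFE : F^`()%classic = dF by apply/funext => x; rewrite derive1E; case: (FdF x).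
have cF : continuous F by move=> x; exact: is_derive_continuous (FdF x).
have incF : {homo F : x y / (x < y)%R}.
  move=> x y xy.
  have [|c _] := @MVT _ F dF x y xy (fun x _ => FdF x).
    exact: continuous_subspaceT.
  by move=> E; rewrite -subr_gt0 E mulr_gt0// subr_gt0.
have leF x y : (x <= y)%R -> (F x <= F y)%R.
  by rewrite le_eqVlt => /predU1P[->//|/incF/ltW].
have H n : \int[mu]_(x in `[F (- n%:R)%R, F n%:R]) (G x)%:E =
           \int[mu]_(x in `[(- n%:R)%R, n%:R]) (G (F x) * dF x)%:E.
  rewrite integration_by_substitution_increasing ?dFE//.
  - by rewrite (le_trans (_ : _ <= 0)%R)// lerNl oppr0.
  - by move=> x y _ _; exact: incF.
  - by apply/cvg_ex; exists (dF (- n%:R)%R); apply: cvg_at_right_filter; exact: cdF.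
  - by apply/cvg_ex; exists (dF n%:R); apply: cvg_at_left_filter; exact: cdF.
  - split; first by move=> x _; case: (FdF x).
      by apply: cvg_at_right_filter; exact: cF.
    by apply: cvg_at_left_filter; exact: cF.
  - exact: continuous_subspaceT.
have mG : measurable_fun setT (fun x => (G x)%:E).
  by apply/measurable_EFinP; exact: continuous_measurable_fun.
have mGF : measurable_fun setT (fun x => (G (F x) * dF x)%:E).
  apply/measurable_EFinP; apply: measurable_funM.
    by apply: measurableT_comp; exact: continuous_measurable_fun.
  exact: continuous_measurable_fun.
have nd1 : nondecreasing_seq (fun n : nat => `[(- n%:R)%R, n%:R]%classic : set R).
  move=> m n mn; apply/subsetPset => x /=; rewrite !in_itv/= => /andP[a b].
  by rewrite (le_trans _ a) ?lerN2 ?ler_nat// (le_trans b)// ler_nat.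
have nd2 : nondecreasing_seq (fun n : nat => `[F (- n%:R)%R, F n%:R]%classic : set R).
  move=> m n mn; apply/subsetPset => x /=; rewrite !in_itv/= => /andP[a b].
  by rewrite (le_trans _ a) ?leF ?lerN2 ?ler_nat// (le_trans b)// leF// ler_nat.
have T1 : \bigcup_n (`[(- n%:R)%R, n%:R]%classic : set R) = setT.
  apply/seteqP; split => // x _; exists (Num.truncn `|x|).+1 => //=.
  by rewrite in_itv/= -ler_norml ltW// truncnS_gt.
have c1 : \int[mu]_(x in `[(- n%:R)%R, n%:R]) (G (F x) * dF x)%:E @[n --> \oo] -->
    \int[mu]_x (G (F x) * dF x)%:E.
  rewrite -T1; apply: ge0_nondecreasing_set_cvg_integral => //.
    by move=> i; exact: measurable_funTS.
  by move=> i x _; rewrite lee_fin mulr_ge0// ltW.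
have c2 : \int[mu]_(x in `[F (- n%:R)%R, F n%:R]) (G x)%:E @[n --> \oo] -->
    \int[mu]_(x in U) (G x)%:E.
  rewrite -UE; apply: ge0_nondecreasing_set_cvg_integral => //.
    by move=> i; exact: measurable_funTS.
  by move=> i x _; rewrite lee_fin.
rewrite -(cvg_lim _ c1)// -(cvg_lim _ c2)//.
by congr (limn _); apply/funext => n; exact: H.
Qed.

(** By uniqueness of Lebesgue measure: the shifted measure gives half-open intervals their
    length. *)
Lemma leb_shift (b : R) (A : set R) : measurable A ->
  pushforward mu (fun x => (x + b)%R : measurableTypeR R) A = mu A.
Proof.
move=> mA; apply/esym.
have ms : measurable_fun [set: measurableTypeR R] (fun x : R => (x + b)%R : measurableTypeR R).
  by apply: measurable_funD.
apply: (lebesgue_measure_unique (mu := pushforward mu (fun x => (x + b)%R : measurableTypeR R))) => //.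
move=> _ [[x y]] _ <-.
rewrite [RHS](_ : _ = mu `](x - b)%R, (y - b)%R]%classic); last first.
  congr (mu _); by apply/seteqP; split => t /=; rewrite !in_itv/= ltrBlDr lerBrDr.
rewrite !lebesgue_measure_itv/= !lte_fin ltrD2r.
by case: ifPn => // _; congr (_%:E); ring.
Qed.

Lemma ge0_integral_shift (f : R -> \bar R) (b : R) : measurable_fun setT f ->
  (forall x, 0 <= f x) -> \int[mu]_x f (x + b)%R = \int[mu]_x f x.
Proof.
move=> mf f0.
have ms : measurable_fun [set: measurableTypeR R] (fun x : R => (x + b)%R : measurableTypeR R).
  by apply: measurable_funD.
have := ge0_integral_pushforward ms mu measurableT mf (fun x _ => f0 x).
rewrite preimage_setT => <-.
by apply: eq_measure_integral => A mA _; exact: leb_shift.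
Qed.

Lemma ge0_integral_opp (f : R -> \bar R) : measurable_fun setT f ->
  (forall x, 0 <= f x) -> \int[mu]_x f (- x)%R = \int[mu]_x f x.
Proof.
move=> mf f0.
have ms : measurable_fun [set: measurableTypeR R] (fun x : R => (- x)%R : measurableTypeR R).
  exact: measurable_funN.
have := ge0_integral_pushforward ms mu measurableT mf (fun x _ => f0 x).
rewrite preimage_setT => <-.
by apply: eq_measure_integral => A mA _; exact: lebesgue_measureN.
Qed.

End Substitution.

(** * The Cauchy-Schloemilch substitution *)

Section Cauchy_Schlomilch.
Context {R : realType}.
Local Notation mu := (@lebesgue_measure R).
Local Open Scope ereal_scope.
Implicit Types (G : R -> R) (om : R).

(** The Cauchy-Schloemilch argument in the variable [expR s], which replaces the half-line by the
    real line. Its square is [expR s ^+ 2 / 4 + om ^+ 2 * expR (- s) ^+ 2 - om], so a Gaussian of it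
    differs from an exponential quadratic in [om] by a factor exponential in [om]. *)
Definition cs_arg (om s : R) : R := (expR s / 2 - om * expR (- s))%R.

Lemma is_derive_cs_arg om s :
  is_derive s (1%R : R) (cs_arg om) (expR s / 2 + om * expR (- s))%R.
Proof.
have h : is_derive s (1%R : R) (fun s => expR (- s))%R (- expR (- s))%R.
  apply: (is_derive_eq (is_derive1_comp (is_derive_expR (- s)%R) (is_deriveNid s 1%R))).
  by rewrite mulrN1.
apply: is_derive_eq; rewrite /GRing.scale/=.
by ring.
Qed.

Lemma continuous_cs_arg om : continuous (cs_arg om).
Proof. by move=> s; exact: is_derive_continuous (is_derive_cs_arg om s). Qed.

Lemma continuous_expRN : continuous (fun s : R => expR (- s)).
Proof.
by move=> s; apply: (@continuous_comp _ _ _ (fun s : R => - s)%R expR);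
  [exact: continuousN|exact: continuous_expR].
Qed.

Lemma expR_ge_id (x : R) : (x <= expR x)%R.
Proof. by apply: le_trans (expR_ge1Dx x); rewrite lerDr. Qed.

Lemma cs_sum G om : (0 < om)%R -> continuous G -> (forall x, 0 <= G x)%R ->
  \int[mu]_s (G (cs_arg om s) * (expR s / 2 + om * expR (- s)))%:E = \int[mu]_v (G v)%:E.
Proof.
move=> om0 cG G0.
apply/esym; apply: (@ge0_substitution _ (cs_arg om)
  (fun s => expR s / 2 + om * expR (- s))%R G setT) => //.
- exact: is_derive_cs_arg.
- move=> s; apply: cvgD; apply: cvgM; try exact: cvg_cst.
    exact: continuous_expR.
  exact: continuous_expRN.
- by move=> s; rewrite addr_gt0// mulr_gt0// ?expR_gt0// invr_gt0.
apply/seteqP; split => // v _.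
(* Since [n <= expR n], the first summand makes [expR n / 2] exceed [|v|] plus the bounded second
   term at [n], and the second makes [om * expR n] do the same at [- n]. *)
pose M := (2 * (`|v| + om + 1) + (`|v| + 1) / om)%R.
have v0 := normr_ge0 v.
exists (Num.truncn M).+1 => //=.
set n := _.+1; have nM : (M <= n%:R)%R by rewrite ltW// truncnS_gt.
have hM1 : (2 * (`|v| + om + 1) <= M)%R.
  by rewrite lerDl divr_ge0 ?addr_ge0 ?(ltW om0).
have hM2 : ((`|v| + 1) / om <= M)%R.
  by rewrite lerDr mulr_ge0 ?addr_ge0 ?(ltW om0).
have e1 := expR_ge_id n%:R.
have e2 : (expR (- n%:R) <= 1 :> R)%R by rewrite -expR0 ler_expR lerNl oppr0.
have e3 := expR_ge0 (- n%:R : R)%R.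
have /andP[v1 v2] : (- `|v| <= v <= `|v|)%R by rewrite -ler_norml.
rewrite in_itv/= /cs_arg opprK; apply/andP; split.
  have : (`|v| + 1 <= om * expR n%:R)%R.
    rewrite -ler_pdivrMl// mulrC; apply: le_trans hM2 _; exact: le_trans e1.
  by lra.
have : (om * expR (- n%:R) <= om)%R by rewrite ler_piMr// ltW.
by lra.
Qed.

(** Reflecting [s] into [ln (2 * om) - s] negates [cs_arg] and exchanges the two summands of its
    derivative. *)
Lemma cs_reflect G om : (0 < om)%R -> continuous G -> (forall x, 0 <= G x)%R ->
  (forall x, G (- x) = G x)%R ->
  \int[mu]_s (G (cs_arg om s) * (expR s / 2))%:E =
  \int[mu]_s (G (cs_arg om s) * (om * expR (- s)))%:E.
Proof.
move=> om0 cG G0 Gev.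
have cGc : continuous (fun s => G (cs_arg om s)).
  by move=> s; apply: continuous_comp; [exact: continuous_cs_arg|exact: cG].
have mf : measurable_fun [set: R] (fun s => (G (cs_arg om s) * (expR s / 2))%:E).
  apply/measurable_EFinP; apply: measurable_funM.
    exact: continuous_measurable_fun.
  by apply: measurable_funM => //; apply: continuous_measurable_fun; exact: continuous_expR.
have f0 s : 0 <= (G (cs_arg om s) * (expR s / 2))%:E.
  by rewrite lee_fin mulr_ge0// divr_ge0// expR_ge0.
pose f s := (G (cs_arg om s) * (expR s / 2))%:E.
rewrite -(@ge0_integral_shift _ f (ln (2 * om)))// -(@ge0_integral_opp _ (fun s => f (s + ln (2 * om))%R))//.
- apply: eq_integral => s _; rewrite /f /cs_arg.
  have o2 : (0 < 2 * om)%R by rewrite mulr_gt0.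
  rewrite opprD opprK !expRD [expR (- ln _)]expRN lnK ?posrE//.
  have E1 : (expR (- s) * (2 * om) / 2 = om * expR (- s))%R by field.
  have E2 : (om * (expR s * (2 * om)^-1) = expR s / 2)%R.
    by field; rewrite lt0r_neq0.
  rewrite E1 E2 -Gev; congr (_ * _)%:E; congr G.
  by rewrite opprB.
- apply: (measurableT_comp mf); exact: measurable_funD.
- by move=> x; exact: f0.
Qed.

(** By [cs_reflect] the two summands of the derivative of [cs_arg] contribute equally, so twice the
    first gives the whole. At [om = 0] the range is only a half-line, and the factor two comes from
    the evenness of [G] instead. *)
Lemma cs1_ge0 G om : (0 <= om)%R -> continuous G -> (forall x, 0 <= G x)%R ->
  (forall x, G (- x) = G x)%R ->
  \int[mu]_s (G (cs_arg om s) * expR s)%:E = \int[mu]_v (G v)%:E.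
Proof.
move=> om0 cG G0 Gev.
have cGc : continuous (fun s => G (cs_arg om s)).
  by move=> s; apply: continuous_comp; [exact: continuous_cs_arg|exact: cG].
have mf : measurable_fun [set: R] (fun s => (G (cs_arg om s) * (expR s / 2))%:E).
  apply/measurable_EFinP; apply: measurable_funM.
    exact: continuous_measurable_fun.
  by apply: measurable_funM => //; apply: continuous_measurable_fun; exact: continuous_expR.
have mf2 : measurable_fun [set: R] (fun s => (G (cs_arg om s) * (om * expR (- s)))%:E).
  apply/measurable_EFinP; apply: measurable_funM.
    exact: continuous_measurable_fun.
  by apply: measurable_funM => //; apply: continuous_measurable_fun; exact: continuous_expRN.
have -> : \int[mu]_s (G (cs_arg om s) * expR s)%:E =
    \int[mu]_s (G (cs_arg om s) * (expR s / 2))%:E +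
    \int[mu]_s (G (cs_arg om s) * (expR s / 2))%:E.
  rewrite -ge0_integralD//.
  - by apply: eq_integral => s _; rewrite -EFinD; congr (_%:E); lra.
  - by move=> s _; rewrite lee_fin mulr_ge0// divr_ge0// expR_ge0.
  - by move=> s _; rewrite lee_fin mulr_ge0// divr_ge0// expR_ge0.
move: om0; rewrite le_eqVlt => /predU1P[om0|om0].
  rewrite ge0_symfun_integralT//; last by move=> x /=; rewrite Gev.
  have -> : \int[mu]_(x in [set x | (0 <= x)%R]) (G x)%:E =
      \int[mu]_s (G (cs_arg om s) * (expR s / 2))%:E.
    rewrite (_ : [set x | (0 <= x)%R] = `[0%R, +oo[%classic); last first.
      by apply/seteqP; split => x /=; rewrite in_itv/= andbT.
    rewrite -integral_itv_obnd_cbnd; last first.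
      by apply: measurable_funTS; apply/measurable_EFinP; exact: continuous_measurable_fun.
    transitivity (\int[mu]_s (G (expR s / 2) * (expR s / 2))%:E); last first.
      by apply: eq_integral => s _; rewrite /cs_arg -om0 mul0r subr0.
    apply: (@ge0_substitution _ (fun s => expR s / 2)%R (fun s => expR s / 2)%R G) => //.
    + by move=> s; apply: is_derive_eq; rewrite /GRing.scale/= mulrC; lra.
    + move=> s; apply: cvgM; [exact: continuous_expR|exact: cvg_cst].
    + by move=> s; rewrite divr_gt0// expR_gt0.
    apply/seteqP; split => [x [n _]|x] /=; rewrite !in_itv/= andbT.
      by move=> /andP[h _]; apply: lt_le_trans h; rewrite divr_gt0// expR_gt0.
    move=> x0; pose M := (2 * x + (2 * x)^-1)%R.
    exists (Num.truncn M).+1 => //=; set n := _.+1.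
    have nM : (M <= n%:R)%R by rewrite ltW// truncnS_gt.
    have i0 : (0 < (2 * x)^-1)%R by rewrite invr_gt0 mulr_gt0.
    have e1 := expR_ge_id n%:R.
    rewrite in_itv/=; apply/andP; split; last by rewrite /M in nM; lra.
    rewrite expRN ler_pdivrMr// mulrC -[leRHS]invrK lef_pV2 ?posrE ?invr_gt0 ?expR_gt0 ?mulr_gt0//.
    by rewrite /M in nM; lra.
  by rewrite -mule2n -mule_natl.
rewrite {2}(cs_reflect om0)// -ge0_integralD//.
- rewrite -(cs_sum om0 cG G0); apply: eq_integral => s _.
  by rewrite -EFinD -mulrDr.
- by move=> s _; rewrite lee_fin mulr_ge0// divr_ge0// expR_ge0.
- by move=> s _; rewrite lee_fin mulr_ge0// mulr_ge0 ?expR_ge0// ltW.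
Qed.

Lemma cs2_ge0 G om : (0 < om)%R -> continuous G -> (forall x, 0 <= G x)%R ->
  (forall x, G (- x) = G x)%R ->
  \int[mu]_s (G (cs_arg om s) * (2 * om * expR (- s)))%:E = \int[mu]_v (G v)%:E.
Proof.
move=> om0 cG G0 Gev; rewrite -(cs1_ge0 (ltW om0) cG G0 Gev).
have := cs_reflect om0 cG G0 Gev.
have cGc : continuous (fun s => G (cs_arg om s)).
  by move=> s; apply: continuous_comp; [exact: continuous_cs_arg|exact: cG].
have mf : measurable_fun [set: R] (fun s => (G (cs_arg om s) * (expR s / 2))%:E).
  apply/measurable_EFinP; apply: measurable_funM.
    exact: continuous_measurable_fun.
  by apply: measurable_funM => //; apply: continuous_measurable_fun; exact: continuous_expR.
have mf2 : measurable_fun [set: R] (fun s => (G (cs_arg om s) * (om * expR (- s)))%:E).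
  apply/measurable_EFinP; apply: measurable_funM.
    exact: continuous_measurable_fun.
  by apply: measurable_funM => //; apply: continuous_measurable_fun; exact: continuous_expRN.
move=> H.
have -> : \int[mu]_s (G (cs_arg om s) * (2 * om * expR (- s)))%:E =
   \int[mu]_s (2%:E * (G (cs_arg om s) * (om * expR (- s)))%:E).
  by apply: eq_integral => s _; rewrite -EFinM; congr (_%:E); ring.
rewrite ge0_integralZl//; last first.
  by move=> s _; rewrite lee_fin mulr_ge0// mulr_ge0 ?expR_ge0// ltW.
rewrite -H -ge0_integralZl//; last first.
  by move=> s _; rewrite lee_fin mulr_ge0// divr_ge0// expR_ge0.
by apply: eq_integral => s _; rewrite -EFinM; congr (_%:E); field.
Qed.

End Cauchy_Schlomilch.

(** * Gaussian integrals and the subordination formulas *)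

Section Gauss.
Context {R : realType}.
Implicit Types (e x : R) (a z : R[i]).

Lemma ge0_integral_scale (G : R -> R) (c : R) : 0 < c -> continuous G ->
  (forall x, 0 <= G x) ->
  (\int[leb]_x (G (c * x))%:E = (c^-1)%:E * \int[leb]_x (G x)%:E)%E.
Proof.
move=> c0 cG G0.
have cGc : continuous (fun x => G (c * x)).
  move=> x; apply: (@continuous_comp _ _ _ (fun x => c * x) G); last exact: cG.
  by apply: cvgM; [exact: cvg_cst|exact: cvg_id].
have mGc : measurable_fun [set: R] (fun x => (G (c * x))%:E).
  by apply/measurable_EFinP; exact: continuous_measurable_fun.
have -> : (\int[leb]_x (G x)%:E = \int[leb]_x (G (c * x) * c)%:E)%E.
  apply: (@ge0_substitution _ (fun x => c * x) (fun=> c) G setT) => //.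
  - by move=> x; apply: is_derive_eq; rewrite /GRing.scale/=; ring.
  - by move=> x; exact: cvg_cst.
  apply/seteqP; split => // x _; exists (Num.truncn (`|x| / c)).+1 => //=.
  rewrite in_itv/= mulrN -ler_norml.
  by rewrite -ler_pdivrMl// mulrC ltW// truncnS_gt.
rewrite -ge0_integralZl//; last 3 first.
- apply/measurable_EFinP; apply: measurable_funM => //.
  exact: continuous_measurable_fun.
- by move=> x _; rewrite lee_fin mulr_ge0// ltW.
- by rewrite lee_fin invr_ge0 ltW.
apply: eq_integral => x _; rewrite -EFinM; congr (_%:E); field.
by rewrite lt0r_neq0.
Qed.

Lemma continuous_gauss e : continuous (fun x => expR (- (e * x ^+ 2))).
Proof.
move=> x; apply: (@continuous_comp _ _ _ (fun x : R => - (e * x ^+ 2)) expR).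
  by apply: cvgN; apply: cvgM; [exact: cvg_cst|exact: exprn_continuous].
exact: continuous_expR.
Qed.

Lemma integral_gauss e : 0 < e ->
  (\int[leb]_x (expR (- (e * x ^+ 2)))%:E = (Num.sqrt (pi / e))%:E)%E.
Proof.
move=> e0.
have := @ge0_integral_scale gauss_fun (Num.sqrt e) (_ : 0 < Num.sqrt e) (@continuous_gauss_fun R) (@gauss_fun_ge0 R).
rewrite sqrtr_gt0 => /(_ e0).
have -> : (\int[leb]_x (gauss_fun x)%:E = (Num.sqrt pi)%:E :> \bar R)%E by exact: integralT_gauss.
rewrite -EFinM => H.
rewrite sqrtrM ?pi_ge0// sqrtrV ?ltW// [X in _ = X%:E]mulrC -H.
by apply: eq_integral => x _; rewrite /gauss_fun exprMn sqr_sqrtr// ltW.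
Qed.

Lemma rintegrable_gauss e : 0 < e -> rintegrable leb (fun x => expR (- (e * x ^+ 2))).
Proof.
move=> e0; apply/integrableP; split.
  by apply/measurable_EFinP; apply: continuous_measurable_fun; exact: continuous_gauss.
under eq_integral do rewrite /= ger0_norm ?expR_ge0//.
by rewrite integral_gauss// ltry.
Qed.

Lemma Rintegral_gauss e : 0 < e -> \int[leb]_x expR (- (e * x ^+ 2)) = Num.sqrt (pi / e).
Proof. by move=> e0; rewrite /Rintegral integral_gauss. Qed.

(** Half of the Gaussian absorbs the polynomial, through [1 + y <= expR y]. *)
Lemma gauss_poly_bound e x : 0 < e ->
  (1 + x ^+ 2) * expR (- (e * x ^+ 2)) <= (1 + 2 / e) * expR (- (e / 2 * x ^+ 2)).
Proof.
move=> e0.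
have -> : - (e * x ^+ 2) = - (e / 2 * x ^+ 2) - (e / 2 * x ^+ 2) by lra.
rewrite expRD mulrA ler_wpM2r ?expR_ge0//.
rewrite expRN ler_pdivrMr ?expR_gt0//.
have h := expR_ge1Dx (e / 2 * x ^+ 2).
have x2 : 0 <= x ^+ 2 by exact: sqr_ge0.
have he : 0 < 2 / e by rewrite divr_gt0.
apply: le_trans (_ : (1 + 2 / e) * (1 + e / 2 * x ^+ 2) <= _); last first.
  by rewrite ler_wpM2l// addr_ge0// ltW.
rewrite mulrDl mul1r mulrDr mulr1.
have -> : 2 / e * (e / 2 * x ^+ 2) = x ^+ 2 by field; rewrite lt0r_neq0.
have : 0 <= e / 2 * x ^+ 2 by rewrite mulr_ge0// divr_ge0// ltW.
by lra.
Qed.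

Lemma rintegrable_poly_gauss (f : R -> R) (M e : R) : 0 < e -> measurable_fun [set: R] f ->
  (forall x, `|f x| <= M * ((1 + x ^+ 2) * expR (- (e * x ^+ 2)))) -> rintegrable leb f.
Proof.
move=> e0 mf fM.
apply: (@rintegrable_le _ _ (measurableTypeR R) leb f
  (fun x : R => `|M| * (1 + 2 / e) * expR (- (e / 2 * x ^+ 2)))) => //.
- by apply: rintegrableZ; apply: rintegrable_gauss; rewrite divr_gt0.
- move=> x; apply: le_trans (fM x) _; rewrite -mulrA.
  apply: le_trans (_ : `|M| * ((1 + x ^+ 2) * expR (- (e * x ^+ 2))) <= _).
    by rewrite ler_wpM2r ?ler_norm// mulr_ge0 ?expR_ge0// addr_ge0// sqr_ge0.
  by rewrite ler_wpM2l// gauss_poly_bound.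
Qed.

(** On [[- n - 1, n + 1]] the boundary terms are at most [2 M / (n + 1)] by the last hypothesis;
    dominated convergence does the rest. *)
Lemma Rintegral_derive0 (h dh : R -> R) (M : R) :
  (forall x : R, is_derive x 1 h (dh x)) -> continuous dh -> rintegrable leb dh ->
  (forall x, `|h x| * `|x| <= M) -> \int[leb]_x dh x = 0.
Proof.
move=> hd cd di hM.
have M0 : 0 <= M by apply: le_trans (hM 0); rewrite mulr_ge0.
have ch : continuous h by move=> x; exact: is_derive_continuous (hd x).
have dE : h^`() = dh by apply/funext => x; rewrite derive1E; case: (hd x).
pose dn (n : nat) (x : R) := ((dh \_ (`[(- n.+1%:R)%R, (n.+1%:R)%R])) x)%:E.
have E n : (\int[leb]_x dn n x = (h n.+1%:R - h (- n.+1%:R))%:E)%E.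
  transitivity (\int[leb]_(x in `[(- n.+1%:R)%R, (n.+1%:R)%R]) (dh x)%:E)%E.
    rewrite [RHS]integral_mkcond; apply: eq_integral => x _.
    by rewrite /dn restrict_EFin.
  rewrite EFinB; apply: continuous_FTC2 => //.
  - by have : 0 < n.+1%:R :> R by []; lra.
  - exact: continuous_subspaceT.
  - split; first by move=> x _; case: (hd x).
      by apply: cvg_at_right_filter; exact: ch.
    by apply: cvg_at_left_filter; exact: ch.
  - by move=> x _; rewrite dE.
have mdh := rintegrable_measurable di.
have c1 : (\int[leb]_x dn n x)%E @[n --> \oo] --> (\int[leb]_x (dh x)%:E)%E.
  apply: (@dominated_cvg _ _ _ leb setT measurableT dn (fun x => (dh x)%:E) (fun x => `|dh x|%:E)).
  - move=> n; apply/measurable_EFinP.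
    by apply/(measurable_restrictT dh) => //; exact: measurable_funTS.
  - move=> x _; apply: cvg_EFin; first by near=> n.
    apply: cvg_near_cst; near=> n; rewrite /dn /= patchE mem_set//=.
    rewrite in_itv/= -ler_norml; apply: le_trans (_ : n%:R <= _); last by rewrite ler_nat.
    near: n; exact: nbhs_infty_ger.
  - by [].
  - exact: rintegrable_norm di.
  - move=> n x _; rewrite /dn abse_EFin lee_fin patchE.
    by case: ifP => // _; rewrite normr0.
have c2 : (\int[leb]_x dn n x)%E @[n --> \oo] --> (0 : \bar R)%E.
  under eq_fun do rewrite E.
  apply: cvg_EFin; first by near=> n.
  apply/cvgrPdist_le => /= r r0; near=> n.
  rewrite sub0r normrN.
  have n0 : 0 < n.+1%:R :> R by [].
  have h1 := hM n.+1%:R; have h2 := hM (- n.+1%:R).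
  rewrite normrN !(ger0_norm (ltW n0)) in h1 h2.
  rewrite -!ler_pdivlMr// in h1 h2.
  apply: le_trans (ler_normB _ _) _.
  apply: le_trans (_ : 2 * M / n.+1%:R <= _).
    by rewrite mulrDl mul1r mulrDl lerD.
  rewrite ler_pdivrMr// -ler_pdivrMl//.
  apply: le_trans (_ : n%:R <= _); last by rewrite ler_nat.
  near: n; exact: nbhs_infty_ger.
have -> : \int[leb]_x dh x = fine (\int[leb]_x (dh x)%:E)%E by [].
by rewrite (cvg_unique _ c1 c2).
Unshelve. all: by end_near. Qed.

Lemma cint_derive0 (f df : R -> R[i]) (M : R) :
  (forall x, cder f x (df x)) -> (forall x, exists l, cder df x l) -> cintegrable leb df ->
  (forall x, cmod (f x) * `|x| <= M) -> cint leb df = 0.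
Proof.
move=> fd ddf [i1 i2] fM; apply: complex_eq => /=.
  apply: (@Rintegral_derive0 (fun x => complex.Re (f x)) _ M) => //.
  - by move=> x; case: (fd x).
  - by move=> x; case: (ddf x) => l []; move=> h _; exact: is_derive_continuous h.
  - by move=> x; apply: le_trans (fM x); rewrite ler_wpM2r// ler_Re_cmod.
apply: (@Rintegral_derive0 (fun x => complex.Im (f x)) _ M) => //.
- by move=> x; case: (fd x).
- by move=> x; case: (ddf x) => l []; move=> _ h; exact: is_derive_continuous h.
- by move=> x; apply: le_trans (fM x); rewrite ler_wpM2r// ler_Im_cmod.
Qed.

Definition cgauss a x : R[i] := cexp (- (a * (x ^+ 2)%:C)).
(** A square root of [pi / a]. For complex [a] only its square is computed, in [gauss_int_sqr], so
    that no branch of the root has to be chosen. *)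
Definition gauss_int a : R[i] := cint leb (cgauss a).

Lemma cmod_cgauss a x : cmod (cgauss a x) = expR (- (complex.Re a * x ^+ 2)).
Proof. by rewrite cmod_cexp !ReImE mulr0 subr0. Qed.

Lemma cder_cgauss a x : cder (cgauss a) x (- (2 * a * x%:C) * cgauss a x).
Proof.
rewrite /cgauss; apply: cder_cexp.
have h : is_derive x (1 : R) (fun x => x ^+ 2) (2 * x).
  by apply: is_derive_eq; rewrite /GRing.scale/=; ring.
apply: cder_eq (cderZ (- a) (cder_real h)) _ _ => [y|]; first by rewrite mulNr.
by rewrite rmorphM/= rmorph_nat; ring.
Qed.

Lemma mcfun_cgauss a : mcfun (cgauss a).
Proof.
apply: mcfun_cexp; apply: mcfunN; apply: mcfunM; first exact: mcfun_cst.
by apply: mcfun_real; exact: measurable_funX.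
Qed.

Lemma cintegrable_poly_cgauss (u : R -> R[i]) (M : R) a : 0 < complex.Re a -> mcfun u ->
  (forall x, cmod (u x) <= M * (1 + x ^+ 2)) ->
  cintegrable leb (fun x => u x * cgauss a x).
Proof.
move=> a0 mU uM; apply: cintegrableP; first by apply: mcfunM => //; exact: mcfun_cgauss.
apply: (@rintegrable_poly_gauss _ M (complex.Re a)) => //.
  by apply: measurable_cmod; apply: mcfunM => //; exact: mcfun_cgauss.
move=> x; rewrite ger0_norm ?cmod_ge0// cmodM cmod_cgauss mulrA.
by rewrite ler_wpM2r ?expR_ge0.
Qed.

Lemma cintegrable_cgauss a : 0 < complex.Re a -> cintegrable leb (cgauss a).
Proof.
move=> a0; have := @cintegrable_poly_cgauss (fun=> 1) 1 a a0.
rewrite (_ : (fun x => 1 * cgauss a x) = cgauss a); last by apply/funext => x; rewrite mul1r.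
apply; first exact: mcfun_cst.
by move=> x; rewrite cmod1 mul1r lerDl sqr_ge0.
Qed.

Lemma gauss_abs_bound e x : 0 < e -> (1 + `|x|) * expR (- (e * x ^+ 2)) * `|x| <= 3 * (1 + e^-1).
Proof.
move=> e0.
have h := expR_ge1Dx (e * x ^+ 2).
have := normr_ge0 x; have := real_normK (num_real x); move: `|x| => y.
move=> y2 y0; rewrite -y2 in h *.
rewrite expRN mulrAC ler_pdivrMr ?expR_gt0//.
apply: le_trans (_ : 3 * (1 + e^-1) * (1 + e * y ^+ 2) <= _); last first.
  by rewrite ler_wpM2l// mulr_ge0// addr_ge0// invr_ge0 ltW.
have -> : 3 * (1 + e^-1) * (1 + e * y ^+ 2) =
  3 + 3 * y ^+ 2 + 3 * e^-1 + 3 * (e * y ^+ 2) by field; rewrite lt0r_neq0.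
have i0 : 0 < e^-1 by rewrite invr_gt0.
have : 0 <= e * y ^+ 2 by rewrite mulr_ge0 ?sqr_ge0// ltW.
by nra.
Qed.

Lemma cintegrable_cexpi (u : R -> R[i]) y : cintegrable leb u ->
  cintegrable leb (fun xi => cexpi (y * xi) * u xi).
Proof.
move=> iu; apply: (@cintegrable_bounded _ _ _ _ _ _ 1) => //.
  by apply: mcfun_cexpi; exact: measurable_funM.
by move=> xi; rewrite cmod_cexpi.
Qed.

Lemma cintegrable_id_cgauss a : 0 < complex.Re a ->
  cintegrable leb (fun xi => xi%:C * cgauss a xi).
Proof.
move=> a0; apply: (@cintegrable_poly_cgauss _ 1) => //; first exact: mcfun_real.
move=> xi; rewrite cmod_real mul1r -(real_normK (num_real xi)).
by have := normr_ge0 xi; nra.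
Qed.

Lemma gaussFT1 a y : 0 < complex.Re a ->
  cint leb (fun xi => cexpi (y * xi) * (xi%:C * cgauss a xi)) =
  ii * y%:C / (2 * a) * cint leb (fun xi => cexpi (y * xi) * cgauss a xi).
Proof.
move=> a0.
have an0 : a != 0 by apply/eqP => a00; rewrite a00 ltxx in a0.
have i1 := cintegrable_cexpi y (cintegrable_cgauss a0).
have i2 := cintegrable_cexpi y (cintegrable_id_cgauss a0).
(* The integrand is the derivative of [cexpi (y * xi) * cgauss a xi]. *)
have Z : cint leb (fun xi => ii * y%:C * (cexpi (y * xi) * cgauss a xi) +
    (- (2 * a)) * (cexpi (y * xi) * (xi%:C * cgauss a xi))) = 0.
  apply: (@cint_derive0 (fun xi => cexpi (y * xi) * cgauss a xi) _ (3 * (1 + (complex.Re a)^-1))).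
  - move=> xi.
    have h1 : is_derive xi (1 : R) (fun xi => y * xi) y.
      by apply: is_derive_eq; rewrite /GRing.scale/=; ring.
    apply: cder_eq (cderM (cder_cexpi h1) (cder_cgauss a xi)) _ _ => //.
    by ring.
  - move=> xi.
    have h1 : is_derive xi (1 : R) (fun xi => y * xi) y.
      by apply: is_derive_eq; rewrite /GRing.scale/=; ring.
    have h2 : cder (fun xi => xi%:C) xi 1.
      by apply: cder_eq (cder_real (is_derive_id xi (1 : R))) _ _.
    have h3 := cderM (cder_cexpi h1) (cder_cgauss a xi).
    have h4 := cderM (cder_cexpi h1) (cderM h2 (cder_cgauss a xi)).
    eexists; exact: (cderD (cderZ _ h3) (cderZ _ h4)).
  - by apply: cintegrableD; apply: cintegrableZ.
  - move=> xi; rewrite cmodM cmod_cexpi mul1r cmod_cgauss.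
    apply: le_trans (gauss_abs_bound xi a0).
    by rewrite ler_wpM2r// ler_peMl ?expR_ge0// lerDl.
rewrite (cintD (cintegrableZ _ i1) (cintegrableZ _ i2)) !cintZ// in Z.
move: Z; set J := cint leb _ => Z; set J' := cint leb _ in Z *.
apply: (@mulfI _ (2 * a)); first by rewrite mulf_neq0// pnatr_eq0.
have -> : 2 * a * (ii * y%:C / (2 * a) * J) = ii * y%:C * J by field.
by move: Z; rewrite mulNr => /eqP; rewrite subr_eq0 => /eqP.
Qed.

(** As a function of [x] the transform satisfies [G' = - x G / (2 a)], so its product with
    [exp (x^2 / (4 a))] is constant. *)
Lemma gaussFT a x : 0 < complex.Re a ->
  cint leb (fun xi => cexpi (x * xi) * cgauss a xi) =
  gauss_int a * cexp (- ((x ^+ 2)%:C / (4 * a))).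
Proof.
move=> a0.
have an0 : a != 0 by apply/eqP => a00; rewrite a00 ltxx in a0.
pose G y := cint leb (fun xi => cexpi (y * xi) * cgauss a xi).
have dG y : cder G y (- (y%:C / (2 * a)) * G y).
  have := @cder_cint_cexpi _ _ _ leb (fun xi => xi) (cgauss a) y (@measurable_id _ _ _)
    (cintegrable_cgauss a0) (cintegrable_id_cgauss a0).
  move=> h; apply: cder_eq h _ _ => //.
  have -> : cint leb (fun xi => cexpi (y * xi) * (ii * (xi%:C * cgauss a xi))) =
      ii * cint leb (fun xi => cexpi (y * xi) * (xi%:C * cgauss a xi)).
    rewrite -cintZ; last exact/cintegrable_cexpi/cintegrable_id_cgauss.
    by apply: eq_cint => xi; ring.
  rewrite gaussFT1// -/(G y).
  have -> : ii * (ii * y%:C / (2 * a) * G y) = (ii * ii) * (y%:C / (2 * a) * G y) by ring.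
  have -> : ii * ii = -1 :> R[i] by apply: complex_eq; rewrite !ReImE/=; ring.
  by rewrite mulN1r mulNr.
have K y : cder (fun y => G y * cexp ((y ^+ 2)%:C / (4 * a))) y 0.
  have h : is_derive y (1 : R) (fun x => x ^+ 2) (2 * y).
    by apply: is_derive_eq; rewrite /GRing.scale/=; ring.
  have h2 : cder (fun y => (y ^+ 2)%:C / (4 * a)) y (y%:C / (2 * a)).
    apply: cder_eq (cderZ (4 * a)^-1 (cder_real h)) _ _ => [t|]; first by rewrite mulrC.
    by rewrite rmorphM/= rmorph_nat; field.
  apply: cder_eq (cderM (dG y) (cder_cexp h2)) _ _ => //.
  by ring.
have := cder0_cst K x 0.
rewrite expr0n/= mul0r cexp0 mulr1 => Gx.
have -> : gauss_int a = G 0.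
  by apply: eq_cint => xi; rewrite mul0r cexpi0 mul1r.
by rewrite -Gx -mulrA -cexpD subrr cexp0 mulr1.
Qed.

Lemma gauss_int_real e : 0 < e -> gauss_int (e%:C) = (Num.sqrt (pi / e))%:C.
Proof.
move=> e0.
have E x : cgauss (e%:C) x = (expR (- (e * x ^+ 2)))%:C.
  by rewrite /cgauss -rmorphM -rmorphN cexp_real.
apply: complex_eq; rewrite /gauss_int /cint [LHS]/=.
  by rewrite -Rintegral_gauss//; apply: eq_Rintegral => x _; rewrite E.
transitivity (\int[@leb R]_x 0); last by rewrite /Rintegral integral0.
by apply: eq_Rintegral => x _; rewrite E.
Qed.

(* [z * gauss_int z ^+ 2] is constant along vertical lines: an integration by parts gives
   [d gauss_int / dt = - i gauss_int / (2 z)]. *)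
Lemma gauss_int_sqr a : 0 < complex.Re a -> a * gauss_int a ^+ 2 = pi%:C.
Proof.
move: a => [e b] /= e0.
pose z (t : R) : R[i] := e +i* t.
have z0 t : 0 < complex.Re (z t) by [].
have zn0 t : z t != 0 by apply/eqP => /(congr1 (@complex.Re R))/= e00; rewrite e00 ltxx in e0.
have me : 0 < complex.Re (e%:C) by [].
pose c t := cint leb (fun v => cexpi (t * - v ^+ 2) * cgauss (e%:C) v).
have cE t : c t = gauss_int (z t).
  apply: eq_cint => v; rewrite -cexp_im -cexpD; congr cexp.
  by apply: complex_eq; rewrite !ReImE/=; ring.
have mv : mcfun (fun v : measurableTypeR R => (- v ^+ 2)%:C : R[i]).
  by apply: mcfun_real; apply: measurable_funN; exact: measurable_funX.
have iv2 (a : R[i]) : 0 < complex.Re a -> cintegrable leb (fun v => (- v ^+ 2)%:C * cgauss a v).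
  move=> a0; apply: (@cintegrable_poly_cgauss _ 1) => // v.
  by rewrite cmod_real normrN ger0_norm ?sqr_ge0// mul1r lerDr.
have dc t : cder c t (- ii / (2 * z t) * c t).
  have := @cder_cint_cexpi _ _ _ leb (fun v => - v ^+ 2) (cgauss e%:C) t
    (proj1 mv) (cintegrable_cgauss me) (iv2 _ me).
  move=> h; apply: cder_eq h _ _ => //.
  have Z : cint leb (fun v => cgauss (z t) v + 2 * z t * ((- v ^+ 2)%:C * cgauss (z t) v)) = 0.
    apply: (@cint_derive0 (fun v => v%:C * cgauss (z t) v) _ (3 * (1 + e^-1))).
    - move=> v.
      have h2 : cder (fun xi => xi%:C) v 1.
        by apply: cder_eq (cder_real (is_derive_id v (1 : R))) _ _.
      apply: cder_eq (cderM h2 (cder_cgauss (z t) v)) _ _ => //.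
      by rewrite rmorphN/= rmorphXn/=; ring.
    - move=> v.
      have h1 : is_derive v (1 : R) (fun x => - x ^+ 2) (- (2 * v)).
        by apply: is_derive_eq; rewrite /GRing.scale/=; ring.
      eexists; exact: (cderD (cder_cgauss (z t) v) (cderZ _ (cderM (cder_real h1) (cder_cgauss (z t) v)))).
    - by apply: cintegrableD; [exact: cintegrable_cgauss|apply: cintegrableZ; exact: iv2].
    - move=> v; rewrite cmodM cmod_cgauss cmod_real.
      apply: le_trans (gauss_abs_bound v (z0 t)).
      by rewrite ler_wpM2r// ler_wpM2r ?expR_ge0// lerDr.
  rewrite (cintD (cintegrable_cgauss (z0 t)) (cintegrableZ _ (iv2 _ (z0 t)))) in Z.
  move: Z; rewrite (cintZ _ (iv2 _ (z0 t))).
  rewrite -/(gauss_int (z t)) -cE.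
  have -> : cint leb (fun v => cexpi (t * - v ^+ 2) * (ii * ((- v ^+ 2)%:C * cgauss e%:C v))) =
      ii * cint leb (fun v => (- v ^+ 2)%:C * cgauss (z t) v).
    rewrite -cintZ; last exact: iv2.
    apply: eq_cint => v; rewrite /cgauss.
    have -> : cexp (- (z t * (v ^+ 2)%:C)) = cexpi (t * - v ^+ 2) * cexp (- (e%:C * (v ^+ 2)%:C)).
      rewrite -cexp_im -cexpD; congr cexp.
      by apply: complex_eq; rewrite !ReImE/=; ring.
    by ring.
  move: (cint leb (fun v => (- v ^+ 2)%:C * cgauss (z t) v)) => J Z.
  have -> : c t = - (2 * z t * J) by move/eqP : Z; rewrite addr_eq0 => /eqP.
  by field; exact: zn0.
have dz t : cder z t ii.
  have h : is_derive t (1 : R) (fun t => t) 1 by exact: is_derive_id.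
  apply: cder_eq (cderD (cder_cst (e%:C) t) (cderZ ii (cder_real h))) _ _ => [s|].
    by apply: complex_eq; rewrite !ReImE/=; ring.
  by rewrite add0r mulr1.
have K t : cder (fun t => z t * (c t * c t)) t 0.
  apply: cder_eq (cderM (dz t) (cderM (dc t) (dc t))) _ _ => //.
  by field; exact: zn0.
have := cder0_cst K b 0; rewrite !cE.
have -> : z 0 = e%:C by [].
rewrite gauss_int_real// -expr2 => ->.
rewrite -expr2 -rmorphXn/= -rmorphM/= sqr_sqrtr ?divr_ge0 ?pi_ge0 ?(ltW e0)//.
by congr (_%:C); rewrite mulrC divfK// lt0r_neq0.
Qed.

Lemma cmod_gauss_int_sqr a : 0 < complex.Re a -> cmod (gauss_int a) ^+ 2 = pi / cmod a.
Proof.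
move=> a0; have an0 : a != 0 by apply/eqP => a00; rewrite a00 ltxx in a0.
have := congr1 (@cmod R) (gauss_int_sqr a0); rewrite cmodM cmodX cmod_real ger0_norm ?pi_ge0// => <-.
by rewrite mulrAC divff ?cmod_eq0// mul1r.
Qed.

Lemma gauss_int_neq0 a : 0 < complex.Re a -> gauss_int a != 0.
Proof.
move=> a0; apply/eqP => h; have := gauss_int_sqr a0.
rewrite h expr0n/= mulr0 => /(congr1 (@complex.Re R))/= p0.
by have := pi_gt0 R; rewrite -p0 ltxx.
Qed.

(** Transfers an identity from nonnegative to signed functions: add a majorant [g] for which the
    identity is known, and cancel it. *)
Lemma Rintegral_dom_ge0 d (T : measurableType d) (mu : {measure set T -> \bar R})
    d2 (T2 : measurableType d2) (nu : {measure set T2 -> \bar R})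
    (h g : T -> R) (h2 g2 : T2 -> R) :
  rintegrable mu h -> rintegrable mu g -> rintegrable nu h2 -> rintegrable nu g2 ->
  (\int[mu]_x (h x + g x)%:E = \int[nu]_x (h2 x + g2 x)%:E)%E ->
  (\int[mu]_x (g x)%:E = \int[nu]_x (g2 x)%:E)%E ->
  \int[mu]_x h x = \int[nu]_x h2 x.
Proof.
move=> ih ig ih2 ig2 E1 E2.
have e1 : \int[mu]_x (h x + g x) = \int[nu]_x (h2 x + g2 x).
  by rewrite /Rintegral E1.
have e2 : \int[mu]_x g x = \int[nu]_x g2 x by rewrite /Rintegral E2.
by move: e1; rewrite !RintegralD// e2 => /addIr.
Qed.

Lemma cgauss_ReIm_bound a x :
  `|complex.Re (cgauss a x)| <= expR (- (complex.Re a * x ^+ 2)) /\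
  `|complex.Im (cgauss a x)| <= expR (- (complex.Re a * x ^+ 2)).
Proof. by rewrite -cmod_cgauss ler_Re_cmod ler_Im_cmod. Qed.

Lemma continuous_cgauss a : continuous (fun x => complex.Re (cgauss a x)) /\
  continuous (fun x => complex.Im (cgauss a x)).
Proof.
by split => x; have [h1 h2] := cder_cgauss a x;
  [exact: is_derive_continuous h1|exact: is_derive_continuous h2].
Qed.

Lemma gauss_even a x : cgauss a (- x) = cgauss a x.
Proof. by rewrite /cgauss sqrrN. Qed.

(* A change of variables valid for nonnegative even continuous functions transfers to the
   complex Gaussian: each part of it is a difference of two such functions. *)
Lemma cgauss_transfer a (phi w : R -> R) : 0 < complex.Re a ->
  continuous phi -> continuous w -> (forall s, 0 <= w s) ->
  (forall G : R -> R, continuous G -> (forall x, 0 <= G x) -> (forall x, G (- x) = G x) ->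
    (\int[leb]_s (G (phi s) * w s)%:E = \int[leb]_v (G v)%:E)%E) ->
  cintegrable leb (fun s => (w s)%:C * cgauss a (phi s)) /\
  cint leb (fun s => (w s)%:C * cgauss a (phi s)) = gauss_int a.
Proof.
move=> a0 cphi cw w0 H.
pose g x := expR (- (complex.Re a * x ^+ 2)).
have cg : continuous g by exact: continuous_gauss.
have g0 x : 0 <= g x by exact: expR_ge0.
have gev x : g (- x) = g x by rewrite /g sqrrN.
have mw : measurable_fun [set: R] w by exact: continuous_measurable_fun.
have mphi : measurable_fun [set: R] phi by exact: continuous_measurable_fun.
have ig : rintegrable leb g by exact: rintegrable_gauss.
have igw : rintegrable leb (fun s => g (phi s) * w s).
  apply/integrableP; split.
    apply/measurable_EFinP; apply: measurable_funM => //.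
    by apply: (measurableT_comp _ mphi); exact: continuous_measurable_fun.
  under eq_integral do rewrite /= ger0_norm ?mulr_ge0//.
  by rewrite H// integral_gauss// ltry.
have ci : cintegrable leb (fun s => (w s)%:C * cgauss a (phi s)).
  apply: (cintegrable_le _ igw) => //.
    apply: mcfunM; first exact: mcfun_real.
    exact: (mcfun_comp (mcfun_cgauss a) mphi).
  by move=> s; rewrite cmodM cmod_real ger0_norm// cmod_cgauss mulrC.
have [cr cim] := continuous_cgauss a.
have [ir iim] := ci; have [ir' iim'] := cintegrable_cgauss a0.
have key (p : R -> R) : continuous p -> (forall x, `|p x| <= g x) -> (forall x, p (- x) = p x) ->
    (\int[leb]_s (p (phi s) * w s + g (phi s) * w s)%:E = \int[leb]_v (p v + g v)%:E)%E.
  move=> cp pg pev; rewrite -(H (fun v => p v + g v)).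
  - by apply: eq_integral => s _; rewrite mulrDl.
  - by move=> x; apply: cvgD; [exact: cp|exact: cg].
  - by move=> x; have := pg x; rewrite ler_norml => /andP[]; lra.
  - by move=> x; rewrite pev gev.
split => //; apply: complex_eq => /=.
  have irw : rintegrable leb (fun s => complex.Re (cgauss a (phi s)) * w s).
    by apply: eq_rintegrable ir => s; rewrite Re_mul Re_real Im_real mul0r subr0 mulrC.
  transitivity (\int[leb]_s (complex.Re (cgauss a (phi s)) * w s)).
    by apply: eq_Rintegral => s _; rewrite Re_mul/= mul0r subr0 mulrC.
  apply: (Rintegral_dom_ge0 irw igw ir' ig) => //; last by rewrite H.
  apply: key => // x; first by case: (cgauss_ReIm_bound a x).
  by rewrite gauss_even.
have irw : rintegrable leb (fun s => complex.Im (cgauss a (phi s)) * w s).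
  by apply: eq_rintegrable iim => s; rewrite Im_mul Re_real Im_real mul0r addr0 mulrC.
transitivity (\int[leb]_s (complex.Im (cgauss a (phi s)) * w s)).
  by apply: eq_Rintegral => s _; rewrite Im_mul/= mul0r addr0 mulrC.
apply: (Rintegral_dom_ge0 irw igw iim' ig) => //; last by rewrite H.
apply: key => // x; first by case: (cgauss_ReIm_bound a x).
by rewrite gauss_even.
Qed.

Lemma gauss_int_scale a (l : R) : 0 < complex.Re a -> 0 < l ->
  gauss_int (a * (l ^+ 2)%:C) = gauss_int a * (l^-1)%:C.
Proof.
move=> a0 l0.
have cl : continuous (fun x => l * x) by move=> x; apply: cvgM; [exact: cvg_cst|exact: cvg_id].
have [|h1 h2] := @cgauss_transfer a (fun x => l * x) (fun=> l) a0 cl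
    (fun x => cvg_cst _) (fun=> ltW l0).
  move=> G cG G0 _.
  have cGc : continuous (fun x => G (l * x)).
    by move=> x; apply: (@continuous_comp _ _ _ (fun x => l * x) G); [exact: cl|exact: cG].
  under eq_integral do rewrite EFinM.
  rewrite ge0_integralZr//; last 3 first.
  + by apply/measurable_EFinP; exact: continuous_measurable_fun.
  + by move=> x _; rewrite lee_fin.
  + by rewrite lee_fin ltW.
  by rewrite ge0_integral_scale// muleAC -EFinM mulVf ?mul1e// lt0r_neq0.
transitivity (cint leb (fun x => (l^-1)%:C * (l%:C * cgauss a (l * x)))); last first.
  by rewrite cintZ// h2 mulrC.
apply: eq_cint => x; rewrite mulrA -rmorphM/= mulVf ?lt0r_neq0// mul1r /cgauss exprMn.
by rewrite [in RHS]rmorphM/= mulrA.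
Qed.

(** The exponent is quadratic in [om], hence in [xi]: these are the Gaussians that the subordination
    formulas superpose. *)
Definition csE (z : R[i]) (om s : R) : R[i] :=
  cexp (- (z * (expR s ^+ 2 / 4 + om ^+ 2 * expR (- s) ^+ 2)%:C)).

Lemma csE_cgauss z om s : csE z om s = cexp (- (z * om%:C)) * cgauss z (cs_arg om s).
Proof.
rewrite /csE /cgauss -cexpD -opprD -mulrDr -rmorphD/=; congr (cexp (- (z * _%:C))).
rewrite /cs_arg sqrrB.
have -> : (expR s / 2) * (om * expR (- s)) = om / 2.
  have := expRD s (- s); rewrite addrN expR0 => e1.
  have -> : expR s / 2 * (om * expR (- s)) = expR s * expR (- s) * (om / 2) by ring.
  by rewrite -e1 mul1r.
by rewrite !exprMn; field.
Qed.

Lemma cs1 z (om : R) : 0 < complex.Re z -> 0 <= om ->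
  cintegrable leb (fun s => (expR s)%:C * csE z om s) /\
  cint leb (fun s => (expR s)%:C * csE z om s) = gauss_int z * cexp (- (z * om%:C)).
Proof.
move=> z0 om0.
have [|h1 h2] := @cgauss_transfer z (cs_arg om) expR z0 (@continuous_cs_arg R om)
   (@continuous_expR R) (@expR_ge0 R).
  by move=> G cG G0 Gev; exact: cs1_ge0.
have E s : (expR s)%:C * csE z om s =
    cexp (- (z * om%:C)) * ((expR s)%:C * cgauss z (cs_arg om s)).
  by rewrite csE_cgauss; ring.
split; first by apply: eq_cintegrable (cintegrableZ _ h1) => s; rewrite E.
by rewrite mulrC -h2 -cintZ//; apply: eq_cint => s; rewrite E.
Qed.

(** The weight [2 * expR (- s)] in place of [expR s] produces the quotient by [om] that occurs in
    the spectral projection. *)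
Lemma cs2 z (om : R) : 0 < complex.Re z -> 0 < om ->
  cintegrable leb (fun s => (2 * expR (- s))%:C * csE z om s) /\
  cint leb (fun s => (2 * expR (- s))%:C * csE z om s) =
  gauss_int z * cexp (- (z * om%:C)) / om%:C.
Proof.
move=> z0 om0.
have cw : continuous (fun s => 2 * om * expR (- s)).
  by move=> s; apply: cvgM; [exact: cvg_cst|exact: continuous_expRN].
have w0 s : 0 <= 2 * om * expR (- s).
  by rewrite mulr_ge0 ?expR_ge0// mulr_ge0// ltW.
have [|h1 h2] := @cgauss_transfer z (cs_arg om) _ z0 (@continuous_cs_arg R om) cw w0.
  by move=> G cG G0 Gev; exact: cs2_ge0.
have omn0 : om%:C != 0 :> R[i] by rewrite fmorph_eq0 lt0r_neq0.
have E s : (2 * expR (- s))%:C * csE z om s =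
    cexp (- (z * om%:C)) / om%:C * ((2 * om * expR (- s))%:C * cgauss z (cs_arg om s)).
  rewrite csE_cgauss !rmorphM/=.
  by field.
split; first by apply: eq_cintegrable (cintegrableZ _ h1) => s; rewrite E.
by rewrite -mulrA mulrC -h2 -cintZ//; apply: eq_cint => s; rewrite E.
Qed.

(** The [k]-th power of [w <= k (1 + 2 w^2 / k) <= k exp (2 w^2 / k)]. *)
Lemma pow_gauss_bound (w : R) k : 0 <= w -> w ^+ k <= k%:R ^+ k * expR (2 * w ^+ 2).
Proof.
move=> w0; case: k => [|k].
  by rewrite !expr0 mul1r -[leLHS]expR0 ler_expR mulr_ge0// sqr_ge0.
have k1 : 1 <= k.+1%:R :> R by rewrite ler1n.
have -> : 2 * w ^+ 2 = k.+1%:R * (2 * w ^+ 2 / k.+1%:R).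
  by rewrite [RHS]mulrC divfK// pnatr_eq0.
rewrite expRM_natl -exprMn lerXn2r ?nnegrE ?mulr_ge0 ?expR_ge0//.
apply: le_trans (_ : k.+1%:R * (1 + 2 * w ^+ 2 / k.+1%:R) <= _); last first.
  by rewrite ler_wpM2l// expR_ge1Dx.
rewrite mulrDr mulr1 mulrC divfK ?pnatr_eq0//.
by nra.
Qed.

(** The substitution [v = expR s / 2], which is [cs1_ge0] at [om = 0], turns the integral into a
    Gaussian moment in [v], and the power of [v] is absorbed into part of the Gaussian. *)
Lemma exp_moment (j : nat) (c : R) : 0 < c ->
  rintegrable leb (fun s : R => expR s ^+ j.+1 * expR (- (c * expR s ^+ 2))) /\
  \int[leb]_s (expR s ^+ j.+1 * expR (- (c * expR s ^+ 2))) <=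
    2 ^+ j * j%:R ^+ j * Num.sqrt pi / Num.sqrt c ^+ j.+1.
Proof.
move=> c0; have sc0 : 0 < Num.sqrt c by rewrite sqrtr_gt0.
have sc2 : Num.sqrt c ^+ 2 = c by rewrite sqr_sqrtr// ltW.
pose G (v : R) := 2 ^+ j * `|v| ^+ j * expR (- (4 * c * v ^+ 2)).
have cG : continuous G.
  move=> v; apply: cvgM; last exact: continuous_gauss.
  apply: cvgM; first exact: cvg_cst.
  apply: (@continuous_comp _ _ _ (fun v : R => `|v|) (fun v => v ^+ j)).
    exact: norm_continuous.
  exact: exprn_continuous.
have G0 v : 0 <= G v by rewrite !mulr_ge0 ?expR_ge0 ?exprn_ge0.
have Gev v : G (- v) = G v by rewrite /G normrN sqrrN.
have GE s : G (cs_arg 0 s) * expR s = expR s ^+ j.+1 * expR (- (c * expR s ^+ 2)).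
  rewrite /G /cs_arg mul0r subr0 ger0_norm ?divr_ge0 ?expR_ge0//.
  have -> : 4 * c * (expR s / 2) ^+ 2 = c * expR s ^+ 2 by field.
  have -> : 2 ^+ j * (expR s / 2) ^+ j = expR s ^+ j.
    by rewrite -exprMn; congr (_ ^+ _); field.
  by rewrite [expR s ^+ j.+1]exprSr mulrAC.
have := cs1_ge0 (lexx 0) cG G0 Gev.
under eq_integral do rewrite GE.
move=> E.
pose K : R := 2 ^+ j * j%:R ^+ j / Num.sqrt c ^+ j.
have K0 : 0 <= K by rewrite divr_ge0 ?mulr_ge0 ?exprn_ge0// ltW.
have GK v : G v <= K * expR (- (c * v ^+ 2)).
  have h := pow_gauss_bound j (mulr_ge0 (ltW sc0) (normr_ge0 v)).
  rewrite exprMn [X in expR (2 * X)]exprMn sc2 real_normK ?num_real// in h.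
  rewrite /G /K.
  have -> : 2 ^+ j * j%:R ^+ j / Num.sqrt c ^+ j * expR (- (c * v ^+ 2)) =
    2 ^+ j * (j%:R ^+ j * expR (- (c * v ^+ 2)) / Num.sqrt c ^+ j) by ring.
  rewrite -mulrA ler_wpM2l ?exprn_ge0// ler_pdivlMr ?exprn_gt0//.
  rewrite mulrAC [`|v| ^+ j * _]mulrC.
  apply: le_trans (_ : j%:R ^+ j * expR (2 * (c * v ^+ 2)) * expR (- (4 * c * v ^+ 2)) <= _).
    by rewrite ler_wpM2r// expR_ge0.
  rewrite -mulrA -expRD ler_wpM2l ?exprn_ge0// ler_expR.
  have : 0 <= c * v ^+ 2 by rewrite mulr_ge0 ?sqr_ge0// ltW.
  by rewrite -[4 * c * _]mulrA; lra.
have iK : rintegrable leb (fun v : R => K * expR (- (c * v ^+ 2))).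
  by apply: rintegrableZ; exact: rintegrable_gauss.
have iG : rintegrable leb G.
  apply: (@rintegrable_le _ _ (measurableTypeR R) leb G _ _ iK) => //.
    exact: continuous_measurable_fun.
  by move=> v; rewrite ger0_norm.
have iS : rintegrable leb (fun s : R => expR s ^+ j.+1 * expR (- (c * expR s ^+ 2))).
  apply/integrableP; split.
    apply/measurable_EFinP; apply: continuous_measurable_fun.
    rewrite (_ : (fun s => _) = (fun s => G (cs_arg 0 s) * expR s)); last first.
      by apply/funext => s; rewrite GE.
    move=> s; apply: cvgM; last exact: continuous_expR.
    by apply: (@continuous_comp _ _ _ (cs_arg 0) G); [exact: continuous_cs_arg|exact: cG].
  under eq_integral => s _.
    rewrite /= ger0_norm; last by rewrite mulr_ge0 ?exprn_ge0 ?expR_ge0.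
    over.
  by rewrite E; exact: (integral_fune_lt_pinfty measurableT iG).
split => //.
have -> : \int[leb]_s (expR s ^+ j.+1 * expR (- (c * expR s ^+ 2))) = \int[leb]_v G v.
  by rewrite /Rintegral E.
apply: le_trans (_ : \int[leb]_v (K * expR (- (c * v ^+ 2))) <= _).
  by apply: le_Rintegral => // v _; exact: GK.
rewrite RintegralZl//; last exact: rintegrable_gauss.
rewrite Rintegral_gauss// sqrtrM ?pi_ge0// sqrtrV ?(ltW c0)//.
by rewrite /K exprSr invfM le_eqVlt; apply/orP; left; apply/eqP; ring.
Qed.

End Gauss.

(** * Tensor products and Gaussians in several variables *)

Section VecIntegrals.
Context {R : realType}.

Lemma rintegrable_vmuSP n (F : vec n.+1 -> R) : measurable_fun [set: vec n.+1] F ->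
  rintegrable (leb \x vmu n)%E (fun p => F (vcons p)) -> rintegrable (vmu n.+1) F.
Proof.
move=> mF /integrableP[_ h]; apply/integrableP; split; first exact/measurable_EFinP.
rewrite [X in (X < _)%E](_ : _ =
  (\int[pushforward (leb \x vmu n) (@vcons R n)]_v `|(EFin \o F) v|)%E)//.
rewrite (ge0_integral_pushforward (@measurable_vcons R n))//.
by apply: measurableT_comp => //; exact/measurable_EFinP.
Qed.

Lemma Rintegral_vmuS n (F : vec n.+1 -> R) : rintegrable (vmu n.+1) F ->
  \int[vmu n.+1]_v F v = \int[leb]_x \int[vmu n]_y F (vcons (x, y)).
Proof.
move=> iF; have iFc := integrable_vmuS iF.
rewrite (Rintegral12 (m1 := leb) (m2 := vmu n) (f := fun p : measurableTypeR R * vec n => F (vcons p)) iFc).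
rewrite /Rintegral; congr fine.
rewrite [LHS](_ : _ = \int[pushforward (leb \x vmu n) (@vcons R n)]_v (F v)%:E)%E//.
rewrite (integral_pushforward (@measurable_vcons R n))//.
by case/integrableP : iF.
Qed.

Lemma cint_vmuS n (F : vec n.+1 -> R[i]) : cintegrable (vmu n.+1) F ->
  cint (vmu n.+1) F = cint leb (fun x => cint (vmu n) (fun y => F (vcons (x, y)))).
Proof. by move=> [i1 i2]; apply: complex_eq => /=; rewrite Rintegral_vmuS. Qed.

Lemma rintegrable_tensor n (h : 'I_n -> R -> R) : (forall i, rintegrable leb (h i)) ->
  rintegrable (vmu n) (fun v => \prod_i h i (v 0 i)).
Proof.
elim: n h => [|n IH] h hi.
  apply: (@eq_rintegrable _ _ _ _ (fun=> 1)) => [v|]; first by rewrite big_ord0.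
  apply/integrableP; split; first exact/measurable_EFinP/measurable_cst.
  by rewrite integral_dirac// diracT mul1e/= normr1 ltry.
apply: rintegrable_vmuSP.
  apply: measurable_prod => i _.
  apply: (measurableT_comp (rintegrable_measurable (hi i))).
  exact: measurable_vec_coord.
have := integrable_prodM (hi ord0) (IH (fun i => h (lift ord0 i)) (fun i => hi _)).
apply: eq_rintegrable => -[x y] /=; rewrite big_ord_recl vcons0.
by congr (_ * _); apply: eq_bigr => i _; rewrite vconsS.
Qed.

Lemma cintegrable_tensor n (h : 'I_n -> R -> R[i]) : (forall i, cintegrable leb (h i)) ->
  cintegrable (vmu n) (fun v => \prod_i h i (v 0 i)).
Proof.
move=> hi; apply: cintegrableP.
  apply: mcfun_prod => i; apply: (mcfun_comp (cintegrable_mcfun (hi i))).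
  exact: measurable_vec_coord.
apply: eq_rintegrable (rintegrable_tensor (fun i => rintegrable_cmod (hi i))) => v.
by rewrite cmod_prod.
Qed.

Lemma cint_tensor n (h : 'I_n -> R -> R[i]) : (forall i, cintegrable leb (h i)) ->
  cint (vmu n) (fun v => \prod_i h i (v 0 i)) = \prod_i cint leb (h i).
Proof.
elim: n h => [|n IH] h hi.
  rewrite big_ord0; apply: complex_eq; rewrite /= /Rintegral integral_dirac// ?diracT ?mul1e//=;
  by [rewrite big_ord0|apply/measurable_EFinP; under eq_fun do rewrite big_ord0; exact: measurable_cst].
rewrite cint_vmuS; last exact: cintegrable_tensor.
rewrite big_ord_recl -IH//.
transitivity (cint leb (fun x => cint (vmu n) (fun v => \prod_i h (lift ord0 i) (v 0 i)) * h ord0 x)).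
  apply: eq_cint => x; rewrite mulrC -cintZ; last first.
    exact: (cintegrable_tensor (h := fun i => h (lift ord0 i))).
  apply: eq_cint => y; rewrite big_ord_recl vcons0; congr (_ * _).
  by apply: eq_bigr => i _; rewrite vconsS.
by rewrite cintZ// mulrC.
Qed.

Lemma Rintegral_tensor n (h : 'I_n -> R -> R) : (forall i, rintegrable leb (h i)) ->
  \int[vmu n]_v (\prod_i h i (v 0 i)) = \prod_i \int[leb]_x h i x.
Proof.
move=> hi.
have hc i : cintegrable leb (fun x => (h i x)%:C).
  by apply: cintegrableP; [exact/mcfun_real/rintegrable_measurable|
    apply: eq_rintegrable (rintegrable_norm (hi i)) => x; rewrite cmod_real].
have E i : cint leb (fun x => (h i x)%:C) = (\int[leb]_x h i x)%:C.
  by apply: complex_eq => //=; rewrite /Rintegral integral0.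
have := cint_tensor hc; under [RHS]eq_bigr do rewrite E.
rewrite -rmorph_prod => /(congr1 (@complex.Re R)) /= <-.
by apply: eq_Rintegral => v _; rewrite -rmorph_prod.
Qed.

Lemma dotvE n (x y : 'rV[R]_n) : dotv x y = \sum_i x 0 i * y 0 i.
Proof. by []. Qed.

Lemma dotv_ge0 n (x : 'rV[R]_n) : 0 <= dotv x x.
Proof. by apply: sumr_ge0 => i _; rewrite -expr2 sqr_ge0. Qed.

Lemma dotvC n (x y : 'rV[R]_n) : dotv x y = dotv y x.
Proof. by apply: eq_bigr => i _; rewrite mulrC. Qed.

Lemma dotvBl n (x y z : 'rV[R]_n) : dotv (x - y) z = dotv x z - dotv y z.
Proof. by rewrite -sumrB; apply: eq_bigr => i _; rewrite !mxE mulrBl. Qed.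

Lemma measurable_dotv d (T : measurableType d) n (f g : T -> vec (R := R) n) :
  measurable_fun [set: T] f -> measurable_fun [set: T] g ->
  measurable_fun [set: T] (fun x => dotv (f x) (g x)).
Proof.
move=> mf mg; apply: measurable_sum => i.
by apply: measurable_funM;
  [apply: (measurableT_comp (@measurable_vec_coord R n i) mf)|
   apply: (measurableT_comp (@measurable_vec_coord R n i) mg)].
Qed.

Lemma cexp_dotv n (a : R[i]) (v : 'rV[R]_n) :
  cexp (- (a * (dotv v v)%:C)) = \prod_i cgauss a (v 0 i).
Proof.
rewrite /cgauss -cexp_sum sumrN -mulr_sumr -rmorph_sum/=.
by congr (cexp (- (a * _%:C))); apply: eq_bigr => i _; rewrite expr2.
Qed.

Lemma cexpi_dotv n (x v : 'rV[R]_n) : cexpi (dotv x v) = \prod_i cexpi (x 0 i * v 0 i).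
Proof.
rewrite -cexp_im /dotv rmorph_sum/= mulr_sumr cexp_sum.
by apply: eq_bigr => i _; rewrite cexp_im.
Qed.

Lemma cintegrable_vgauss n (a : R[i]) (x : 'rV[R]_n) : 0 < complex.Re a ->
  cintegrable (vmu n) (fun v => cexpi (dotv x v) * cexp (- (a * (dotv v v)%:C))).
Proof.
move=> a0.
apply: eq_cintegrable (cintegrable_tensor
  (h := fun i t => cexpi (x 0 i * t) * cgauss a t) _) => [v|i].
  by rewrite cexp_dotv cexpi_dotv -big_split.
exact/cintegrable_cexpi/cintegrable_cgauss.
Qed.

Lemma vgaussFT n (a : R[i]) (x : 'rV[R]_n) : 0 < complex.Re a ->
  cint (vmu n) (fun v => cexpi (dotv x v) * cexp (- (a * (dotv v v)%:C))) =
  gauss_int a ^+ n * cexp (- ((dotv x x)%:C / (4 * a))).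
Proof.
move=> a0.
transitivity (cint (vmu n) (fun v => \prod_i (cexpi (x 0 i * v 0 i) * cgauss a (v 0 i)))).
  by apply: eq_cint => v; rewrite cexp_dotv cexpi_dotv -big_split.
rewrite (cint_tensor (h := fun i t => cexpi (x 0 i * t) * cgauss a t)); last first.
  by move=> i; exact/cintegrable_cexpi/cintegrable_cgauss.
under eq_bigr do rewrite gaussFT//.
rewrite big_split/= prodr_const card_ord -cexp_sum; congr (_ * cexp _).
rewrite sumrN -mulr_suml -rmorph_sum/=.
by congr (- (_%:C / _)); apply: eq_bigr => i _; rewrite expr2.
Qed.

Lemma vgaussFT1 n (a : R[i]) (x : 'rV[R]_n) l : 0 < complex.Re a ->
  cint (vmu n) (fun v => cexpi (dotv x v) * ((v 0 l)%:C * cexp (- (a * (dotv v v)%:C)))) =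
  ii * (x 0 l)%:C / (2 * a) * (gauss_int a ^+ n * cexp (- ((dotv x x)%:C / (4 * a)))).
Proof.
move=> a0; rewrite -vgaussFT//.
pose h i (t : R) := cexpi (x 0 i * t) * ((if i == l then t%:C else 1) * cgauss a t).
have hi i : cintegrable leb (h i).
  rewrite /h; apply: cintegrable_cexpi; case: (i == l); first exact: cintegrable_id_cgauss.
  by apply: eq_cintegrable (cintegrable_cgauss a0) => t; rewrite mul1r.
transitivity (cint (vmu n) (fun v => \prod_i h i (v 0 i))).
  apply: eq_cint => v; rewrite cexp_dotv cexpi_dotv !big_split/=; congr (_ * (_ * _)).
  by rewrite (bigD1 l)//= eqxx big1 ?mulr1// => i /negbTE ->.
rewrite cint_tensor//.
transitivity (ii * (x 0 l)%:C / (2 * a) *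
   \prod_i cint leb (fun t => cexpi (x 0 i * t) * cgauss a t)); last first.
  congr (_ * _).
  rewrite -(cint_tensor (h := fun i t => cexpi (x 0 i * t) * cgauss a t)); last first.
    by move=> i; exact/cintegrable_cexpi/cintegrable_cgauss.
  by apply: eq_cint => v; rewrite cexp_dotv cexpi_dotv -big_split.
rewrite (bigD1 l)//= [in RHS](bigD1 l)//= mulrA; congr (_ * _).
  by rewrite /h eqxx gaussFT1.
apply: eq_bigr => i /negbTE il; apply: eq_cint => t.
by rewrite /h il mul1r.
Qed.

(** Functions supported in a ball are dominated on the surrounding cube, whose indicator is a tensor
    product with a computable integral. *)
Definition cube1 (r x : R) : R := \1_(`[- r, r]%classic : set R) x.

Lemma rintegrable_cube n (r : R) :
  rintegrable (vmu n) (fun v => \prod_i cube1 r (v 0 i)) /\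
  (0 <= r -> \int[vmu n]_v (\prod_i cube1 r (v 0 i)) = (2 * r) ^+ n).
Proof.
have i1 : rintegrable leb (cube1 r).
  by apply: integrable_indic_itv.
split; first exact: (rintegrable_tensor (h := fun=> cube1 r)).
move=> r0; rewrite (Rintegral_tensor (h := fun=> cube1 r))//.
rewrite prodr_const card_ord; congr (_ ^+ _).
rewrite /Rintegral integral_indic// setIT /leb /= lebesgue_measure_itv/= lte_fin.
move: r0; rewrite le_eqVlt => /predU1P[<-|r0]; first by rewrite oppr0 ltxx mulr0.
by rewrite (lt_trans _ r0) ?oppr_lt0//= opprK mulr2n mulrDl mul1r.
Qed.

Lemma coord_le_eucl n (v : 'rV[R]_n) i : `|v 0 i| <= eucl v.
Proof.
rewrite -sqrtr_sqr ler_wsqrtr// /dotv (bigD1 i)//= -expr2 lerDl.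
by apply: sumr_ge0 => j _; rewrite -expr2 sqr_ge0.
Qed.

Lemma cube_ge1 n (v : 'rV[R]_n) (r : R) : eucl v <= r ->
  \prod_i cube1 r (v 0 i) = 1.
Proof.
move=> vr; rewrite big1// => i _; rewrite /cube1 indicE mem_set//= in_itv/= -ler_norml.
exact: le_trans (coord_le_eucl v i) vr.
Qed.

Lemma cube_ge0 n (v : 'rV[R]_n) (r : R) :
  0 <= \prod_i cube1 r (v 0 i).
Proof. by apply: prodr_ge0 => i _; rewrite /cube1 indicE. Qed.

End VecIntegrals.

(** * The Dirac symbol and its exponential *)

Section Adjoint.
Context {R : realType}.

Lemma adjmxM m n p (A : 'M[R[i]]_(m, n)) (B : 'M[R[i]]_(n, p)) :
  adjmx (A *m B) = adjmx B *m adjmx A.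
Proof.
apply/matrixP => i j; rewrite !mxE cconj_sum; apply: eq_bigr => k _.
by rewrite !mxE cconjM mulrC.
Qed.

Lemma adjmxD m n (A B : 'M[R[i]]_(m, n)) : adjmx (A + B) = adjmx A + adjmx B.
Proof. by apply/matrixP => i j; rewrite !mxE cconjD. Qed.

Lemma adjmxZ m n (c : R[i]) (A : 'M[R[i]]_(m, n)) : adjmx (c *: A) = cconj c *: adjmx A.
Proof. by apply/matrixP => i j; rewrite !mxE cconjM. Qed.

Lemma adjmxN m n (A : 'M[R[i]]_(m, n)) : adjmx (- A) = - adjmx A.
Proof. by apply/matrixP => i j; rewrite !mxE; apply: complex_eq; rewrite !ReImE. Qed.

Lemma adjmxK m n (A : 'M[R[i]]_(m, n)) : adjmx (adjmx A) = A.
Proof. by apply/matrixP => i j; rewrite !mxE cconjK. Qed.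

Lemma adjmx_sum m n I (r : seq I) (F : I -> 'M[R[i]]_(m, n)) :
  adjmx (\sum_(i <- r) F i) = \sum_(i <- r) adjmx (F i).
Proof.
elim/big_rec2: _ => [|i x y _ <-]; last by rewrite adjmxD.
by apply/matrixP => i j; rewrite !mxE cconj0.
Qed.

End Adjoint.

Section Clifford.
Context {R : realType} (d N : nat) (gamma : 'I_d.+1 -> 'M[R[i]]_N).
Hypotheses (cg : clifford gamma) (hg : hermitian_gammas gamma).

Definition alpha (l : 'I_d) := gamma ord0 *m gamma (lift ord0 l).
Definition aslash (x : 'rV[R]_d) := \sum_l (x 0 l)%:C *: alpha l.

(** The Clifford relations give each identity twice over; this cancels the factor. *)
Lemma mx2I n p (A B : 'M[R[i]]_(n, p)) : (2 : R[i]) *: A = 2 *: B -> A = B.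
Proof. by apply: scalerI; rewrite pnatr_eq0. Qed.

Lemma gamma0_sqr : gamma ord0 *m gamma ord0 = 1%:M.
Proof.
apply: mx2I; have := cg ord0 ord0; rewrite /Defs.minkowski eqxx/= mulr1.
by rewrite -mulr2n -scaler_nat => ->; congr (_ *: _); apply: complex_eq; rewrite /= ?addr0.
Qed.

Lemma gamma_anti l : gamma (lift ord0 l) *m gamma ord0 = - alpha l.
Proof.
have := cg (lift ord0 l) ord0; rewrite /Defs.minkowski.
rewrite (_ : (_ == _) = false); last by apply/negbTE/eqP => /(congr1 val).
rewrite mulr0 scale0r => h; apply/eqP; rewrite -subr_eq0 opprK.
exact/eqP.
Qed.

Lemma alphaM l k : alpha l *m alpha k = - (gamma (lift ord0 l) *m gamma (lift ord0 k)).
Proof.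
rewrite /alpha -mulmxA (mulmxA (gamma (lift ord0 l))) gamma_anti /alpha.
by rewrite mulNmx mulmxN !mulmxA gamma0_sqr mul1mx.
Qed.

Lemma alpha_anti l k : alpha l *m alpha k + alpha k *m alpha l =
  (2 * (l == k)%:R : R)%:C *: 1%:M.
Proof.
rewrite !alphaM -opprD cg /Defs.minkowski (inj_eq (@lift_inj _ ord0)) -scaleNr.
case: eqP => [_|_] /=; last by rewrite !mulr0 -rmorphN/= oppr0.
by congr (_ *: _); rewrite -rmorphN/= mulrN1 opprK mulr1.
Qed.

Lemma alpha_gamma0 l : alpha l *m gamma ord0 + gamma ord0 *m alpha l = 0.
Proof.
rewrite {1}/alpha -mulmxA gamma_anti mulmxN addrC; exact: subrr.
Qed.

Lemma adj_alpha l : adjmx (alpha l) = alpha l.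
Proof. by rewrite /alpha adjmxM hg.1 hg.2 mulNmx gamma_anti opprK. Qed.

Lemma adj_aslash x : adjmx (aslash x) = aslash x.
Proof.
rewrite /aslash adjmx_sum; apply: eq_bigr => l _; rewrite adjmxZ adj_alpha.
by congr (_ *: _); apply: complex_eq; rewrite !ReImE ?oppr0.
Qed.

Lemma aslash_sqr x : aslash x *m aslash x = (dotv x x)%:C *: 1%:M.
Proof.
apply: mx2I; rewrite {1}scaler_nat mulr2n /aslash.
have sE : aslash x *m aslash x = \sum_l \sum_k ((x 0 l)%:C *: alpha l) *m ((x 0 k)%:C *: alpha k).
  by rewrite /aslash mulmx_suml; apply: eq_bigr => l _; rewrite mulmx_sumr.
(* Adding the double sum to its transpose leaves anticommutators only, and these vanish off the
   diagonal. *)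
rewrite -/(aslash x) {1}sE {1}sE [X in _ + X]exchange_big/=.
rewrite -big_split/=.
transitivity (\sum_l ((2 * (x 0 l * x 0 l))%:C *: (1%:M : 'M[R[i]]_N))).
  apply: eq_bigr => l _; rewrite -big_split/=.
  rewrite (bigD1 l)//= [X in _ + X]big1; last first.
    move=> k kl; rewrite -!scalemxAl -!scalemxAr !scalerA [(x 0 k)%:C * _]mulrC -scalerDr.
    by rewrite alpha_anti eq_sym (negbTE kl) mulr0 scale0r scaler0.
  rewrite addr0 -!scalemxAl -!scalemxAr !scalerA -scalerDr alpha_anti eqxx scalerA.
  by congr (_ *: _); rewrite -!rmorphM/=; congr (_ %:C); ring.
rewrite -scaler_suml scalerA; congr (_ *: _).
rewrite -(rmorph_sum (real_complex R))/= -mulr_sumr rmorphM/=; congr (_ * _).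
by apply: complex_eq; rewrite /= ?addr0.
Qed.

Lemma aslash_gamma0 x : aslash x *m gamma ord0 = - (gamma ord0 *m aslash x).
Proof.
apply/eqP; rewrite -subr_eq0 opprK /aslash mulmx_suml mulmx_sumr -big_split/=.
rewrite big1// => l _; rewrite -scalemxAl -scalemxAr -scalerDr alpha_gamma0; exact: scaler0.
Qed.

Variable m : R.

Definition om (xi : 'rV[R]_d) := Num.sqrt (dotv xi xi + m ^+ 2).

Lemma om_ge0 xi : 0 <= om xi. Proof. exact: sqrtr_ge0. Qed.
Lemma om_sqr xi : om xi ^+ 2 = dotv xi xi + m ^+ 2.
Proof. by rewrite sqr_sqrtr// addr_ge0 ?sqr_ge0// dotv_ge0. Qed.

Lemma dirac_symbolE xi : dirac_symbol gamma m xi = aslash xi + m%:C *: gamma ord0.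
Proof. by []. Qed.

Lemma dirac_symbol_sqr xi :
  dirac_symbol gamma m xi *m dirac_symbol gamma m xi = (om xi ^+ 2)%:C *: 1%:M.
Proof.
rewrite dirac_symbolE mulmxDl !mulmxDr aslash_sqr -!scalemxAr -!scalemxAl aslash_gamma0 scalerN.
rewrite addrA addrNK gamma0_sqr scalerA -scalerDl om_sqr; congr (_ *: _).
by rewrite -rmorphM -rmorphD/= expr2.
Qed.

Lemma dirac_symbol0 xi : om xi = 0 -> dirac_symbol gamma m xi = 0.
Proof.
move=> o0; have := om_sqr xi; rewrite o0 expr0n/= => /eqP; rewrite eq_sym.
rewrite paddr_eq0 ?dotv_ge0 ?sqr_ge0// sqrf_eq0 => /andP[/eqP x0 /eqP ->].
rewrite /dirac_symbol scale0r addr0 big1// => l _.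
suff -> : xi 0 l = 0 by rewrite scale0r.
have := coord_le_eucl xi l; rewrite /eucl x0 sqrtr0 normr_le0 => /eqP; exact.
Qed.

(** The spectral projection of the Dirac symbol for the eigenvalue [om xi]; the one for [- om xi] is
    the same expression for [gflip gamma]. Where [om] vanishes the inverse is zero and this is half
    the identity, which keeps the splitting of the propagator valid there. *)
Definition dproj (xi : 'rV[R]_d) : 'M[R[i]]_N :=
  2^-1 *: (1%:M + ((om xi)^-1)%:C *: dirac_symbol gamma m xi).
End Clifford.

(** * The matrix exponential of the Dirac symbol *)

Section Expm.
Context {R : realType} (d N : nat) (gamma : 'I_d.+1 -> 'M[R[i]]_N).
Hypotheses (cg : clifford gamma) (hg : hermitian_gammas gamma).

(* flips the sign of the Dirac symbol, hence exchanges the two spectral projections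
   and reverses time *)
Definition gflip (mu : 'I_d.+1) := if val mu == 0%N then - gamma mu else gamma mu.

Lemma gflip_clifford : clifford gflip.
Proof.
move=> mu nu; rewrite /gflip; have := cg mu nu; rewrite /Defs.minkowski.
case: (altP (mu =P nu)) => [->|mn].
  by case: (val nu == 0%N) => h; rewrite ?mulNmx ?mulmxN ?opprK.
rewrite mulr0 scale0r => h.
case: ifP => h0; case: ifP => h1; rewrite ?mulNmx ?mulmxN ?opprK// -?opprD ?h ?oppr0//.
Qed.

Lemma gflip_hermitian : hermitian_gammas gflip.
Proof. by split => [|j]; rewrite /gflip/= ?adjmxN ?hg.1// ?hg.2. Qed.

Lemma dirac_symbol_gflip m xi : dirac_symbol gflip m xi = - dirac_symbol gamma m xi.
Proof.
rewrite /dirac_symbol /gflip/= opprD scalerN; congr (_ + _).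
by rewrite -sumrN; apply: eq_bigr => l _; rewrite mulNmx scalerN.
Qed.

Lemma mulmx_lincomb (H : 'M[R[i]]_N) (a b c e : R[i]) : H *m H = e *: 1%:M ->
  (c *: H) *m (a *: 1%:M + b *: H) = (c * b * e) *: 1%:M + (c * a) *: H.
Proof.
move=> null_weight; rewrite mulmxDr -!scalemxAr -!scalemxAl mulmx1 null_weight !scalerA addrC.
by congr (_ *: _ + _ *: _); ring.
Qed.

(** The symbol squares to a scalar, so even powers are scalars and odd powers are multiples of the
    symbol, with the coefficients of cosine and sine. *)
Lemma mpow_symbol m t xi k : let H := dirac_symbol gamma m xi in
  om m xi != 0 ->
  (k`!%:R)^-1 *: mpow ((0 +i* (- t)) *: H) k =
  (cos_coeff (t * om m xi) k)%:C *: 1%:M +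
  ((- ii) * (sin_coeff (t * om m xi) k)%:C * ((om m xi)^-1)%:C) *: H.
Proof.
move=> H o0.
have fk0 n : (n`!%:R : R[i]) != 0 by rewrite pnatr_eq0 -lt0n fact_gt0.
suff : forall k, mpow ((0 +i* (- t)) *: H) k =
  (k`!%:R * (cos_coeff (t * om m xi) k)%:C) *: 1%:M +
  (k`!%:R * ((- ii) * (sin_coeff (t * om m xi) k)%:C * ((om m xi)^-1)%:C)) *: H.
  by move=> ->; rewrite scalerDr !scalerA !mulrA mulVf// !mul1r.
move=> {}k.
have fkC n : (n`!%:R : R[i]) = (n`!%:R)%:C by rewrite (rmorph_nat (real_complex R)).
have fk0' n : (n`!%:R : R) != 0 by rewrite pnatr_eq0 -lt0n fact_gt0.
pose x := t * om m xi.
have cE n : n`!%:R * cos_coeff x n = (~~ odd n)%:R * (-1) ^+ n./2 * x ^+ n.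
  by rewrite /cos_coeff/= mulrC mulfVK.
have sE n : n`!%:R * sin_coeff x n = (odd n)%:R * (-1) ^+ n.-1./2 * x ^+ n.
  by rewrite /sin_coeff/= mulrC mulfVK.
elim: k => [|k IH].
  rewrite /mpow/= -/x !mulrA !(mulrAC _ (- ii)) fkC -!rmorphM/= cE sE /= !mul0r.
  rewrite scale0r addr0 !mul1r expr0.
  by rewrite rmorph1 scale1r.
rewrite /mpow iterS -/(mpow _ k) IH -/x !mulrA !(mulrAC _ (- ii)) !fkC -!rmorphM/=.
rewrite (mulrC (k`!%:R * sin_coeff x k)) (mulrC ((k.+1)`!%:R * sin_coeff x k.+1)).
rewrite !cE !sE (mulmx_lincomb _ _ _ (dirac_symbol_sqr cg m xi)).
congr (_ *: _ + _ *: _).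
  rewrite (_ : 0 +i* (- t) = - ii * t%:C); last by apply: complex_eq; rewrite !ReImE/=; ring.
  have -> : (~~ odd k.+1)%:R * (-1) ^+ (k.+1)./2 * x ^+ k.+1 =
    - ((odd k)%:R * (-1) ^+ k.-1./2 * x ^+ k) * x.
    rewrite /= negbK; case: k {IH} => [|k] /=; first by rewrite !mul0r oppr0 mul0r.
    case: (odd _); rewrite ?mul0r ?oppr0 ?mul0r// !mul1r exprS mulN1r !exprS; ring.
  set c := (odd k)%:R * _ * _.
  rewrite /x; apply: complex_eq; rewrite !ReImE/=; try ring.
  by field.
have -> : (odd k.+1)%:R * (-1) ^+ (k.+1).-1./2 * x ^+ k.+1 =
    ((~~ odd k)%:R * (-1) ^+ k./2 * x ^+ k) * x.
  by rewrite /= exprSr !mulrA.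
set c := (~~ odd k)%:R * _ * _.
rewrite /x; apply: complex_eq; rewrite !ReImE/=; try ring.
by field.
Qed.

Lemma limn_lincomb (u v : nat -> R) (a b lu lv : R) : u @ \oo --> lu -> v @ \oo --> lv ->
  limn (fun n => a * u n + b * v n) = a * lu + b * lv.
Proof.
move=> hu hv; apply/cvg_lim => //.
by apply: cvgD; apply: cvgM => //; exact: cvg_cst.
Qed.

Lemma expm_symbol m t xi : let H := dirac_symbol gamma m xi in
  expm ((0 +i* (- t)) *: H) =
  (cos (t * om m xi))%:C *: 1%:M +
  ((- ii) * (sin (t * om m xi))%:C * ((om m xi)^-1)%:C) *: H.
Proof.
(* At a zero of [om] the symbol itself is zero. *)
move=> H; have [w0|w0] := eqVneq (om m xi) 0.
  rewrite /H dirac_symbol0// !scaler0 addr0 w0 mulr0 cos0 scale1r.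
  have pE n : expm_partial (0 : 'M[R[i]]_N) n.+1 = 1%:M.
    rewrite /expm_partial big_ord_recl/= /mpow/= big1 ?addr0 ?fact0 ?invr1 ?scale1r// => i _.
    by rewrite mul0mx scaler0.
  apply/matrixP => i j; rewrite mxE.
  suff h (F : R[i] -> R) : limn (fun n => F (expm_partial (0 : 'M[R[i]]_N) n i j)) = F ((1%:M : 'M[R[i]]_N) i j).
    by rewrite !h; case: (_ i j).
  (* The partial sum of index zero is empty and not the identity, hence the shift. *)
  apply: cvg_lim => //; rewrite -(cvg_shiftS).
  under eq_fun do rewrite pE; exact: cvg_cst.
have cc : series (cos_coeff (t * om m xi)) @ \oo --> cos (t * om m xi).
  rewrite unlock; exact: is_cvg_series_cos_coeff.
have cs : series (sin_coeff (t * om m xi)) @ \oo --> sin (t * om m xi).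
  rewrite unlock; exact: is_cvg_series_sin_coeff.
have pE n : expm_partial ((0 +i* (- t)) *: H) n =
  (series (cos_coeff (t * om m xi)) n)%:C *: 1%:M +
  ((- ii) * (series (sin_coeff (t * om m xi)) n)%:C * ((om m xi)^-1)%:C) *: H.
  rewrite /expm_partial /series/= !big_mkord.
  under eq_bigr do rewrite mpow_symbol//.
  rewrite big_split/= -!scaler_suml; congr (_ *: _ + _ *: _).
    by rewrite (rmorph_sum (real_complex R)).
  by rewrite (rmorph_sum (real_complex R))/= mulr_sumr mulr_suml.
apply/matrixP => i j; rewrite mxE.
under eq_fun do rewrite pE mxE [X in X + _]mxE [X in _ + X]mxE !ReImE/= .
set e1 := complex.Re _; set e2 := complex.Re _.
apply: complex_eq => /=.
  transitivity (limn (fun n => e1 * series (cos_coeff (t * om m xi)) n +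
     (complex.Im (H i j) * (om m xi)^-1) * series (sin_coeff (t * om m xi)) n)).
    by congr (limn _); apply/funext => n; ring.
  rewrite (limn_lincomb _ _ cc cs) !mxE !ReImE/=; rewrite /e1 mxE; ring.
transitivity (limn (fun n => complex.Im ((1%:M : 'M[R[i]]_N) i j) * series (cos_coeff (t * om m xi)) n +
     (- complex.Re (H i j) * (om m xi)^-1) * series (sin_coeff (t * om m xi)) n)).
  by congr (limn _); apply/funext => n; rewrite pE mxE [X in X + _]mxE [X in _ + X]mxE !ReImE/=; ring.
rewrite (limn_lincomb _ _ cc cs) !mxE !ReImE/=; ring.
Qed.

End Expm.

Section Propagator.
Context {R : realType} (d N : nat) (gamma : 'I_d.+1 -> 'M[R[i]]_N).
Hypotheses (cg : clifford gamma) (hg : hermitian_gammas gamma).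

Lemma expm_dproj m t xi :
  expm ((0 +i* (- t)) *: dirac_symbol gamma m xi) =
  cexpi (- (t * om m xi)) *: dproj gamma m xi +
  cexpi (t * om m xi) *: dproj (gflip gamma) m xi.
Proof.
apply/matrixP => i j; rewrite (expm_symbol cg).
rewrite [LHS]mxE [X in X + _ = _]mxE [X in _ + X = _]mxE.
rewrite [RHS]mxE [X in _ = X + _]mxE [X in _ = _ + X]mxE /dproj.
rewrite [X in _ = _ * X + _]mxE [X in _ = _ * (_ * X) + _]mxE.
rewrite [X in _ = _ * (_ * (_ + X)) + _]mxE.
rewrite [X in _ = _ + _ * X]mxE [X in _ = _ + _ * (_ * X)]mxE.
rewrite [X in _ = _ + _ * (_ * (_ + X))]mxE.
have -> : dirac_symbol (gflip gamma) m xi i j = - dirac_symbol gamma m xi i j.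
  by rewrite dirac_symbol_gflip mxE.
set e := (1%:M : 'M[R[i]]_N) i j; set h := dirac_symbol _ _ _ _ _; move: e h => e h.
have -> : cexpi (- (t * om m xi)) = (cos (t * om m xi))%:C - ii * (sin (t * om m xi))%:C.
  by apply: complex_eq; rewrite !ReImE/= ?cosN ?sinN; ring.
have -> : cexpi (t * om m xi) = (cos (t * om m xi))%:C + ii * (sin (t * om m xi))%:C.
  by apply: complex_eq; rewrite !ReImE/= ; ring.
move: (((om m xi)^-1)%:C) ((cos (t * om m xi))%:C) ((sin (t * om m xi))%:C) => o c s.
by field.
Qed.
End Propagator.

Section SwapDom.
Context {R : realType} d1 d2 (T1 : measurableType d1) (T2 : measurableType d2).
Variables (m1 : {sigma_finite_measure set T1 -> \bar R}).
Variables (m2 : {sigma_finite_measure set T2 -> \bar R}).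

Lemma cint_swap_dom (f : T1 -> T2 -> R[i]) (G : T1 -> R) (H : T2 -> R) :
  mcfun (fun p : T1 * T2 => f p.1 p.2) -> rintegrable m1 G -> rintegrable m2 H ->
  (forall x y, cmod (f x y) <= G x * H y) ->
  cint m1 (fun x => cint m2 (f x)) = cint m2 (fun y => cint m1 (f^~ y)).
Proof.
move=> mf iG iH fGH; apply: cint_swap => //.
have := integrable_prodM iG iH => iGH.
have : cintegrable (m1 \x m2)%E (fun p => f p.1 p.2).
  by apply: (cintegrable_le mf iGH) => -[x y]/=.
move=> /rintegrable_cmod/integrable12ltyP /=.
have mc : measurable_fun [set: T1 * T2] (fun p => (cmod (f p.1 p.2))%:E).
  exact/measurable_EFinP/measurable_cmod.
move=> /(_ mc); apply: le_lt_trans; rewrite le_eqVlt; apply/orP; left; apply/eqP.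
apply: eq_integral => x _; apply: eq_integral => y _ /=.
by rewrite ger0_norm ?cmod_ge0.
Qed.
End SwapDom.

(** * Fourier multipliers *)

Section FourierL1.
Context {R : realType} (d N : nat).
Implicit Types (f : 'rV[R]_d -> 'cV[R[i]]_N).

Lemma ciintE (F : vec d -> R[i]) : cintegrable (vmu d) F -> ciint F = cint (vmu d) F.
Proof. by move=> [i1 i2]; rewrite /ciint /cint !riintE. Qed.

Lemma vnorm_ge0 (v : 'cV[R[i]]_N) : 0 <= vnorm v.
Proof. exact: sqrtr_ge0. Qed.

Lemma vnorm_sqr (v : 'cV[R[i]]_N) : vnorm v ^+ 2 = \sum_i cmod (v i 0) ^+ 2.
Proof.
rewrite sqr_sqrtr; last by apply: sumr_ge0 => i _; rewrite addr_ge0// sqr_ge0.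
by apply: eq_bigr => i _; rewrite cmod_sqr.
Qed.

Lemma cmod_le_vnorm (v : 'cV[R[i]]_N) i : cmod (v i 0) <= vnorm v.
Proof.
rewrite -(ler_pXn2r (n := 2)) ?nnegrE ?cmod_ge0 ?vnorm_ge0// vnorm_sqr (bigD1 i)//= lerDl.
by apply: sumr_ge0 => j _; exact: sqr_ge0.
Qed.

Section inL1.
Variable f : 'rV[R]_d -> 'cV[R[i]]_N.
Hypothesis f1 : in_L1 f.

Definition nL1 : R := fine (L1norm f).

Lemma mcfun_L1 i : mcfun (fun x : vec d => f x i 0).
Proof.
by have [mR mI] := f1.1 i; split => _ B mB; rewrite setTI; [exact: mR|exact: mI].
Qed.

Lemma measurable_vnorm_L1 : measurable_fun [set: vec d] (fun x => vnorm (f x)).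
Proof.
apply: measurableT_comp; first by apply: continuous_measurable_fun; exact: sqrt_continuous.
apply: measurable_sum => i; have [mR mI] := mcfun_L1 i.
by apply: measurable_funD; exact: measurable_funX.
Qed.

Lemma L1normE : L1norm f = (\int[vmu d]_x (vnorm (f x))%:E)%E.
Proof.
rewrite /L1norm iintE//; first by apply/measurable_EFinP; exact: measurable_vnorm_L1.
by move=> x; rewrite lee_fin vnorm_ge0.
Qed.

Lemma rintegrable_L1 : rintegrable (vmu d) (fun x => vnorm (f x)).
Proof.
apply/integrableP; split; first by apply/measurable_EFinP; exact: measurable_vnorm_L1.
apply: le_lt_trans f1.2; rewrite L1normE le_eqVlt; apply/orP; left; apply/eqP.
by apply: eq_integral => x _ /=; rewrite ger0_norm ?vnorm_ge0.
Qed.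

Lemma nL1E : nL1 = \int[vmu d]_x vnorm (f x).
Proof. by rewrite /nL1 L1normE. Qed.

Lemma nL1_ge0 : 0 <= nL1.
Proof. by rewrite nL1E; apply: Rintegral_ge0 => x _; exact: vnorm_ge0. Qed.

Lemma L1norm_fin : L1norm f = nL1%:E.
Proof.
rewrite fineK// ge0_fin_numE ?f1.2// L1normE; apply: integral_ge0 => x _.
by rewrite lee_fin vnorm_ge0.
Qed.

Lemma fourierE xi i :
  fourier f xi i 0 = cint (vmu d) (fun x => cexpi (- dotv x xi) * f x i 0).
Proof.
rewrite mxE ciintE//; apply: (cintegrable_le _ rintegrable_L1) => [|x].
  apply: mcfunM; last exact: mcfun_L1.
  apply: mcfun_cexpi; apply: measurable_funN; apply: measurable_dotv => //.
by rewrite cmodM cmod_cexpi mul1r cmod_le_vnorm.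
Qed.

Lemma mcfun_fourier i : mcfun (fun xi : vec d => fourier f xi i 0).
Proof.
under eq_fun do rewrite fourierE.
apply: mcfun_cint; apply: mcfunM.
  apply: mcfun_cexpi; apply: measurable_funN; apply: measurable_dotv => //.
exact: (mcfun_comp (mcfun_L1 i)).
Qed.

Lemma cmod_fourier xi i : cmod (fourier f xi i 0) <= nL1.
Proof.
rewrite fourierE nL1E; apply: (le_cmod_cint_dom _ rintegrable_L1) => [|x].
  apply: mcfunM; last exact: mcfun_L1.
  apply: mcfun_cexpi; apply: measurable_funN; apply: measurable_dotv => //.
by rewrite cmodM cmod_cexpi mul1r cmod_le_vnorm.
Qed.

End inL1.
End FourierL1.

Section Multiplier.
Context {R : realType} (d N : nat) (gamma : 'I_d.+1 -> 'M[R[i]]_N).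
Variable m : R.

Lemma dprojE xi i j : dproj gamma m xi i j =
  2^-1 * ((i == j)%:R + \sum_l (xi 0 l / om m xi)%:C * alpha gamma l i j
    + (m / om m xi)%:C * gamma ord0 i j).
Proof.
rewrite /dproj mxE [X in _ * X]mxE [X in _ * (X + _)]mxE [X in _ * (_ + X)]mxE -addrA.
congr (_ * (_ + _)).
rewrite /dirac_symbol [X in _ * X]mxE [X in _ * (_ + X)]mxE mulrDr.
congr (_ + _); last by rewrite mulrA -rmorphM/= [_^-1 * _]mulrC.
rewrite summxE mulr_sumr; apply: eq_bigr => l _; rewrite [X in _ * X]mxE.
by rewrite mulrA -rmorphM/= [_^-1 * _]mulrC.
Qed.

(** One crude constant that bounds the entries of [dproj], enters all bounds of the kernel, and is
    unchanged by [gflip]. *)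
Definition gbound : R := 1 + \sum_i \sum_j (\sum_l cmod (alpha gamma l i j) + cmod (gamma ord0 i j)).

Lemma coord_le_om (xi : 'rV[R]_d) l : `|xi 0 l / om m xi| <= 1.
Proof.
have [w0|w0] := eqVneq (om m xi) 0; first by rewrite w0 invr0 mulr0 normr0.
have wp : 0 < om m xi by rewrite lt0r w0 om_ge0.
rewrite normrM normfV (gtr0_norm wp) ler_pdivrMr// mul1r (le_trans (coord_le_eucl _ _))//.
by rewrite ler_wsqrtr// lerDl sqr_ge0.
Qed.

Lemma mass_le_om (xi : 'rV[R]_d) : `|m / om m xi| <= 1.
Proof.
have [w0|w0] := eqVneq (om m xi) 0; first by rewrite w0 invr0 mulr0 normr0.
have wp : 0 < om m xi by rewrite lt0r w0 om_ge0.
rewrite normrM normfV (gtr0_norm wp) ler_pdivrMr// mul1r -sqrtr_sqr.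
by rewrite ler_wsqrtr// lerDr dotv_ge0.
Qed.

Lemma gbound_ge1 : 1 <= gbound.
Proof.
rewrite /gbound lerDl; apply: sumr_ge0 => i _; apply: sumr_ge0 => j _.
by rewrite addr_ge0 ?cmod_ge0//; apply: sumr_ge0 => l _; exact: cmod_ge0.
Qed.

Lemma cmod_dproj xi i j : cmod (dproj gamma m xi i j) <= gbound.
Proof.
rewrite dprojE cmodM cmodV (_ : 2 = (2 : R)%:C); last by rewrite (rmorph_nat (real_complex R)).
rewrite cmod_real ger0_norm// mulrC ler_pdivrMr//.
apply: le_trans (cmodD _ _) _.
apply: (@le_trans _ _ (1 + (\sum_l cmod (alpha gamma l i j) + cmod (gamma ord0 i j)))).
  rewrite addrA; apply: lerD; last first.
    by rewrite cmodM cmod_real ler_piMl ?cmod_ge0// mass_le_om.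
  apply: le_trans (cmodD _ _) _; apply: lerD.
    by case: (i == j); rewrite ?cmod1 ?cmod0.
  apply: le_trans (cmod_sum _ _ _) _; apply: ler_sum => l _.
  by rewrite cmodM cmod_real ler_piMl ?cmod_ge0// coord_le_om.
apply: (@le_trans _ _ gbound); last by have := gbound_ge1; lra.
rewrite /gbound lerD2l (bigD1 i)//= (bigD1 j)//= -!addrA lerD2l lerDl addr_ge0//.
  apply: sumr_ge0 => k _; rewrite addr_ge0 ?cmod_ge0//.
  by apply: sumr_ge0 => l _; exact: cmod_ge0.
apply: sumr_ge0 => k _; apply: sumr_ge0 => k' _.
rewrite addr_ge0 ?cmod_ge0//.
by apply: sumr_ge0 => l _; exact: cmod_ge0.
Qed.

Lemma measurable_om : measurable_fun [set: vec d] (om m : vec d -> R).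
Proof.
apply: measurableT_comp; first by apply: continuous_measurable_fun; exact: sqrt_continuous.
by apply: measurable_funD => //; apply: measurable_dotv.
Qed.

Lemma mcfun_dproj i j : mcfun (fun xi : vec d => dproj gamma m xi i j).
Proof.
under eq_fun do rewrite dprojE.
have mi : measurable_fun [set: vec d] (fun xi : vec d => (om m xi)^-1).
  under eq_fun do rewrite -powR_inv1 ?om_ge0//.
  exact: (measurableT_comp (@measurable_powR R (-1)) measurable_om).
apply: mcfunM; first exact: mcfun_cst.
apply: mcfunD.
  apply: mcfunD; first exact: mcfun_cst.
  apply: mcfun_sum => l; apply: mcfunM; last exact: mcfun_cst.
  apply: mcfun_real; apply: measurable_funM => //; exact: measurable_vec_coord.
apply: mcfunM; last exact: mcfun_cst.
by apply: mcfun_real; apply: measurable_funM.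
Qed.

(** The projection is built in, so that a half-wave is given by a scalar symbol and the half-wave of
    opposite frequency is reached through [gflip gamma]. *)
Definition mult (a : 'rV[R]_d -> R[i]) (f : 'rV[R]_d -> 'cV[R[i]]_N) (x : 'rV[R]_d) :
  'cV[R[i]]_N :=
  \col_i (((2 * pi) ^- d)%:C * cint (vmu d) (fun xi =>
     cexpi (dotv x xi) * (a xi * (dproj gamma m xi *m fourier f xi) i 0))).

Section bounds.
Variables (f : 'rV[R]_d -> 'cV[R[i]]_N) (rho : R).
Hypotheses (f1 : in_L1 f) (fsupp : fourier_supp_ball f rho) (rho0 : 0 <= rho).

Lemma mcfun_projfourier i : mcfun (fun xi : vec d => (dproj gamma m xi *m fourier f xi) i 0).
Proof.
under eq_fun do rewrite mxE.
apply: mcfun_sum => j; apply: mcfunM; first exact: mcfun_dproj.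
exact: mcfun_fourier.
Qed.

Lemma cmod_projfourier xi i :
  cmod ((dproj gamma m xi *m fourier f xi) i 0) <=
  N%:R * gbound * nL1 f * \prod_l cube1 rho (xi 0 l).
Proof.
have [xr|xr] := ltP rho (eucl xi).
  rewrite (fsupp xr) mulmx0 mxE cmod0 mulr_ge0 ?cube_ge0//.
  by rewrite !mulr_ge0 ?nL1_ge0// (le_trans _ gbound_ge1).
rewrite cube_ge1// mulr1 mxE; apply: le_trans (cmod_sum _ _ _) _.
apply: (@le_trans _ _ (\sum_(j < N) (gbound * nL1 f))); last first.
  by rewrite sumr_const card_ord -(mulr_natl (_ * _)) mulrA.
apply: ler_sum => j _; rewrite cmodM ler_pM ?cmod_ge0 ?cmod_dproj//.
exact: cmod_fourier.
Qed.

Lemma cintegrable_mult (a : 'rV[R]_d -> R[i]) (M : R) x i :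
  mcfun (a : vec d -> R[i]) ->
  (forall xi, eucl xi <= rho -> cmod (a xi) <= M) ->
  cintegrable (vmu d) (fun xi =>
     cexpi (dotv x xi) * (a xi * (dproj gamma m xi *m fourier f xi) i 0)) /\
  cmod (cint (vmu d) (fun xi =>
     cexpi (dotv x xi) * (a xi * (dproj gamma m xi *m fourier f xi) i 0)))
   <= M * (N%:R * gbound * nL1 f) * (2 * rho) ^+ d.
Proof.
move=> ma aM.
have mF : mcfun (fun xi : vec d =>
     cexpi (dotv x xi) * (a xi * (dproj gamma m xi *m fourier f xi) i 0)).
  apply: mcfunM; first by apply: mcfun_cexpi; apply: measurable_dotv.
  by apply: mcfunM => //; exact: mcfun_projfourier.
have [ic /(_ rho0) vc] := @rintegrable_cube R d rho.
have iG := rintegrableZ (M * (N%:R * gbound * nL1 f)) ic.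
have bd xi : cmod (cexpi (dotv x xi) * (a xi * (dproj gamma m xi *m fourier f xi) i 0)) <=
    M * (N%:R * gbound * nL1 f) * \prod_l cube1 rho (xi 0 l).
  rewrite !cmodM cmod_cexpi mul1r -mulrA.
  have [xr|xr] := ltP rho (eucl xi).
    rewrite (fsupp xr) mulmx0 mxE cmod0 mulr0.
    (* The bound assumed on the ball, taken at the origin, shows [0 <= M]. *)
    have [/(aM _) h|h] := leP (eucl (0 : 'rV[R]_d)) rho.
      rewrite !mulr_ge0 ?cube_ge0 ?nL1_ge0 ?(le_trans _ gbound_ge1)//.
      by rewrite (le_trans _ h)// cmod_ge0.
    move: h; rewrite /eucl (_ : dotv 0 0 = 0) ?sqrtr0; first by rewrite ltNge rho0.
    by rewrite /dotv big1// => l _; rewrite mxE mul0r.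
  by rewrite ler_pM ?cmod_ge0 ?aM// cmod_projfourier.
split; first exact: (cintegrable_le mF iG).
apply: le_trans (le_cmod_cint_dom mF iG bd) _.
by rewrite RintegralZl// vc.
Qed.

Definition multbound (M : R) := (2 * pi) ^- d * (M * (N%:R * gbound * nL1 f) * (2 * rho) ^+ d).

Lemma cmod_mult (a : 'rV[R]_d -> R[i]) (M : R) x i :
  mcfun (a : vec d -> R[i]) ->
  (forall xi, eucl xi <= rho -> cmod (a xi) <= M) ->
  cmod (mult a f x i 0) <= multbound M.
Proof.
move=> ma aM; rewrite mxE cmodM cmod_real ger0_norm ?invr_ge0 ?exprn_ge0 ?mulr_ge0 ?pi_ge0//.
rewrite ler_wpM2l ?invr_ge0 ?exprn_ge0 ?mulr_ge0 ?pi_ge0//.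
by have [_] := cintegrable_mult x i ma aM.
Qed.

Lemma multD (a b : 'rV[R]_d -> R[i]) (M M' : R) x :
  mcfun (a : vec d -> R[i]) -> mcfun (b : vec d -> R[i]) ->
  (forall xi, eucl xi <= rho -> cmod (a xi) <= M) ->
  (forall xi, eucl xi <= rho -> cmod (b xi) <= M') ->
  mult (fun xi => a xi + b xi) f x = mult a f x + mult b f x.
Proof.
move=> ma mb aM bM; apply/colP => i; rewrite mxE [RHS]mxE [X in X + _]mxE [X in _ + X]mxE.
rewrite -mulrDr -cintD.
- by congr (_ * _); apply: eq_cint => xi; ring.
- by have [] := cintegrable_mult x i ma aM.
- by have [] := cintegrable_mult x i mb bM.
Qed.

Lemma multZ (a : 'rV[R]_d -> R[i]) (M : R) c x :
  mcfun (a : vec d -> R[i]) ->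
  (forall xi, eucl xi <= rho -> cmod (a xi) <= M) ->
  mult (fun xi => c * a xi) f x = c *: mult a f x.
Proof.
move=> ma aM; apply/colP => i; rewrite mxE [RHS]mxE [X in _ = c * X]mxE.
rewrite mulrCA; congr (_ * _).
rewrite -cintZ; last by have [] := cintegrable_mult x i ma aM.
by apply: eq_cint => xi; ring.
Qed.

Lemma mult_eq (a b : 'rV[R]_d -> R[i]) x :
  (forall xi, eucl xi <= rho -> a xi = b xi) -> mult a f x = mult b f x.
Proof.
move=> ab; apply/colP => i; rewrite mxE [RHS]mxE; congr (_ * _).
apply: eq_cint => xi; have [xr|xr] := ltP rho (eucl xi); last by rewrite ab.
by rewrite (fsupp xr) mulmx0 [X in _ * (_ * X)]mxE [in RHS]mxE !mulr0.
Qed.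

End bounds.
End Multiplier.

Section PropSplit.
Context {R : realType} (d N : nat) (gamma : 'I_d.+1 -> 'M[R[i]]_N).
Hypotheses (cg : clifford gamma).
Variables (f : 'rV[R]_d -> 'cV[R[i]]_N) (rho : R).
Hypotheses (f1 : in_L1 f) (fsupp : fourier_supp_ball f rho) (rho0 : 0 <= rho).

Definition phase (m t : R) (xi : 'rV[R]_d) : R[i] := cexpi (t * om m xi).

Lemma mcfun_phase m t : mcfun (phase m t : vec d -> R[i]).
Proof.
by apply: mcfun_cexpi; apply: measurable_funM => //; exact: measurable_om.
Qed.

Lemma cmod_phase m t xi : cmod (phase m t xi) = 1.
Proof. exact: cmod_cexpi. Qed.

Lemma dirac_propE m t x : dirac_prop gamma m t f x =
  mult gamma m (phase m (- t)) f x + mult (gflip gamma) m (phase m t) f x.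
Proof.
apply/colP => i; rewrite mxE [RHS]mxE [X in _ = X + _]mxE [X in _ = _ + X]mxE.
have ph s xi : eucl xi <= rho -> cmod (phase m s xi) <= 1 by rewrite cmod_phase.
have [i1 _] := cintegrable_mult gamma m f1 fsupp rho0 x i (mcfun_phase m (- t)) (ph _).
have [i2 _] := cintegrable_mult (gflip gamma) m f1 fsupp rho0 x i (mcfun_phase m t) (ph _).
have e xi : cexpi (dotv x xi) * (expm ((0 +i* (- t)) *: dirac_symbol gamma m xi) *m fourier f xi) i 0
  = cexpi (dotv x xi) * (phase m (- t) xi * (dproj gamma m xi *m fourier f xi) i 0)
  + cexpi (dotv x xi) * (phase m t xi * (dproj (gflip gamma) m xi *m fourier f xi) i 0).
  have := expm_dproj cg m t xi; move: (expm _) => E ->; rewrite /phase mulNr.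
  move: (dproj gamma m xi) (dproj (gflip gamma) m xi) (fourier f xi) => P Q v.
  by rewrite mulmxDl mxE -!scalemxAl [X in _ * (X + _)]mxE [X in _ * (_ + X)]mxE mulrDr.
rewrite -mulrDr -cintD// -ciintE; last first.
  exact: cintegrableD.
by congr (_ * ciint _); apply/funext => xi.
Qed.

End PropSplit.

Section SwapIter.
Context {R : realType} d1 d2 (T1 : measurableType d1) (T2 : measurableType d2).
Variables (m1 : {sigma_finite_measure set T1 -> \bar R}).
Variables (m2 : {sigma_finite_measure set T2 -> \bar R}).

(** Fubini with a majorant that is not a product: in the subordination integral the width in [xi] of
    the Gaussian depends on [s]. *)
Lemma cint_swap_iter (f : T1 -> T2 -> R[i]) (G : T1 -> T2 -> R) (H : T1 -> R) :
  mcfun (fun p : T1 * T2 => f p.1 p.2) ->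
  (forall x, rintegrable m2 (G x)) -> (forall x y, cmod (f x y) <= G x y) ->
  (forall x, \int[m2]_y G x y <= H x) -> rintegrable m1 H ->
  cint m1 (fun x => cint m2 (f x)) = cint m2 (fun y => cint m1 (f^~ y)).
Proof.
move=> mf iG fG GH iH; apply: cint_swap => //.
have mfx x : mcfun (f x).
  exact: (mcfun_comp mf (measurable_pair1 x)).
have e x : (\int[m2]_y (cmod (f x y))%:E = (\int[m2]_y cmod (f x y))%:E)%E.
  rewrite /Rintegral fineK//; apply: integrable_fin_num => //.
  exact: rintegrable_cmod (cintegrable_le (mfx x) (iG x) (fG x)).
under eq_integral do rewrite e.
have hH x : 0 <= \int[m2]_y cmod (f x y) <= H x.
  rewrite Rintegral_ge0//=; last by move=> y _; exact: cmod_ge0.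
  apply: le_trans (GH x); apply: le_Rintegral => //; last exact: iG.
  exact: rintegrable_cmod (cintegrable_le (mfx x) (iG x) (fG x)).
have H0 x : 0 <= H x by have /andP[a b] := hH x; exact: le_trans a b.
apply: (@le_lt_trans _ _ (\int[m1]_x (H x)%:E)%E).
  apply: ge0_le_integral => //.
  - by move=> x _; rewrite lee_fin; have /andP[] := hH x.
  - apply/measurable_EFinP; apply: (measurable_Rintegral_param m2 (F := fun x y => cmod (f x y))).
    exact: measurable_cmod mf.
  - by apply/measurable_EFinP; exact: rintegrable_measurable iH.
  - by move=> x _; rewrite lee_fin; have /andP[] := hH x.
case/integrableP: iH => _; apply: le_lt_trans.
rewrite le_eqVlt; apply/orP; left; apply/eqP.
by apply/eq_integral => x _ /=; rewrite ger0_norm.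
Qed.
End SwapIter.

(** * The kernel of the damped half-wave *)

Section ExpDecay.
Context {R : realType}.

Lemma rintegrable_opp (f : R -> R) : rintegrable leb f -> rintegrable leb (fun x => f (- x)).
Proof.
move=> fi; have mf := rintegrable_measurable fi.
have mopp : measurable_fun [set: measurableTypeR R] (fun x : R => - x : measurableTypeR R).
  exact: (@measurable_funN _ (measurableTypeR R) R setT idfun (@measurable_id _ _ setT)).
case/integrableP: fi => _ fi; apply/integrableP; split.
  by apply/measurable_EFinP; exact: (measurableT_comp mf mopp).
apply: le_lt_trans fi; rewrite le_eqVlt; apply/orP; left; apply/eqP.
apply: (@ge0_integral_opp _ (fun x => `|(EFin \o f) x|%E)) => //.
by apply: measurableT_comp => //; exact/measurable_EFinP.
Qed.

Lemma rintegrable_exp_abs (c : R) : 0 < c -> rintegrable leb (fun x => expR (- (c * `|x|))).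
Proof.
move=> c0.
have i1 : rintegrable leb (exponential_pdf c) by exact: integrable_exponential_pdf.
have i2 := rintegrable_opp i1.
apply: (@rintegrable_le _ _ (measurableTypeR R) leb _
   (fun x : R => c^-1 * (exponential_pdf c x + exponential_pdf c (- x)))).
- apply: (measurableT_comp (@measurable_expR R)); apply: measurable_funN.
  by apply: measurable_funM => //; exact: measurable_normr.
- by apply: rintegrableZ; exact: rintegrableD.
move=> x; rewrite ger0_norm ?expR_ge0// ler_pdivlMl//.
have p0 y : 0 <= exponential_pdf c y by apply: exponential_pdf_ge0; exact: ltW.
have [x0|x0] := leP 0 x.
  rewrite [X in X + _]exponential_pdfE// ger0_norm// mulNr lerDl.
  exact: p0.
rewrite [X in _ + X]exponential_pdfE ?oppr_ge0 ?(ltW x0)// ltr0_norm// mulNr lerDr.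
exact: p0.
Qed.

(** [om] dominates the mean of the [|xi 0 i|], so a tensor product of exponentials of rate [e / d]
    is a majorant. *)
Lemma rintegrable_exp_om d (m e : R) : (0 < d)%N -> 0 < e ->
  rintegrable (vmu d) (fun xi => expR (- (e * om m xi))).
Proof.
move=> d0 e0; have dp : (0 : R) < d%:R by rewrite ltr0n.
have ed : 0 < e / d%:R by rewrite divr_gt0.
apply: (rintegrable_le _ (rintegrable_tensor (h := fun _ t => expR (- (e / d%:R * `|t|))) _)).
- apply: (measurableT_comp (@measurable_expR R)); apply: measurable_funN.
  by apply: measurable_funM => //; exact: measurable_om.
- by move=> _; exact: rintegrable_exp_abs.
move=> xi; rewrite ger0_norm ?expR_ge0// -expR_sum ler_expR sumrN lerN2 -mulr_sumr.
rewrite -mulrA ler_wpM2l ?(ltW e0)// ler_pdivrMl//.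
apply: (@le_trans _ _ (\sum_(i < d) om m xi)); last first.
  by rewrite sumr_const card_ord mulr_natl.
apply: ler_sum => l _; apply: le_trans (coord_le_eucl _ _) _.
by rewrite ler_wsqrtr// lerDl sqr_ge0.
Qed.

Lemma vgauss_real d (e : R) : 0 < e ->
  rintegrable (vmu d) (fun v => expR (- (e * dotv v v))) /\
  \int[vmu d]_v expR (- (e * dotv v v)) = Num.sqrt (pi / e) ^+ d.
Proof.
move=> e0.
have E (v : vec d) : \prod_i expR (- (e * v 0 i ^+ 2)) = expR (- (e * dotv v v)).
  by rewrite -expR_sum sumrN -mulr_sumr; congr (expR (- (_ * _))); apply: eq_bigr => i _; rewrite expr2.
have ii := fun _ : 'I_d => rintegrable_gauss e0.
split; first exact: eq_rintegrable E (rintegrable_tensor ii).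
under eq_Rintegral do rewrite -E.
by rewrite (Rintegral_tensor ii) prodr_const card_ord Rintegral_gauss.
Qed.

End ExpDecay.

(** * Kernel formulas from subordination *)

Section Kernel.
Context {R : realType} (d : nat) (m : R) (z : R[i]).
Hypothesis z0 : 0 < complex.Re z.

(** In the variable [expR s ^+ 2] this is, for [m != 0] and up to elementary factors, a Macdonald
    function of order [(j + 1) / 2]. In dimension two only [j = 0] and [j = 2] occur, and the order
    is half an odd integer. *)
Definition Qint (A : R[i]) (j : nat) := cint leb (fun s =>
  (expR s ^+ j.+1)%:C * cexp (- (A * (expR s ^+ 2)%:C + z * (m ^+ 2 * expR (- s) ^+ 2)%:C))).

Lemma measurable_expR_pow (c : R) k :
  measurable_fun [set: measurableTypeR R] (fun s : R => expR (c * s) ^+ k).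
Proof.
apply: measurable_funX; apply: (measurableT_comp (@measurable_expR R)).
by apply: measurable_funM.
Qed.

Lemma mcfun_Q (A : R[i]) (j : nat) : mcfun (fun s : measurableTypeR R =>
  (expR s ^+ j)%:C * cexp (- (A * (expR s ^+ 2)%:C + z * (m ^+ 2 * expR (- s) ^+ 2)%:C))).
Proof.
have m1 k : measurable_fun [set: measurableTypeR R] (fun s : R => expR s ^+ k).
  by have := measurable_expR_pow 1 k; under eq_fun do rewrite mul1r.
have m2 k : measurable_fun [set: measurableTypeR R] (fun s : R => expR (- s) ^+ k).
  by have := measurable_expR_pow (-1) k; under eq_fun do rewrite mulN1r.
apply: mcfunM; first by apply: mcfun_real; exact: m1.
apply: mcfun_cexp; apply: mcfunN; apply: mcfunD; (apply: mcfunM; first exact: mcfun_cst).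
  by apply: mcfun_real; exact: m1.
by apply: mcfun_real; apply: measurable_funM => //; exact: m2.
Qed.

Lemma cmod_Q (A : R[i]) (j : nat) s :
  cmod ((expR s ^+ j)%:C * cexp (- (A * (expR s ^+ 2)%:C + z * (m ^+ 2 * expR (- s) ^+ 2)%:C)))
  <= expR s ^+ j * expR (- (complex.Re A * expR s ^+ 2)).
Proof.
rewrite cmodM cmod_real cmod_cexp ger0_norm ?exprn_ge0 ?expR_ge0// ler_wpM2l ?exprn_ge0 ?expR_ge0//.
rewrite ler_expR !ReImE/= !mulr0 !subr0 lerN2 lerDl mulr_ge0 ?(ltW z0)//.
by rewrite mulr_ge0 ?sqr_ge0.
Qed.

Lemma cintegrable_Q (A : R[i]) (j : nat) : 0 < complex.Re A -> cintegrable leb (fun s =>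
  (expR s ^+ j.+1)%:C * cexp (- (A * (expR s ^+ 2)%:C + z * (m ^+ 2 * expR (- s) ^+ 2)%:C))).
Proof.
by move=> A0; have [i1 _] := exp_moment j A0; apply: (cintegrable_le (mcfun_Q A _) i1) => s; exact: cmod_Q.
Qed.

Definition Qint_const (j : nat) : R := 2 ^+ j * j%:R ^+ j * Num.sqrt pi.

Lemma cmod_Qint (A : R[i]) (j : nat) : 0 < complex.Re A ->
  cmod (Qint A j) <= Qint_const j / Num.sqrt (complex.Re A) ^+ j.+1.
Proof.
move=> A0; have [i1 b] := exp_moment j A0; apply: le_trans b.
by apply: (le_cmod_cint_dom (mcfun_Q A _) i1) => s; exact: cmod_Q.
Qed.

Let e := complex.Re z.

Section gen.
Variables (x : 'rV[R]_d) (p : 'rV[R]_d -> R) (w : R -> R) (k j : nat) (c P : R).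
Hypothesis mp : measurable_fun [set: vec d] (p : vec d -> R).
Hypothesis mw : measurable_fun [set: measurableTypeR R] (w : measurableTypeR R -> R).
Hypothesis w0 : forall s, 0 <= w s.
Hypothesis wE : forall s, w s * expR s ^+ k * expR s ^+ d = c * expR s ^+ j.+1.
Hypothesis P0 : 0 <= P.
Hypothesis pP : forall b xi, 0 < b ->
  `|p xi| * expR (- (e * b ^+ 2 * dotv xi xi)) <= P * b ^- k * expR (- (e * b ^+ 2 / 2 * dotv xi xi)).

(** One exchange of integrals for the prefactors [1], [m] and [xi 0 l]. Absorbing [p] into half of
    the Gaussian costs [b ^- k] with [b = expR (- s)]; by [wE] the weight, this cost and the factor
    [expR s ^+ d] from the Gaussian integral combine to [expR s ^+ j.+1], which is integrable
    against the remaining exponential. *)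
Lemma kernel_swap :
  cint (vmu d) (fun xi => cint leb (fun s =>
    cexpi (dotv x xi) * ((p xi)%:C * ((w s)%:C * csE z (om m xi) s)))) =
  cint leb (fun s => (w s)%:C * cexp (- (z * (expR s ^+ 2 / 4 + m ^+ 2 * expR (- s) ^+ 2)%:C)) *
    cint (vmu d) (fun xi => cexpi (dotv x xi) * ((p xi)%:C *
      cexp (- (z * (expR (- s) ^+ 2)%:C * (dotv xi xi)%:C))))).
Proof.
have split s (xi : 'rV[R]_d) : csE z (om m xi) s =
    cexp (- (z * (expR s ^+ 2 / 4 + m ^+ 2 * expR (- s) ^+ 2)%:C)) *
    cexp (- (z * (expR (- s) ^+ 2)%:C * (dotv xi xi)%:C)).
  rewrite /csE -cexpD om_sqr; congr cexp.
  by apply: complex_eq; rewrite !ReImE/=; ring.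
pose G s (xi : vec d) := w s * expR (- (e / 4 * expR s ^+ 2)) *
   (P * expR (- s) ^- k * expR (- (e * expR (- s) ^+ 2 / 2 * dotv xi xi))).
have eb s : 0 < e * expR (- s) ^+ 2 / 2 by rewrite divr_gt0// mulr_gt0// exprn_gt0// expR_gt0.
have cmodf s xi : cmod (cexpi (dotv x xi) * ((p xi)%:C *
      cexp (- (z * (expR (- s) ^+ 2)%:C * (dotv xi xi)%:C)))) =
   `|p xi| * expR (- (e * expR (- s) ^+ 2 * dotv xi xi)).
  rewrite 2!cmodM cmod_cexpi cmod_real cmod_cexp mul1r; congr (_ * expR _).
  by rewrite !ReImE/= -/e; ring.
have e1 s xi : cexpi (dotv x xi) * ((p xi)%:C * ((w s)%:C * csE z (om m xi) s)) =
  (w s)%:C * cexp (- (z * (expR s ^+ 2 / 4 + m ^+ 2 * expR (- s) ^+ 2)%:C)) *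
   (cexpi (dotv x xi) * ((p xi)%:C * cexp (- (z * (expR (- s) ^+ 2)%:C * (dotv xi xi)%:C)))).
  by rewrite split; ring.
transitivity (cint leb (fun s => cint (vmu d) (fun xi =>
    cexpi (dotv x xi) * ((p xi)%:C * ((w s)%:C * csE z (om m xi) s))))).
  apply/esym; apply: (@cint_swap_iter R _ _ (measurableTypeR R) (vec d) leb (vmu d)
    (fun s xi => cexpi (dotv x xi) * ((p xi)%:C * ((w s)%:C * csE z (om m xi) s))) G
    (fun s => c * P * Num.sqrt (pi / (e / 2)) ^+ d * (expR s ^+ j.+1 * expR (- (e / 4 * expR s ^+ 2))))).
  - pose T := (measurableTypeR R * vec (R := R) d)%type.
    have mfst : measurable_fun [set: T] (fun q : T => q.1) by exact: measurable_fst.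
    have msnd : measurable_fun [set: T] (fun q : T => q.2) by exact: measurable_snd.
    have m1 cc n : measurable_fun [set: T] (fun q : T => expR (cc * q.1) ^+ n).
      exact: (measurableT_comp (measurable_expR_pow cc n) mfst).
    have m1' n : measurable_fun [set: T] (fun q : T => expR q.1 ^+ n).
      by have := m1 1 n; under eq_fun do rewrite mul1r.
    have m2' n : measurable_fun [set: T] (fun q : T => expR (- q.1) ^+ n).
      by have := m1 (-1) n; under eq_fun do rewrite mulN1r.
    apply: mcfunM; first by apply: mcfun_cexpi; exact: measurable_dotv.
    apply: mcfunM; first by apply: mcfun_real; exact: (measurableT_comp mp msnd).
    apply: mcfunM; first by apply: mcfun_real; exact: (measurableT_comp mw mfst).
    apply: mcfun_cexp; apply: mcfunN; apply: mcfunM; first exact: mcfun_cst.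
    apply: mcfun_real; apply: measurable_funD.
      by apply: measurable_funM => //; exact: m1'.
    apply: measurable_funM; last exact: m2'.
    by apply: measurable_funX; exact: (measurableT_comp (measurable_om m) msnd).
  - move=> s; apply: rintegrableZ; apply: rintegrableZ.
    by have [] := vgauss_real d (eb s).
  - move=> s xi; rewrite e1 cmodM cmodf cmodM cmod_real ger0_norm// cmod_cexp.
    rewrite /G ler_pM ?mulr_ge0 ?expR_ge0//; last by apply: pP; exact: expR_gt0.
    rewrite ler_wpM2l// ler_expR !ReImE/= mulr0 subr0 -/e lerN2.
    have : 0 <= e * (m ^+ 2 * expR (- s) ^+ 2) by rewrite mulr_ge0 ?(ltW z0)// mulr_ge0 ?sqr_ge0.
    by move: (m ^+ 2 * expR (- s) ^+ 2) (expR s ^+ 2) => X Y; lra.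
  - move=> s; have [ii vv] := vgauss_real d (eb s).
    rewrite RintegralZl//; last exact: rintegrableZ.
    rewrite RintegralZl// vv.
    have -> : pi / (e * expR (- s) ^+ 2 / 2) = pi / (e / 2) * expR s ^+ 2.
      rewrite expRN exprVn; field.
      by rewrite !gt_eqF ?expR_gt0// /e.
    rewrite sqrtrM; last by rewrite divr_ge0 ?pi_ge0// divr_ge0 ?(ltW z0).
    rewrite sqrtr_sqr ger0_norm ?expR_ge0// exprMn (expRN s) exprVn invrK.
    have := wE s; move: (expR s) (Num.sqrt _ ^+ d) (expR (- _)) (w s) => E S B W h.
    rewrite le_eqVlt; apply/orP; left; apply/eqP.
    transitivity (W * E ^+ k * E ^+ d * B * P * S); first by ring.
    by rewrite h; ring.
  - by apply: rintegrableZ; have [] := @exp_moment R j (e / 4) (divr_gt0 z0 (ltr0Sn _ _)).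
apply: eq_cint => s.
transitivity (cint (vmu d) (fun xi =>
  (w s)%:C * cexp (- (z * (expR s ^+ 2 / 4 + m ^+ 2 * expR (- s) ^+ 2)%:C)) *
   (cexpi (dotv x xi) * ((p xi)%:C * cexp (- (z * (expR (- s) ^+ 2)%:C * (dotv xi xi)%:C)))))).
  by apply: eq_cint => xi; exact: e1.
rewrite cintZ//.
apply: (@cintegrable_le _ _ _ (vmu d) _ (fun xi => P * expR (- s) ^- k * expR (- (e * expR (- s) ^+ 2 / 2 * dotv xi xi)))).
- apply: mcfunM; first by apply: mcfun_cexpi; exact: measurable_dotv.
  apply: mcfunM; first by apply: mcfun_real.
  apply: mcfun_cexp; apply: mcfunN; apply: mcfunM; first exact: mcfun_cst.
  by apply: mcfun_real; exact: measurable_dotv.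
- by apply: rintegrableZ; have [] := vgauss_real d (eb s).
- by move=> xi; rewrite cmodf; apply: pP; exact: expR_gt0.
Qed.

End gen.

(** The rate of [expR s ^+ 2] left after the Gaussian integral in [xi]. It equals
    [(z^2 + |x|^2) / (4 z)], so for small damping it is small near the light cone. *)
Definition kernel_rate (x : 'rV[R]_d) : R[i] := (z + (dotv x x)%:C / z) / 4.

Lemma z_neq0 : z != 0.
Proof. by apply: contraTneq z0 => ->; rewrite ltxx. Qed.

Lemma Re_kernel_rate x : complex.Re (kernel_rate x) = e / 4 * (1 + dotv x x / cmod z ^+ 2).
Proof.
have cz : cmod z ^+ 2 != 0 by rewrite sqrf_eq0 cmod_eq0 z_neq0.
have -> : kernel_rate x = (4^-1 : R)%:C * (z + (dotv x x / cmod z ^+ 2)%:C * cconj z).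
  rewrite /kernel_rate mulrC (_ : (4^-1 : R[i]) = (4^-1 : R)%:C); last first.
    by rewrite (fmorphV (real_complex R)) (rmorph_nat (real_complex R)).
  congr (_ * (_ + _)); rewrite rmorphM/= -mulrA; congr (_ * _).
  rewrite (fmorphV (real_complex R))/= -mul_conj invfM mulfVK//.
  by rewrite -cmod_eq0 cmod_conj cmod_eq0 z_neq0.
by rewrite !ReImE/= -/e; ring.
Qed.

Lemma Re_kernel_rate_gt0 x : 0 < complex.Re (kernel_rate x).
Proof.
rewrite Re_kernel_rate mulr_gt0 ?divr_gt0//.
by rewrite (lt_le_trans ltr01)// lerDl divr_ge0 ?dotv_ge0 ?sqr_ge0.
Qed.

Lemma measurable_wpow (c cc : R) :
  measurable_fun [set: measurableTypeR R] (fun s : R => c * expR (cc * s)).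
Proof.
by apply: measurable_funM => //; have := measurable_expR_pow cc 1; under eq_fun do rewrite expr1.
Qed.

Lemma gauss_half b (xi : 'rV[R]_d) : 0 < b ->
  expR (- (e * b ^+ 2 * dotv xi xi)) <= expR (- (e * b ^+ 2 / 2 * dotv xi xi)).
Proof.
move=> b0; rewrite ler_expR lerN2.
have : 0 <= e * b ^+ 2 * dotv xi xi by rewrite mulr_ge0 ?dotv_ge0// mulr_ge0 ?(ltW z0)// sqr_ge0.
by move: (b ^+ 2) (dotv xi xi) => B D; lra.
Qed.

(** Scaling the Gaussian parameter by [expR (- s) ^+ 2] splits off [gauss_int z ^+ d], which no
    longer depends on [s], and the power [expR s ^+ d]. *)
Lemma cexp_AE x s : let a := z * (expR (- s) ^+ 2)%:C in
  cexp (- (z * (expR s ^+ 2 / 4 + m ^+ 2 * expR (- s) ^+ 2)%:C)) *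
  (gauss_int a ^+ d * cexp (- ((dotv x x)%:C / (4 * a)))) =
  gauss_int z ^+ d * (expR s ^+ d)%:C *
  cexp (- (kernel_rate x * (expR s ^+ 2)%:C + z * (m ^+ 2 * expR (- s) ^+ 2)%:C)).
Proof.
move=> a.
have -> : gauss_int a = gauss_int z * (expR s)%:C by rewrite gauss_int_scale ?expR_gt0// expRN invrK.
rewrite exprMn -rmorphXn mulrCA -cexpD; congr (_ * cexp _).
have s0 : (expR s)%:C != 0 :> R[i] by rewrite -cmod_gt0 cmod_real normr_gt0 gt_eqF// expR_gt0.
have -> : (dotv x x)%:C / (4 * a) = (dotv x x)%:C / z / 4 * (expR s ^+ 2)%:C.
  rewrite /a expRN exprVn (fmorphV (real_complex R)) !rmorphXn/=; field.
  by rewrite s0 z_neq0.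
rewrite /kernel_rate [(_ / 4 + _)%:C]rmorphD/= [(_ / 4)%:C]rmorphM/= (fmorphV (real_complex R)).
rewrite (rmorph_nat (real_complex R)).
move: ((expR s ^+ 2)%:C) ((m ^+ 2 * expR (- s) ^+ 2)%:C) ((dotv x x)%:C / z) => X Y Z.
by field.
Qed.

Lemma Re_zs s : 0 < complex.Re (z * (expR (- s) ^+ 2)%:C).
Proof. by rewrite !ReImE/= mulr0 subr0 mulr_gt0// exprn_gt0// expR_gt0. Qed.

Hypothesis d0 : (0 < d)%N.

Lemma cintegrable_exp_om (g : 'rV[R]_d -> R) x : measurable_fun [set: vec d] (g : vec d -> R) ->
  (forall xi, `|g xi| <= 1) ->
  cintegrable (vmu d) (fun xi => cexpi (dotv x xi) * ((g xi)%:C * cexp (- (z * (om m xi)%:C)))).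
Proof.
move=> mg g1; apply: (cintegrable_le _ (rintegrable_exp_om m d0 z0)) => [|xi].
  apply: mcfunM; first by apply: mcfun_cexpi; exact: measurable_dotv.
  apply: mcfunM; first exact: mcfun_real.
  apply: mcfun_cexp; apply: mcfunN; apply: mcfunM; first exact: mcfun_cst.
  by apply: mcfun_real; exact: measurable_om.
rewrite 2!cmodM cmod_cexpi mul1r cmod_real cmod_cexp !ReImE/= mulr0 subr0.
by rewrite ler_piMl ?expR_ge0.
Qed.

(** [kernel0], [kernel1] and [kernell] treat the scalar symbols [1], [m / om] and [xi 0 l / om] that
    make up the entries of [dproj]. *)
Lemma kernel0 x :
  gauss_int z * cint (vmu d) (fun xi => cexpi (dotv x xi) * (1%:C * cexp (- (z * (om m xi)%:C)))) =
  gauss_int z ^+ d * Qint (kernel_rate x) d.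
Proof.
rewrite -cintZ; last by apply: (@cintegrable_exp_om (fun=> 1)) => // xi; rewrite normr1.
transitivity (cint (vmu d) (fun xi => cint leb (fun s =>
    cexpi (dotv x xi) * (1%:C * ((expR s)%:C * csE z (om m xi) s))))).
  apply: eq_cint => xi; have [i1 v1] := cs1 z0 (om_ge0 m xi).
  rewrite rmorph1 mul1r mulrCA -v1 -cintZ//; apply: eq_cint => s.
  by rewrite mul1r.
rewrite (@kernel_swap x (fun=> 1) (fun s => expR s) 0 d 1 1)//; last 3 first.
- exact: (@measurable_expR R).
- by move=> s; rewrite expr0 mulr1 mul1r exprS.
- by move=> b xi b0; rewrite normr1 expr0 invr1 !mul1r; exact: gauss_half.
rewrite -cintZ; last exact/cintegrable_Q/Re_kernel_rate_gt0.
apply: eq_cint => s.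
have -> : cint (vmu d) (fun xi => cexpi (dotv x xi) * (1%:C *
      cexp (- (z * (expR (- s) ^+ 2)%:C * (dotv xi xi)%:C)))) =
   cint (vmu d) (fun xi => cexpi (dotv x xi) *
      cexp (- (z * (expR (- s) ^+ 2)%:C * (dotv xi xi)%:C))).
  by apply: eq_cint => xi; rewrite rmorph1 mul1r.
rewrite vgaussFT; last exact: Re_zs.
by rewrite -mulrA cexp_AE [expR s ^+ d.+1]exprS [(expR s * _)%:C]rmorphM/=; ring.
Qed.

Lemma kernel1 x : m != 0 -> (1 < d)%N ->
  gauss_int z * cint (vmu d) (fun xi =>
    cexpi (dotv x xi) * ((m / om m xi)%:C * cexp (- (z * (om m xi)%:C)))) =
  gauss_int z ^+ d * ((2 * m)%:C * Qint (kernel_rate x) d.-2).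
Proof.
move=> m0 d1.
have o0 (xi : 'rV[R]_d) : 0 < om m xi.
  rewrite lt0r om_ge0 andbT -sqrf_eq0 om_sqr paddr_eq0 ?dotv_ge0 ?sqr_ge0//.
  by rewrite negb_and sqrf_eq0 m0 orbT.
rewrite -cintZ; last first.
  apply: (@cintegrable_exp_om (fun xi => m / om m xi)) => [|xi]; last exact: mass_le_om.
  apply: measurable_funM => //.
  under eq_fun do rewrite -powR_inv1 ?om_ge0//.
  exact: (measurableT_comp (@measurable_powR R (-1)) (measurable_om m)).
transitivity (cint (vmu d) (fun xi => cint leb (fun s =>
    cexpi (dotv x xi) * (m%:C * ((2 * expR (- s))%:C * csE z (om m xi) s))))).
  apply: eq_cint => xi; have [i1 v1] := cs2 z0 (o0 xi).
  transitivity (cexpi (dotv x xi) * m%:C * (gauss_int z * cexp (- (z * (om m xi)%:C)) / (om m xi)%:C)).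
    by rewrite rmorphM/= (fmorphV (real_complex R))/=; ring.
  rewrite -v1 -cintZ//; apply: eq_cint => s.
  by rewrite -mulrA.
(* The weight [expR (- s)] lowers the power [d] by one, whence the index [d.-2]. *)
rewrite (@kernel_swap x (fun=> m) (fun s => 2 * expR (- s)) 0 d.-2 2 `|m|)//; last 3 first.
- by have := measurable_wpow 2 (-1); under eq_fun do rewrite mulN1r.
- move=> s; rewrite expr0 mulr1 -{1}(ltn_predK d1) exprS -mulrA; congr (_ * _).
  rewrite mulrA -expRD addNr expR0 mul1r; congr (_ ^+ _).
  by rewrite prednK// -ltnS prednK.
- by move=> b xi b0; rewrite expr0 invr1 mulr1 ler_wpM2l// gauss_half.
rewrite mulrA -cintZ; last exact/cintegrable_Q/Re_kernel_rate_gt0.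
apply: eq_cint => s.
have -> : cint (vmu d) (fun xi => cexpi (dotv x xi) * (m%:C *
      cexp (- (z * (expR (- s) ^+ 2)%:C * (dotv xi xi)%:C)))) =
   m%:C * cint (vmu d) (fun xi => cexpi (dotv x xi) *
      cexp (- (z * (expR (- s) ^+ 2)%:C * (dotv xi xi)%:C))).
  rewrite -cintZ; last exact/cintegrable_vgauss/Re_zs.
  by apply: eq_cint => xi; ring.
rewrite vgaussFT; last exact: Re_zs.
have -> : (expR s ^+ d.-2.+1)%:C = (expR (- s))%:C * (expR s ^+ d)%:C.
  rewrite -rmorphM/=; congr (_ %:C).
  by case: d d1 => [|[|n]]//= _; rewrite [in RHS]exprS mulrA -expRD addNr expR0 mul1r.
have := cexp_AE x s => /=; set X := cexp _; set Y := _ * cexp _; set W := cexp _ => h.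
transitivity ((2 * expR (- s))%:C * m%:C * (X * Y)); first by ring.
by rewrite h !rmorphM/=; ring.
Qed.

Lemma kernell x l :
  gauss_int z * cint (vmu d) (fun xi =>
    cexpi (dotv x xi) * ((xi 0 l / om m xi)%:C * cexp (- (z * (om m xi)%:C)))) =
  gauss_int z ^+ d * (ii * (x 0 l)%:C / z * Qint (kernel_rate x) d).
Proof.
rewrite -cintZ; last first.
  apply: (@cintegrable_exp_om (fun xi => xi 0 l / om m xi)) => [|xi]; last exact: coord_le_om.
  apply: measurable_funM; first exact: measurable_vec_coord.
  under eq_fun do rewrite -powR_inv1 ?om_ge0//.
  exact: (measurableT_comp (@measurable_powR R (-1)) (measurable_om m)).
transitivity (cint (vmu d) (fun xi => cint leb (fun s =>
    cexpi (dotv x xi) * ((xi 0 l)%:C * ((2 * expR (- s))%:C * csE z (om m xi) s))))).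
  apply: eq_cint => xi.
  (* Where [om] vanishes so does [xi 0 l], and both sides are zero; [cs2] requires [om] positive. *)
  have [w0|w0] := eqVneq (om m xi) 0.
    have x0 : xi 0 l = 0.
      apply/eqP; rewrite -normr_le0 -w0; apply: le_trans (coord_le_eucl _ _) _.
      by rewrite ler_wsqrtr// lerDl sqr_ge0.
    rewrite x0 mul0r rmorph0 mul0r mulr0 mulr0.
    transitivity (cint leb (fun s => 0 * ((expR s)%:C * csE z 0 s))); last first.
      by apply: eq_cint => s; ring.
    by rewrite cintZ ?mul0r//; have [] := cs1 z0 (lexx 0).
  have wp : 0 < om m xi by rewrite lt0r w0 om_ge0.
  have [i1 v1] := cs2 z0 wp.
  transitivity (cexpi (dotv x xi) * (xi 0 l)%:C * (gauss_int z * cexp (- (z * (om m xi)%:C)) / (om m xi)%:C)).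
    by rewrite rmorphM/= (fmorphV (real_complex R))/=; ring.
  rewrite -v1 -cintZ//; apply: eq_cint => s.
  by rewrite -mulrA.
rewrite (@kernel_swap x (fun xi => xi 0 l) (fun s => 2 * expR (- s)) 1 d.-1 2 (Num.sqrt e)^-1)//; last 4 first.
- exact: measurable_vec_coord.
- by have := measurable_wpow 2 (-1); under eq_fun do rewrite mulN1r.
- move=> s; rewrite expr1 prednK//; congr (_ * _).
  by rewrite -mulrA -expRD addNr expR0 mulr1.
- move=> b xi b0; rewrite expr1.
  have se : 0 < Num.sqrt e * b by rewrite mulr_gt0// sqrtr_gt0.
  set y := Num.sqrt e * b * `|xi 0 l|.
  have y0 : 0 <= y by rewrite mulr_ge0// ltW.
  (* With [y = sqrt e * b * |xi 0 l|] this lets half of the Gaussian absorb [|xi 0 l|], at the cost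
     of one factor [1 / b]. *)
  have yE : y <= expR (y ^+ 2 / 2).
    apply: (le_trans _ (expR_ge1Dx _)).
    by rewrite -subr_ge0; have := sqr_ge0 (y - 1); rewrite sqrrB; lra.
  have -> : `|xi 0 l| = (Num.sqrt e * b)^-1 * y by rewrite /y mulKf// gt_eqF.
  rewrite -[X in _ <= X * _]invfM -[X in X <= _]mulrA.
  apply: ler_wpM2l; first by rewrite invr_ge0 ltW.
  apply: le_trans (ler_wpM2r (expR_ge0 _) yE) _.
  rewrite -expRD ler_expR /y !exprMn sqr_sqrtr ?(ltW z0)//.
  rewrite real_normK ?num_real//.
  have : xi 0 l ^+ 2 <= dotv xi xi.
    rewrite /dotv (bigD1 l)//= -expr2 lerDl.
    by apply: sumr_ge0 => i _; rewrite -expr2 sqr_ge0.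
  have : 0 <= e * b ^+ 2 by rewrite mulr_ge0 ?(ltW z0)// sqr_ge0.
  by move: (e * b ^+ 2) (xi 0 l ^+ 2) (dotv xi xi) => E X D; nra.
rewrite mulrA -cintZ; last exact/cintegrable_Q/Re_kernel_rate_gt0.
apply: eq_cint => s.
rewrite vgaussFT1; last exact: Re_zs.
have := cexp_AE x s => /=; set X := cexp _; set Y := _ * cexp _; set W := cexp _ => h.
have s0 : (expR s)%:C != 0 :> R[i] by rewrite -cmod_gt0 cmod_real normr_gt0 gt_eqF// expR_gt0.
transitivity ((2 * expR (- s))%:C * (ii * (x 0 l)%:C / (2 * (z * (expR (- s) ^+ 2)%:C))) * (X * Y)).
  by ring.
rewrite h expRN exprVn rmorphM/= !(fmorphV (real_complex R))/= !rmorphXn/= (rmorph_nat (real_complex R)).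
rewrite [_ ^+ d.+1]exprS; field.
by rewrite s0 z_neq0.
Qed.

End Kernel.

(** * The damped half-wave as a convolution *)

Section Convolution.
Context {R : realType} (d N : nat) (gamma : 'I_d.+1 -> 'M[R[i]]_N) (m : R) (z : R[i]).
Hypothesis z0 : 0 < complex.Re z.
Hypothesis d1 : (1 < d)%N.
Let d0 : (0 < d)%N := ltnW d1.

Definition damp (xi : 'rV[R]_d) : R[i] := cexp (- (z * (om m xi)%:C)).

Lemma mcfun_damp : mcfun (damp : vec d -> R[i]).
Proof.
apply: mcfun_cexp; apply: mcfunN; apply: mcfunM; first exact: mcfun_cst.
by apply: mcfun_real; exact: measurable_om.
Qed.

Lemma cmod_damp xi : cmod (damp xi) = expR (- (complex.Re z * om m xi)).
Proof. by rewrite cmod_cexp !ReImE/= mulr0 subr0. Qed.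

Lemma cmod_damp_le1 xi : cmod (damp xi) <= 1.
Proof.
by rewrite cmod_damp -expR0 ler_expR oppr_le0 mulr_ge0 ?om_ge0 ?(ltW z0).
Qed.

Definition Kmx (x : 'rV[R]_d) : 'M[R[i]]_N := \matrix_(i, j)
  (((2 * pi) ^- d)%:C * cint (vmu d) (fun xi => cexpi (dotv x xi) * (damp xi * dproj gamma m xi i j))).

Lemma cintegrable_Kmx x i j :
  cintegrable (vmu d) (fun xi => cexpi (dotv x xi) * (damp xi * dproj gamma m xi i j)).
Proof.
apply: (cintegrable_le _ (rintegrableZ (gbound gamma) (rintegrable_exp_om m d0 z0))) => [|xi].
  apply: mcfunM; first by apply: mcfun_cexpi; exact: measurable_dotv.
  by apply: mcfunM; [exact: mcfun_damp|exact: mcfun_dproj].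
by rewrite 2!cmodM cmod_cexpi mul1r mulrC cmod_damp ler_wpM2r ?expR_ge0// cmod_dproj.
Qed.

(** Damping makes the symbol integrable, so the integral in [xi] may be exchanged with the Fourier
    integral of [f]. *)
Lemma mult_conv (f : 'rV[R]_d -> 'cV[R[i]]_N) x i : in_L1 f ->
  mult gamma m damp f x i 0 = \sum_j cint (vmu d) (fun y => Kmx (x - y) i j * f y j 0).
Proof.
move=> f1; rewrite mxE.
have i1 j y : cmod (f y j 0) <= vnorm (f y) by exact: cmod_le_vnorm.
have mK j : mcfun (fun xi : vec d => damp xi * dproj gamma m xi i j).
  by apply: mcfunM; [exact: mcfun_damp|exact: mcfun_dproj].
have mprod j : mcfun (fun p : vec (R := R) d * vec (R := R) d => cexpi (dotv x p.1) *
    (damp p.1 * dproj gamma m p.1 i j) * (cexpi (- dotv p.2 p.1) * f p.2 j 0)).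
  apply: mcfunM.
    apply: mcfunM; first by apply: mcfun_cexpi; exact: measurable_dotv.
    exact: (mcfun_comp (mK j) (@measurable_fst _ _ _ _)).
  apply: mcfunM; first by apply: mcfun_cexpi; apply: measurable_funN; exact: measurable_dotv.
  exact: (mcfun_comp (mcfun_L1 f1 j) (@measurable_snd _ _ _ _)).
have bd j (xi y : vec d) : cmod (cexpi (dotv x xi) * (damp xi * dproj gamma m xi i j) *
    (cexpi (- dotv y xi) * f y j 0)) <=
    gbound gamma * expR (- (complex.Re z * om m xi)) * vnorm (f y).
  rewrite 4!cmodM !cmod_cexpi !mul1r cmod_damp.
  rewrite ler_pM ?mulr_ge0 ?cmod_ge0 ?expR_ge0 ?cmod_le_vnorm//.
  by rewrite mulrC ler_wpM2r ?expR_ge0// cmod_dproj.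
have iE := rintegrableZ (gbound gamma) (rintegrable_exp_om m d0 z0).
transitivity (((2 * pi) ^- d)%:C * \sum_j cint (vmu d) (fun xi =>
   cint (vmu d) (fun y => cexpi (dotv x xi) * (damp xi * dproj gamma m xi i j) *
     (cexpi (- dotv y xi) * f y j 0)))).
  congr (_ * _); rewrite -cint_sum; last first.
    move=> j.
    apply: (cintegrable_le _ (rintegrableZ (nL1 f) iE)) => [|xi].
      exact: mcfun_cint.
    have iL := rintegrable_L1 f1.
    apply: (@le_trans _ _ (\int[vmu d]_y (gbound gamma * expR (- (complex.Re z * om m xi)) * vnorm (f y)))).
      apply: le_cmod_cint_dom; [|exact: rintegrableZ|exact: bd].
      exact: (mcfun_comp (mprod j) (measurable_pair1 xi)).
    by rewrite RintegralZl// mulrC nL1E.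
  apply: eq_cint => xi; rewrite mxE !mulr_sumr; apply: eq_bigr => j _.
  rewrite cintZ; first by rewrite fourierE//; ring.
  apply: (cintegrable_le _ (rintegrable_L1 f1)) => [|y].
    apply: mcfunM; last exact: mcfun_L1.
    by apply: mcfun_cexpi; apply: measurable_funN; exact: measurable_dotv.
  by rewrite cmodM cmod_cexpi mul1r.
rewrite mulr_sumr; apply: eq_bigr => j _.
rewrite (@cint_swap_dom _ _ _ _ _ (vmu d) (vmu d) _ _ _ (mprod j) iE (rintegrable_L1 f1) (bd j)).
rewrite -cintZ; last first.
  apply: (cintegrable_le _ (rintegrableZ (\int[vmu d]_xi (gbound gamma * expR (- (complex.Re z * om m xi))))
    (rintegrable_L1 f1))) => [|y].
    apply: mcfun_cint.
    exact: (mcfun_comp (mprod j) (@measurable_swap _ _ _ _)).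
  rewrite -RintegralZr//.
  apply: le_cmod_cint_dom; [| |move=> xi; exact: bd].
    exact: (mcfun_comp (mprod j) (measurable_pair2 y)).
  have := rintegrableZ (vnorm (f y)) iE; apply: eq_rintegrable => xi; exact: mulrC.
apply: eq_cint => y; rewrite /Kmx mxE -mulrA; congr (_ * _).
rewrite mulrC -cintZ; last exact: cintegrable_Kmx.
apply: eq_cint => xi; rewrite dotvBl cexpiD (dotvC y xi) (dotvC x xi).
by ring.
Qed.

Lemma KmxE x i j : gauss_int z * Kmx x i j = ((2 * pi) ^- d)%:C * (2^-1 * (gauss_int z ^+ d *
  (((i == j)%:R + ii / z * aslash gamma x i j) * Qint m z (kernel_rate z x) d
   + (2 * m)%:C * gamma ord0 i j * Qint m z (kernel_rate z x) d.-2))).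
Proof.
rewrite mxE mulrCA; congr (_ * _).
have mo : measurable_fun [set: vec d] (fun xi : vec d => (om m xi)^-1).
  under eq_fun do rewrite -powR_inv1 ?om_ge0//.
  exact: (measurableT_comp (@measurable_powR R (-1)) (measurable_om m)).
have i0 : cintegrable (vmu d) (fun xi => cexpi (dotv x xi) * (1%:C * damp xi)).
  by apply: (@cintegrable_exp_om R d m z z0 d0 (fun=> 1) x) => // xi; rewrite normr1.
have iL l : cintegrable (vmu d) (fun xi => cexpi (dotv x xi) * ((xi 0 l / om m xi)%:C * damp xi)).
  apply: (@cintegrable_exp_om R d m z z0 d0 (fun xi => xi 0 l / om m xi) x) => [|xi].
    by apply: measurable_funM => //; exact: measurable_vec_coord.
  exact: coord_le_om.
have i1 : cintegrable (vmu d) (fun xi => cexpi (dotv x xi) * ((m / om m xi)%:C * damp xi)).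
  apply: (@cintegrable_exp_om R d m z z0 d0 (fun xi => m / om m xi) x) => [|xi].
    exact: measurable_funM.
  exact: mass_le_om.
transitivity (gauss_int z * (2^-1 * ((i == j)%:R * cint (vmu d) (fun xi => cexpi (dotv x xi) * (1%:C * damp xi)) +
   \sum_l alpha gamma l i j * cint (vmu d) (fun xi => cexpi (dotv x xi) * ((xi 0 l / om m xi)%:C * damp xi)) +
   gamma ord0 i j * cint (vmu d) (fun xi => cexpi (dotv x xi) * ((m / om m xi)%:C * damp xi))))).
  congr (_ * _); rewrite -!cintZ//.
  under [X in _ + X + _]eq_bigr do rewrite -cintZ//.
  have iS : cintegrable (vmu d) (fun xi => \sum_l alpha gamma l i j * (cexpi (dotv x xi) * ((xi 0 l / om m xi)%:C * damp xi))).
    by apply: cintegrable_sum => l; exact: cintegrableZ.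
  rewrite -cint_sum; last by move=> l; exact: cintegrableZ.
  rewrite -cintD//; last exact: cintegrableZ.
  rewrite -cintD; [|by apply: cintegrableD => //; exact: cintegrableZ|exact: cintegrableZ].
  rewrite -cintZ; last first.
    by apply: cintegrableD; [apply: cintegrableD => //|]; exact: cintegrableZ.
  apply: eq_cint => xi; rewrite dprojE rmorph1.
  have -> : \sum_l alpha gamma l i j * (cexpi (dotv x xi) * ((xi 0 l / om m xi)%:C * damp xi)) =
    cexpi (dotv x xi) * damp xi * \sum_l (xi 0 l / om m xi)%:C * alpha gamma l i j.
    by rewrite mulr_sumr; apply: eq_bigr => l _; ring.
  by ring.
rewrite mulrCA; congr (_ * _); rewrite !mulrDr.
rewrite mulrCA (kernel0 _ z0 d0) mulr_sumr.
under [X in _ + X + _]eq_bigr do rewrite mulrCA (kernell _ z0 d0).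
have -> : gauss_int z * (gamma ord0 i j * cint (vmu d) (fun xi => cexpi (dotv x xi) * ((m / om m xi)%:C * damp xi)))
  = gamma ord0 i j * (gauss_int z ^+ d * ((2 * m)%:C * Qint m z (kernel_rate z x) d.-2)).
  rewrite mulrCA; congr (_ * _).
  have [m0|m0] := eqVneq m 0; last exact: (kernel1 z0 d0).
  rewrite m0 mulr0 rmorph0 mul0r mulr0.
  transitivity (gauss_int z * cint (vmu d) (fun xi : vec d => 0 * (cexpi (dotv x xi) * (1%:C * damp xi)))).
    by congr (_ * _); apply: eq_cint => xi; rewrite mul0r rmorph0; ring.
  by rewrite cintZ// mul0r mulr0.
have -> : aslash gamma x i j = \sum_l (x 0 l)%:C * alpha gamma l i j.
  by rewrite /aslash summxE; apply: eq_bigr => l _; rewrite mxE.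
have -> : \sum_l alpha gamma l i j * (gauss_int z ^+ d * (ii * (x 0 l)%:C / z * Qint m z (kernel_rate z x) d)) =
  gauss_int z ^+ d * (ii / z * (\sum_l (x 0 l)%:C * alpha gamma l i j) * Qint m z (kernel_rate z x) d).
  by rewrite mulr_sumr mulr_suml mulr_sumr; apply: eq_bigr => l _; ring.
by ring.
Qed.

(** One of the [d] Gaussian factors cancels the [gauss_int z] of the subordination formula; the
    other [d - 1] carry the dispersive decay. *)
Lemma KmxE' x i j : Kmx x i j = ((2 * pi) ^- d)%:C * (2^-1 * (gauss_int z ^+ d.-1 *
  (((i == j)%:R + ii / z * aslash gamma x i j) * Qint m z (kernel_rate z x) d
   + (2 * m)%:C * gamma ord0 i j * Qint m z (kernel_rate z x) d.-2))).
Proof.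
apply: (mulfI (gauss_int_neq0 z0)); rewrite KmxE.
have -> : gauss_int z ^+ d = gauss_int z * gauss_int z ^+ d.-1 by rewrite -exprS prednK.
move: ((2 * pi) ^- d)%:C => c; ring.
Qed.

End Convolution.

(** * The dispersive bound *)

Section SupBound.
Context {R : realType} (d N : nat) (gamma : 'I_d.+1 -> 'M[R[i]]_N) (m : R) (z : R[i]) (e : R).
Hypotheses (e0 : 0 < e) (e1 : e <= 1) (ez : e <= complex.Re z).
Let z0 : 0 < complex.Re z := lt_le_trans e0 ez.
Hypothesis m1 : `|m| <= 1.
Hypothesis d1 : (1 < d)%N.

Lemma gbound_entry i j :
  1 + (\sum_l cmod (alpha gamma l i j) + cmod (gamma ord0 i j)) <= gbound gamma.
Proof.
rewrite /gbound lerD2l (bigD1 i)//= (bigD1 j)//= -!addrA lerD2l lerDl addr_ge0//.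
  apply: sumr_ge0 => k _; rewrite addr_ge0 ?cmod_ge0//.
  by apply: sumr_ge0 => l _; exact: cmod_ge0.
apply: sumr_ge0 => k _; apply: sumr_ge0 => k' _.
rewrite addr_ge0 ?cmod_ge0//.
by apply: sumr_ge0 => l _; exact: cmod_ge0.
Qed.

Definition kernel_const : R := (2 * pi) ^- d * (gbound gamma * (Qint_const (R := R) d + Qint_const d.-2)).
(** The first factor is the decay in [|z|]. The second is what a damping of only [e] costs; for [e]
    of order [1 / rho] it is of order [rho ^ ((d + 1) / 2)]. *)
Definition decay (z : R[i]) (e : R) : R :=
  Num.sqrt (pi / cmod z) ^+ d.-1 * (2 / Num.sqrt e) ^+ d.+1.

Lemma Qint_const_ge0 j : (0 : R) <= Qint_const j.
Proof. by rewrite /Qint_const !mulr_ge0 ?exprn_ge0 ?sqrtr_ge0. Qed.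

Lemma kernel_const_ge0 : 0 <= kernel_const.
Proof.
apply: mulr_ge0; first by rewrite invr_ge0 exprn_ge0// mulr_ge0// pi_ge0.
apply: mulr_ge0; last by apply: addr_ge0; exact: Qint_const_ge0.
exact: le_trans ler01 (gbound_ge1 gamma).
Qed.

Lemma cmod_gauss_int : cmod (gauss_int z) = Num.sqrt (pi / cmod z).
Proof. by rewrite -cmod_gauss_int_sqr// sqrtr_sqr ger0_norm ?cmod_ge0. Qed.

(** The factor [aslash x / z] of the kernel is unbounded in [x], but the real part of [kernel_rate]
    grows like [|x|^2 / |z|^2]. The quantity [S] measures both, so they compensate and the bound is
    uniform in [x]. *)
Lemma cmod_Kmx x i j : cmod (Kmx gamma m z x i j) <= kernel_const * decay z e.
Proof.
rewrite (KmxE' gamma m z0 d1) cmodM cmod_real ger0_norm ?invr_ge0 ?exprn_ge0 ?mulr_ge0 ?pi_ge0//.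
rewrite /kernel_const -[X in _ <= X]mulrA ler_wpM2l ?invr_ge0 ?exprn_ge0 ?mulr_ge0 ?pi_ge0//.
rewrite cmodM cmodM cmodX cmod_gauss_int /decay.
have -> : cmod (2^-1 : R[i]) = 2^-1.
  by rewrite cmodV (_ : (2 : R[i]) = (2 : R)%:C) ?cmod_real ?ger0_norm// (rmorph_nat (real_complex R)).
set P := Num.sqrt (pi / cmod z) ^+ d.-1.
have P0 : 0 <= P by rewrite exprn_ge0 ?sqrtr_ge0.
set A := kernel_rate z x.
have A0 : 0 < complex.Re A by exact: Re_kernel_rate_gt0.
have se : 0 < Num.sqrt e by rewrite sqrtr_gt0.
set S := Num.sqrt (1 + dotv x x / cmod z ^+ 2).
have S1 : 1 <= S.
  by rewrite -sqrtr1 ler_wsqrtr// lerDl divr_ge0 ?dotv_ge0 ?sqr_ge0.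
have SA : Num.sqrt e / 2 * S <= Num.sqrt (complex.Re A).
  rewrite Re_kernel_rate// sqrtrM ?divr_ge0 ?(ltW z0)// sqrtrM ?(ltW z0)// -/S.
  rewrite ler_wpM2r// ?(le_trans ler01)// sqrtrV// (_ : 4 = 2 ^+ 2) ?sqrtr_sqr ?ger0_norm//; last by ring.
  by rewrite ler_wpM2r// ler_wsqrtr.
have Sx l : `|x 0 l| / cmod z <= S.
  rewrite -[leLHS]ger0_norm ?divr_ge0 ?cmod_ge0// -sqrtr_sqr ler_wsqrtr// exprMn exprVn.
  rewrite real_normK ?num_real//.
  have : x 0 l ^+ 2 <= dotv x x.
    rewrite /dotv (bigD1 l)//= -expr2 lerDl.
    by apply: sumr_ge0 => k _; rewrite -expr2 sqr_ge0.
  move=> h; apply: (@le_trans _ _ (dotv x x / cmod z ^+ 2)); last by rewrite lerDr.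
  by rewrite ler_wpM2r ?invr_ge0 ?sqr_ge0.
set D := (2 / Num.sqrt e) ^+ d.+1.
have D0 : 0 <= D by rewrite exprn_ge0// divr_ge0// ltW.
(* Applied to [y] equal to [1], [|m|] and [|x 0 l| / |z|], all at most [S]; one power of [S] in the
   denominator absorbs [y]. *)
have QE k (y : R) : 0 <= y -> y <= S -> y * (Qint_const k / Num.sqrt (complex.Re A) ^+ k.+1) <=
    Qint_const k * (2 / Num.sqrt e) ^+ k.+1.
  move=> y0 yS.
  have S0 : 0 < S by rewrite (lt_le_trans ltr01).
  apply: (@le_trans _ _ (y * (Qint_const k / (Num.sqrt e / 2 * S) ^+ k.+1))).
    rewrite ler_wpM2l// ler_wpM2l ?Qint_const_ge0// lef_pV2 ?posrE ?exprn_gt0 ?sqrtr_gt0 ?mulr_gt0 ?divr_gt0//.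
    by apply: lerXn2r => //; rewrite nnegrE ?mulr_ge0 ?divr_ge0 ?sqrtr_ge0 ?(ltW S0).
  rewrite exprMn invfM -exprVn invfM invrK [_^-1 * 2]mulrC.
  rewrite (_ : y * _ = (Qint_const k * (2 / Num.sqrt e) ^+ k.+1) * (y / S ^+ k.+1)); last by ring.
  rewrite ler_piMr ?mulr_ge0 ?Qint_const_ge0 ?exprn_ge0 ?divr_ge0 ?(ltW se)//.
  rewrite ler_pdivrMr ?exprn_gt0// mul1r (le_trans yS)// exprS ler_peMr ?(ltW S0)//.
  exact: exprn_ege1.
have Q2 : `|m| * (Qint_const d.-2 / Num.sqrt (complex.Re A) ^+ d.-2.+1) <= Qint_const d.-2 * D.
  apply: le_trans (QE _ _ (normr_ge0 _) (le_trans m1 S1)) _.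
  rewrite ler_wpM2l ?Qint_const_ge0//; apply: ler_weXn2l; last first.
    by rewrite ltnS (leq_trans (leq_pred _)) ?leq_pred.
  rewrite ler_pdivlMr// mul1r (@le_trans _ _ 1)// ?ler1n//.
  by rewrite -sqrtr1 ler_wsqrtr.
have Qd1 := QE d 1 ler01 S1; rewrite mul1r -/D in Qd1.
have bQ1 : cmod (((i == j)%:R + ii / z * aslash gamma x i j) * Qint m z A d) <=
   (1 + \sum_l cmod (alpha gamma l i j)) * (Qint_const d * D).
  rewrite cmodM.
  apply: (@le_trans _ _ ((1 + \sum_l `|x 0 l| / cmod z * cmod (alpha gamma l i j)) *
      (Qint_const d / Num.sqrt (complex.Re A) ^+ d.+1))).
    apply: ler_pM; rewrite ?cmod_ge0//; last exact: cmod_Qint.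
    apply: le_trans (cmodD _ _) _; apply: lerD.
      by case: (i == j); rewrite ?cmod1 ?cmod0.
    rewrite /aslash summxE 2!cmodM cmod_ii mul1r cmodV.
    apply: (@le_trans _ _ ((cmod z)^-1 * \sum_l `|x 0 l| * cmod (alpha gamma l i j))).
      rewrite ler_wpM2l ?invr_ge0 ?cmod_ge0//; apply: le_trans (cmod_sum _ _ _) _.
      by apply: ler_sum => l _; rewrite mxE cmodM cmod_real.
    by rewrite mulr_sumr; apply: ler_sum => l _; rewrite mulrA [_^-1 * _]mulrC.
  rewrite !mulrDl !mul1r; apply: lerD => //.
  rewrite !mulr_suml; apply: ler_sum => l _.
  rewrite mulrAC [leRHS]mulrC ler_wpM2r ?cmod_ge0//; apply: QE => //.
  by rewrite divr_ge0 ?cmod_ge0.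
have bQ2 : cmod ((2 * m)%:C * gamma ord0 i j * Qint m z A d.-2) <=
   2 * cmod (gamma ord0 i j) * (Qint_const d.-2 * D).
  rewrite 2!cmodM cmod_real normrM ger0_norm//.
  have := cmod_Qint m z0 d.-2 A0 => h.
  have : `|m| * cmod (Qint m z A d.-2) <= Qint_const d.-2 * D.
    by apply: le_trans Q2; rewrite ler_wpM2l.
  move=> {}h; rewrite (_ : 2 * `|m| * _ * _ = 2 * cmod (gamma ord0 i j) *
     (`|m| * cmod (Qint m z A d.-2))); last by ring.
  by rewrite ler_wpM2l// mulr_ge0 ?cmod_ge0.
rewrite (_ : _ * (P * D) = P * (gbound gamma * (Qint_const d + Qint_const d.-2) * D)); last by ring.
rewrite mulrCA ler_wpM2l//.
rewrite ler_pdivrMl//.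
apply: le_trans (cmodD _ _) _; apply: le_trans (lerD bQ1 bQ2) _.
have := gbound_entry i j.
have a0 : 0 <= \sum_l cmod (alpha gamma l i j) by apply: sumr_ge0 => l _; exact: cmod_ge0.
have g0 := cmod_ge0 (gamma ord0 i j).
have q1 : 0 <= Qint_const d * D by rewrite mulr_ge0 ?Qint_const_ge0.
have q2 : 0 <= Qint_const d.-2 * D by rewrite mulr_ge0 ?Qint_const_ge0.
rewrite (_ : 2 * (_ * _ * D) = 2 * gbound gamma * (Qint_const d * D + Qint_const d.-2 * D)); last by ring.
move: (Qint_const d * D) (Qint_const d.-2 * D) (cmod _) (\sum_l _) (gbound _) q1 q2 g0 a0 => q q' g a G q1 q2 g0 a0 h.
by nra.
Qed.

Lemma cmod_mult_damp (f : 'rV[R]_d -> 'cV[R[i]]_N) x i : in_L1 f ->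
  cmod (mult gamma m (damp m z) f x i 0) <= N%:R * (kernel_const * decay z e) * nL1 f.
Proof.
move=> f1; rewrite (mult_conv gamma m z0 d1)//; apply: le_trans (cmod_sum _ _ _) _.
have -> : N%:R * (kernel_const * decay z e) * nL1 f = \sum_(j < N) (kernel_const * decay z e * nL1 f).
  by rewrite sumr_const card_ord -mulrA mulr_natl.
apply: ler_sum => j _.
have mK : mcfun (fun y : vec d => Kmx gamma m z (x - y) i j).
  apply: (mcfun_comp (f := fun v : vec d => Kmx gamma m z v i j)).
    under eq_fun do rewrite mxE.
    apply: mcfunM; first exact: mcfun_cst.
    apply: mcfun_cint.
    apply: mcfunM; first by apply: mcfun_cexpi; exact: measurable_dotv.
    have mK : mcfun (fun xi : vec d => damp m z xi * dproj gamma m xi i j).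
      by apply: mcfunM; [exact: mcfun_damp|exact: mcfun_dproj].
    exact: (mcfun_comp mK (@measurable_snd _ _ _ _)).
  apply: measurable_to_vec => l.
  under eq_fun do rewrite !mxE.
  by apply: measurable_funB => //; exact: measurable_vec_coord.
apply: le_trans (le_cmod_cint_dom _ (rintegrableZ (kernel_const * decay z e) (rintegrable_L1 f1)) _) _.
- by apply: mcfunM => //; exact: mcfun_L1.
- by move=> y; rewrite cmodM ler_pM ?cmod_ge0 ?cmod_Kmx ?cmod_le_vnorm.
- by rewrite RintegralZl ?nL1E//; exact: rintegrable_L1.
Qed.

End SupBound.

(** * The Bessel inequality *)

Section WeightRemoval.
Context {R : realType} d (T : measurableType d) (mu : {measure set T -> \bar R}).
Local Open Scope ereal_scope.

(** Monotone convergence as the Gaussian cutoff opens up. The term in [C'] leaves room for the error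
    that a cutoff causes in an integration by parts. *)
Lemma integral_weight_removal (p G : T -> R) (C C' : R) :
  measurable_fun [set: T] p -> measurable_fun [set: T] G ->
  (forall x, 0 <= p x)%R -> (forall x, 0 <= G x)%R ->
  (forall n : nat, \int[mu]_x (expR (- (n.+1%:R^-1 ^+ 2 * p x)) * G x)%:E <= (C + C' * n.+1%:R^-1)%:E) ->
  \int[mu]_x (G x)%:E <= C%:E.
Proof.
move=> mp mG p0 G0 H.
pose g n x := (expR (- (n.+1%:R^-1 ^+ 2 * p x)) * G x)%:E.
have gG x : g^~ x @ \oo --> (G x)%:E.
  apply: cvg_EFin; first by apply: nearW => n.
  rewrite -[X in _ --> X]mul1r; apply: cvgM; last exact: cvg_cst.
  rewrite -[X in _ --> X]expR0; apply: continuous_cvg; first exact: continuous_expR.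
  rewrite -oppr0; apply: cvgN; rewrite -[X in _ --> X](mul0r (p x)); apply: cvgM; last exact: cvg_cst.
  by rewrite -[X in _ --> X](mulr0 (0 : R)%R); apply: cvgM; exact: cvg_harmonic.
have mg n : measurable_fun [set: T] (g n).
  apply/measurable_EFinP; apply: measurable_funM => //.
  by apply: measurableT_comp => //; apply: measurable_funN; exact: measurable_funM.
have g0 n x : [set: T] x -> 0 <= g n x by move=> _; rewrite lee_fin mulr_ge0 ?expR_ge0.
have ndg x : [set: T] x -> {homo g^~ x : n k / (n <= k)%N >-> n <= k}.
  move=> _ n k nk; rewrite lee_fin ler_wpM2r// ler_expR lerN2 ler_wpM2r//.
  by apply: lerXn2r; rewrite ?nnegrE ?invr_ge0// lef_pV2 ?posrE ?ltr0n// ler_nat ltnS.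
have := @cvg_monotone_convergence _ _ _ mu _ measurableT g mg g0 ndg.
have -> : \int[mu]_x (fun x => limn (g^~ x)) x = \int[mu]_x (G x)%:E.
  by apply: eq_integral => x _; apply/cvg_lim.
move=> h; apply: (lee_cvg_to h (g := fun n : nat => (C + C' * n.+1%:R^-1)%:E)).
  apply: cvg_EFin; first by apply: nearW => n.
  rewrite -[X in _ --> X]addr0; apply: cvgD; first exact: cvg_cst.
  by rewrite -[X in _ --> X](mulr0 C'); apply: cvgM; [exact: cvg_cst|exact: cvg_harmonic].
by apply: nearW => n; exact: H.
Qed.
End WeightRemoval.

Lemma cint_real {R : realType} d (T : measurableType d) (mu : {measure set T -> \bar R})
  (f : T -> R) : cint mu (fun x => (f x)%:C) = (\int[mu]_x f x)%:C.
Proof. by apply: complex_eq => //=; rewrite /Rintegral integral0. Qed.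

Lemma measurable_vecB {R : realType} d (T : measurableType d) n (f g : T -> vec (R := R) n) :
  measurable_fun [set: T] f -> measurable_fun [set: T] g ->
  measurable_fun [set: T] (fun x => (f x : 'rV[R]_n) - g x : vec (R := R) n).
Proof.
move=> mf mg; apply: measurable_to_vec => l; under eq_fun do rewrite !mxE.
by apply: measurable_funB;
  [exact: (measurableT_comp (@measurable_vec_coord R n l) mf)|
   exact: (measurableT_comp (@measurable_vec_coord R n l) mg)].
Qed.

Section SliceSwap.
Context {R : realType} d1 d2 (T1 : measurableType d1) (T2 : measurableType d2).
Variables (m1 : {sigma_finite_measure set T1 -> \bar R}).
Variables (m2 : {sigma_finite_measure set T2 -> \bar R}).

Lemma Rintegral_swap_ge0 (F : T1 -> T2 -> R) :
  measurable_fun [set: T1 * T2] (fun p => F p.1 p.2) -> (forall x y, 0 <= F x y) ->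
  (forall x, rintegrable m2 (F x)) -> (forall y, rintegrable m1 (F^~ y)) ->
  rintegrable m2 (fun y => \int[m1]_x F x y) ->
  rintegrable m1 (fun x => \int[m2]_y F x y) /\
  \int[m1]_x \int[m2]_y F x y = \int[m2]_y \int[m1]_x F x y.
Proof.
move=> mF F0 i2 i1 ii.
have e1 x : (\int[m2]_y (F x y)%:E = (\int[m2]_y F x y)%:E)%E.
  by rewrite /Rintegral fineK//; apply: integrable_fin_num => //; exact: i2.
have e2 y : (\int[m1]_x (F x y)%:E = (\int[m1]_x F x y)%:E)%E.
  by rewrite /Rintegral fineK//; apply: integrable_fin_num => //; exact: i1.
have E : (\int[m1]_x (\int[m2]_y F x y)%:E = \int[m2]_y (\int[m1]_x F x y)%:E)%E.
  rewrite (eq_integral (fun x => \int[m2]_y (F x y)%:E)%E); last by move=> x _; rewrite e1.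
  rewrite [RHS](eq_integral (fun y => \int[m1]_x (F x y)%:E)%E); last by move=> y _; rewrite e2.
  apply: (@fubini_tonelli _ _ _ _ _ m1 m2 (fun p => (F p.1 p.2)%:E)) => [|p]; last by rewrite lee_fin.
  exact/measurable_EFinP.
split; last by rewrite /Rintegral E.
apply/integrableP; split.
  by apply/measurable_EFinP; exact: (measurable_Rintegral_param m2 (F := F)).
case/integrableP: ii => _; apply: le_lt_trans.
rewrite le_eqVlt; apply/orP; left; apply/eqP.
rewrite (eq_integral (fun x => (\int[m2]_y F x y)%:E)%E); last first.
  by move=> x _ /=; rewrite ger0_norm// Rintegral_ge0.
rewrite E; apply: eq_integral => y _ /=; rewrite ger0_norm// Rintegral_ge0//.
Qed.
End SliceSwap.

Section Bessel.
Context {R : realType} (d : nat).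

Lemma gauss_shift1 (e u : R) : 0 < e ->
  rintegrable leb (fun x : R => expR (- (e * (x - u) ^+ 2))) /\
  \int[leb]_x expR (- (e * (x - u) ^+ 2)) = Num.sqrt (pi / e).
Proof.
move=> e0.
have mF : measurable_fun [set: measurableTypeR R] (fun x : R => (expR (- (e * x ^+ 2)))%:E).
  by apply/measurable_EFinP; exact: rintegrable_measurable (rintegrable_gauss e0).
have E : (\int[leb]_x (expR (- (e * (x - u) ^+ 2)))%:E = (Num.sqrt (pi / e))%:E)%E.
  rewrite -integral_gauss//.
  apply: (@ge0_integral_shift R (fun x : R => (expR (- (e * x ^+ 2)))%:E) (- u)) => //.
split; last by rewrite /Rintegral E.
apply/integrableP; split.
  apply/measurable_EFinP; apply: (measurableT_comp (@measurable_expR R)); apply: measurable_funN.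
  by apply: measurable_funM => //; apply: measurable_funX; exact: measurable_funB.
apply: le_lt_trans (ltry (Num.sqrt (pi / e))); rewrite -E le_eqVlt; apply/orP; left; apply/eqP.
by apply: eq_integral => x _ /=; rewrite ger0_norm ?expR_ge0.
Qed.

Lemma vgauss_shift (e : R) (u : 'rV[R]_d) : 0 < e ->
  rintegrable (vmu d) (fun v => expR (- (e * dotv (v - u) (v - u)))) /\
  \int[vmu d]_v expR (- (e * dotv (v - u) (v - u))) = Num.sqrt (pi / e) ^+ d.
Proof.
move=> e0.
have E (v : vec d) : \prod_i expR (- (e * (v 0 i - u 0 i) ^+ 2)) = expR (- (e * dotv (v - u) (v - u))).
  rewrite -expR_sum sumrN -mulr_sumr; congr (expR (- (_ * _))); apply: eq_bigr => i _.
  by rewrite !mxE expr2.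
have ii (i : 'I_d) := (gauss_shift1 (u 0 i) e0).1.
split; first exact: eq_rintegrable E (rintegrable_tensor ii).
under eq_Rintegral do rewrite -E.
rewrite (Rintegral_tensor ii).
under eq_bigr do rewrite (gauss_shift1 _ e0).2.
by rewrite prodr_const card_ord.
Qed.

Variables (v : 'rV[R]_d -> R[i]) (M rho : R).
Hypothesis mv : mcfun (v : vec d -> R[i]).
Hypothesis vM : forall xi, cmod (v xi) <= M * \prod_l cube1 rho (xi 0 l).

Definition ift (x : 'rV[R]_d) := cint (vmu d) (fun xi => cexpi (dotv x xi) * v xi).

Lemma cintegrable_ift x : cintegrable (vmu d) (fun xi => cexpi (dotv x xi) * v xi).
Proof.
have [ic _] := @rintegrable_cube R d rho.
apply: (cintegrable_le _ (rintegrableZ M ic)) => [|xi].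
  by apply: mcfunM => //; apply: mcfun_cexpi; exact: measurable_dotv.
by rewrite cmodM cmod_cexpi mul1r.
Qed.

Definition ift_bound := \int[vmu d]_xi (M * \prod_l cube1 rho (xi 0 l)).

Lemma cmod_ift x : cmod (ift x) <= ift_bound.
Proof.
have [ic _] := @rintegrable_cube R d rho.
apply: le_cmod_cint_dom; [|exact: rintegrableZ|].
  by apply: mcfunM => //; apply: mcfun_cexpi; exact: measurable_dotv.
by move=> xi; rewrite cmodM cmod_cexpi mul1r.
Qed.

Lemma mcfun_ift : mcfun (ift : vec d -> R[i]).
Proof.
apply: mcfun_cint; apply: mcfunM; first by apply: mcfun_cexpi; exact: measurable_dotv.
exact: (mcfun_comp mv (@measurable_snd _ _ _ _)).
Qed.

Lemma rintegrable_v2 : rintegrable (vmu d) (fun xi => cmod (v xi) ^+ 2).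
Proof.
have [ic _] := @rintegrable_cube R d rho.
apply: (rintegrable_le _ (rintegrableZ (M ^+ 2) ic)) => [|xi].
  by apply: measurable_funX; exact: measurable_cmod.
rewrite ger0_norm ?sqr_ge0//.
have /(lerXn2r 2) := vM xi.
rewrite !nnegrE cmod_ge0 (le_trans (cmod_ge0 _) (vM xi)) => /(_ isT isT) h.
apply: le_trans h _; rewrite exprMn ler_wpM2l ?sqr_ge0//.
rewrite -prodrXl le_eqVlt; apply/orP; left; apply/eqP; apply: eq_bigr => l _.
by rewrite /cube1 indicE; case: (_ \in _); rewrite ?expr0n ?expr1n.
Qed.

Section schur.
Variables (H : 'rV[R]_d -> 'rV[R]_d -> R) (B c : R).
Hypothesis H0 : forall xi eta, 0 <= H xi eta.
Hypothesis Hs : forall xi eta, H xi eta = H eta xi.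
Hypothesis HM : forall xi eta, H xi eta <= B.
Hypothesis mH2 : measurable_fun [set: (vec (R := R) d * vec (R := R) d)%type] (fun p => H p.1 p.2).
Hypothesis Hi : forall xi, rintegrable (vmu d) (H xi).
Hypothesis Hv : forall xi, \int[vmu d]_eta H xi eta = c.

Let iHv (g : vec (R := R) d -> R) xi : rintegrable (vmu d) g -> rintegrable (vmu d) (fun eta => H xi eta * g eta).
Proof.
have mHx : measurable_fun [set: vec (R := R) d] (H xi : vec d -> R).
  exact: (measurableT_comp mH2 (measurable_pair1 _)).
move=> ig'; apply: (rintegrable_le _ (rintegrableZ B (rintegrable_norm ig'))).
  by apply: measurable_funM => //; exact: rintegrable_measurable ig'.
by move=> eta; rewrite normrM ger0_norm// ler_wpM2r.
Qed.

Let HI1 eta (a : R) : rintegrable (vmu d) (fun xi => H xi eta * a) /\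
  \int[vmu d]_xi (H xi eta * a) = c * a.
Proof.
have E xi : a * H eta xi = H xi eta * a by rewrite Hs mulrC.
split; first by have := rintegrableZ a (Hi eta); apply: eq_rintegrable => xi; exact: E.
transitivity (\int[vmu d]_xi (a * H eta xi)); first by apply: eq_Rintegral => xi _; rewrite E.
by rewrite (RintegralZl _ measurableT (Hi eta)) Hv mulrC.
Qed.

Let schur_swap : rintegrable (vmu d) (fun xi => \int[vmu d]_eta (H xi eta * cmod (v eta) ^+ 2)) /\
  \int[vmu d]_xi \int[vmu d]_eta (H xi eta * cmod (v eta) ^+ 2) =
  c * \int[vmu d]_xi cmod (v xi) ^+ 2.
Proof.
have i22 := rintegrable_v2.
have [iS ES] : rintegrable (vmu d) (fun xi => \int[vmu d]_eta (H xi eta * cmod (v eta) ^+ 2)) /\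
    \int[vmu d]_xi \int[vmu d]_eta (H xi eta * cmod (v eta) ^+ 2) =
    \int[vmu d]_eta \int[vmu d]_xi (H xi eta * cmod (v eta) ^+ 2).
  apply: (@Rintegral_swap_ge0 R _ _ (vec d) (vec d) (vmu d) (vmu d) (fun xi eta => H xi eta * cmod (v eta) ^+ 2)).
  - apply: measurable_funM => //; apply: measurable_funX; apply: measurable_cmod.
    exact: (mcfun_comp mv (@measurable_snd _ _ _ _)).
  - by move=> xi eta; rewrite mulr_ge0 ?sqr_ge0.
  - by move=> xi; exact: iHv.
  - by move=> eta; exact: (HI1 eta _).1.
  - have := rintegrableZ c i22; apply: eq_rintegrable => eta.
    by rewrite (HI1 eta _).2.
split; first exact: iS.
by rewrite ES; under eq_Rintegral do rewrite (HI1 _ _).2; rewrite RintegralZl.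
Qed.

Let schur_slice xi :
  cmod (v xi * cint (vmu d) (fun eta => (H xi eta)%:C * cconj (v eta))) <=
  2^-1 * (c * cmod (v xi) ^+ 2) + 2^-1 * \int[vmu d]_eta (H xi eta * cmod (v eta) ^+ 2).
Proof.
have E eta : cmod ((H xi eta)%:C * cconj (v eta)) = H xi eta * cmod (v eta).
  by rewrite cmodM cmod_real ger0_norm// cmod_conj.
have mHv : mcfun (fun eta : vec d => (H xi eta)%:C * cconj (v eta)).
  apply: mcfunM; last exact: mcfun_conj.
  by apply: mcfun_real; exact: (measurableT_comp mH2 (measurable_pair1 _)).
have [ic _] := @rintegrable_cube R d rho.
have ivc : rintegrable (vmu d) (fun eta => cmod (v eta)).
  apply: (rintegrable_le _ (rintegrableZ M ic)) => [|eta]; first exact: measurable_cmod.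
  by rewrite ger0_norm ?cmod_ge0.
have iB := iHv xi rintegrable_v2.
have iD := iHv xi ivc.
have pw eta : cmod (v xi) * (H xi eta * cmod (v eta)) <=
  2^-1 * cmod (v xi) ^+ 2 * H xi eta + 2^-1 * (H xi eta * cmod (v eta) ^+ 2).
  have := mulr_ge0 (H0 xi eta) (sqr_ge0 (cmod (v xi) - cmod (v eta))).
  by rewrite sqrrB; move: (H _ _) (cmod _) (cmod _) => h a b; nra.
rewrite cmodM.
have h1 : cmod (cint (vmu d) (fun eta => (H xi eta)%:C * cconj (v eta))) <=
     \int[vmu d]_eta (H xi eta * cmod (v eta)).
  by apply: (le_cmod_cint_dom mHv iD) => eta; rewrite E.
apply: le_trans (ler_wpM2l (cmod_ge0 _) h1) _.
rewrite -(RintegralZl _ measurableT iD).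
have -> : 2^-1 * (c * cmod (v xi) ^+ 2) +
  2^-1 * (\int[vmu d]_eta (H xi eta * cmod (v eta) ^+ 2)) =
  \int[vmu d]_eta (2^-1 * cmod (v xi) ^+ 2 * H xi eta + 2^-1 * (H xi eta * cmod (v eta) ^+ 2)).
  rewrite (RintegralD measurableT (rintegrableZ _ (Hi xi)) (rintegrableZ _ iB)).
  rewrite (RintegralZl _ measurableT (Hi xi)) (RintegralZl _ measurableT iB) Hv.
  by move: (\int[vmu d]_eta _) => X; ring.
apply: (le_Rintegral measurableT (rintegrableZ _ iD)) => [|eta _]; last exact: pw.
exact: (rintegrableD (rintegrableZ _ (Hi xi)) (rintegrableZ _ iB)).
Qed.

(** Schur's test: [2 a b <= a^2 + b^2] under the kernel, whose rows all have mass [c] and which is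
    symmetric. *)
Lemma schur :
  cmod (cint (vmu d) (fun xi => v xi * cint (vmu d) (fun eta => (H xi eta)%:C * cconj (v eta)))) <=
  c * \int[vmu d]_xi cmod (v xi) ^+ 2.
Proof.
have [iS ES] := schur_swap.
have iA := rintegrableZ c rintegrable_v2.
have mI : mcfun (fun xi : vec d => cint (vmu d) (fun eta => (H xi eta)%:C * cconj (v eta))).
  apply: mcfun_cint; apply: mcfunM; first exact: mcfun_real.
  by apply: mcfun_conj; exact: (mcfun_comp mv (@measurable_snd _ _ _ _)).
have iG := rintegrableD (rintegrableZ 2^-1 iA) (rintegrableZ 2^-1 iS).
apply: le_trans (le_cmod_cint_dom (mcfunM mv mI) iG schur_slice) _.
rewrite (RintegralD measurableT (rintegrableZ 2^-1 iA) (rintegrableZ 2^-1 iS)).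
rewrite (RintegralZl _ measurableT iA) (RintegralZl _ measurableT iS) (RintegralZl _ measurableT rintegrable_v2) ES.
move: (\int[vmu d]_xi _) => X.
by rewrite le_eqVlt; apply/orP; left; apply/eqP; field.
Qed.
End schur.

(** With the Gaussian weight Fubini applies, and integrating out [x] leaves a Gaussian kernel in the
    two frequencies. *)
Lemma bessel_weight (e : R) : 0 < e ->
  rintegrable (vmu d) (fun x => expR (- (e * dotv x x)) * cmod (ift x) ^+ 2) /\
  \int[vmu d]_x (expR (- (e * dotv x x)) * cmod (ift x) ^+ 2) <=
  (2 * pi) ^+ d * \int[vmu d]_xi cmod (v xi) ^+ 2.
Proof.
move=> e0.
have [ig _] := vgauss_real d e0.
have [ic _] := @rintegrable_cube R d rho.
have md : measurable_fun [set: vec (R := R) d] (fun x : vec d => dotv x x) by exact: measurable_dotv.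
have mg : measurable_fun [set: vec (R := R) d] (fun x : vec d => expR (- (e * dotv x x))).
  by apply: measurableT_comp => //; apply: measurable_funN; exact: measurable_funM.
have ii : rintegrable (vmu d) (fun x => expR (- (e * dotv x x)) * cmod (ift x) ^+ 2).
  apply: (rintegrable_le _ (rintegrableZ (ift_bound ^+ 2) ig)) => [|x].
    by apply: measurable_funM => //; apply: measurable_funX; exact/measurable_cmod/mcfun_ift.
  rewrite ger0_norm; last by rewrite mulr_ge0 ?expR_ge0 ?sqr_ge0.
  rewrite mulrC ler_wpM2r ?expR_ge0//.
  by apply: lerXn2r; rewrite ?nnegrE ?cmod_ge0 ?cmod_ift// (le_trans (cmod_ge0 _) (cmod_ift 0)).
split => //.
(* The Fourier transform of the weight. Its mass is [(2 pi) ^ d] whatever [e], and this is the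
   Plancherel constant. *)
pose H (xi eta : 'rV[R]_d) := Num.sqrt (pi / e) ^+ d * expR (- ((4 * e)^-1 * dotv (eta - xi) (eta - xi))).
have H0 xi eta : 0 <= H xi eta by rewrite mulr_ge0 ?exprn_ge0 ?sqrtr_ge0 ?expR_ge0.
have Hs xi eta : H xi eta = H eta xi.
  rewrite /H; congr (_ * expR (- (_ * _))); rewrite /dotv; apply: eq_bigr => i _.
  by rewrite !mxE; ring.
have e4 : 0 < (4 * e)^-1 by rewrite invr_gt0 mulr_gt0.
have HI xi : rintegrable (vmu d) (H xi) /\ \int[vmu d]_eta H xi eta = (2 * pi) ^+ d.
  have [i1 v1] := vgauss_shift xi e4.
  split; first exact: rintegrableZ.
  rewrite RintegralZl// v1 -exprMn; congr (_ ^+ _).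
  rewrite invrK -sqrtrM ?divr_ge0 ?pi_ge0 ?(ltW e0)//.
  rewrite (_ : pi / e * (pi * (4 * e)) = (2 * pi) ^+ 2); last by field; rewrite gt_eqF.
  by rewrite sqrtr_sqr ger0_norm// mulr_ge0// pi_ge0.
(* the weighted norm is the quadratic form of [v] for the kernel [H], and Schur's test applies *)
pose W x := cconj (ift x).
have mW : mcfun (W : vec d -> R[i]) by exact/mcfun_conj/mcfun_ift.
have mexp : mcfun (fun p : vec (R := R) d * vec (R := R) d => cexpi (dotv p.1 p.2)).
  by apply: mcfun_cexpi; exact: measurable_dotv.
have mexpN : mcfun (fun p : vec (R := R) d * vec (R := R) d => cexpi (- dotv p.1 p.2)).
  by apply: mcfun_cexpi; apply: measurable_funN; exact: measurable_dotv.
have mg1 : mcfun (fun p : vec (R := R) d * vec (R := R) d => (expR (- (e * dotv p.1 p.1)))%:C).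
  exact: (mcfun_comp (mcfun_real mg) (@measurable_fst _ _ _ _)).
have mv2 : mcfun (fun p : vec (R := R) d * vec (R := R) d => v p.2).
  exact: (mcfun_comp mv (@measurable_snd _ _ _ _)).
have E1 : (\int[vmu d]_x (expR (- (e * dotv x x)) * cmod (ift x) ^+ 2))%:C =
   cint (vmu d) (fun xi => v xi * cint (vmu d) (fun eta => (H xi eta)%:C * cconj (v eta))).
  transitivity (cint (vmu d) (fun x => cint (vmu d) (fun xi =>
      (expR (- (e * dotv x x)))%:C * W x * (cexpi (dotv x xi) * v xi)))).
    transitivity (cint (vmu d) (fun x => (expR (- (e * dotv x x)) * cmod (ift x) ^+ 2)%:C)).
      by rewrite cint_real.
    apply: eq_cint => x; rewrite cintZ; last exact: cintegrable_ift.
    by rewrite -/(ift x) -mulrA [W x * _]mulrC mul_conj rmorphM.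
  rewrite (@cint_swap_dom _ _ _ _ _ (vmu d) (vmu d) _
     (fun x => ift_bound * expR (- (e * dotv x x))) (fun xi => M * \prod_l cube1 rho (xi 0 l))); first last.
  - move=> x xi; rewrite 3!cmodM cmod_cexpi mul1r cmod_real ger0_norm ?expR_ge0// cmod_conj.
    rewrite [X in _ <= X * _]mulrC ler_pM ?mulr_ge0 ?expR_ge0 ?cmod_ge0//.
    by rewrite ler_wpM2l ?expR_ge0// cmod_ift.
  - exact: rintegrableZ.
  - exact: rintegrableZ.
  - apply: mcfunM.
      by apply: mcfunM => //; exact: (mcfun_comp mW (@measurable_fst _ _ _ _)).
    exact: mcfunM.
  apply: eq_cint => xi.
  transitivity (v xi * cint (vmu d) (fun x => cint (vmu d) (fun eta =>
     (expR (- (e * dotv x x)))%:C * cexpi (dotv x xi) * (cexpi (- dotv x eta) * cconj (v eta))))).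
    rewrite -cintZ; last first.
      apply: (cintegrable_le _ (rintegrableZ ift_bound ig)) => [|x].
        apply: mcfun_cint; apply: mcfunM.
          apply: mcfunM => //; apply: mcfun_cexpi.
          apply: measurable_dotv => //; exact: measurable_fst.
        by apply: mcfunM => //; exact: mcfun_conj.
      have -> : cint (vmu d) (fun eta =>
        (expR (- (e * dotv x x)))%:C * cexpi (dotv x xi) * (cexpi (- dotv x eta) * cconj (v eta))) =
        (expR (- (e * dotv x x)))%:C * cexpi (dotv x xi) * W x.
        rewrite /W /ift -cint_conj; last exact: cintegrable_ift.
        rewrite -cintZ; last first.
          have [h1 h2] := cintegrable_ift x; split => //=.
          have := rintegrableZ (-1) h2; apply: eq_rintegrable => y; rewrite mulN1r; exact: erefl.
        by apply: eq_cint => eta; rewrite cconjM cconj_cexpi.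
      rewrite 2!cmodM cmod_cexpi mulr1 cmod_real ger0_norm ?expR_ge0// cmod_conj mulrC.
      by rewrite ler_wpM2r ?expR_ge0// cmod_ift.
    apply: eq_cint => x.
    rewrite (_ : W x = cint (vmu d) (fun eta => cexpi (- dotv x eta) * cconj (v eta))); last first.
      rewrite /W /ift -cint_conj; last exact: cintegrable_ift.
      by apply: eq_cint => eta; rewrite cconjM cconj_cexpi.
    rewrite cintZ; first by ring.
    have [h1 h2] := cintegrable_ift x.
    have h3 : cintegrable (vmu d) (fun eta => cconj (cexpi (dotv x eta) * v eta)).
      split => //=; have := rintegrableZ (-1) h2; apply: eq_rintegrable => y.
      by rewrite mulN1r.
    by apply: eq_cintegrable h3 => eta; rewrite cconjM cconj_cexpi.
  congr (_ * _).
  rewrite (@cint_swap_dom _ _ _ _ _ (vmu d) (vmu d) _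
     (fun x => expR (- (e * dotv x x))) (fun xi => M * \prod_l cube1 rho (xi 0 l))); first last.
  - move=> x eta; rewrite 3!cmodM !cmod_cexpi mul1r mulr1 cmod_real ger0_norm ?expR_ge0// cmod_conj.
    by rewrite ler_wpM2l ?expR_ge0.
  - exact: rintegrableZ.
  - exact: ig.
  - apply: mcfunM.
      apply: mcfunM => //; apply: mcfun_cexpi.
      apply: measurable_dotv => //; exact: measurable_fst.
    by apply: mcfunM => //; exact: mcfun_conj.
  apply: eq_cint => eta.
  have ec : 0 < complex.Re (e%:C) by [].
  transitivity (cconj (v eta) * cint (vmu d) (fun x =>
     cexpi (dotv (xi - eta) x) * cexp (- (e%:C * (dotv x x)%:C)))).
    rewrite -cintZ; last exact: cintegrable_vgauss.
    apply: eq_cint => x; rewrite dotvBl cexpiD -rmorphM -rmorphN/= cexp_real.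
    by rewrite (dotvC xi x) (dotvC eta x); ring.
  rewrite vgaussFT// mulrC gauss_int_real// /H; congr (_ * _).
  rewrite rmorphM rmorphXn/=; congr (_ * _).
  rewrite (_ : _ / _ = ((4 * e)^-1 * dotv (eta - xi) (eta - xi))%:C); last first.
    rewrite rmorphM/= fmorphV/= rmorphM/= (rmorph_nat (real_complex R)) mulrC; congr (_ * _%:C).
    by rewrite /dotv; apply: eq_bigr => i _; rewrite !mxE; ring.
  by rewrite -rmorphN/= cexp_real.
have mH2 : measurable_fun [set: (vec (R := R) d * vec (R := R) d)%type] (fun p => H p.1 p.2).
  apply: measurable_funM => //; apply: measurableT_comp => //; apply: measurable_funN.
  apply: measurable_funM => //.
  have mB : measurable_fun [set: (vec (R := R) d * vec (R := R) d)%type]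
     (fun p => (p.2 : 'rV[R]_d) - p.1 : vec (R := R) d).
    by apply: measurable_vecB; [exact: measurable_snd|exact: measurable_fst].
  exact: measurable_dotv.
have HM xi eta : H xi eta <= Num.sqrt (pi / e) ^+ d.
  rewrite /H ler_piMr ?exprn_ge0 ?sqrtr_ge0// -[X in _ <= X]expR0 ler_expR oppr_le0.
  by rewrite mulr_ge0 ?(ltW e4)// dotv_ge0.
have := schur H0 Hs HM mH2 (fun xi => (HI xi).1) (fun xi => (HI xi).2).
rewrite -E1 cmod_real ger0_norm; first by [].
by apply: Rintegral_ge0 => x _; rewrite mulr_ge0 ?expR_ge0 ?sqr_ge0.
Qed.

Lemma bessel : (\int[vmu d]_x (cmod (ift x) ^+ 2)%:E <=
  ((2 * pi) ^+ d * \int[vmu d]_xi cmod (v xi) ^+ 2)%:E)%E.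
Proof.
apply: (@integral_weight_removal R _ (vec d) (vmu d) (fun x => dotv x x) (fun x => cmod (ift x) ^+ 2) _ 0).
- exact: measurable_dotv.
- by apply: measurable_funX; exact/measurable_cmod/mcfun_ift.
- by move=> x; exact: dotv_ge0.
- by move=> x; exact: sqr_ge0.
move=> n; rewrite mul0r addr0.
have e0 : (0 : R) < n.+1%:R^-1 ^+ 2 by rewrite exprn_gt0// invr_gt0 ltr0n.
have [i1 b1] := bessel_weight e0.
rewrite -lee_fin in b1; apply: le_trans b1; rewrite /Rintegral fineK//.
exact: integrable_fin_num.
Qed.

End Bessel.

Section Flip.
Context {R : realType} (d N : nat) (gamma : 'I_d.+1 -> 'M[R[i]]_N).

Lemma alpha_gflip l : alpha (gflip gamma) l = - alpha gamma l.
Proof. by rewrite /alpha /gflip/= mulNmx. Qed.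

Lemma aslash_gflip x : aslash (gflip gamma) x = - aslash gamma x.
Proof. by rewrite /aslash -sumrN; apply: eq_bigr => l _; rewrite alpha_gflip scalerN. Qed.

Lemma gflip0 : gflip gamma ord0 = - gamma ord0.
Proof. by []. Qed.

Lemma gbound_gflip : gbound (gflip gamma) = gbound gamma.
Proof.
rewrite /gbound; congr (_ + _); apply: eq_bigr => i _; apply: eq_bigr => j _; congr (_ + _).
  by apply: eq_bigr => l _; rewrite alpha_gflip mxE cmodN.
by rewrite gflip0 mxE cmodN.
Qed.

Lemma kernel_const_gflip : kernel_const (gflip gamma) = kernel_const gamma.
Proof. by rewrite /kernel_const gbound_gflip. Qed.

End Flip.

(** * Damping on the Fourier support *)

Section Binomial.
Context {R : realType} (d N : nat) (gamma : 'I_d.+1 -> 'M[R[i]]_N) (m : R).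
Variables (f : 'rV[R]_d -> 'cV[R[i]]_N) (rho : R).
Hypotheses (f1 : in_L1 f) (fsupp : fourier_supp_ball f rho) (rho1 : 1 <= rho) (m1 : `|m| <= 1).
Hypothesis d1 : (1 < d)%N.
Let rho0 : 0 <= rho := le_trans ler01 rho1.

Lemma mult_sum n (c : 'I_n -> R[i]) (a : 'I_n -> 'rV[R]_d -> R[i]) x :
  (forall j, mcfun (a j : vec d -> R[i])) -> (forall j xi, cmod (a j xi) <= 1) ->
  mult gamma m (fun xi => \sum_j c j * a j xi) f x = \sum_j c j *: mult gamma m (a j) f x.
Proof.
elim: n c a => [|n IH] c a ma a1.
  rewrite big_ord0; apply/colP => i; rewrite mxE [RHS]mxE.
  have h : cintegrable (vmu d) (fun xi => cexpi (dotv x xi) * (0 * (dproj gamma m xi *m fourier f xi) i 0)).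
    have [] := @cintegrable_mult R d N gamma m f rho f1 fsupp rho0 (fun=> 0) 0 x i (mcfun_cst _ _) => // xi _.
    by rewrite cmod0.
  rewrite (_ : cint _ _ = cint (vmu d) (fun xi => 0 * (cexpi (dotv x xi) * (0 * (dproj gamma m xi *m fourier f xi) i 0)))).
    by rewrite cintZ// mul0r mulr0.
  by apply: eq_cint => xi; rewrite big_ord0; ring.
rewrite big_ord_recl -(IH (fun j => c (lift ord0 j)) (fun j => a (lift ord0 j)))//.
rewrite -(@multZ R d N gamma m f rho f1 fsupp rho0 _ 1)//.
rewrite -(@multD R d N gamma m f rho f1 fsupp rho0 _ _ (cmod (c ord0)) (\sum_(j < n) cmod (c (lift ord0 j)))).
- by apply: (mult_eq _ _ fsupp) => xi _; rewrite big_ord_recl.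
- by apply: mcfunM => //; exact: mcfun_cst.
- by apply: mcfun_sum => j; apply: mcfunM => //; exact: mcfun_cst.
- by move=> xi _; rewrite cmodM ler_piMr ?cmod_ge0.
- move=> xi _; apply: le_trans (cmod_sum _ _ _) _; apply: ler_sum => j _.
  by rewrite cmodM ler_piMr ?cmod_ge0.
Qed.

Lemma om_le (xi : 'rV[R]_d) : eucl xi <= rho -> om m xi <= 2 * rho.
Proof.
move=> xr; rewrite -[leRHS]ger0_norm ?mulr_ge0// -sqrtr_sqr ler_wsqrtr//.
have h : dotv xi xi <= rho ^+ 2.
  rewrite -(sqr_sqrtr (dotv_ge0 xi)); apply: lerXn2r; rewrite ?nnegrE ?sqrtr_ge0//.
have h2 : m ^+ 2 <= 1 by rewrite -real_normK ?num_real// exprn_ile1.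
have h3 : 1 <= rho ^+ 2 by rewrite exprn_ege1.
by rewrite exprMn; lra.
Qed.

(** Small only on the Fourier support, where [eps * om] is at most [2 * eps * rho]. *)
Definition binom_rest (eps s : R) n (xi : 'rV[R]_d) : R[i] :=
  phase m (- s) xi * ((1 - expR (- (eps * om m xi))) ^+ n)%:C.

Lemma mcfun_binom_rest eps s n : mcfun (binom_rest eps s n : vec d -> R[i]).
Proof.
apply: mcfunM; first exact: mcfun_phase.
apply: mcfun_real; apply: measurable_funX; apply: measurable_funB => //.
apply: measurableT_comp => //; apply: measurable_funN; apply: measurable_funM => //.
exact: measurable_om.
Qed.

Lemma cmod_binom_rest eps s n xi : 0 < eps -> eucl xi <= rho ->
  cmod (binom_rest eps s n xi) <= (2 * (eps * rho)) ^+ n.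
Proof.
move=> e0 xr; rewrite cmodM cmod_phase mul1r cmod_real normrX; apply: lerXn2r.
- by rewrite nnegrE.
- by rewrite nnegrE !mulr_ge0// ltW.
have eo : 0 <= eps * om m xi by rewrite mulr_ge0 ?om_ge0// ltW.
rewrite ger0_norm; last by rewrite subr_ge0 -[X in _ <= X]expR0 ler_expR oppr_le0.
have := expR_ge1Dx (- (eps * om m xi)); have := om_le xr.
by move=> h1; have := ler_wpM2l (ltW e0) h1; lra.
Qed.

Definition damp_time (eps s : R) (j : nat) : R[i] := (j.+1%:R * eps) +i* s.

Lemma Re_damp_time eps s j : complex.Re (damp_time eps s j) = j.+1%:R * eps. Proof. by []. Qed.
Lemma Im_damp_time eps s j : complex.Im (damp_time eps s j) = s. Proof. by []. Qed.

Lemma mult_binomial eps s n x : 0 < eps ->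
  mult gamma m (phase m (- s)) f x =
  \sum_(j < n) ((-1) ^+ j * 'C(n, j.+1)%:R) *: mult gamma m (damp m (damp_time eps s j)) f x +
  mult gamma m (binom_rest eps s n) f x.
Proof.
move=> e0.
have dm j (xi : 'rV[R]_d) : cmod (damp m (damp_time eps s j) xi) <= 1.
  by apply: cmod_damp_le1; rewrite /= mulr_gt0.
rewrite -mult_sum; [|by move=> j; exact: mcfun_damp|by move=> j xi; exact: dm].
rewrite -(@multD R d N gamma m f rho f1 fsupp rho0 _ _
   (\sum_(j < n) cmod ((-1) ^+ j * 'C(n, j.+1)%:R : R[i])) ((2 * (eps * rho)) ^+ n)).
- apply: (mult_eq _ _ fsupp) => xi _.
  set q := expR (- (eps * om m xi)).
  have dE j : damp m (damp_time eps s j) xi = phase m (- s) xi * (q ^+ j.+1)%:C.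
    rewrite /damp cexpE Re_opp Im_opp Re_mul Im_mul Re_damp_time Im_damp_time Re_real Im_real.
    rewrite !mulr0 subr0 add0r mulrC.
    congr (_ * _%:C); last by rewrite /q -expRM_natl; congr expR; ring.
    by rewrite /phase mulNr.
  under eq_bigr do rewrite dE.
  rewrite /binom_rest -/q.
  (* The binomial theorem with the constant term split off: it expresses [1] by powers [q ^+ j.+1],
     each a damping by [j.+1 * eps], and the error [(1 - q) ^+ n]. *)
  have -> : (1 - q) ^+ n = 1 + \sum_(j < n) (-1) ^+ j.+1 * 'C(n, j.+1)%:R * q ^+ j.+1.
    rewrite addrC exprD1n big_ord_recl/= expr0 bin0 mulr1n; congr (_ + _).
    apply: eq_bigr => j _; by rewrite /bump/= add1n -[LHS]mulr_natr [(- q) ^+ _]exprNn mulrAC.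
  rewrite rmorphD/= rmorph1 rmorph_sum/= mulrDr mulr1 addrCA -[LHS]addr0; congr (_ + _).
  rewrite mulr_sumr -big_split/= big1// => j _.
  rewrite !rmorphM/= !rmorphXn/= rmorphN1 (rmorph_nat (real_complex R)).
  by rewrite !exprS; ring.
- by apply: mcfun_sum => j; apply: mcfunM; [exact: mcfun_cst|exact: mcfun_damp].
- exact: mcfun_binom_rest.
- move=> xi _; apply: le_trans (cmod_sum _ _ _) _; apply: ler_sum => j _.
  by rewrite cmodM ler_piMr ?cmod_ge0.
- by move=> xi xr; exact: cmod_binom_rest.
Qed.

Lemma sum_bin_le n : \sum_(j < n) ('C(n, j.+1)%:R : R) <= 2 ^+ n.
Proof.
have -> : (2 : R) = 1 + 1 by [].
rewrite exprD1n big_ord_recl/= bin0 expr1n mulr1n.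
rewrite -[leLHS]add0r lerD//; apply: ler_sum => j _.
by rewrite expr1n /bump/= add1n.
Qed.

Lemma cmod_bin n j : cmod ((-1) ^+ j * 'C(n, j.+1)%:R : R[i]) = 'C(n, j.+1)%:R.
Proof.
rewrite cmodM cmodX cmodN cmod1 expr1n mul1r (_ : _%:R = ('C(n, j.+1)%:R : R)%:C).
  by rewrite cmod_real ger0_norm.
by rewrite (rmorph_nat (real_complex R)).
Qed.

Definition sdecay (eps s : R) : R := Num.sqrt (pi / `|s|) ^+ d.-1 * (2 / Num.sqrt eps) ^+ d.+1.

Lemma sdecay_ge0 eps s : 0 <= sdecay eps s.
Proof. by rewrite mulr_ge0 ?exprn_ge0 ?divr_ge0 ?sqrtr_ge0. Qed.

(** The binomial coefficients sum to at most [2 ^+ n], and each damped term has damping at least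
    [eps] and imaginary part [s], so a single dispersive bound serves all of them. *)
Lemma sup_mult eps s n x i : 0 < eps -> eps <= 1 -> s != 0 ->
  cmod (mult gamma m (phase m (- s)) f x i 0) <=
  2 ^+ n * (N%:R * (kernel_const gamma * sdecay eps s) * nL1 f) +
  multbound gamma f rho ((2 * (eps * rho)) ^+ n).
Proof.
move=> e0 e1 s0; rewrite (mult_binomial _ n _ e0) mxE.
apply: le_trans (cmodD _ _) _; apply: lerD; last first.
  apply: (cmod_mult gamma m f1 fsupp rho0); first exact: mcfun_binom_rest.
  by move=> xi xr; exact: cmod_binom_rest.
rewrite summxE; apply: le_trans (cmod_sum _ _ _) _.
apply: (@le_trans _ _ (\sum_(j < n) 'C(n, j.+1)%:R * (N%:R * (kernel_const gamma * sdecay eps s) * nL1 f))); last first.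
  rewrite -mulr_suml ler_wpM2r ?sum_bin_le//.
  apply: mulr_ge0; last exact: nL1_ge0.
  by apply: mulr_ge0 => //; apply: mulr_ge0; [exact: kernel_const_ge0|exact: sdecay_ge0].
apply: ler_sum => j _; rewrite mxE cmodM cmod_bin ler_wpM2l//.
have ez : eps <= complex.Re (damp_time eps s j) by rewrite /= ler_peMl ?(ltW e0)// ler1n.
apply: le_trans (cmod_mult_damp gamma e0 e1 ez m1 d1 _ _ f1) _.
rewrite ler_wpM2r ?nL1_ge0// ler_wpM2l// ler_wpM2l ?kernel_const_ge0//.
rewrite /decay /sdecay ler_wpM2r ?exprn_ge0 ?divr_ge0 ?sqrtr_ge0//.
apply: lerXn2r; rewrite ?nnegrE ?sqrtr_ge0// ler_wsqrtr// ler_wpM2l ?pi_ge0//.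
have cz : `|s| <= cmod (damp_time eps s j) by exact: (ler_Im_cmod (damp_time eps s j)).
by rewrite lef_pV2 ?posrE ?normr_gt0// (lt_le_trans _ cz)// normr_gt0.
Qed.

End Binomial.

(** * L2 bounds for the half-waves *)

Section L2.
Context {R : realType} (d N : nat) (gamma : 'I_d.+1 -> 'M[R[i]]_N) (m : R).
Variables (f : 'rV[R]_d -> 'cV[R[i]]_N) (rho : R).
Hypotheses (f1 : in_L1 f) (fsupp : fourier_supp_ball f rho) (rho0 : 0 <= rho).

Definition mult_L2_bound : R := (2 * pi) ^- d * ((N%:R * gbound gamma * nL1 f) ^+ 2 * (2 * rho) ^+ d).

Lemma multE (a : 'rV[R]_d -> R[i]) x i : mult gamma m a f x i 0 =
  ((2 * pi) ^- d)%:C * ift (fun xi => a xi * (dproj gamma m xi *m fourier f xi) i 0) x.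
Proof. by rewrite mxE. Qed.

(** Bessel's inequality: the spectrum is bounded by a multiple of [nL1 f] and lives in a cube of
    volume [(2 * rho) ^+ d]. *)
Lemma L2_mult (a : 'rV[R]_d -> R[i]) i : mcfun (a : vec d -> R[i]) ->
  (forall xi, cmod (a xi) <= 1) ->
  (\int[vmu d]_x (cmod (mult gamma m a f x i 0) ^+ 2)%:E <= mult_L2_bound%:E)%E.
Proof.
move=> ma a1.
set v := fun xi => a xi * (dproj gamma m xi *m fourier f xi) i 0.
set M := N%:R * gbound gamma * nL1 f.
have mv : mcfun (v : vec d -> R[i]) by apply: mcfunM => //; exact: mcfun_projfourier.
have vM xi : cmod (v xi) <= M * \prod_l cube1 rho (xi 0 l).
  have := cmod_projfourier gamma m f1 fsupp xi i; apply: le_trans.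
  by rewrite /v cmodM ler_piMl ?cmod_ge0.
have p0 : 0 <= (2 * pi : R) ^- d by rewrite invr_ge0 exprn_ge0// mulr_ge0// pi_ge0.
rewrite (eq_integral (fun x : vec d => (((2 * pi) ^- d) ^+ 2)%:E * (cmod (ift v x) ^+ 2)%:E)%E); last first.
  by move=> x _; rewrite multE cmodM cmod_real ger0_norm// exprMn EFinM.
rewrite ge0_integralZl//; first last.
- by rewrite lee_fin sqr_ge0.
- by move=> x _; rewrite lee_fin sqr_ge0.
- by apply/measurable_EFinP; apply: measurable_funX; exact/measurable_cmod/mcfun_ift.
have := bessel mv vM; move=> h.
apply: (@le_trans _ _ ((((2 * pi) ^- d) ^+ 2)%:E * ((2 * pi) ^+ d * \int[vmu d]_xi cmod (v xi) ^+ 2)%:E)%E).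
  by apply: lee_wpmul2l => //; rewrite lee_fin sqr_ge0.
rewrite -EFinM lee_fin mulrA expr2 -(mulrA _ _ ((2 * pi) ^+ d)) mulVf; last first.
  by rewrite gt_eqF// exprn_gt0// mulr_gt0// pi_gt0.
rewrite mulr1 /mult_L2_bound ler_wpM2l//.
have [ic /(_ rho0) vc] := @rintegrable_cube R d rho.
rewrite -vc -RintegralZl//; apply: le_Rintegral => //.
- exact: (rintegrable_v2 mv vM).
- exact: rintegrableZ.
move=> xi _.
have /(lerXn2r 2) := vM xi.
rewrite !nnegrE cmod_ge0 (le_trans (cmod_ge0 _) (vM xi)) => /(_ isT isT) h'.
apply: le_trans h' _; rewrite exprMn ler_wpM2l ?sqr_ge0//.
rewrite -prodrXl le_eqVlt; apply/orP; left; apply/eqP; apply: eq_bigr => l _.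
by rewrite /cube1 indicE; case: (_ \in _); rewrite ?expr0n ?expr1n.
Qed.

Lemma mcfun_mult (a : 'rV[R]_d -> R[i]) i : mcfun (a : vec d -> R[i]) ->
  mcfun (fun x : vec d => mult gamma m a f x i 0).
Proof.
move=> ma; under eq_fun do rewrite multE.
apply: mcfunM; first exact: mcfun_cst.
by apply: mcfun_ift; apply: mcfunM => //; exact: mcfun_projfourier.
Qed.

End L2.

Section CintTools.
Context {R : realType}.

Lemma Rintegral_reflect (f : R -> R) (b : R) : rintegrable leb f ->
  rintegrable leb (fun s => f (b - s)) /\ \int[leb]_s f (b - s) = \int[leb]_s f s.
Proof.
move=> fi; have mf := rintegrable_measurable fi.
have mr : measurable_fun [set: measurableTypeR R] (fun s : R => b - s : measurableTypeR R).
  exact: measurable_funB.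
have E (g : R -> \bar R) : measurable_fun [set: measurableTypeR R] g -> (forall x, 0 <= g x)%E ->
    (\int[leb]_s g (b - s)%R = \int[leb]_s g s)%E.
  move=> mg g0; rewrite -(ge0_integral_opp mg)// -(@ge0_integral_shift _ (fun s => g (- s)%R) (- b)).
  - by apply: eq_integral => s _; rewrite opprB.
  - apply: (measurableT_comp mg); exact: (@measurable_funN _ (measurableTypeR R) R setT idfun (@measurable_id _ _ setT)).
  - by move=> s.
split.
  apply/integrableP; split.
    by apply/measurable_EFinP; exact: (measurableT_comp mf mr).
  case/integrableP: fi => _; apply: le_lt_trans.
  rewrite -(E (fun s => `|(EFin \o f) s|)%E)//.
  by apply: measurableT_comp => //; exact/measurable_EFinP.
rewrite /Rintegral; congr fine; rewrite integralE [RHS]integralE.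
have mE : measurable_fun [set: measurableTypeR R] (EFin \o f) by exact/measurable_EFinP.
congr (_ - _)%E.
  transitivity (\int[leb]_s (EFin \o f)^\+ (b - s)%R)%E.
    by apply: eq_integral => s _; rewrite !funeposE.
  by rewrite (E (EFin \o f)^\+%E) => //; exact: measurable_funepos.
transitivity (\int[leb]_s (EFin \o f)^\- (b - s)%R)%E.
  by apply: eq_integral => s _; rewrite !funenegE.
by rewrite (E (EFin \o f)^\-%E) => //; exact: measurable_funeneg.
Qed.

Lemma cint_reflect (f : R -> R[i]) (b : R) : cintegrable leb f ->
  cintegrable leb (fun s => f (b - s)) /\ cint leb (fun s => f (b - s)) = cint leb f.
Proof.
move=> [f1 f2]; have [a1 b1] := Rintegral_reflect b f1; have [a2 b2] := Rintegral_reflect b f2.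
by split; [split|apply: complex_eq].
Qed.

Lemma cder_cint d (T : measurableType d) (mu : {measure set T -> \bar R}) (f df : R -> T -> R[i])
    (G : T -> R) (a : R) : (forall x, cintegrable mu (f x)) ->
  (forall x y, cder (f^~ y) x (df x y)) -> rintegrable mu G ->
  (forall x y, cmod (df x y) <= G y) ->
  cder (fun x => cint mu (f x)) a (cint mu (df a)).
Proof.
move=> fi fd Gi dG; split => /=.
  apply: (@is_derive_Rintegral _ _ _ mu (fun t x => complex.Re (f t x))
    (fun t x => complex.Re (df t x)) G) => //.
  - by move=> t; case: (fi t).
  - by move=> t x; case: (fd t x).
  - by move=> t x; exact: le_trans (ler_Re_cmod _) (dG t x).
apply: (@is_derive_Rintegral _ _ _ mu (fun t x => complex.Im (f t x))
  (fun t x => complex.Im (df t x)) G) => //.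
- by move=> t; case: (fi t).
- by move=> t x; case: (fd t x).
- by move=> t x; exact: le_trans (ler_Im_cmod _) (dG t x).
Qed.

Lemma Rintegral_dominated d (T : measurableType d) (mu : {measure set T -> \bar R})
    (f_ : nat -> T -> R) (f G : T -> R) : (forall n, measurable_fun [set: T] (f_ n)) ->
  (forall x, f_ ^~ x @ \oo --> f x) -> rintegrable mu G -> (forall n x, `|f_ n x| <= G x) ->
  (fun n => \int[mu]_x f_ n x) @ \oo --> \int[mu]_x f x.
Proof.
move=> mf cf iG fG.
have mff : measurable_fun [set: T] f by apply: (measurable_fun_cvg mf) => x _; exact: cf.
have [|||fi _ h] := @dominated_convergence _ _ _ mu _ measurableT (fun n => EFin \o f_ n) (EFin \o f)
    (EFin \o G) (fun n => proj2 (@measurable_EFinP _ _ _ _ _) (mf n)) _ _ iG _.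
- exact/measurable_EFinP.
- by apply: aeW => x _; apply: cvg_EFin; [exact: nearW|exact: cf].
- by apply: aeW => x n _; rewrite lee_fin.
by apply: fine_cvg; rewrite fineK//; exact: integrable_fin_num.
Qed.

Lemma cint_dominated_cst d (T : measurableType d) (mu : {measure set T -> \bar R})
    (f_ : nat -> T -> R[i]) (f : T -> R[i]) (G : T -> R) (c : R[i]) : (forall n, mcfun (f_ n)) ->
  (forall x, (fun n => complex.Re (f_ n x)) @ \oo --> complex.Re (f x)) ->
  (forall x, (fun n => complex.Im (f_ n x)) @ \oo --> complex.Im (f x)) ->
  rintegrable mu G -> (forall n x, cmod (f_ n x) <= G x) -> (forall n, cint mu (f_ n) = c) ->
  cint mu f = c.
Proof.
move=> mf c1 c2 iG fG fc.
have h1 := @Rintegral_dominated _ _ mu (fun n x => complex.Re (f_ n x)) _ G (fun n => (mf n).1) c1 iG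
  (fun n x => le_trans (ler_Re_cmod _) (fG n x)).
have h2 := @Rintegral_dominated _ _ mu (fun n x => complex.Im (f_ n x)) _ G (fun n => (mf n).2) c2 iG
  (fun n x => le_trans (ler_Im_cmod _) (fG n x)).
have e1 : (fun n => \int[mu]_x complex.Re (f_ n x)) = fun=> complex.Re c.
  by apply/funext => n; rewrite -(fc n).
have e2 : (fun n => \int[mu]_x complex.Im (f_ n x)) = fun=> complex.Im c.
  by apply/funext => n; rewrite -(fc n).
rewrite e1 in h1; rewrite e2 in h2.
apply: complex_eq => /=.
  by rewrite -(cvg_lim (@Rhausdorff R) h1) lim_cst.
by rewrite -(cvg_lim (@Rhausdorff R) h2) lim_cst.
Qed.

End CintTools.

(** * The null structure in dimension two *)

Section ClosedForm.
Context {R : realType}.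
Implicit Types A z w : R[i].

Definition PhiI A z (tau s : R) : R[i] :=
  (expR s)%:C * cexp (- (A * (expR s ^+ 2)%:C + z * (expR tau ^+ 2 * expR (- s) ^+ 2)%:C)).
(** [Qint] of index zero at mass [expR tau]. In terms of the logarithm of the mass, reflecting [s]
    into [tau - s] exchanges [A] and [z]. *)
Definition Phi A z tau := cint leb (PhiI A z tau).

Lemma mcfun_PhiI A z tau : mcfun (PhiI A z tau : measurableTypeR R -> R[i]).
Proof. by have := mcfun_Q (expR tau) z A 1; under eq_fun do rewrite expr1. Qed.

Lemma cmod_PhiI A z tau s : 0 < complex.Re z ->
  cmod (PhiI A z tau s) <= expR s ^+ 1 * expR (- (complex.Re A * expR s ^+ 2)).
Proof. by move=> z0; have := cmod_Q (expR tau) z0 A 1 s; rewrite expr1. Qed.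

Lemma cintegrable_PhiI A z tau : 0 < complex.Re A -> 0 < complex.Re z -> cintegrable leb (PhiI A z tau).
Proof.
move=> A0 z0; have [i1 _] := exp_moment 0 A0.
by apply: (cintegrable_le (mcfun_PhiI A z tau) i1) => s; exact: cmod_PhiI.
Qed.

Definition PhiB A := \int[leb]_s (expR s ^+ 1 * expR (- (complex.Re A * expR s ^+ 2))).

Lemma cmod_Phi A z tau : 0 < complex.Re A -> 0 < complex.Re z -> cmod (Phi A z tau) <= PhiB A.
Proof.
move=> A0 z0; have [i1 _] := exp_moment 0 A0.
by apply: (le_cmod_cint_dom (mcfun_PhiI A z tau) i1) => s; exact: cmod_PhiI.
Qed.

Lemma PhiI_reflect A z tau s :
  (expR tau)%:C * PhiI z A tau (tau - s) =
  (expR tau ^+ 2 * expR (- s) ^+ 2)%:C * PhiI A z tau s.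
Proof.
have e1 : expR (tau - s) = expR tau * expR (- s) by rewrite expRD.
have e2 : expR tau * expR (- (tau - s)) = expR s by rewrite -expRD opprB addrC subrK.
rewrite /PhiI (_ : expR tau ^+ 2 * expR (- (tau - s)) ^+ 2 = expR s ^+ 2); last first.
  by rewrite -exprMn e2.
have -> : z * (expR (tau - s) ^+ 2)%:C + A * (expR s ^+ 2)%:C =
    A * (expR s ^+ 2)%:C + z * (expR tau ^+ 2 * expR (- s) ^+ 2)%:C.
  by rewrite addrC e1 exprMn.
rewrite !mulrA -!rmorphM/= e1; congr (_%:C * _).
have : expR (- s) * expR s = 1 by rewrite -expRD addNr expR0.
move: (expR (- s)) (expR s) (expR tau) => a b c h.
transitivity (c ^+ 2 * a * (a * b)); first by rewrite h; ring.
by ring.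
Qed.

Lemma xexpN (e y : R) : 0 < e -> 0 <= y -> y * expR (- (e * y)) <= e^-1.
Proof.
move=> e0 y0; rewrite expRN ler_pdivrMr ?expR_gt0// ler_pdivlMl//.
by apply: le_trans (expR_ge1Dx _); rewrite lerDr.
Qed.

(** Differentiation brings down [expR tau ^+ 2 * expR (- s) ^+ 2], and by [PhiI_reflect] the result
    is the same integral with [A] and [z] exchanged. *)
Lemma cder_Phi A z tau : 0 < complex.Re A -> 0 < complex.Re z ->
  cder (Phi A z) tau (- (2 * z * (expR tau)%:C) * Phi z A tau).
Proof.
move=> A0 z0; have [i1 _] := exp_moment 0 A0.
have e2 (t : R) : is_derive t (1 : R) (fun t => expR t ^+ 2) (2 * expR t ^+ 2).
  by apply: is_derive_eq; rewrite /GRing.scale/=; ring.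
have dd t s : cder (fun t => PhiI A z t s) t
    (- (2 * z) * ((expR t ^+ 2 * expR (- s) ^+ 2)%:C * PhiI A z t s)).
  have h1 : cder (fun t => (expR t ^+ 2)%:C) t ((2 * expR t ^+ 2)%:C) by exact: cder_real.
  have h2 : cder (fun t => - (A * (expR s ^+ 2)%:C + z * (expR t ^+ 2 * expR (- s) ^+ 2)%:C)) t
     (- (2 * z * (expR t ^+ 2 * expR (- s) ^+ 2)%:C)).
    apply: cder_eq (cderD (cder_cst (- (A * (expR s ^+ 2)%:C)) t)
      (cderZ (- z * (expR (- s) ^+ 2)%:C) h1)) _ _ => [u|].
      by rewrite !rmorphM/=; ring.
    by rewrite !rmorphM/= (rmorph_nat (real_complex R)); ring.
  apply: cder_eq (cderZ ((expR s)%:C) (cder_cexp h2)) _ _ => //.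
  by rewrite /PhiI; move: (cexp _) => E; ring.
have := @cder_cint _ _ (measurableTypeR R) leb (PhiI A z) (fun t s => - (2 * z) * ((expR t ^+ 2 * expR (- s) ^+ 2)%:C * PhiI A z t s))
   (fun s => cmod (2 * z) * (complex.Re z)^-1 * (expR s ^+ 1 * expR (- (complex.Re A * expR s ^+ 2)))) tau.
move=> h; apply: (cder_eq (h _ _ _ _)) => //.
- by move=> t; exact: cintegrable_PhiI.
- by apply: rintegrableZ; exact: i1.
- move=> t s; rewrite [X in X <= _]cmodM cmodN -[X in _ <= X]mulrA ler_wpM2l ?cmod_ge0//.
  rewrite cmodM cmod_real ger0_norm ?mulr_ge0 ?sqr_ge0//.
  set y := expR t ^+ 2 * expR (- s) ^+ 2.
  have y0 : 0 <= y by rewrite mulr_ge0 ?sqr_ge0.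
  rewrite /PhiI -/y cmodM cmod_real ger0_norm ?expR_ge0// cmod_cexp !ReImE/= !mulr0 !subr0.
  rewrite opprD expRD expr1.
  have := xexpN z0 y0.
  have b0 : 0 <= expR s * expR (- (complex.Re A * expR s ^+ 2)) by rewrite mulr_ge0 ?expR_ge0.
  move=> /(ler_wpM2l b0).
  by move=> slice_int; lra.
have [ir hr] := cint_reflect tau (cintegrable_PhiI tau z0 A0).
transitivity (- (2 * z) * ((expR tau)%:C * cint leb (fun s => PhiI z A tau (tau - s)))); last first.
  by rewrite hr -/(Phi z A tau); ring.
rewrite -(cintZ _ ir) -(cintZ _ (cintegrableZ _ ir)).
by apply: eq_cint => s; rewrite -PhiI_reflect.
Qed.

Lemma cder_expR (t : R) : cder (fun t => (expR t)%:C : R[i]) t ((expR t)%:C).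
Proof. by apply: cder_real; apply: is_derive_eq; rewrite /GRing.scale/= mul1r. Qed.

(** The massless limit: [cs1] at [om = 0] for the parameter [4 * A]. *)
Lemma Phi_inf A : 0 < complex.Re A -> cint leb (fun s => (expR s)%:C * cexp (- (A * (expR s ^+ 2)%:C))) = gauss_int A / 2.
Proof.
move=> A0; have A4 : 0 < complex.Re (A * (2 ^+ 2 : R)%:C).
  by rewrite !ReImE/= mulr0 subr0 mulr_gt0// exprn_gt0.
have [_ h] := cs1 A4 (lexx 0).
rewrite mulr0 oppr0 cexp0 mulr1 gauss_int_scale// in h.
rewrite (fmorphV (real_complex R)) (rmorph_nat (real_complex R)) in h.
rewrite -h; apply: eq_cint => s; congr (_ * _).
rewrite /csE expr0n/= mul0r addr0; congr (cexp (- _)).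
rewrite -[LHS]mulr1 -!mulrA; congr (_ * _); rewrite mulr1 -rmorphM/=; congr (_%:C); by field.
Qed.

Section ode.
Variables (A z w : R[i]).
Hypotheses (A0 : 0 < complex.Re A) (z0 : 0 < complex.Re z) (w0 : 0 < complex.Re w).
Hypothesis wE : w ^+ 2 = 4 * A * z.

(** The difference [W] of the two sides solves [W' = w e^tau W], so it is a multiple of
    [exp (w e^tau)]. As [W] is bounded and [Re w > 0], the multiple is zero. *)
Lemma Phi_swap tau : w * Phi A z tau = 2 * z * Phi z A tau.
Proof.
pose W t := w * Phi A z t - 2 * z * Phi z A t.
have dW t : cder W t (w * (expR t)%:C * W t).
  have h1 := cderZ w (cder_Phi t A0 z0).
  have h2 := cderZ (- (2 * z)) (cder_Phi t z0 A0).
  apply: cder_eq (cderD h1 h2) _ _ => [u|]; first by rewrite /W; ring.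
  rewrite /W; move: (Phi A z t) (Phi z A t) ((expR t)%:C) => p q e.
  transitivity (e * (w ^+ 2 * p - 2 * z * w * q)); first by rewrite wE; ring.
  by ring.
have dE t : cder (fun t => cexp (- (w * (expR t)%:C))) t (- (w * (expR t)%:C) * cexp (- (w * (expR t)%:C))).
  apply: cder_cexp; apply: cder_eq (cderZ (- w) (cder_expR t)) _ _ => [u|]; ring.
have cst := @cder0_cst R (fun t => cexp (- (w * (expR t)%:C)) * W t).
have {}cst x y : cexp (- (w * (expR x)%:C)) * W x = cexp (- (w * (expR y)%:C)) * W y.
  apply: cst => t; apply: cder_eq (cderM (dE t) (dW t)) _ _ => //; ring.
pose B := cmod w * PhiB A + cmod (2 * z) * PhiB z.
have WB t : cmod (W t) <= B.
  apply: le_trans (cmodD _ _) _; rewrite cmodN; apply: lerD.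
    by rewrite cmodM ler_wpM2l ?cmod_ge0// cmod_Phi.
  by rewrite cmodM ler_wpM2l ?cmod_ge0// cmod_Phi.
have B0 : 0 <= B := le_trans (cmod_ge0 _) (WB 0).
suff : cexp (- (w * (expR tau)%:C)) * W tau = 0.
  by move/eqP; rewrite mulf_eq0 (negbTE (cexp_neq0 _))/= subr_eq0 => /eqP.
apply/eqP; rewrite -cmod_eq0 -[_ == 0]negbK cmod_eq0 -cmod_gt0; apply/negP => c0.
set c := cmod _ in c0.
(* Here [Re w * expR x = (B + 1) / c], so boundedness would give [c <= B * expR (- ((B + 1) / c))],
   which contradicts [y <= expR y]. *)
pose x := ln ((B + 1) / (complex.Re w * c)).
have pos : 0 < (B + 1) / (complex.Re w * c).
  by rewrite divr_gt0 ?mulr_gt0// ltr_wpDl.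
have Ex : expR x = (B + 1) / (complex.Re w * c) by rewrite lnK ?posrE.
have : c <= B * expR (- (complex.Re w * expR x)).
  rewrite /c (cst tau x) cmodM cmod_cexp !ReImE/= mulr0 subr0 mulrC.
  by rewrite ler_wpM2r ?expR_ge0.
rewrite leNgt => /negP; apply.
rewrite expRN ltr_pdivrMr ?expR_gt0//.
apply: (@lt_le_trans _ _ (c * (complex.Re w * expR x))).
  rewrite Ex; have -> : c * (complex.Re w * ((B + 1) / (complex.Re w * c))) = B + 1.
    by field; rewrite !gt_eqF.
  by rewrite ltrDl.
rewrite ler_wpM2l ?(ltW c0)//.
by apply: le_trans (expR_ge1Dx _); rewrite lerDr.
Qed.

Lemma cder_Phi' tau : cder (Phi A z) tau (- (w * (expR tau)%:C) * Phi A z tau).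
Proof.
apply: cder_eq (cder_Phi tau A0 z0) _ _ => //.
transitivity (- (expR tau)%:C * (2 * z * Phi z A tau)); first by ring.
by rewrite -Phi_swap; ring.
Qed.

(** By [Phi_swap] the derivative of [Phi] is a multiple of [Phi] itself, which determines it up to a
    constant; the constant is found in the massless limit. *)
Lemma PhiE tau : Phi A z tau = gauss_int A / 2 * cexp (- (w * (expR tau)%:C)).
Proof.
pose c t := cexp (w * (expR t)%:C) * Phi A z t.
have dE t : cder (fun t => cexp (w * (expR t)%:C)) t (w * (expR t)%:C * cexp (w * (expR t)%:C)).
  by apply: cder_cexp; exact: (cderZ w (cder_expR t)).
have cst x y : c x = c y.
  apply: (@cder0_cst R c) => t; apply: cder_eq (cderM (dE t) (cder_Phi' t)) _ _ => //; ring.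
have [i1 _] := exp_moment 0 A0.
have key : cint leb (fun s => (expR s)%:C * cexp (- (A * (expR s ^+ 2)%:C))) = c tau.
  (* Masses tending to zero. The factor [cexp (w * v)] is put into [f], so that the integrals of all
     [f (u n)] have the same value [c tau]. *)
  pose u n : R := harmonic n.
  have u0 n : 0 < u n by exact: harmonic_gt0.
  have u1 n : u n <= 1 by rewrite /u/= invf_le1 ?ltr0n// ler1n.
  pose f (v s : R) := (expR s)%:C * cexp (- (A * (expR s ^+ 2)%:C) + (w * v%:C - z * (expR (- s) ^+ 2)%:C * (v ^+ 2)%:C)).
  have df s v : exists l, cder (fun v => f v s) v l.
    have h1 : cder (fun v : R => v%:C) v 1 by apply: cder_real; exact: is_derive_id.
    have h2 := cderM h1 h1.
    eexists; apply: cderZ; apply: cder_cexp; apply: cderD; first exact: cder_cst.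
    apply: cderD; first exact: (cderZ w h1).
    apply: (cder_eq (cderZ (- (z * (expR (- s) ^+ 2)%:C)) h2)) => // y.
    by rewrite expr2 rmorphM/=; ring.
  have cf s : (fun n => complex.Re (f (u n) s)) @ \oo --> complex.Re (f 0 s) /\
      (fun n => complex.Im (f (u n) s)) @ \oo --> complex.Im (f 0 s).
    have [l [l1 l2]] := df s 0.
    split.
      apply: (@cvg_comp _ _ _ u (fun v => complex.Re (f v s)) _ (nbhs (0 : R))); first exact: cvg_harmonic.
      exact: is_derive_continuous l1.
    apply: (@cvg_comp _ _ _ u (fun v => complex.Im (f v s)) _ (nbhs (0 : R))); first exact: cvg_harmonic.
    exact: is_derive_continuous l2.
  have fE n s : f (u n) s = cexp (w * (u n)%:C) * PhiI A z (ln (u n)) s.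
    rewrite /f /PhiI lnK ?posrE// mulrCA -cexpD; congr (_ * cexp _).
    by rewrite !rmorphM/=; ring.
  transitivity (cint leb (f 0)).
    apply: eq_cint => s; rewrite /f; congr (_ * cexp _).
    by rewrite expr0n/= !rmorph0; ring.
  apply: (@cint_dominated_cst _ _ (measurableTypeR R) leb (fun n => f (u n)) _
     (fun s => expR (complex.Re w) * (expR s ^+ 1 * expR (- (complex.Re A * expR s ^+ 2))))).
  - move=> n; have := mcfunM (mcfun_cst _ (cexp (w * (u n)%:C))) (mcfun_PhiI A z (ln (u n))).
    by under eq_fun do rewrite -fE.
  - by move=> s; exact: (cf s).1.
  - by move=> s; exact: (cf s).2.
  - exact: rintegrableZ.
  - move=> n s; rewrite fE cmodM; apply: ler_pM; rewrite ?cmod_ge0//; last exact: cmod_PhiI.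
    by rewrite cmod_cexp !ReImE/= mulr0 subr0 ler_expR ler_piMr ?(ltW w0).
  - move=> n; rewrite (cst tau (ln (u n))) /c lnK ?posrE// -cintZ; last exact: cintegrable_PhiI.
    by apply: eq_cint => s; exact: fE.
rewrite -(Phi_inf A0) key /c mulrAC -cexpD addrN cexp0 mul1r//.
Qed.

End ode.

Section Qforms.
Variables (A z w : R[i]) (m : R).
Hypotheses (A0 : 0 < complex.Re A) (z0 : 0 < complex.Re z) (w0 : 0 < complex.Re w).
Hypothesis wE : w ^+ 2 = 4 * A * z.

(** The Macdonald function of order one half is elementary. The massless case is separate because
    [PhiE] is used at [tau = ln |m|]. *)
Lemma Qint0E : Qint m z A 0 = gauss_int A / 2 * cexp (- (w * `|m|%:C)).
Proof.
have [m0|m0] := eqVneq m 0.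
  rewrite m0 normr0 rmorph0 mulr0 oppr0 cexp0 mulr1 -(Phi_inf A0).
  apply: eq_cint => s; rewrite expr1; congr (_ * cexp _).
  by rewrite expr0n/= mul0r rmorph0 mulr0 addr0.
have mp : 0 < `|m| by rewrite normr_gt0.
have := PhiE A0 z0 w0 wE (ln `|m|); rewrite lnK ?posrE// => <-.
apply: eq_cint => s; rewrite expr1 /PhiI lnK ?posrE//.
by rewrite real_normK ?num_real.
Qed.

Lemma Qint_minus : 2 * z * cint leb (fun s => (m ^+ 2 * expR (- s))%:C *
    cexp (- (A * (expR s ^+ 2)%:C + z * (m ^+ 2 * expR (- s) ^+ 2)%:C))) =
  w * `|m|%:C * Qint m z A 0 /\
  cintegrable leb (fun s => (m ^+ 2 * expR (- s))%:C *
    cexp (- (A * (expR s ^+ 2)%:C + z * (m ^+ 2 * expR (- s) ^+ 2)%:C))).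
Proof.
have [m0|m0] := eqVneq m 0.
  have i0 := cintegrableZ 0 (cintegrable_Q 0 z0 0 A0).
  have E s : 0 * ((expR s ^+ 1)%:C * cexp (- (A * (expR s ^+ 2)%:C + z * (0 ^+ 2 * expR (- s) ^+ 2)%:C)))
   = (m ^+ 2 * expR (- s))%:C * cexp (- (A * (expR s ^+ 2)%:C + z * (m ^+ 2 * expR (- s) ^+ 2)%:C)) :> R[i].
    by rewrite m0 (_ : 0 ^+ 2 = 0 :> R) ?expr0n// !mul0r.
  split; last by apply: eq_cintegrable i0 => s; exact: E.
  transitivity (2 * z * cint leb (fun s => 0 * ((expR s ^+ 1)%:C * cexp (- (A * (expR s ^+ 2)%:C + z * (0 ^+ 2 * expR (- s) ^+ 2)%:C))))).
    by congr (_ * _); apply: eq_cint => s; rewrite E.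
  rewrite cintZ; last exact: (cintegrable_Q 0 z0 0 A0).
  by rewrite mul0r mulr0 m0 normr0 rmorph0 mulr0 mul0r.
have mp : 0 < `|m| by rewrite normr_gt0.
pose tau := ln `|m|.
have Et : expR tau = `|m| by rewrite lnK ?posrE.
have E2 : expR tau ^+ 2 = m ^+ 2 by rewrite Et real_normK ?num_real.
have [ir hr] := cint_reflect tau (cintegrable_PhiI tau z0 A0).
have E s : (expR tau)%:C * PhiI z A tau (tau - s) = (m ^+ 2 * expR (- s))%:C *
    cexp (- (A * (expR s ^+ 2)%:C + z * (m ^+ 2 * expR (- s) ^+ 2)%:C)).
  rewrite PhiI_reflect /PhiI E2 mulrA -rmorphM/=; congr (_%:C * _).
  by rewrite expr2 -!mulrA -expRD addNr expR0 mulr1.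
split; last by apply: eq_cintegrable (cintegrableZ _ ir) => s; exact: E.
transitivity (2 * z * cint leb (fun s => (expR tau)%:C * PhiI z A tau (tau - s))).
  by congr (_ * _); apply: eq_cint => s; rewrite E.
rewrite (cintZ _ ir) hr -/(Phi z A tau).
transitivity ((expR tau)%:C * (2 * z * Phi z A tau)); first by ring.
by rewrite -(Phi_swap A0 z0 w0 wE) (PhiE A0 z0 w0 wE) Qint0E Et; ring.
Qed.

(** The recurrence from order one half to three halves: the derivative of [expR s * E s] integrates
    to zero, and its term in [expR (- s)] is evaluated by [Qint_minus]. *)
Lemma Qint2E : 2 * A * Qint m z A 2 = (1 + w * `|m|%:C) * Qint m z A 0.
Proof.
have [hm im] := Qint_minus.
pose E s := cexp (- (A * (expR s ^+ 2)%:C + z * (m ^+ 2 * expR (- s) ^+ 2)%:C)).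
have i0 := cintegrable_Q m z0 0 A0.
have i2 := cintegrable_Q m z0 2 A0.
pose g (s : R) : R[i] := 2 * z * ((m ^+ 2 * expR (- s))%:C * E s) +
   ((expR s ^+ 1)%:C * E s + (- (2 * A)) * ((expR s ^+ 3)%:C * E s)).
have ig : cintegrable leb g.
  by apply: cintegrableD; [exact: cintegrableZ|apply: cintegrableD => //; exact: cintegrableZ].
have dN (s : R) : cder (fun s => (expR (- s))%:C) s (- (expR (- s))%:C).
  have h : is_derive s (1 : R) (fun s => expR (- s)) (- expR (- s)).
    by apply: is_derive_eq; rewrite /GRing.scale/= mulrN1.
  by have := cder_real h; rewrite rmorphN.
have dP := @cder_expR.
have dE s : cder E s ((- (2 * A * (expR s ^+ 2)%:C) + 2 * z * (m ^+ 2 * expR (- s) ^+ 2)%:C) * E s).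
  apply: cder_cexp.
  have h1 := cderZ (- A) (cderM (dP s) (dP s)).
  have h2 := cderZ (- (z * (m ^+ 2)%:C)) (cderM (dN s) (dN s)).
  apply: cder_eq (cderD h1 h2) _ _ => [t|].
    by rewrite !expr2 !rmorphM/=; ring.
  by rewrite !expr2 !rmorphM/=; ring.
have gE s : g s = (expR s)%:C * E s + (expR s)%:C * ((- (2 * A * (expR s ^+ 2)%:C) + 2 * z * (m ^+ 2 * expR (- s) ^+ 2)%:C) * E s).
  have e1 : (expR s)%:C * (m ^+ 2 * expR (- s) ^+ 2)%:C = (m ^+ 2 * expR (- s))%:C :> R[i].
    rewrite -rmorphM/=; congr (_%:C); rewrite expr2 mulrCA; congr (_ * _).
    by rewrite mulrA -expRD addrN expR0 mul1r.
  rewrite /g -e1 expr1 [expR s ^+ 3]exprS [(expR s * expR s ^+ 2)%:C]rmorphM/=.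
  by move: ((expR s)%:C) ((expR s ^+ 2)%:C) ((m ^+ 2 * expR (- s) ^+ 2)%:C) (E s) => a b c e; ring.
have dg s : cder (fun s => (expR s)%:C * E s) s (g s).
  by rewrite gE; exact: (cderM (dP s) (dE s)).
have ddg s : exists l, cder g s l.
  eexists; apply: (@cder_eq _ (fun s => (expR s)%:C * E s + (expR s)%:C * ((- (2 * A * ((expR s)%:C * (expR s)%:C)) + 2 * z * ((m ^+ 2)%:C * ((expR (- s))%:C * (expR (- s))%:C))) * E s))); [| |reflexivity].
    apply: cderD; first exact: dg.
    apply: cderM; first exact: dP.
    apply: cderM; last exact: dE.
    apply: cderD.
      apply: (@cder_eq _ (fun s => - (2 * A) * ((expR s)%:C * (expR s)%:C))); [|by move=> t; ring|reflexivity].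
      exact: (cderZ _ (cderM (dP s) (dP s))).
    exact: (cderZ _ (cderZ _ (cderM (dN s) (dN s)))).
  by move=> t; rewrite gE !expr2 !rmorphM.
have bd s : cmod ((expR s)%:C * E s) * `|s| <= 1 + (complex.Re A)^-1.
  have h := cmod_Q m z0 A 1 s; rewrite !expr1 -/(E s) in h.
  apply: le_trans (ler_wpM2r (normr_ge0 s) h) _.
  have [s0|s0] := leP 0 s.
    rewrite ger0_norm//; apply: (@le_trans _ _ (complex.Re A)^-1); last by rewrite lerDr.
    have := xexpN A0 (sqr_ge0 (expR s)); apply: le_trans.
    rewrite mulrAC ler_wpM2r ?expR_ge0// expr2 ler_wpM2l ?expR_ge0//.
    exact: expR_ge_id.
  rewrite ltr0_norm//; apply: (@le_trans _ _ 1); last by rewrite lerDl invr_ge0 ltW.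
  apply: (@le_trans _ _ (expR s * - s)).
    rewrite mulrAC ler_piMr ?mulr_ge0 ?expR_ge0// ?oppr_ge0 ?(ltW s0)//.
    by rewrite -[X in _ <= X]expR0 ler_expR oppr_le0 mulr_ge0 ?sqr_ge0// ltW.
  rewrite -[s in expR s]opprK expRN mulrC ler_pdivrMr ?expR_gt0// mul1r.
  exact: expR_ge_id.
have := cint_derive0 dg ddg ig bd.
rewrite /g cintD; [|exact: cintegrableZ|by apply: cintegrableD => //; exact: cintegrableZ].
rewrite cintZ// hm cintD//; last exact: cintegrableZ.
rewrite cintZ// -/(Qint m z A 2) -/(Qint m z A 0).
move: (Qint m z A 2) (Qint m z A 0) => q2 q0 h.
apply/eqP; rewrite -subr_eq0; apply/eqP.
transitivity (- (w * `|m|%:C * q0 + (q0 + - (2 * A) * q2))); first by ring.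
by rewrite h oppr0.
Qed.

End Qforms.
End ClosedForm.

(** * The hermitian form and the Dirac bilinear form *)

Section Hermitian.
Context {R : realType}.

(** From Lagrange's identity. *)
Lemma cauchy_schwarz_sum n (a b : 'I_n -> R) :
  (\sum_i a i * b i) ^+ 2 <= (\sum_i a i ^+ 2) * (\sum_i b i ^+ 2).
Proof.
have h : 0 <= \sum_i \sum_j (a i * b j - a j * b i) ^+ 2.
  by apply: sumr_ge0 => i _; apply: sumr_ge0 => j _; exact: sqr_ge0.
have E : \sum_i \sum_j (a i * b j - a j * b i) ^+ 2 =
  2 * ((\sum_i a i ^+ 2) * (\sum_i b i ^+ 2)) - 2 * (\sum_i a i * b i) ^+ 2.
  transitivity (\sum_i (a i ^+ 2 * \sum_j b j ^+ 2 + b i ^+ 2 * \sum_j a j ^+ 2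
     - 2 * (a i * b i) * \sum_j a j * b j)).
    apply: eq_bigr => i _; rewrite !mulr_sumr -big_split -sumrB/=.
    by apply: eq_bigr => j _; ring.
  by rewrite sumrB big_split/= -!mulr_suml -mulr_sumr; ring.
by move: h; rewrite E; lra.
Qed.

Definition hdot N (u v : 'cV[R[i]]_N) : R[i] := (adjmx u *m v) 0 0.

Lemma hdotE N (u v : 'cV[R[i]]_N) : hdot u v = \sum_i cconj (u i 0) * v i 0.
Proof. by rewrite /hdot mxE; apply: eq_bigr => i _; rewrite mxE. Qed.

Lemma cmod_hdot N (u v : 'cV[R[i]]_N) : cmod (hdot u v) <= vnorm u * vnorm v.
Proof.
rewrite hdotE; apply: le_trans (cmod_sum _ _ _) _.
rewrite -(ler_pXn2r (n := 2)) ?nnegrE ?mulr_ge0 ?vnorm_ge0//; last first.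
  by apply: sumr_ge0 => i _; exact: cmod_ge0.
rewrite exprMn !vnorm_sqr.
rewrite (eq_bigr (fun i => cmod (u i 0) * cmod (v i 0))); last first.
  by move=> i _; rewrite cmodM cmod_conj.
exact: cauchy_schwarz_sum.
Qed.

Lemma hdot_self N (u : 'cV[R[i]]_N) : hdot u u = ((vnorm u) ^+ 2)%:C.
Proof.
rewrite hdotE vnorm_sqr rmorph_sum/=; apply: eq_bigr => i _.
by rewrite mulrC mul_conj.
Qed.

Lemma hdotDr N (u v w : 'cV[R[i]]_N) : hdot u (v + w) = hdot u v + hdot u w.
Proof. by rewrite /hdot mulmxDr mxE. Qed.
Lemma hdotZr N (u v : 'cV[R[i]]_N) c : hdot u (c *: v) = c * hdot u v.
Proof. by rewrite /hdot -scalemxAr mxE. Qed.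
Lemma hdotDl N (u v w : 'cV[R[i]]_N) : hdot (v + w) u = hdot v u + hdot w u.
Proof. by rewrite /hdot adjmxD mulmxDl mxE. Qed.
Lemma hdotZl N (u v : 'cV[R[i]]_N) c : hdot (c *: v) u = cconj c * hdot v u.
Proof. by rewrite /hdot adjmxZ -scalemxAl mxE. Qed.
Lemma hdot_adj N (A : 'M[R[i]]_N) (u v : 'cV[R[i]]_N) : hdot u (A *m v) = hdot (adjmx A *m u) v.
Proof. by rewrite /hdot adjmxM adjmxK mulmxA. Qed.
Lemma hdot_conj N (u v : 'cV[R[i]]_N) : cconj (hdot u v) = hdot v u.
Proof.
rewrite !hdotE cconj_sum; apply: eq_bigr => i _.
by rewrite cconjM cconjK mulrC.
Qed.

End Hermitian.

Section Current.
Context {R : realType} (d N : nat) (gamma : 'I_d.+1 -> 'M[R[i]]_N).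
Hypotheses (cg : clifford gamma) (hg : hermitian_gammas gamma).

Definition current (x : 'rV[R]_d) (phi : 'cV[R[i]]_N) : R := complex.Re (hdot phi (aslash gamma x *m phi)).

Lemma hdot_aslash x phi : hdot phi (aslash gamma x *m phi) = (current x phi)%:C.
Proof.
rewrite /current; apply: complex_eq => //=.
have := hdot_conj phi (aslash gamma x *m phi).
rewrite -{2}(adj_aslash cg hg x) -hdot_adj => /(congr1 (@complex.Im R)) /=.
by move: (complex.Im _) => u; lra.
Qed.

Lemma vnorm_gamma0 (v : 'cV[R[i]]_N) : vnorm (gamma ord0 *m v) = vnorm v.
Proof.
have : hdot (gamma ord0 *m v) (gamma ord0 *m v) = hdot v v.
  by rewrite hdot_adj hg.1 mulmxA gamma0_sqr// mul1mx.
rewrite !hdot_self => /(congr1 (@complex.Re R)) /= /eqP.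
by rewrite eqrXn2 ?vnorm_ge0// => /eqP.
Qed.

(** For [z = i t] this is [- i (t - alpha . x) phi], and on the cone [|x| = t] the matrix
    [t - alpha . x] is [2 t] times a projection. By [vnorm_nullv] its square norm is then [2 t]
    times the density [t |phi|^2 - current]. *)
Definition nullv (z : R[i]) (x : 'rV[R]_d) (phi : 'cV[R[i]]_N) : 'cV[R[i]]_N :=
  cconj z *: phi + ii *: (aslash gamma x *m phi).

Lemma vnorm_aslash x phi : vnorm (aslash gamma x *m phi) ^+ 2 = dotv x x * vnorm phi ^+ 2.
Proof.
have : ((vnorm (aslash gamma x *m phi)) ^+ 2)%:C = (dotv x x * vnorm phi ^+ 2)%:C :> R[i].
  rewrite -hdot_self [RHS]rmorphM/= -hdot_self hdot_adj adj_aslash//.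
  rewrite mulmxA aslash_sqr// -scalemxAl mul1mx hdotZl; congr (_ * _).
  by apply: complex_eq; rewrite !ReImE ?oppr0.
by move/(congr1 (@complex.Re R)).
Qed.

Lemma vnorm_nullv z x phi : vnorm (nullv z x phi) ^+ 2 =
  (cmod z ^+ 2 + dotv x x) * vnorm phi ^+ 2 - 2 * complex.Im z * current x phi.
Proof.
apply: (@complexI R); rewrite -hdot_self /nullv !hdotDr !hdotDl !hdotZr !hdotZl.
rewrite -(hdot_conj phi (aslash gamma x *m phi)) hdot_aslash !hdot_self vnorm_aslash.
rewrite cconjK.
by apply: complex_eq; rewrite !ReImE ?cmod_sqr/= ?cmod_sqr; ring.
Qed.

Lemma dbarE (phi psi : 'cV[R[i]]_N) : dbar gamma phi psi = hdot phi (gamma ord0 *m psi).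
Proof. by rewrite /dbar /hdot mulmxA. Qed.

(** Moving the kernel to the other factor conjugates it past [gamma ord0]. As [aslash x]
    anticommutes with [gamma ord0] while conjugation changes the sign of [ii], the leading part
    [z + i aslash x] turns into the operator that defines [nullv]. *)
Lemma dbar_kernel (a b z : R[i]) x (K : 'M[R[i]]_N) (v phi : 'cV[R[i]]_N) :
  K = a *: (z *: 1%:M + ii *: aslash gamma x) + b *: gamma ord0 ->
  cmod (dbar gamma (K *m v) phi) <=
  vnorm v * (cmod a * vnorm (nullv z x phi) + cmod b * vnorm phi).
Proof.
move=> ->; rewrite dbarE.
set S := aslash gamma x; set g := gamma ord0.
have -> : (a *: (z *: 1%:M + ii *: S) + b *: g) *m v =
   a *: (z *: v + ii *: (S *m v)) + b *: (g *m v).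
  by rewrite mulmxDl -!scalemxAl mulmxDl -!scalemxAl mul1mx.
rewrite hdotDl !hdotZl hdotDl !hdotZl.
have -> : hdot (S *m v) (g *m phi) = - hdot (g *m v) (S *m phi).
  rewrite /S -{1}(adj_aslash cg hg x) -hdot_adj mulmxA aslash_gamma0// mulNmx -mulmxA -scaleN1r hdotZr.
  by rewrite mulN1r (hdot_adj (gamma ord0)) hg.1.
have -> : hdot v (g *m phi) = hdot (g *m v) phi by rewrite hdot_adj hg.1.
have -> : hdot (g *m v) (g *m phi) = hdot v phi.
  by rewrite hdot_adj hg.1 mulmxA gamma0_sqr// mul1mx.
have -> : cconj a * (cconj z * hdot (g *m v) phi + cconj ii * - hdot (g *m v) (S *m phi)) =
   cconj a * hdot (g *m v) (nullv z x phi).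
  rewrite /nullv hdotDr !hdotZr; congr (_ * (_ + _)).
  have -> : cconj ii = - ii :> R[i] by apply: complex_eq; rewrite !ReImE/= ?oppr0.
  by ring.
apply: le_trans (cmodD _ _) _; rewrite !cmodM !cmod_conj mulrDr; apply: lerD.
  rewrite mulrCA ler_wpM2l ?cmod_ge0// -[X in _ <= X * _]vnorm_gamma0; exact: cmod_hdot.
by rewrite mulrCA ler_wpM2l ?cmod_ge0// cmod_hdot.
Qed.

End Current.

(** * Kernel bounds in dimension two *)

Section Kernel2.
Context {R : realType} (N : nat) (gamma : 'I_3 -> 'M[R[i]]_N).
Hypotheses (cg : clifford gamma) (hg : hermitian_gammas gamma).

(** The root with real part [sqrt ((|D| + Re D) / 2)], which is positive because [D] is not real. *)
Lemma csqrt_exists (D : R[i]) : complex.Im D != 0 ->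
  exists w : R[i], 0 < complex.Re w /\ w ^+ 2 = D.
Proof.
case: D => a b /= b0.
have hab : a ^+ 2 < cmod (a +i* b) ^+ 2.
  by rewrite cmod_sqr/= ltrDl exprn_even_gt0.
have r0 : 0 <= cmod (a +i* b) by exact: cmod_ge0.
have rp : 0 < (cmod (a +i* b) + a) / 2.
  by rewrite divr_gt0//; move: (cmod _) r0 hab => r r0 hab; nra.
set c := Num.sqrt ((cmod (a +i* b) + a) / 2).
have c0 : 0 < c by rewrite sqrtr_gt0.
have c2 : c ^+ 2 = (cmod (a +i* b) + a) / 2 by rewrite sqr_sqrtr// ltW.
exists (c +i* (b / (2 * c))); split => //.
have -> : (c +i* (b / (2 * c))) ^+ 2 = (c ^+ 2 - b ^+ 2 / (4 * c ^+ 2)) +i* b.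
  by apply: complex_eq; rewrite expr2 ?Re_mul ?Im_mul/=; field; rewrite gt_eqF.
congr (_ +i* _).
have b2 : b ^+ 2 = cmod (a +i* b) ^+ 2 - a ^+ 2 by rewrite cmod_sqr/= addrC addKr.
rewrite b2 c2; move: rp; move: (cmod _) => r rp.
field; apply/eqP => h; move: rp; rewrite h mul0r ltxx //.
Qed.

Section fixz.
Variables (m : R) (z : R[i]) (x : 'rV[R]_2).
Hypotheses (z0 : 0 < complex.Re z) (zt : complex.Im z != 0).
Let et := complex.Re z * `|complex.Im z|.
(** Equal to [4 * z * kernel_rate z x]. Its real part measures the distance to the light cone and
    its imaginary part is twice the product of damping and time. *)
Definition cone_symbol : R[i] := z ^+ 2 + (dotv x x)%:C.

Lemma et_gt0 : 0 < et. Proof. by rewrite mulr_gt0// normr_gt0. Qed.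

Lemma Im_cone_symbol : complex.Im cone_symbol = 2 * complex.Re z * complex.Im z.
Proof. by rewrite /cone_symbol expr2 !ReImE; ring. Qed.

Lemma Im_cone_symbol_neq0 : complex.Im cone_symbol != 0.
Proof. by rewrite Im_cone_symbol !mulf_neq0// gt_eqF. Qed.

(** With [D] the cone symbol and [w ^+ 2 = D], the leading coefficient is of size at most [(1 + |w|
    |m|) exp (- Re w |m|) / (|w| |D|)] up to a constant. The exponential controls the factor [|m|],
    so the bounds do not depend on the mass. *)
Lemma kernel2_bound : exists a b : R[i],
  [/\ Kmx gamma m z x = a *: (z *: 1%:M + ii *: aslash gamma x) + b *: gamma ord0,
      cmod a ^+ 2 <= 8 * ((cmod cone_symbol ^+ 3)^-1 + (cmod cone_symbol * et ^+ 2)^-1) &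
      cmod b ^+ 2 <= 4 * (et ^+ 2)^-1].
Proof.
have [w [w0 wE]] := csqrt_exists Im_cone_symbol_neq0.
have [A AEq] : exists A, A = kernel_rate z x by exists (kernel_rate z x).
have A0 : 0 < complex.Re A by rewrite AEq; exact: Re_kernel_rate_gt0.
have An : A != 0 by apply: contraTneq A0 => ->; rewrite ltxx.
have zn : z != 0 by exact: z_neq0.
have AE : w ^+ 2 = 4 * A * z by rewrite wE AEq /kernel_rate /cone_symbol; field.
have D0 : 0 < cmod cone_symbol.
  by rewrite cmod_gt0; apply: contraNneq Im_cone_symbol_neq0 => ->.
have w2 : cmod w ^+ 2 = cmod cone_symbol by rewrite -cmodX wE.
have wp : 0 < cmod w by rewrite cmod_gt0; apply: contraTneq w0 => ->; rewrite ltxx.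
pose kap : R[i] := ((2 * pi) ^- 2)%:C * (2^-1 * gauss_int z).
exists (kap * (Qint m z A 2 / z)), (kap * ((2 * m)%:C * Qint m z A 0)).
(* Imaginary parts in [w ^+ 2 = cone_symbol] give [Re w Im w = Re z Im z], hence a lower bound for
   [Re w] in terms of [|w|]. *)
have Rw : et <= complex.Re w * cmod w.
  have h : complex.Re w * complex.Im w = complex.Re z * complex.Im z.
    have := congr1 (@complex.Im R) wE; rewrite Im_cone_symbol expr2 Im_mul => h.
    by move: h; rewrite [complex.Im w * _]mulrC; lra.
  have -> : et = complex.Re w * `|complex.Im w|.
    by rewrite /et -[in RHS](gtr0_norm w0) -normrM h normrM gtr0_norm.
  by rewrite ler_wpM2l ?(ltW w0)// ler_Im_cmod.
have me : `|m| * expR (- (complex.Re w * `|m|)) <= (complex.Re w)^-1.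
  by apply: xexpN.
have e1 : expR (- (complex.Re w * `|m|)) <= 1.
  by rewrite -[X in _ <= X]expR0 ler_expR oppr_le0 mulr_ge0 ?(ltW w0).
have pi3 : (1 : R) <= pi by have := @pi_ge2 R; lra.
have kQ0 : cmod (kap * Qint m z A 0) <= (cmod w)^-1 * expR (- (complex.Re w * `|m|)).
  rewrite (Qint0E m A0 z0 w0 AE) /kap.
  have h2 : cmod (2^-1 : R[i]) = 2^-1.
    by rewrite cmodV (_ : (2 : R[i]) = (2 : R)%:C) ?cmod_real ?ger0_norm// (rmorph_nat (real_complex R)).
  rewrite !cmodM h2 cmod_cexp !ReImE/= mulr0 subr0 cmod_real ger0_norm; last first.
    by rewrite invr_ge0 exprn_ge0// mulr_ge0// pi_ge0.
  (* The moduli are compared after squaring: the left side becomes [pi^2 / (|z| |A|)], and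
     [4 |A| |z| = |w|^2]. *)
  have cc : cmod (gauss_int z) * cmod (gauss_int A) = 2 * pi * (cmod w)^-1.
    apply/eqP; rewrite -(@eqrXn2 _ 2) ?mulr_ge0 ?cmod_ge0 ?invr_ge0 ?pi_ge0 ?cmod_ge0//.
    rewrite !exprMn !cmod_gauss_int_sqr// exprVn w2 (_ : cone_symbol = 4 * A * z); last by rewrite -wE.
    rewrite !cmodM (_ : (4 : R[i]) = (4 : R)%:C) ?cmod_real ?ger0_norm//; last first.
      by rewrite (rmorph_nat (real_complex R)).
    by apply/eqP; field; rewrite !gt_eqF ?cmod_gt0.
  rewrite [X in X <= _](_ : _ = (2 * pi) ^- 2 * 2^-1 * 2^-1 * (cmod (gauss_int z) * cmod (gauss_int A)) * expR (- (complex.Re w * `|m|))); last first.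
    by move: (_ ^- 2) (cmod (gauss_int z)) (cmod (gauss_int A)) (expR _) => p1 p2 p3 p4; ring.
  rewrite cc ler_wpM2r ?expR_ge0// mulrA ler_piMl ?invr_ge0 ?cmod_ge0//.
  rewrite [X in X <= _](_ : _ = (8 * pi)^-1); last first.
    have p0 : (pi : R) != 0 by exact: lt0r_neq0 (pi_gt0 R).
    by move: (pi : R) p0 => p p0; field.
  by rewrite invf_le1 ?mulr_gt0 ?pi_gt0//; lra.
have mw : cmod w * `|m| * expR (- (complex.Re w * `|m|)) <= cmod cone_symbol / et.
  rewrite -mulrA; apply: (@le_trans _ _ (cmod w * (complex.Re w)^-1)).
    by rewrite ler_wpM2l ?cmod_ge0.
  rewrite ler_pdivlMr ?et_gt0// -w2 expr2 -mulrA ler_wpM2l ?cmod_ge0//.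
  by rewrite mulrC ler_pdivrMr// mulrC.
split.
- apply/matrixP => i j; rewrite (KmxE' gamma m z0)//.
  have E : ((kap * (Qint m z A 2 / z)) *: (z *: 1%:M + ii *: aslash gamma x) +
     (kap * ((2 * m)%:C * Qint m z A 0)) *: gamma ord0) i j =
     kap * (Qint m z A 2 / z) * (z * (i == j)%:R + ii * aslash gamma x i j) +
     kap * ((2 * m)%:C * Qint m z A 0) * gamma ord0 i j.
    by move: (aslash gamma x) (gamma ord0) (kap * _) (kap * _) => S g k1 k2; rewrite !mxE.
  apply: etrans (esym E).
  rewrite -AEq /kap /= expr1.
  move: ((2 * pi) ^- 2)%:C (Qint _ _ _ _) (Qint _ _ _ _) => c q2 q0.
  by field.
- have -> : kap * (Qint m z A 2 / z) = 2 * (1 + w * `|m|%:C) * (kap * Qint m z A 0) / cone_symbol.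
    rewrite (_ : cone_symbol = 4 * A * z); last by rewrite -wE.
    have := Qint2E m A0 z0 w0 AE => h.
    have -> : Qint m z A 2 = (1 + w * `|m|%:C) * Qint m z A 0 / (2 * A).
      by rewrite -h; field.
    by field; rewrite An zn.
  have h1 : cmod (2 * (1 + w * `|m|%:C) * (kap * Qint m z A 0) / cone_symbol) <=
     2 * (1 + cmod cone_symbol / et) / (cmod w * cmod cone_symbol).
    rewrite [X in X <= _]cmodM cmodV [(cmod w * cmod cone_symbol)^-1]invfM [X in _ <= X]mulrA ler_wpM2r ?invr_ge0 ?cmod_ge0//.
    have h2 : cmod (2 : R[i]) = 2.
      by rewrite (_ : (2 : R[i]) = (2 : R)%:C) ?cmod_real ?ger0_norm// (rmorph_nat (real_complex R)).
    rewrite [X in X <= _]cmodM [cmod (2 * _)]cmodM h2.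
    rewrite -[X in X <= _]mulrA -[X in _ <= X]mulrA ler_wpM2l//.
    apply: (@le_trans _ _ ((1 + cmod w * `|m|) * ((cmod w)^-1 * expR (- (complex.Re w * `|m|))))).
      apply: ler_pM; rewrite ?cmod_ge0//.
      by apply: le_trans (cmodD _ _) _; rewrite cmod1 cmodM cmod_real normr_id lexx.
    rewrite mulrCA mulrC ler_wpM2r ?invr_ge0 ?cmod_ge0// mulrDl mul1r; exact: lerD.
  have h0 : 0 <= 1 + cmod cone_symbol / et by rewrite addr_ge0 ?divr_ge0 ?cmod_ge0 ?(ltW et_gt0).
  apply: le_trans (lerXn2r 2 _ _ h1) _; rewrite ?nnegrE ?cmod_ge0//.
    by rewrite mulr_ge0 ?invr_ge0 ?mulr_ge0 ?cmod_ge0.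
  have [e eE] : exists e, e = et by exists et.
  have e0 : 0 < e by rewrite eE et_gt0.
  rewrite -eE exprMn exprMn exprVn exprMn w2.
  have h3 : (1 + cmod cone_symbol / e) ^+ 2 <= 2 * (1 + (cmod cone_symbol / e) ^+ 2).
    by have := sqr_ge0 (1 - cmod cone_symbol / e); move: (cmod cone_symbol / e) => y; nra.
  apply: (@le_trans _ _ (2 ^+ 2 * (2 * (1 + (cmod cone_symbol / e) ^+ 2)) / (cmod cone_symbol * cmod cone_symbol ^+ 2))).
    by rewrite ler_wpM2r ?invr_ge0 ?mulr_ge0 ?cmod_ge0 ?sqr_ge0// ler_wpM2l.
  rewrite le_eqVlt; apply/orP; left; apply/eqP.
  by move: (cmod cone_symbol) D0 => D D0; field; rewrite !gt_eqF.
- have h1 : cmod (kap * ((2 * m)%:C * Qint m z A 0)) <= 2 / et.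
    rewrite mulrCA cmodM cmod_real normrM ger0_norm// -mulrA ler_wpM2l//.
    apply: (@le_trans _ _ (`|m| * ((cmod w)^-1 * expR (- (complex.Re w * `|m|))))).
      by rewrite ler_wpM2l.
    rewrite mulrCA; apply: (@le_trans _ _ ((cmod w)^-1 * (complex.Re w)^-1)).
      by rewrite ler_wpM2l ?invr_ge0 ?cmod_ge0.
    by rewrite -invfM lef_pV2 ?posrE ?et_gt0 ?mulr_gt0// mulrC.
  apply: le_trans (lerXn2r 2 _ _ h1) _; rewrite ?nnegrE ?cmod_ge0//.
    by rewrite divr_ge0// ltW// et_gt0.
  by rewrite exprMn exprVn le_eqVlt; apply/orP; left; apply/eqP; ring.
Qed.

Lemma dbar_kernel2 (v phi : 'cV[R[i]]_N) :
  cmod (dbar gamma (Kmx gamma m z x *m v) phi) ^+ 2 <= vnorm v ^+ 2 *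
   (16 * ((cmod cone_symbol ^+ 3)^-1 + (cmod cone_symbol * et ^+ 2)^-1) * vnorm (nullv gamma z x phi) ^+ 2
    + 8 * (et ^+ 2)^-1 * vnorm phi ^+ 2).
Proof.
have [a [b [KE ha hb]]] := kernel2_bound.
have h := dbar_kernel cg hg v phi KE.
have n0 := vnorm_ge0 (nullv gamma z x phi); have p0 := vnorm_ge0 phi.
apply: le_trans (lerXn2r 2 _ _ h) _; rewrite ?nnegrE ?cmod_ge0//.
  by rewrite mulr_ge0 ?vnorm_ge0// addr_ge0 ?mulr_ge0 ?cmod_ge0.
rewrite exprMn ler_wpM2l ?sqr_ge0//.
apply: (@le_trans _ _ (2 * (cmod a ^+ 2 * vnorm (nullv gamma z x phi) ^+ 2) + 2 * (cmod b ^+ 2 * vnorm phi ^+ 2))).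
  rewrite -!exprMn; move: (_ * _) (_ * _) => p q.
  by have := sqr_ge0 (p - q); nra.
have h1 := ler_wpM2r (sqr_ge0 (vnorm (nullv gamma z x phi))) ha.
have h2 := ler_wpM2r (sqr_ge0 (vnorm phi)) hb.
by lra.
Qed.

End fixz.
End Kernel2.

(** * The flux of a conserved current *)

Section Divergence.
Context {R : realType}.

Lemma is_derive_at0 (h : R -> R) (x l : R) :
  is_derive (0 : R) 1 (fun s => h (x + s)) l -> is_derive x 1 h l.
Proof.
move=> H.
have H' : is_derive (x - x) 1 (fun s => h (x + s)) l by rewrite subrr.
have k : is_derive x 1 (fun u : R => u - x) 1.
  by apply: is_derive_eq; rewrite subr0.
have := @is_derive1_comp R (fun s => h (x + s)) (fun u : R => u - x) x l 1 H' k.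
rewrite (_ : _ \o _ = h); last by apply/funext => u /=; rewrite addrC subrK.
by move=> /is_derive_eq; apply; rewrite /GRing.scale/= ?mul1r ?mulr1.
Qed.

Lemma dotv_vcons n (x : R) (y : vec (R := R) n) :
  dotv (vcons (x, y)) (vcons (x, y)) = x ^+ 2 + dotv y y.
Proof.
rewrite dotvE big_ord_recl vcons0/= expr2; congr (_ + _).
by rewrite dotvE; apply: eq_bigr => j _; rewrite vconsS.
Qed.

Lemma line_coord n (x : 'rV[R]_n) (s : R) (l j : 'I_n) :
  (x + s *: delta_mx 0 l) 0 j = x 0 j + s * (j == l)%:R.
Proof. by rewrite !mxE eqxx. Qed.

Lemma vcons_addr0 n (x s : R) (y : vec (R := R) n) :
  (vcons (x, y) : 'rV[R]_n.+1) + s *: delta_mx 0 ord0 = vcons (x + s, y).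
Proof.
apply/rowP => j; rewrite line_coord.
have [->|[k ->]] : j = ord0 \/ exists k, j = lift ord0 k.
- by case: (unliftP ord0 j) => [k ->|->]; [right; exists k|left].
- by rewrite !vcons0 eqxx mulr1.
- by rewrite !vconsS mulr0 addr0.
Qed.

Lemma vcons_addrS n (x s : R) (y : vec (R := R) n) k :
  (vcons (x, y) : 'rV[R]_n.+1) + s *: delta_mx 0 (lift ord0 k) =
  vcons (x, (y : 'rV[R]_n) + s *: delta_mx 0 k : vec n).
Proof.
apply/rowP => j; rewrite line_coord.
have [->|[i ->]] : j = ord0 \/ exists k, j = lift ord0 k.
- by case: (unliftP ord0 j) => [i ->|->]; [right; exists i|left].
- by rewrite !vcons0 mulr0 addr0.
- by rewrite !vconsS line_coord (inj_eq lift_inj).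
Qed.

Lemma rintegrable_vgaussw n (e : R) : 0 < e ->
  rintegrable (vmu n) (fun x => expR (- (e * dotv x x))).
Proof.
move=> e0; apply: eq_rintegrable (vgauss_shift (0 : 'rV[R]_n) e0).1 => x.
by rewrite subr0.
Qed.

(** Induction on the dimension. For the first coordinate Fubini puts its integral innermost; for any
    other coordinate the slices satisfy the same hypotheses, since the Gaussian bound survives
    slicing. *)
Lemma vmu_derive0 n (l : 'I_n) (F dF : vec (R := R) n -> R) (C e : R) : 0 < e ->
  measurable_fun [set: vec n] dF ->
  (forall x : 'rV[R]_n, is_derive (0 : R) 1 (fun s => F (x + s *: delta_mx 0 l)) (dF x)) ->
  (forall x : 'rV[R]_n, continuous (fun s : R => dF (x + s *: delta_mx 0 l))) ->
  (forall x, `|F x| <= C * expR (- (e * dotv x x))) ->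
  (forall x, `|dF x| <= C * expR (- (e * dotv x x))) ->
  \int[vmu n]_x dF x = 0.
Proof.
move=> e0; elim: n l F dF C => [[]//|n IH] l F dF C mdF hd hc hF hdF.
have C_ge0 : 0 <= C.
  have := le_trans (normr_ge0 _) (hF 0).
  by rewrite pmulr_lge0// expR_gt0.
have idF : rintegrable (vmu n.+1) dF.
  apply: (rintegrable_le mdF (rintegrableZ C (rintegrable_vgaussw n.+1 e0))) => x.
  exact: hdF.
have [l0|[k lk]] : l = ord0 \/ exists k, l = lift ord0 k.
- by case: (unliftP ord0 l) => [k ->|->]; [right; exists k|left].
- subst l; rewrite (Rintegral_vmuS idF).
  have ip := integrable_vmuS idF.
  rewrite (Rintegral12 (m1 := leb) (m2 := vmu n) (f := fun p : measurableTypeR R * vec n => dF (vcons p)) ip).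
  rewrite -(Rintegral21 (m1 := leb) (m2 := vmu n) (f := fun p : measurableTypeR R * vec n => dF (vcons p)) ip).
  rewrite (_ : (fun y => _) = fun=> 0); first by rewrite /Rintegral integral0.
  apply/funext => y /=.
  have ele x : expR (- (e * dotv (vcons (x, y)) (vcons (x, y)))) <= expR (- (e * x ^+ 2)).
    by rewrite ler_expR lerN2 ler_wpM2l ?(ltW e0)// dotv_vcons lerDl dotv_ge0.
  have cv : continuous (fun s : R => dF (vcons (s, y))).
    have := hc (vcons (0, y)); rewrite (_ : (fun s => _) = (fun s : R => dF (vcons (s, y))))//.
    by apply/funext => s; rewrite vcons_addr0 add0r.
  apply: (@Rintegral_derive0 _ (fun s => F (vcons (s, y))) _ (C * (3 * (1 + e^-1)))).
  + move=> x; apply: is_derive_at0; have := hd (vcons (x, y)).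
    by under eq_fun do rewrite vcons_addr0.
  + exact: cv.
  + apply: (@rintegrable_le _ _ _ leb _ (fun x => C * expR (- (e * x ^+ 2)))).
    * exact: (continuous_measurable_fun cv).
    * exact: rintegrableZ (rintegrable_gauss e0).
    * by move=> x; apply: le_trans (hdF _) _; rewrite ler_wpM2l.
  + move=> x; apply: (@le_trans _ _ (C * (expR (- (e * x ^+ 2)) * `|x|))).
      rewrite mulrA ler_wpM2r//; apply: le_trans (hF _) _; by rewrite ler_wpM2l.
    rewrite ler_wpM2l//; apply: le_trans (gauss_abs_bound x e0).
    by rewrite ler_wpM2r// ler_peMl ?expR_ge0// lerDl.
- subst l; rewrite (Rintegral_vmuS idF).
  rewrite (_ : (fun x => _) = fun=> 0); first by rewrite /Rintegral integral0.
  apply/funext => x /=.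
  apply: (IH k (fun y => F (vcons (x, y))) _ C).
  + exact: (measurableT_comp mdF (@measurable_vcons1 R n x)).
  + by move=> y; have := hd (vcons (x, y)); under eq_fun do rewrite vcons_addrS.
  + by move=> y; have := hc (vcons (x, y)); under eq_fun do rewrite vcons_addrS.
  + move=> y; apply: le_trans (hF _) _; rewrite ler_wpM2l// ler_expR lerN2 ler_wpM2l ?(ltW e0)//.
    by rewrite dotv_vcons lerDr sqr_ge0.
  + move=> y; apply: le_trans (hdF _) _; rewrite ler_wpM2l// ler_expR lerN2 ler_wpM2l ?(ltW e0)//.
    by rewrite dotv_vcons lerDr sqr_ge0.
Qed.

End Divergence.

Section RTools.
Context {R : realType} d (T : measurableType d) (mu : {measure set T -> \bar R}).

Lemma Rintegral_sum n (F : 'I_n -> T -> R) : (forall i, rintegrable mu (F i)) ->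
  rintegrable mu (fun x => \sum_i F i x) /\
  \int[mu]_x (\sum_i F i x) = \sum_i \int[mu]_x F i x.
Proof.
elim: n F => [|n IH] F iF.
  split.
    apply: (@eq_rintegrable _ _ _ _ (fun=> 0)); first by move=> x; rewrite big_ord0.
    exact: integrable0.
  under eq_fun do rewrite big_ord0.
  by rewrite big_ord0 /Rintegral integral0.
have [i1 E1] := IH (fun i => F (lift ord0 i)) (fun i => iF _).
have iD := rintegrableD (iF ord0) i1.
split; first by apply: eq_rintegrable iD => x; rewrite big_ord_recl.
under eq_fun do rewrite big_ord_recl.
by rewrite (RintegralD measurableT (iF ord0) i1) E1 big_ord_recl.
Qed.

Lemma integral_le_Rintegral (f g : T -> R) : measurable_fun [set: T] f ->
  (forall x, 0 <= f x) -> (forall x, f x <= g x) -> rintegrable mu g ->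
  (\int[mu]_x (f x)%:E <= (\int[mu]_x g x)%:E)%E.
Proof.
move=> mf f0 fg ig.
apply: (@le_trans _ _ (\int[mu]_x (g x)%:E)%E).
  apply: ge0_le_integral => //.
  - by move=> x _; rewrite lee_fin.
  - exact/measurable_EFinP.
  - exact/measurable_EFinP/(rintegrable_measurable ig).
  - by move=> x _; rewrite lee_fin.
by rewrite /Rintegral fineK//; exact: integrable_fin_num.
Qed.

Lemma rintegrable_of_le (f : T -> R) (A : R) : measurable_fun [set: T] f ->
  (forall x, 0 <= f x) -> (\int[mu]_x (f x)%:E <= A%:E)%E ->
  rintegrable mu f /\ \int[mu]_x f x <= A.
Proof.
move=> mf f0 fA.
have i : rintegrable mu f.
  apply/integrableP; split; first exact/measurable_EFinP.
  apply: le_lt_trans (ltry A); apply: le_trans fA.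
  rewrite le_eqVlt; apply/orP; left; apply/eqP; apply: eq_integral => x _.
  by rewrite /= ger0_norm.
split => //; rewrite -lee_fin /Rintegral fineK//; exact: integrable_fin_num.
Qed.

End RTools.

Section FluxProfile.
Context {R : realType} (a : R).
Hypothesis a0 : 0 < a.

(** An inverse square regularised at scale [a]. For [a] twice the damping times the initial time of
    a block, it dominates on that block the inverse square modulus of the cone symbol. *)
Definition lorentz (u : R) : R := (u ^+ 2 + a ^+ 2)^-1.
(** The primitive of [lorentz] that vanishes at minus infinity. It is bounded by [pi / a], and so is
    the total change of the multiplier built from it. *)
Definition lorprim (u : R) : R := (atan (u / a) + pi / 2) / a.

Lemma lorentz_den u : 0 < u ^+ 2 + a ^+ 2.
Proof. by rewrite ltr_wpDl ?sqr_ge0// exprn_gt0. Qed.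

Lemma lorentz_ge0 u : 0 <= lorentz u.
Proof. by rewrite invr_ge0 ltW// lorentz_den. Qed.

Lemma lorentz_le u : lorentz u <= a ^- 2.
Proof. by rewrite lef_pV2 ?posrE ?lorentz_den ?exprn_gt0// lerDr sqr_ge0. Qed.

Lemma norm_lorentz u : `|u| * lorentz u <= (2 * a)^-1.
Proof.
rewrite ler_pdivrMr ?lorentz_den// mulrC ler_pdivlMr ?mulr_gt0//.
have := sqr_ge0 (`|u| - a); rewrite sqrrB real_normK ?num_real// -mulr_natr.
by move: (`|u|) => v; lra.
Qed.

Lemma lorprim_ge0 u : 0 <= lorprim u.
Proof. by rewrite divr_ge0 ?(ltW a0)//; have := atan_gtNpi2 (u / a); lra. Qed.

Lemma lorprim_le u : lorprim u <= pi / a.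
Proof. by rewrite ler_pM2r ?invr_gt0//; have := atan_ltpi2 (u / a); lra. Qed.

Lemma is_derive_lorprim (f : R -> R) (t l : R) : is_derive t 1 f l ->
  is_derive t 1 (fun s => lorprim (f s)) (lorentz (f t) * l).
Proof.
move=> hf.
have h1 : is_derive t 1 (fun s => f s / a) (l / a).
  by apply: is_derive_eq; rewrite /GRing.scale/= mulr0 add0r mulrC.
have h2 := @is_derive1_comp R atan (fun s => f s / a) t _ _ (is_derive1_atan _) h1.
have h3 : is_derive t 1 (fun s => a^-1 * (atan (f s / a) + pi / 2))
    (a^-1 * ((1 + (f t / a) ^+ 2)^-1 * (l / a))).
  have -> : (fun s => a^-1 * (atan (f s / a) + pi / 2)) =
    (a^-1 \*: ((atan \o (fun s => f s / a)) + cst (pi / 2)))%R by [].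
  by apply: is_derive_eq; rewrite /GRing.scale/= addr0; congr (_ * _).
have -> : (fun s => lorprim (f s)) = (fun s => a^-1 * (atan (f s / a) + pi / 2)).
  by apply/funext => s; rewrite /lorprim mulrC.
apply: is_derive_eq; rewrite /lorentz; field.
by rewrite !gt_eqF ?lorentz_den//= addr_gt0 // exprn_gt0.
Qed.

Lemma continuous_lorentz : continuous lorentz.
Proof.
move=> u; apply: cvgV; first by rewrite gt_eqF// lorentz_den.
apply: cvgD; last exact: cvg_cst.
exact: exprn_continuous.
Qed.

Lemma continuous_lorprim : continuous lorprim.
Proof. by move=> u; exact: is_derive_continuous (is_derive_lorprim (is_derive_id u 1)). Qed.

End FluxProfile.

(** * The flux inequality *)

Section Flux.
Context {R : realType} (d : nat).
Local Notation TX := (measurableTypeR R * vec (R := R) d)%type.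
Variables (P dP : R -> vec (R := R) d -> R) (J dJ : 'I_d -> R -> vec (R := R) d -> R) (M A : R).
Hypothesis P0 : forall t x, 0 <= P t x.
Hypothesis PM : forall t x, P t x <= M.
Hypothesis dPM : forall t x, `|dP t x| <= M.
Hypothesis JP : forall l t x, `|J l t x| <= P t x.
Hypothesis dJM : forall l t x, `|dJ l t x| <= M.
Hypothesis hP : forall (t : R) x, is_derive t 1 (P^~ x) (dP t x).
Hypothesis cP : forall x, continuous (dP^~ x).
Hypothesis hJ : forall l t (x : 'rV[R]_d),
  is_derive (0 : R) 1 (fun s => J l t (x + s *: delta_mx 0 l)) (dJ l t x).
Hypothesis cJ : forall l t (x : 'rV[R]_d), continuous (fun s : R => dJ l t (x + s *: delta_mx 0 l)).
Hypothesis div0 : forall t x, dP t x + \sum_l dJ l t x = 0.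
Hypothesis mP : measurable_fun [set: TX] (fun p => P p.1 p.2).
Hypothesis mdP : measurable_fun [set: TX] (fun p => dP p.1 p.2).
Hypothesis mJ : forall l, measurable_fun [set: TX] (fun p => J l p.1 p.2).
Hypothesis mdJ : forall l, measurable_fun [set: TX] (fun p => dJ l p.1 p.2).
Hypothesis PA : forall t, (\int[vmu d]_x (P t x)%:E <= A%:E)%E.
Variables (y : 'rV[R]_d) (c a T : R).
Hypotheses (a0 : 0 < a) (T0 : 0 < T).

Let M0 : 0 <= M. Proof. exact: le_trans (P0 0 0) (PM 0 0). Qed.

(** With [c = e ^+ 2] this is minus the real part of the cone symbol at [z = e + i t]. *)
Definition cone (t : R) (x : 'rV[R]_d) : R := t ^+ 2 - dotv (x - y) (x - y) - c.

Lemma dotv_line (x u : 'rV[R]_d) (s : R) l :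
  dotv (x + s *: delta_mx 0 l - u) (x + s *: delta_mx 0 l - u) =
  dotv (x - u) (x - u) + 2 * s * (x - u) 0 l + s ^+ 2.
Proof.
have E : forall v w : 'rV[R]_d, dotv (v + w) (v + w) = dotv v v + 2 * dotv v w + dotv w w.
  move=> v w; rewrite !dotvE mulr_sumr -!big_split/=; apply: eq_bigr => i _.
  by rewrite !mxE; ring.
rewrite (_ : x + _ - u = (x - u) + s *: delta_mx 0 l); last by rewrite addrAC.
rewrite E; have D : forall v : 'rV[R]_d, dotv v (s *: delta_mx 0 l) = s * v 0 l.
  move=> v; rewrite dotvE (bigD1 l)//= big1 ?addr0; last first.
    by move=> i il; rewrite !mxE eqxx (negPf il)/= mulr0 mulr0.
  by rewrite !mxE !eqxx/= mulr1 mulrC.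
have El : (s *: delta_mx 0 l : 'rV[R]_d) 0 l = s by rewrite !mxE !eqxx mulr1.
by rewrite (D (x - u)) (D (s *: delta_mx 0 l)) El; ring.
Qed.

Lemma is_derive_dotv (x u : 'rV[R]_d) l :
  is_derive (0 : R) 1 (fun s : R => dotv (x + s *: delta_mx 0 l - u) (x + s *: delta_mx 0 l - u))
    (2 * (x - u) 0 l).
Proof.
under eq_fun do rewrite dotv_line.
by apply: is_derive_eq; rewrite /GRing.scale/=; ring.
Qed.

Lemma is_derive_cone_x t (x : 'rV[R]_d) l :
  is_derive (0 : R) 1 (fun s : R => cone t (x + s *: delta_mx 0 l)) (- (2 * (x - y) 0 l)).
Proof.
have h := is_derive_dotv x y l; rewrite /cone.
by apply: is_derive_eq; rewrite /GRing.scale/=; ring.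
Qed.

Lemma is_derive_cone_t (t : R) x : is_derive t 1 (cone^~ x) (2 * t).
Proof. by rewrite /cone; apply: is_derive_eq; rewrite /GRing.scale/=; ring. Qed.

Lemma measurable_cone : measurable_fun [set: TX] (fun p => cone p.1 p.2).
Proof.
apply: measurable_funB; last exact: measurable_cst.
apply: measurable_funB.
  by apply: measurable_funX; exact: measurable_fst.
have h : measurable_fun [set: TX] (fun p => (p.2 : 'rV[R]_d) - y : vec (R := R) d).
  by apply: measurable_vecB; [exact: measurable_snd|exact: measurable_cst].
exact: (measurable_dotv h h).
Qed.

Let mbb : measurable_fun [set: TX] (fun p => lorentz a (cone p.1 p.2)).
Proof.
by apply: (measurableT_comp _ measurable_cone); apply: continuous_measurable_fun; exact: continuous_lorentz.
Qed.

Let mBB : measurable_fun [set: TX] (fun p => lorprim a (cone p.1 p.2)).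
Proof.
by apply: (measurableT_comp _ measurable_cone); apply: continuous_measurable_fun; exact: continuous_lorprim.
Qed.

Section weighted.
Variable e : R.
Hypothesis e0 : 0 < e.

(** The density is integrable but the derivatives of the current are only bounded, so integration by
    parts needs a cutoff. Here [e] is the scale of this cutoff, not the damping; it tends to zero in
    [flux]. *)
Definition gcut (x : 'rV[R]_d) : R := expR (- (e ^+ 2 * dotv x x)).

Let gw0 x : 0 <= gcut x. Proof. exact: expR_ge0. Qed.

Let ee0 : 0 < e ^+ 2 / 2. Proof. by rewrite divr_gt0// exprn_gt0. Qed.

Lemma is_derive_gcut (x : 'rV[R]_d) l :
  is_derive (0 : R) 1 (fun s : R => gcut (x + s *: delta_mx 0 l)) (- (2 * e ^+ 2 * x 0 l) * gcut x).
Proof.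
have h := is_derive_dotv x 0 l.
have h1 : is_derive (0 : R) 1 (fun s : R => - (e ^+ 2 * dotv (x + s *: delta_mx 0 l) (x + s *: delta_mx 0 l)))
   (- (2 * e ^+ 2 * x 0 l)).
  move: h; under eq_fun do rewrite !subr0.
  rewrite subr0 => h; apply: is_derive_eq; rewrite /GRing.scale/=; ring.
have := @is_derive1_comp R expR _ 0 _ _ (is_derive_expR _) h1.
rewrite (_ : _ \o _ = (fun s : R => gcut (x + s *: delta_mx 0 l)))//.
move=> /is_derive_eq; apply; rewrite scale0r addr0 mulrC //.
Qed.

Lemma gcut_coord (x : 'rV[R]_d) l : (1 + `|x 0 l|) * gcut x <= 2 * (1 + 4 / e ^+ 2) * expR (- (e ^+ 2 / 2 * dotv x x)).
Proof.
have h := gauss_poly_bound (eucl x) (exprn_gt0 2 e0).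
rewrite /eucl sqr_sqrtr ?dotv_ge0// in h.
have hx : 1 + `|x 0 l| <= 2 * (1 + dotv x x).
  have := coord_le_eucl x l; have := dotv_ge0 x; rewrite /eucl => d0 hl.
  have hs := sqr_sqrtr d0.
  by move: (Num.sqrt _) hl hs => r hl hs; have := sqr_ge0 (r - 1); nra.
apply: (@le_trans _ _ (2 * (1 + dotv x x) * gcut x)); first by rewrite ler_wpM2r.
rewrite -[X in X <= _]mulrA -[X in _ <= X]mulrA ler_wpM2l//; apply: le_trans h _.
rewrite ler_wpM2r ?expR_ge0// lerD2l ler_wpM2r ?invr_ge0 ?sqr_ge0//; lra.
Qed.

Lemma gcut_le (x : 'rV[R]_d) : gcut x <= expR (- (e ^+ 2 / 2 * dotv x x)).
Proof.
rewrite ler_expR lerN2 ler_wpM2r ?dotv_ge0//; have := sqr_ge0 e; lra.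
Qed.

(** Makes the cutoff error of order [e]: of the factor [e ^+ 2] from differentiating the cutoff, one
    [e] is spent on the unbounded coordinate. *)
Lemma gcut_coord1 (x : 'rV[R]_d) l : e * `|x 0 l| * gcut x <= 1.
Proof.
rewrite /gcut expRN ler_pdivrMr ?expR_gt0// mul1r.
have := expR_ge1Dx (e ^+ 2 * dotv x x); apply: le_trans.
have := coord_le_eucl x l; have := dotv_ge0 x; rewrite /eucl => d0 hl.
have hs := sqr_sqrtr d0; have n0 := normr_ge0 (x 0 l).
rewrite -hs; move: (Num.sqrt _) hl hs => r hl hs.
have : e * `|x 0 l| <= e * r by rewrite ler_wpM2l ?(ltW e0).
by have := sqr_ge0 (e * r - 1); nra.
Qed.

(** The derivative in the [l]-th coordinate of [gcut * lorprim (cone) * J l]; the last term is due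
    to the cutoff. *)
Definition flux_field l (t : R) (x : 'rV[R]_d) : R :=
  gcut x * (lorprim a (cone t x) * dJ l t x) - gcut x * (lorentz a (cone t x) * (2 * (x - y) 0 l) * J l t x)
  - 2 * e ^+ 2 * x 0 l * gcut x * (lorprim a (cone t x) * J l t x).

Lemma is_derive_flux_field l t (x : 'rV[R]_d) :
  is_derive (0 : R) 1 (fun s : R => gcut (x + s *: delta_mx 0 l) *
     (lorprim a (cone t (x + s *: delta_mx 0 l)) * J l t (x + s *: delta_mx 0 l))) (flux_field l t x).
Proof.
have h1 := is_derive_gcut x l; have h2 := is_derive_lorprim a0 (is_derive_cone_x t x l).
have h3 := hJ l t x.
have x0 : x + 0 *: delta_mx 0 l = x by rewrite scale0r addr0.
by apply: is_derive_eq; rewrite !x0 /GRing.scale/= /flux_field; ring.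
Qed.

Definition flux_field_bound : R := pi / a * M + a ^- 2 * 2 * (1 + `|y|) * M + 2 * e ^+ 2 * (pi / a) * M.

Lemma flux_field_bound_ge0 : 0 <= flux_field_bound.
Proof.
have p0 := @pi_ge0 R.
have pa : 0 <= pi / a by rewrite divr_ge0 ?(ltW a0).
have aa : 0 <= a ^- 2 by rewrite invr_ge0 sqr_ge0.
have e2 := sqr_ge0 e; have y0 : 0 <= 1 + `|y| by rewrite addr_ge0.
rewrite /flux_field_bound; move: (pi / a) (a ^- 2) (e ^+ 2) (1 + `|y|) pa aa e2 y0 => u1 u2 u3 u4 p1 p2 p3 p4.
by do 2?[apply: addr_ge0]; do ?[apply: mulr_ge0].
Qed.

Let JM l t x : `|J l t x| <= M. Proof. exact: le_trans (JP l t x) (PM t x). Qed.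

Lemma norm_flux_field l t x : `|flux_field l t x| <= flux_field_bound * ((1 + `|x 0 l|) * gcut x).
Proof.
have p0 := @pi_ge0 R; have g0 := gw0 x.
have hB : `|lorprim a (cone t x)| <= pi / a by rewrite ger0_norm ?lorprim_ge0 ?lorprim_le.
have hb : `|lorentz a (cone t x)| <= a ^- 2 by rewrite ger0_norm ?lorentz_ge0 ?lorentz_le.
have pa : 0 <= pi / a by rewrite divr_ge0 ?(ltW a0).
have aa : 0 <= a ^- 2 by rewrite invr_ge0 sqr_ge0.
(* Here [|y|] is the sup norm of the row vector. *)
have hy : `|(x - y) 0 l| <= (1 + `|y|) * (1 + `|x 0 l|).
  rewrite !mxE; apply: le_trans (ler_normB _ _) _.
  have : `|y 0 l| <= `|y| by rewrite [X in _ <= X]/Num.norm/= mx_normrE; apply: (le_bigmax _ (fun ij => `|y ij.1 ij.2|) (0, l)).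
  by have := normr_ge0 (x 0 l); have := normr_ge0 (y 0 l); move: (`|y|) (`|y 0 l|) (`|x 0 l|) => p q r; nra.
have n1 : 1 <= 1 + `|x 0 l| by rewrite lerDl.
have h1 : `|gcut x * (lorprim a (cone t x) * dJ l t x)| <= gcut x * (pi / a * M).
  by rewrite normrM ger0_norm// ler_wpM2l// normrM; apply: ler_pM.
have h2 : `|gcut x * (lorentz a (cone t x) * (2 * (x - y) 0 l) * J l t x)| <=
    gcut x * (a ^- 2 * (2 * ((1 + `|y|) * (1 + `|x 0 l|))) * M).
  rewrite normrM ger0_norm// ler_wpM2l// normrM; apply: ler_pM => //.
  by rewrite normrM; apply: ler_pM => //; rewrite normrM ger0_norm// ler_wpM2l.
have h3 : `|2 * e ^+ 2 * x 0 l * gcut x * (lorprim a (cone t x) * J l t x)| <=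
    2 * e ^+ 2 * `|x 0 l| * gcut x * (pi / a * M).
  have e2 := sqr_ge0 e.
  rewrite normrM; apply: ler_pM => //; last by rewrite normrM; apply: ler_pM.
  rewrite normrM (ger0_norm g0) ler_wpM2r// normrM ler_wpM2r//.
  by rewrite ger0_norm// mulr_ge0.
rewrite /flux_field; apply: le_trans (ler_normB _ _) _; apply: le_trans (lerD (ler_normB _ _) (lexx _)) _.
apply: le_trans (lerD (lerD h1 h2) h3) _.
have -> : gcut x * (pi / a * M) + gcut x * (a ^- 2 * (2 * ((1 + `|y|) * (1 + `|x 0 l|))) * M) +
  2 * e ^+ 2 * `|x 0 l| * gcut x * (pi / a * M) = (pi / a * M + a ^- 2 * 2 * (1 + `|y|) * M * (1 + `|x 0 l|)
   + 2 * e ^+ 2 * (pi / a) * M * `|x 0 l|) * gcut x.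
  by move: (pi / a) (a ^- 2) => u1 u2; ring.
rewrite [X in _ <= X]mulrA ler_wpM2r// /flux_field_bound.
have k1 : 0 <= pi / a * M by rewrite mulr_ge0.
have k3 : 0 <= 2 * e ^+ 2 * (pi / a) * M by have := sqr_ge0 e; move: (e ^+ 2) => e2 ?; apply: mulr_ge0 => //; apply: mulr_ge0 => //; apply: mulr_ge0.
move: (pi / a * M) (a ^- 2 * _ * _ * _) (2 * e ^+ 2 * _ * _) k1 k3 => u1 u2 u3 k1 k3.
by have := mulr_ge0 k1 (normr_ge0 (x 0 l)); lra.
Qed.

Lemma measurable_gcut : measurable_fun [set: vec (R := R) d] gcut.
Proof.
apply: measurableT_comp => //; apply: measurable_funN; apply: measurable_funM; first exact: measurable_cst.
by apply: measurable_dotv; exact: measurable_id.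
Qed.

Let mgw : measurable_fun [set: TX] (fun p => gcut p.2).
Proof. exact: (measurableT_comp measurable_gcut measurable_snd). Qed.

Let mcoord (u : 'rV[R]_d) l : measurable_fun [set: TX] (fun p => ((p.2 : 'rV[R]_d) - u) 0 l).
Proof.
have h : measurable_fun [set: TX] (fun p => (p.2 : 'rV[R]_d) - u : vec (R := R) d).
  by apply: measurable_vecB; [exact: measurable_snd|exact: measurable_cst].
exact: (measurableT_comp (@measurable_vec_coord R d l) h).
Qed.

Let mcoord0 l : measurable_fun [set: TX] (fun p => (p.2 : 'rV[R]_d) 0 l).
Proof. exact: (measurableT_comp (@measurable_vec_coord R d l) measurable_snd). Qed.

Lemma measurable_flux_field l : measurable_fun [set: TX] (fun p => flux_field l p.1 p.2).
Proof.
apply: measurable_funB; first apply: measurable_funB.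
- by apply: measurable_funM => //; apply: measurable_funM.
- apply: measurable_funM => //; apply: measurable_funM => //; apply: measurable_funM => //.
  by apply: measurable_funM => //; exact: measurable_cst.
- apply: measurable_funM; last by apply: measurable_funM.
  by apply: measurable_funM => //; apply: measurable_funM => //; exact: measurable_cst.
Qed.

Lemma continuous_flux_field l t (x : 'rV[R]_d) : continuous (fun s : R => flux_field l t (x + s *: delta_mx 0 l)).
Proof.
have shift (h : R -> R) (dh : R -> R) (H : forall s : R, is_derive (0 : R) 1 (fun u => h (s + u)) (dh s)) : continuous h.
  by move=> s; have D := @is_derive_at0 R h s (dh s) (H s); exact: (@is_derive_continuous R h s (dh s) D).
have xs s u : x + (s + u) *: delta_mx 0 l = (x + s *: delta_mx 0 l) + u *: delta_mx 0 l.
  by rewrite scalerDl addrA.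
have c1 : continuous (fun s : R => gcut (x + s *: delta_mx 0 l)).
  apply: (shift _ (fun s => - (2 * e ^+ 2 * (x + s *: delta_mx 0 l) 0 l) * gcut (x + s *: delta_mx 0 l))) => s.
  by under eq_fun do rewrite xs; exact: is_derive_gcut.
have c2 : continuous (fun s : R => cone t (x + s *: delta_mx 0 l)).
  apply: (shift _ (fun s => - (2 * (x + s *: delta_mx 0 l - y) 0 l))) => s.
  by under eq_fun do rewrite xs; exact: is_derive_cone_x.
have c3 : continuous (fun s : R => J l t (x + s *: delta_mx 0 l)).
  apply: (shift _ (fun s => dJ l t (x + s *: delta_mx 0 l))) => s.
  by under eq_fun do rewrite xs; exact: hJ.
have c4 : continuous (fun s : R => lorprim a (cone t (x + s *: delta_mx 0 l))).
  by move=> s; apply: (@continuous_comp _ _ _ (fun s : R => cone t (x + s *: delta_mx 0 l)) (lorprim a)); [exact: c2|exact: continuous_lorprim].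
have c5 : continuous (fun s : R => lorentz a (cone t (x + s *: delta_mx 0 l))).
  by move=> s; apply: (@continuous_comp _ _ _ (fun s : R => cone t (x + s *: delta_mx 0 l)) (lorentz a)); [exact: c2|exact: continuous_lorentz].
have c6 u : continuous (fun s : R => (x + s *: delta_mx 0 l - u) 0 l).
  under eq_fun do rewrite mxE line_coord.
  move=> s; apply: cvgD; last exact: cvg_cst.
  by apply: cvgD; [exact: cvg_cst|apply: cvgM; [exact: cvg_id|exact: cvg_cst]].
have c7 : continuous (fun s : R => (x + s *: delta_mx 0 l) 0 l).
  by have := c6 0; under eq_fun do rewrite subr0.
move=> s; apply: cvgB; first apply: cvgB.
- by apply: cvgM; [exact: c1|apply: cvgM; [exact: c4|exact: cJ]].
- apply: cvgM; [exact: c1|apply: cvgM; last exact: c3].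
  by apply: cvgM; [exact: c5|apply: cvgM; [exact: cvg_cst|exact: c6]].
- apply: cvgM; last by apply: cvgM; [exact: c4|exact: c3].
  by apply: cvgM; last exact: c1; apply: cvgM; [exact: cvg_cst|exact: c7].
Qed.

Lemma Rintegral_flux_field l t : \int[vmu d]_x flux_field l t x = 0.
Proof.
have c0 : 0 <= flux_field_bound * (2 * (1 + 4 / e ^+ 2)).
  by rewrite mulr_ge0 ?flux_field_bound_ge0// mulr_ge0// addr_ge0// divr_ge0// sqr_ge0.
apply: (@vmu_derive0 _ d l (fun x => gcut x * (lorprim a (cone t x) * J l t x)) _
  (pi / a * M + flux_field_bound * (2 * (1 + 4 / e ^+ 2))) (e ^+ 2 / 2) ee0).
- exact: (measurableT_comp (measurable_flux_field l) (measurable_pair1 t)).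
- by move=> x; exact: is_derive_flux_field.
- by move=> x; exact: continuous_flux_field.
- move=> x; rewrite normrM ger0_norm// mulrC; apply: ler_pM => //; last exact: gcut_le.
  rewrite normrM; apply: le_trans (_ : pi / a * M <= _); last by rewrite lerDl.
  by apply: ler_pM => //; rewrite ger0_norm ?lorprim_ge0 ?lorprim_le.
- move=> x; apply: le_trans (norm_flux_field l t x) _.
  apply: le_trans (ler_wpM2l flux_field_bound_ge0 (gcut_coord x l)) _.
  rewrite mulrA ler_wpM2r ?expR_ge0// lerDr mulr_ge0// divr_ge0 ?(ltW a0)// pi_ge0//.
Qed.

Local Notation mu2 := (leb \x vmu d)%E.

Definition chi (t : R) : R := \1_(`[T, 2 * T]%classic : set R) t.

Let T2 : T < 2 * T. Proof. by move: T0; lra. Qed.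

Lemma chi_ge0 t : 0 <= chi t. Proof. by rewrite /chi indicE. Qed.

Lemma rintegrable_chi : rintegrable leb chi.
Proof. exact: integrable_indic_itv. Qed.

Lemma Rintegral_chi : \int[leb]_t chi t = T.
Proof.
rewrite /Rintegral integral_indic// setIT /leb /= lebesgue_measure_itv/= lte_fin T2 /=.
by move: T0; lra.
Qed.

Lemma chi_le t (u v : R) : (T <= t -> t <= 2 * T -> u <= v) -> chi t * u <= chi t * v.
Proof.
move=> h; rewrite /chi indicE; case: (boolP (t \in _)); last by rewrite !mul0r.
by rewrite inE/= in_itv/= => /andP[h1 h2]; rewrite !mul1r h.
Qed.

Let mchi : measurable_fun [set: TX] (fun p => chi p.1).
Proof. exact: (measurableT_comp (rintegrable_measurable rintegrable_chi) measurable_fst). Qed.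

Let iw : rintegrable mu2 (fun p => chi p.1 * expR (- (e ^+ 2 / 2 * dotv p.2 p.2))).
Proof. exact: (integrable_prodM rintegrable_chi (rintegrable_vgaussw d ee0)). Qed.

Let dom_chi (F : R -> 'rV[R]_d -> R) (C : R) : measurable_fun [set: TX] (fun p => F p.1 p.2) ->
  (forall t x, T <= t -> t <= 2 * T -> `|F t x| <= C * expR (- (e ^+ 2 / 2 * dotv x x))) ->
  rintegrable mu2 (fun p => chi p.1 * F p.1 p.2).
Proof.
move=> mF FC; apply: (rintegrable_le _ (rintegrableZ C iw)); first exact: measurable_funM.
move=> [t x] /=; rewrite normrM ger0_norm ?chi_ge0// mulrCA; apply: chi_le => h1 h2.
exact: FC.
Qed.

(** The time derivative of [gcut * lorprim (cone) * P]. *)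
Definition flux_source (t : R) (x : 'rV[R]_d) : R := gcut x * (2 * t * lorentz a (cone t x) * P t x + lorprim a (cone t x) * dP t x).

Lemma rintegrable_flux_source : rintegrable mu2 (fun p => chi p.1 * flux_source p.1 p.2).
Proof.
apply: (@dom_chi flux_source (4 * T * a ^- 2 * M + pi / a * M)).
  apply: measurable_funM => //; apply: measurable_funD; last by apply: measurable_funM.
  apply: measurable_funM => //; apply: measurable_funM => //.
  by apply: measurable_funM; [exact: measurable_cst|exact: measurable_fst].
move=> t x h1 h2; have t0 : 0 <= t by apply: le_trans h1; exact: ltW.
rewrite /flux_source normrM ger0_norm// mulrC; apply: ler_pM => //; last exact: gcut_le.
apply: le_trans (ler_normD _ _) _; apply: lerD; rewrite normrM.
  rewrite !normrM; apply: ler_pM => //; last by rewrite ger0_norm.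
  apply: ler_pM => //; last by rewrite ger0_norm ?lorentz_ge0 ?lorentz_le.
  by rewrite !ger0_norm//; lra.
by apply: ler_pM => //; rewrite ger0_norm ?lorprim_ge0 ?lorprim_le.
Qed.

Lemma FTC_flux_source x : \int[leb]_t (chi t * flux_source t x) =
  gcut x * (lorprim a (cone (2 * T) x) * P (2 * T) x) - gcut x * (lorprim a (cone T x) * P T x).
Proof.
pose F t := gcut x * (lorprim a (cone t x) * P t x).
have hF (t : R) : is_derive t 1 F (flux_source t x).
  have h1 := is_derive_lorprim a0 (is_derive_cone_t t x); have h2 := hP t x.
  by apply: is_derive_eq; rewrite /GRing.scale/= /flux_source; ring.
have cE : continuous (flux_source^~ x).
  have cs : continuous (cone^~ x) by move=> t; exact: is_derive_continuous (is_derive_cone_t t x).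
  move=> t; apply: cvgM; first exact: cvg_cst.
  apply: cvgD; apply: cvgM.
  - apply: cvgM; first by apply: cvgM; [exact: cvg_cst|exact: cvg_id].
    by apply: (@continuous_comp _ _ _ (cone^~ x) (lorentz a)); [exact: cs|exact: continuous_lorentz].
  - exact: (is_derive_continuous (hP t x)).
  - by apply: (@continuous_comp _ _ _ (cone^~ x) (lorprim a)); [exact: cs|exact: continuous_lorprim].
  - exact: cP.
rewrite /Rintegral.
have -> : (\int[leb]_t (chi t * flux_source t x)%:E = \int[leb]_(t in `[T, (2 * T)%R]) (flux_source t x)%:E)%E.
  rewrite [RHS]integral_mkcond; apply: eq_integral => t _.
  by rewrite patchE /chi indicE; case: (t \in _); rewrite ?mul1r ?mul0r.
have dE : F^`() = flux_source^~ x by apply/funext => t; rewrite derive1E; case: (hF t).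
have cF : continuous F by move=> t; exact: is_derive_continuous (hF t).
rewrite (@continuous_FTC2 _ (flux_source^~ x) F T (2 * T) T2)//.
- exact: continuous_subspaceT.
- split; first by move=> t _; case: (hF t).
    by apply: cvg_at_right_filter; exact: cF.
  by apply: cvg_at_left_filter; exact: cF.
- by move=> t _; rewrite dE.
Qed.

Let mPt t : measurable_fun [set: vec (R := R) d] (P t).
Proof. exact: (measurableT_comp mP (measurable_pair1 t)). Qed.

Let iP t : rintegrable (vmu d) (P t) /\ \int[vmu d]_x P t x <= A.
Proof. by apply: rintegrable_of_le => //; exact: mPt. Qed.

Let pa0 : 0 <= pi / a. Proof. by rewrite divr_ge0 ?(ltW a0)// pi_ge0. Qed.

Let gw1 x : gcut x <= 1.
Proof. by rewrite -[X in _ <= X]expR0 ler_expR oppr_le0; apply: mulr_ge0; [exact: sqr_ge0|exact: dotv_ge0]. Qed.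

Let BP0 t x : 0 <= lorprim a (cone t x) * P t x.
Proof. by apply: mulr_ge0 => //; exact: lorprim_ge0. Qed.

Let gwBP t x : gcut x * (lorprim a (cone t x) * P t x) <= pi / a * P t x.
Proof.
apply: (@le_trans _ _ (lorprim a (cone t x) * P t x)); first by rewrite ler_piMl.
by rewrite ler_wpM2r// lorprim_le.
Qed.

Let iPw t : rintegrable (vmu d) (fun x => gcut x * (lorprim a (cone t x) * P t x)).
Proof.
apply: (rintegrable_le _ (rintegrableZ (pi / a) (iP t).1)).
  apply: measurable_funM; first exact: measurable_gcut.
  apply: measurable_funM; last exact: mPt.
  exact: (measurableT_comp mBB (measurable_pair1 t)).
by move=> x; rewrite ger0_norm ?gwBP//; apply: mulr_ge0.
Qed.

(** The time integral reduces to boundary values at [2 * T] and [T]; the latter enters with a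
    favourable sign and is dropped. *)
Lemma Rintegral_flux_source : \int[mu2]_p (chi p.1 * flux_source p.1 p.2) <= pi / a * A.
Proof.
rewrite -(Rintegral21 (m1 := leb) (m2 := vmu d) (f := fun p : TX => chi p.1 * flux_source p.1 p.2) rintegrable_flux_source) /=.
under eq_Rintegral do rewrite FTC_flux_source.
apply: (@le_trans _ _ (\int[vmu d]_x (pi / a * P (2 * T) x))); last first.
  rewrite (RintegralZl _ measurableT (iP (2 * T)).1).
  by apply: ler_wpM2l => //; exact: (iP (2 * T)).2.
apply: (le_Rintegral measurableT _ (rintegrableZ (pi / a) (iP (2 * T)).1)).
  apply: (rintegrableD (iPw (2 * T)) _).
  by apply: eq_rintegrable (rintegrableZ (-1) (iPw T)) => x; rewrite mulN1r.
move=> x _; apply: le_trans (gwBP (2 * T) x); rewrite gerBl; exact: mulr_ge0.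
Qed.

Lemma chiP : rintegrable mu2 (fun p => chi p.1 * P p.1 p.2) /\
  \int[mu2]_p (chi p.1 * P p.1 p.2) <= T * A.
Proof.
have m1 : measurable_fun [set: TX] (fun p => chi p.1 * P p.1 p.2) by exact: measurable_funM.
apply: rintegrable_of_le => //; first by move=> p; rewrite mulr_ge0// chi_ge0.
rewrite (fubini_tonelli1 (m1 := leb) (m2 := vmu d) (fun p : TX => (chi p.1 * P p.1 p.2)%:E)); last 2 first.
- exact/measurable_EFinP.
- by move=> p; rewrite lee_fin mulr_ge0// chi_ge0.
have A0 : 0 <= A.
  by rewrite -lee_fin; apply: le_trans (PA 0); apply: integral_ge0 => x _; rewrite lee_fin.
apply: (@le_trans _ _ (\int[leb]_t (chi t * A)%:E)%E).
  apply: ge0_le_integral => //.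
  - by move=> t _; apply: integral_ge0 => x _; rewrite lee_fin mulr_ge0// chi_ge0.
  - apply: measurable_fun_fubini_tonelli_F; first exact/measurable_EFinP.
    by move=> p; rewrite lee_fin mulr_ge0// chi_ge0.
  - apply/measurable_EFinP; apply: measurable_funM; last exact: measurable_cst.
    exact: rintegrable_measurable rintegrable_chi.
  - move=> t _; rewrite /fubini_F /=.
    under eq_integral do rewrite EFinM.
    rewrite ge0_integralZl//; last 3 first.
    + by apply/measurable_EFinP; exact: (mPt t).
    + by move=> x _; rewrite lee_fin.
    + by rewrite lee_fin chi_ge0.
    by rewrite EFinM lee_wpmul2l ?lee_fin ?chi_ge0//.
under eq_integral do rewrite EFinM.
rewrite ge0_integralZr//; last 2 first.
- by apply/measurable_EFinP; exact: (rintegrable_measurable rintegrable_chi).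
- by move=> t _; rewrite lee_fin chi_ge0.
rewrite EFinM lee_wpmul2r ?lee_fin// -Rintegral_chi /Rintegral fineK//.
exact: (integrable_fin_num measurableT rintegrable_chi).
Qed.

Definition cut_err l (t : R) (x : 'rV[R]_d) : R := 2 * e ^+ 2 * x 0 l * gcut x * (lorprim a (cone t x) * J l t x).

Let norm_cut_err l t x : `|cut_err l t x| <= 2 * e * (pi / a) * P t x.
Proof.
have -> : cut_err l t x = 2 * e * (e * x 0 l * gcut x) * (lorprim a (cone t x) * J l t x) by rewrite /cut_err; ring.
have h1 : `|e * x 0 l * gcut x| <= 1.
  rewrite normrM normrM (gtr0_norm e0) (ger0_norm (gw0 x)); exact: gcut_coord1.
rewrite normrM normrM (_ : `|2 * e| = 2 * e); last by rewrite ger0_norm// mulr_ge0// ltW.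
rewrite -[X in _ <= X]mulrA; apply: ler_pM => //.
- by rewrite mulr_ge0// mulr_ge0// ltW.
- by rewrite ler_piMr// mulr_ge0// ltW.
- rewrite normrM; apply: ler_pM => //; by rewrite ger0_norm ?lorprim_ge0 ?lorprim_le.
Qed.

Let measurable_cut_err l : measurable_fun [set: TX] (fun p => cut_err l p.1 p.2).
Proof.
apply: measurable_funM; last by apply: measurable_funM.
by apply: measurable_funM => //; apply: measurable_funM => //; exact: measurable_cst.
Qed.

Let rint_cut_err l : rintegrable mu2 (fun p => chi p.1 * cut_err l p.1 p.2) /\
  \int[mu2]_p (chi p.1 * cut_err l p.1 p.2) <= 2 * e * (pi / a) * (T * A).
Proof.
have iB := rintegrableZ (2 * e * (pi / a)) chiP.1.
have b0 : 0 <= 2 * e * (pi / a) by rewrite mulr_ge0// mulr_ge0// ltW.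
have iE : rintegrable mu2 (fun p => chi p.1 * cut_err l p.1 p.2).
  apply: (rintegrable_le _ iB); first exact: measurable_funM.
  move=> [t x] /=; rewrite normrM (ger0_norm (chi_ge0 t)) mulrCA ler_wpM2l ?chi_ge0//.
split => //.
apply: (@le_trans _ _ (\int[mu2]_p (2 * e * (pi / a) * (chi p.1 * P p.1 p.2)))).
  apply: (le_Rintegral measurableT iE iB) => -[t x] _ /=.
  rewrite [X in _ <= X]mulrCA ler_wpM2l ?chi_ge0//; exact: le_trans (ler_norm _) (norm_cut_err l t x).
rewrite (RintegralZl _ measurableT chiP.1); apply: ler_wpM2l => //; exact: chiP.2.
Qed.

Let rint_flux_field l : rintegrable mu2 (fun p => chi p.1 * flux_field l p.1 p.2) /\
  \int[mu2]_p (chi p.1 * flux_field l p.1 p.2) = 0.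
Proof.
have i : rintegrable mu2 (fun p => chi p.1 * flux_field l p.1 p.2).
  apply: (@dom_chi (flux_field l) (flux_field_bound * (2 * (1 + 4 / e ^+ 2)))); first exact: measurable_flux_field.
  move=> t x _ _; apply: le_trans (norm_flux_field l t x) _.
  by apply: le_trans (ler_wpM2l flux_field_bound_ge0 (gcut_coord x l)) _; rewrite mulrA.
split => //.
rewrite -(Rintegral12 (m1 := leb) (m2 := vmu d) (f := fun p : TX => chi p.1 * flux_field l p.1 p.2) i) /=.
have iG t : rintegrable (vmu d) (flux_field l t).
  apply: (rintegrable_le _ (rintegrableZ (flux_field_bound * (2 * (1 + 4 / e ^+ 2))) (rintegrable_vgaussw d ee0))).
    exact: (measurableT_comp (measurable_flux_field l) (measurable_pair1 t)).
  move=> x; apply: le_trans (norm_flux_field l t x) _.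
  by apply: le_trans (ler_wpM2l flux_field_bound_ge0 (gcut_coord x l)) _; rewrite mulrA.
under eq_Rintegral do rewrite (RintegralZl _ measurableT (iG _)) Rintegral_flux_field mulr0.
by rewrite /Rintegral integral0.
Qed.

Definition flux_err (t : R) (x : 'rV[R]_d) : R :=
  gcut x * (lorentz a (cone t x) * (2 * (t * P t x - \sum_l (x - y) 0 l * J l t x))).

(** Conservation of the current cancels the terms in which [P] and [J] are differentiated, so the
    derivatives fall only on the multiplier, giving the flux, and on the cutoff, giving the
    error. *)
Lemma flux_errE t x : flux_err t x = flux_source t x + (\sum_l cut_err l t x + \sum_l flux_field l t x).
Proof.
rewrite -big_split/=.
have -> : \sum_l (cut_err l t x + flux_field l t x) = gcut x * lorprim a (cone t x) * \sum_l dJ l t x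
   - gcut x * lorentz a (cone t x) * 2 * \sum_l (x - y) 0 l * J l t x.
  rewrite !mulr_sumr -sumrB; apply: eq_bigr => l _.
  by rewrite /cut_err /flux_field; move: ((x - y) 0 l) => u; ring.
have -> : \sum_l dJ l t x = - dP t x by apply/eqP; rewrite -addr_eq0 addrC div0.
by rewrite /flux_err /flux_source; ring.
Qed.

Lemma rint_flux_err : rintegrable mu2 (fun p => chi p.1 * flux_err p.1 p.2) /\
  \int[mu2]_p (chi p.1 * flux_err p.1 p.2) <= pi / a * A + d%:R * (2 * e * (pi / a) * (T * A)).
Proof.
have [i2 I2] := Rintegral_sum (fun l => (rint_cut_err l).1).
have [i3 I3] := Rintegral_sum (fun l => (rint_flux_field l).1).
have i23 := rintegrableD i2 i3; have i1 := rintegrableD rintegrable_flux_source i23.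
have E p : chi p.1 * flux_source p.1 p.2 + (\sum_l chi p.1 * cut_err l p.1 p.2 + \sum_l chi p.1 * flux_field l p.1 p.2) =
   chi p.1 * flux_err p.1 p.2.
  by rewrite flux_errE -!mulr_sumr; ring.
split; first by apply: eq_rintegrable i1 => p; rewrite E.
rewrite [X in X <= _](_ : _ = \int[mu2]_p (chi p.1 * flux_source p.1 p.2 +
   (\sum_l chi p.1 * cut_err l p.1 p.2 + \sum_l chi p.1 * flux_field l p.1 p.2))); last first.
  by apply: eq_Rintegral => p _; rewrite E.
rewrite (RintegralD measurableT rintegrable_flux_source i23) (RintegralD measurableT i2 i3) I2 I3.
apply: lerD; first exact: Rintegral_flux_source.
rewrite [X in _ + X]big1 ?addr0; last by move=> l _; exact: (rint_flux_field l).2.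
apply: (@le_trans _ _ (\sum_(l < d) (2 * e * (pi / a) * (T * A)))).
  by apply: ler_sum => l _; exact: (rint_cut_err l).2.
by rewrite sumr_const card_ord -[X in X <= _]mulr_natl.
Qed.

End weighted.

(** For the Dirac current this is the square norm of [nullv]. It equals
    [2 t (t P - (x - y) . J) - cone P], the flux up to a term that vanishes on the cone. *)
Definition null_density (t : R) (x : 'rV[R]_d) : R :=
  (c + t ^+ 2 + dotv (x - y) (x - y)) * P t x - 2 * t * \sum_l (x - y) 0 l * J l t x.

Lemma measurable_null_density : measurable_fun [set: TX] (fun p => null_density p.1 p.2).
Proof.
have h : measurable_fun [set: TX] (fun p => (p.2 : 'rV[R]_d) - y : vec (R := R) d).
  by apply: measurable_vecB; [exact: measurable_snd|exact: measurable_cst].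
apply: measurable_funB.
  apply: measurable_funM => //; apply: measurable_funD; last exact: (measurable_dotv h h).
  by apply: measurable_funD; [exact: measurable_cst|apply: measurable_funX; exact: measurable_fst].
apply: measurable_funM.
  by apply: measurable_funM; [exact: measurable_cst|exact: measurable_fst].
apply: measurable_sum => l; apply: measurable_funM => //.
exact: (measurableT_comp (@measurable_vec_coord R d l) h).
Qed.

Hypothesis NN0 : forall t x, 0 <= null_density t x.

(** The first term of the constant comes from the boundary values of the multiplier. The second pays
    for the term [cone * P] by which [null_density] differs from the flux, through [norm_lorentz].
    The cutoff error is proportional to the cutoff scale [1 / (n + 1)] and is removed with the
    weight. *)
Lemma flux : (\int[leb \x vmu d]_p (chi p.1 * (lorentz a (cone p.1 p.2) * null_density p.1 p.2))%:E <=
  (2 * T * (pi / a * A + (2 * a)^-1 * A))%:E)%E.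
Proof.
have mchi : measurable_fun [set: TX] (fun p => chi p.1).
  exact: (measurableT_comp (rintegrable_measurable rintegrable_chi) measurable_fst).
apply: (@integral_weight_removal _ _ _ _ (fun p : TX => dotv p.2 p.2) _ _
  (2 * T * (d%:R * (2 * (pi / a) * (T * A))))).
- by apply: measurable_dotv; exact: measurable_snd.
- by apply: measurable_funM => //; apply: measurable_funM => //; exact: measurable_null_density.
- by move=> p; exact: dotv_ge0.
- by move=> p; rewrite mulr_ge0 ?chi_ge0// mulr_ge0 ?lorentz_ge0.
move=> n; set e := n.+1%:R^-1.
have e0 : 0 < e by rewrite invr_gt0.
have [i0 I0] := rint_flux_err e0; have [iP IP] := chiP.
have iZ := rintegrableZ (2 * T) (rintegrableD i0 (rintegrableZ ((2 * a * T)^-1) iP)).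
have gw1 x : gcut e x <= 1.
  by rewrite -[X in _ <= X]expR0 ler_expR oppr_le0; apply: mulr_ge0; [exact: sqr_ge0|exact: dotv_ge0].
have gw0 x : 0 <= gcut e x by exact: expR_ge0.
apply: le_trans (integral_le_Rintegral _ _ _ iZ) _.
- apply: measurable_funM; last by apply: measurable_funM => //; apply: measurable_funM => //; exact: measurable_null_density.
  exact: (measurableT_comp (measurable_gcut e) measurable_snd).
- by move=> p; rewrite mulr_ge0 ?expR_ge0// mulr_ge0 ?chi_ge0// mulr_ge0 ?lorentz_ge0.
- move=> [t x] /=; rewrite -/(gcut e x) [(2 * a * T)^-1 * _]mulrCA -mulrDr [X in X <= _]mulrCA [X in _ <= X]mulrCA.
  apply: chi_le => h1 h2.
  have t0 : 0 < t by exact: lt_le_trans h1.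
  have EN : flux_err e t x = gcut e x * (lorentz a (cone t x) * null_density t x) / t + gcut e x * (cone t x * lorentz a (cone t x)) * P t x / t.
    have -> : null_density t x = 2 * t * (t * P t x - \sum_l (x - y) 0 l * J l t x) - cone t x * P t x.
      by rewrite /null_density /cone; ring.
    rewrite /flux_err; field; rewrite gt_eqF//.
  (* The flux identity controls the null density divided by [t], and [t <= 2 * T] on the block. *)
  have Nt : gcut e x * (lorentz a (cone t x) * null_density t x) <= 2 * T * (gcut e x * (lorentz a (cone t x) * null_density t x) / t).
    rewrite [X in _ <= X]mulrCA ler_peMr//; last by rewrite ler_pdivlMr// mul1r.
    by rewrite mulr_ge0// mulr_ge0 ?lorentz_ge0.
  apply: le_trans Nt _; rewrite ler_wpM2l ?mulr_ge0 ?(ltW T0)// EN -addrA lerDl.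
  have : - (gcut e x * (cone t x * lorentz a (cone t x)) * P t x / t) <= (2 * a * T)^-1 * P t x.
    apply: le_trans (ler_norm _) _; rewrite normrN normrM normrM (ger0_norm (P0 t x)).
    rewrite [X in X <= _]mulrAC ler_wpM2r// invfM; apply: ler_pM => //.
      rewrite normrM (ger0_norm (gw0 x)) -[X in _ <= X]mul1r; apply: ler_pM => //.
      by rewrite normrM (ger0_norm (lorentz_ge0 a0 _)) norm_lorentz.
    by rewrite ger0_norm ?invr_ge0 ?(ltW t0)// lef_pV2.
  by lra.
rewrite lee_fin (RintegralZl _ measurableT (rintegrableD i0 (rintegrableZ ((2 * a * T)^-1) iP))).
rewrite (RintegralD measurableT i0 (rintegrableZ ((2 * a * T)^-1) iP)) (RintegralZl _ measurableT iP).
have q0 : 0 <= (2 * a * T)^-1 by rewrite invr_ge0 !mulr_ge0 ?(ltW a0) ?(ltW T0).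
have h := lerD I0 (ler_wpM2l q0 IP).
have T20 : 0 <= 2 * T by rewrite mulr_ge0 ?(ltW T0).
apply: le_trans (ler_wpM2l T20 h) _.
rewrite le_eqVlt; apply/orP; left; apply/eqP.
have -> : (2 * a * T)^-1 * (T * A) = (2 * a)^-1 * A by field; rewrite !gt_eqF.
by move: (pi / a) (2 * a)^-1 => u1 u2; ring.
Qed.

End Flux.

(** * The Dirac current *)

Section MultCalculus.
Context {R : realType} (d N : nat) (gamma : 'I_d.+1 -> 'M[R[i]]_N) (m : R).
Local Notation TX := (measurableTypeR R * vec (R := R) d)%type.
Variables (f : 'rV[R]_d -> 'cV[R[i]]_N) (rho : R).
Hypotheses (f1 : in_L1 f) (fsupp : fourier_supp_ball f rho) (rho0 : 0 <= rho).

(** Boundedness is asked on the Fourier support only, so the class is stable under multiplication by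
    [om] and by coordinates, that is, under differentiation of the field. *)
Definition symb (b : 'rV[R]_d -> R[i]) :=
  mcfun (b : vec d -> R[i]) /\ exists M, forall xi, eucl xi <= rho -> cmod (b xi) <= M.

Lemma symb1 : symb (fun=> 1).
Proof. by split; [exact: mcfun_cst|exists 1 => xi _; rewrite cmod1]. Qed.

Lemma symbM a b : symb a -> symb b -> symb (fun xi => a xi * b xi).
Proof.
move=> [ma [M aM]] [mb [M' bM]]; split; first exact: mcfunM.
by exists (M * M') => xi xr; rewrite cmodM ler_pM ?cmod_ge0 ?aM ?bM.
Qed.

Lemma symb_coord l : symb (fun xi => ii * (xi 0 l)%:C).
Proof.
split.
  apply: mcfunM; first exact: mcfun_cst.
  by apply: mcfun_real; exact: measurable_vec_coord.
by exists rho => xi xr; rewrite cmodM cmod_ii mul1r cmod_real (le_trans (coord_le_eucl xi l)).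
Qed.

Lemma symb_om (s : R) : symb (fun xi => ii * (s * om m xi)%:C).
Proof.
split.
  apply: mcfunM; first exact: mcfun_cst.
  by apply: mcfun_real; apply: measurable_funM; [exact: measurable_cst|exact: measurable_om].
exists (`|s| * (rho + `|m|)) => xi xr; rewrite cmodM cmod_ii mul1r cmod_real normrM ler_wpM2l//.
have o0 : 0 <= om m xi by exact: sqrtr_ge0.
rewrite ger0_norm// -(ler_pXn2r (n := 2)) ?nnegrE ?addr_ge0// om_sqr.
have e2 : dotv xi xi <= rho ^+ 2.
  rewrite -(sqr_sqrtr (dotv_ge0 xi)); apply: lerXn2r; rewrite ?nnegrE ?sqrtr_ge0//.
rewrite sqrrD real_normK ?num_real//.
have : 0 <= rho * `|m| by rewrite mulr_ge0.
by move: e2; move: (dotv xi xi) (rho * `|m|) => u v; rewrite -mulr_natr; lra.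
Qed.

Lemma symb_phase t : symb (phase m t).
Proof. by split; [exact: mcfun_phase|exists 1 => xi _; rewrite cmod_phase]. Qed.

Lemma mult_line a x l s i : mult gamma m a f (x + s *: delta_mx 0 l) i 0 =
  ((2 * pi) ^- d)%:C * cint (vmu d) (fun xi => cexpi (s * xi 0 l) *
     (cexpi (dotv x xi) * (a xi * (dproj gamma m xi *m fourier f xi) i 0))).
Proof.
rewrite mxE; congr (_ * _); apply: eq_cint => xi; rewrite [RHS]mulrA; congr (_ * _).
rewrite -cexpiD; congr cexpi.
rewrite !dotvE (eq_bigr (fun j => x 0 j * xi 0 j + s * (j == l)%:R * xi 0 j)); last first.
  by move=> j _; rewrite line_coord mulrDl.
rewrite big_split/= addrC; congr (_ + _).
rewrite (bigD1 l)//= eqxx mulr1 big1 ?addr0// => j jl.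
by rewrite (negPf jl) mulr0 mul0r.
Qed.

Lemma cder_mult_x a x l i : symb a ->
  cder (fun s => mult gamma m a f (x + s *: delta_mx 0 l) i 0) 0
    (mult gamma m (fun xi => ii * (xi 0 l)%:C * a xi) f x i 0).
Proof.
move=> sa; have [ma [M aM]] := sa.
have [mla [M' laM]] := symbM (symb_coord l) sa.
pose u xi : R[i] := cexpi (dotv x xi) * (a xi * (dproj gamma m xi *m fourier f xi) i 0).
have iu : cintegrable (vmu d) u by exact: (cintegrable_mult _ _ f1 fsupp rho0 x i ma aM).1.
have iv := (cintegrable_mult gamma m f1 fsupp rho0 x i mla laM).1.
have ilu : cintegrable (vmu d) (fun xi => (xi 0 l)%:C * u xi).
  apply: eq_cintegrable (cintegrableZ (- ii) iv) => xi; rewrite /u.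
  have -> : - ii * (cexpi (dotv x xi) * (ii * (xi 0 l)%:C * a xi * (dproj gamma m xi *m fourier f xi) i 0)) =
    (- (ii * ii)) * ((xi 0 l)%:C * (cexpi (dotv x xi) * (a xi * (dproj gamma m xi *m fourier f xi) i 0))) by ring.
  have -> : - (ii * ii) = 1 :> R[i] by apply: complex_eq; rewrite !ReImE/=; ring.
  by rewrite mul1r.
have ml : measurable_fun [set: vec (R := R) d] (fun xi : vec d => xi 0 l) by exact: measurable_vec_coord.
have := cderZ ((2 * pi) ^- d)%:C (cder_cint_cexpi 0 ml iu ilu).
move=> h; apply: cder_eq h _ _; first by move=> s; rewrite mult_line.
rewrite mxE; congr (_ * _); apply: eq_cint => xi; rewrite mul0r cexpi0 mul1r /u; ring.
Qed.

Lemma cder_mult_t b (s t : R) x i : symb b ->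
  cder (fun t => mult gamma m (fun xi => phase m (s * t) xi * b xi) f x i 0) t
    (mult gamma m (fun xi => phase m (s * t) xi * (ii * (s * om m xi)%:C * b xi)) f x i 0).
Proof.
move=> sb; have [mb [M bM]] := sb.
have [mlb [M' lbM]] := symbM (symb_om s) sb.
pose u xi : R[i] := cexpi (dotv x xi) * (b xi * (dproj gamma m xi *m fourier f xi) i 0).
have iu : cintegrable (vmu d) u by exact: (cintegrable_mult _ _ f1 fsupp rho0 x i mb bM).1.
have iv := (cintegrable_mult gamma m f1 fsupp rho0 x i mlb lbM).1.
have ilu : cintegrable (vmu d) (fun xi => (s * om m xi)%:C * u xi).
  apply: eq_cintegrable (cintegrableZ (- ii) iv) => xi; rewrite /u.
  have -> : - ii * (cexpi (dotv x xi) * (ii * (s * om m xi)%:C * b xi * (dproj gamma m xi *m fourier f xi) i 0)) =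
    (- (ii * ii)) * ((s * om m xi)%:C * (cexpi (dotv x xi) * (b xi * (dproj gamma m xi *m fourier f xi) i 0))) by ring.
  have -> : - (ii * ii) = 1 :> R[i] by apply: complex_eq; rewrite !ReImE/=; ring.
  by rewrite mul1r.
have ml : measurable_fun [set: vec (R := R) d] (fun xi : vec d => s * om m xi).
  by apply: measurable_funM; [exact: measurable_cst|exact: measurable_om].
have := cderZ ((2 * pi) ^- d)%:C (cder_cint_cexpi t ml iu ilu).
have E t' xi : phase m (s * t') xi = cexpi (t' * (s * om m xi)) by rewrite /phase; congr cexpi; ring.
move=> h; apply: cder_eq h _ _.
  by move=> t'; rewrite mxE; congr (_ * _); apply: eq_cint => xi; rewrite E /u; ring.
by rewrite mxE; congr (_ * _); apply: eq_cint => xi; rewrite E /u; ring.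
Qed.

Lemma mcfun_mult_tx b (s : R) i : symb b ->
  mcfun (fun p : TX => mult gamma m (fun xi => phase m (s * p.1) xi * b xi) f p.2 i 0).
Proof.
move=> [mb _]; under eq_fun do rewrite mxE.
apply: mcfunM; first exact: mcfun_cst.
apply: (@mcfun_cint _ _ _ TX (vec (R := R) d) (vmu d)); apply: mcfunM.
  apply: mcfun_cexpi; apply: measurable_dotv; last exact: measurable_snd.
  exact: (measurableT_comp measurable_snd measurable_fst).
apply: mcfunM; last exact: (mcfun_comp (mcfun_projfourier gamma m f1 i) measurable_snd).
apply: mcfunM; last exact: (mcfun_comp mb measurable_snd).
apply: mcfun_cexpi; apply: measurable_funM.
  apply: measurable_funM; first exact: measurable_cst.
  exact: (measurableT_comp measurable_fst measurable_fst).
exact: (measurableT_comp (measurable_om m) measurable_snd).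
Qed.

Lemma bounded_mult_tx b (s : R) : symb b ->
  exists M, forall t x i, cmod (mult gamma m (fun xi => phase m (s * t) xi * b xi) f x i 0) <= M.
Proof.
move=> [mb [M bM]]; exists (multbound gamma f rho M) => t x i.
apply: cmod_mult => //; first by apply: mcfunM => //; exact: mcfun_phase.
by move=> xi xr; rewrite cmodM cmod_phase mul1r bM.
Qed.

Hypothesis cg : clifford gamma.

Lemma dirac_symbol_dproj xi : dirac_symbol gamma m xi *m dproj gamma m xi = (om m xi)%:C *: dproj gamma m xi.
Proof.
rewrite /dproj -scalemxAr [RHS]scalerA [in RHS]mulrC -[RHS]scalerA; congr (_ *: _).
rewrite mulmxDr mulmx1 -scalemxAr dirac_symbol_sqr// scalerDr scalerA scalerA addrC.
have [w0|w0] := eqVneq (om m xi) 0.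
  by rewrite (dirac_symbol0 gamma w0) w0 !scaler0 expr0n/= mulr0 !scale0r.
congr (_ + _).
  by rewrite -rmorphM/= expr2 mulKf.
by rewrite -rmorphM/= divff// scale1r.
Qed.

(** On the range of [dproj] the Dirac symbol acts as [om]; multiplied by [ii], its terms become the
    space derivatives and the mass term. *)
Lemma mult_dirac a x : symb a ->
  mult gamma m (fun xi => ii * (om m xi)%:C * a xi) f x =
  \sum_l alpha gamma l *m mult gamma m (fun xi => ii * (xi 0 l)%:C * a xi) f x +
  (ii * m%:C) *: (gamma ord0 *m mult gamma m a f x).
Proof.
move=> sa; have [ma [M aM]] := sa.
pose F l j := (fun xi => cexpi (dotv x xi) *
   (ii * (xi 0 l)%:C * a xi * (dproj gamma m xi *m fourier f xi) j 0)).
pose G j := (fun xi => cexpi (dotv x xi) * (a xi * (dproj gamma m xi *m fourier f xi) j 0)).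
have iF l j : cintegrable (vmu d) (F l j).
  have [mla [M' laM]] := symbM (symb_coord l) sa.
  exact: (cintegrable_mult gamma m f1 fsupp rho0 x j mla laM).1.
have iG j : cintegrable (vmu d) (G j).
  exact: (cintegrable_mult gamma m f1 fsupp rho0 x j ma aM).1.
apply/colP => i.
have E1 l : (alpha gamma l *m mult gamma m (fun xi => ii * (xi 0 l)%:C * a xi) f x) i 0 =
   ((2 * pi) ^- d)%:C * cint (vmu d) (fun xi => \sum_j alpha gamma l i j * F l j xi).
  rewrite mxE cint_sum; last by move=> j; exact: cintegrableZ.
  by rewrite mulr_sumr; apply: eq_bigr => j _; rewrite [mult _ _ _ _ _ _ _]mxE (cintZ _ (iF l j)) mulrCA.
have E2 : (gamma ord0 *m mult gamma m a f x) i 0 =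
   ((2 * pi) ^- d)%:C * cint (vmu d) (fun xi => \sum_j gamma ord0 i j * G j xi).
  rewrite mxE cint_sum; last by move=> j; exact: cintegrableZ.
  by rewrite mulr_sumr; apply: eq_bigr => j _; rewrite [mult _ _ _ _ _ _ _]mxE (cintZ _ (iG j)) mulrCA.
have iA : cintegrable (vmu d) (fun xi => \sum_l \sum_j alpha gamma l i j * F l j xi).
  by apply: cintegrable_sum => l; apply: cintegrable_sum => j; exact: cintegrableZ.
have iB : cintegrable (vmu d) (fun xi => (ii * m%:C) * \sum_j gamma ord0 i j * G j xi).
  by apply: cintegrableZ; apply: cintegrable_sum => j; exact: cintegrableZ.
rewrite [RHS]mxE summxE [X in _ = _ + X]mxE E2.
rewrite (eq_bigr _ (fun l _ => E1 l)) -mulr_sumr mulrCA -mulrDr mxE; congr (_ * _).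
rewrite -cint_sum; last by move=> l; apply: cintegrable_sum => j; exact: cintegrableZ.
rewrite -cintZ; last by apply: cintegrable_sum => j; exact: cintegrableZ.
rewrite -cintD//; apply: eq_cint => xi.
have H : (aslash gamma xi *m (dproj gamma m xi *m fourier f xi)) i 0 +
    m%:C * (gamma ord0 *m (dproj gamma m xi *m fourier f xi)) i 0 =
    (om m xi)%:C * (dproj gamma m xi *m fourier f xi) i 0.
  have := dirac_symbol_dproj xi; move: (dproj gamma m xi) => D HD.
  have := congr1 (fun A => (A *m fourier f xi) i 0) HD.
  have -> : (dirac_symbol gamma m xi *m D *m fourier f xi) i 0 =
    (aslash gamma xi *m (D *m fourier f xi)) i 0 + m%:C * (gamma ord0 *m (D *m fourier f xi)) i 0.
    rewrite dirac_symbolE -mulmxA mulmxDl -scalemxAl.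
    by move: (aslash gamma xi *m _) (gamma ord0 *m _) => u v; rewrite !mxE.
  by move=> ->; rewrite -scalemxAl; move: (D *m _) => u; rewrite mxE.
have -> : cexpi (dotv x xi) * (ii * (om m xi)%:C * a xi * (dproj gamma m xi *m fourier f xi) i 0) =
  cexpi (dotv x xi) * ii * a xi * ((om m xi)%:C * (dproj gamma m xi *m fourier f xi) i 0) by ring.
rewrite -H mulrDr; congr (_ + _).
  rewrite /aslash mulmx_suml summxE mulr_sumr; apply: eq_bigr => l _.
  rewrite -scalemxAl mxE mxE !mulr_sumr; apply: eq_bigr => j _.
  by rewrite /F; ring.
rewrite mxE !mulr_sumr; apply: eq_bigr => j _.
by rewrite /G; ring.
Qed.

End MultCalculus.

Lemma sqrD_le2 {R : realType} (a b : R) : (a + b) ^+ 2 <= 2 * (a ^+ 2 + b ^+ 2).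
Proof. by have := sqr_ge0 (a - b); nra. Qed.

Section VectorCalculus.
Context {R : realType} (N : nat).

Definition vder (u : R -> 'cV[R[i]]_N) (t : R) (du : 'cV[R[i]]_N) :=
  forall i, cder (fun s => u s i 0) t (du i 0).

Lemma vder_mulmx (A : 'M[R[i]]_N) u t du : vder u t du -> vder (fun s => A *m u s) t (A *m du).
Proof.
move=> h i; apply: (cder_eq (f := fun s => \sum_j A i j * u s j 0) (l := \sum_j A i j * du j 0)).
- by apply: cder_sum => j; exact: cderZ.
- by move=> s; rewrite mxE.
- by rewrite mxE.
Qed.

Lemma cder_hdot u v t du dv : vder u t du -> vder v t dv ->
  cder (fun s => hdot (u s) (v s)) t (hdot du (v t) + hdot (u t) dv).
Proof.
move=> hu hv.
apply: (cder_eq (f := fun s => \sum_i cconj (u s i 0) * v s i 0)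
  (l := \sum_i (cconj (du i 0) * v t i 0 + cconj (u t i 0) * dv i 0))).
- by apply: cder_sum => i; apply: cderM => //; exact: cder_conj.
- by move=> s; rewrite hdotE.
- by rewrite !hdotE big_split.
Qed.

Lemma vnorm_le_bound (v : 'cV[R[i]]_N) (K : R) : 0 <= K -> (forall i, cmod (v i 0) <= K) ->
  vnorm v <= N.+1%:R * K.
Proof.
move=> K0 h; rewrite -(ler_pXn2r (n := 2)) ?nnegrE ?vnorm_ge0 ?mulr_ge0//.
rewrite vnorm_sqr; apply: (@le_trans _ _ (\sum_(i < N) K ^+ 2)).
  by apply: ler_sum => i _; apply: lerXn2r; rewrite ?nnegrE ?cmod_ge0.
rewrite sumr_const card_ord -[X in X <= _]mulr_natl exprMn ler_wpM2r ?sqr_ge0//.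
by rewrite -natrX ler_nat -mulnn mulnS; apply: leq_trans (leqnSn N) _; exact: leq_addr.
Qed.

Lemma Re_hdot_le (u v : 'cV[R[i]]_N) : `|complex.Re (hdot u v)| <= vnorm u * vnorm v.
Proof. exact: le_trans (ler_Re_cmod _) (cmod_hdot _ _). Qed.

End VectorCalculus.

Section FieldFlux.
Context {R : realType} (d N : nat) (gamma : 'I_d.+1 -> 'M[R[i]]_N) (m : R).
Hypotheses (cg : clifford gamma) (hg : hermitian_gammas gamma).
Local Notation TX := (measurableTypeR R * vec (R := R) d)%type.
Variables (phi phit phitt : R -> 'rV[R]_d -> 'cV[R[i]]_N) (phix phixx : 'I_d -> R -> 'rV[R]_d -> 'cV[R[i]]_N).
Variables (M1 M2 M3 A : R).
Hypothesis vder_t : forall t x, vder (phi^~ x) t (phit t x).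
Hypothesis vder_tt : forall t x, vder (phit^~ x) t (phitt t x).
Hypothesis vder_x : forall l t x, vder (fun s => phi t (x + s *: delta_mx 0 l)) 0 (phix l t x).
Hypothesis vder_xx : forall l t x, vder (fun s => phix l t (x + s *: delta_mx 0 l)) 0 (phixx l t x).
Hypothesis dirac_eqn : forall t x, phit t x =
  - (\sum_l alpha gamma l *m phix l t x + (ii * m%:C) *: (gamma ord0 *m phi t x)).
Hypothesis mcfun_phi : forall i, mcfun (fun p : TX => phi p.1 p.2 i 0).
Hypothesis mphit : forall i, mcfun (fun p : TX => phit p.1 p.2 i 0).
Hypothesis mphix : forall l i, mcfun (fun p : TX => phix l p.1 p.2 i 0).
Hypothesis h1 : forall t x, vnorm (phi t x) <= M1.
Hypothesis h2 : forall t x, vnorm (phit t x) <= M2.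
Hypothesis h3 : forall l t x, vnorm (phix l t x) <= M3.

Definition pdensity (t : R) (x : vec (R := R) d) : R := complex.Re (hdot (phi t x) (phi t x)).
Definition pcurrent l (t : R) (x : vec (R := R) d) : R := complex.Re (hdot (phi t x) (alpha gamma l *m phi t x)).
Definition dpdensity (t : R) (x : vec (R := R) d) : R :=
  complex.Re (hdot (phit t x) (phi t x) + hdot (phi t x) (phit t x)).
Definition dpcurrent l (t : R) (x : vec (R := R) d) : R :=
  complex.Re (hdot (phix l t x) (alpha gamma l *m phi t x) + hdot (phi t x) (alpha gamma l *m phix l t x)).

Lemma pdensityE t x : pdensity t x = vnorm (phi t x) ^+ 2.
Proof. by rewrite /pdensity hdot_self. Qed.

Lemma aslash_delta l : aslash gamma (delta_mx 0 l) = alpha gamma l.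
Proof.
rewrite /aslash (bigD1 l)//= mxE !eqxx scale1r big1 ?addr0// => j jl.
by rewrite mxE (negPf jl) andbF scale0r.
Qed.

Lemma vnorm_alpha l (v : 'cV[R[i]]_N) : vnorm (alpha gamma l *m v) = vnorm v.
Proof.
have := vnorm_aslash cg hg (delta_mx 0 l) v; rewrite aslash_delta.
have -> : dotv (delta_mx 0 l) (delta_mx 0 l) = 1 :> R.
  rewrite dotvE (bigD1 l)//= mxE !eqxx mulr1 big1 ?addr0// => j jl.
  by rewrite mxE (negPf jl) andbF mulr0.
by rewrite mul1r => /eqP; rewrite eqrXn2 ?vnorm_ge0// => /eqP.
Qed.

Lemma pcurrent_le l t x : `|pcurrent l t x| <= pdensity t x.
Proof. by apply: le_trans (Re_hdot_le _ _) _; rewrite vnorm_alpha pdensityE expr2. Qed.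

Lemma current_pcurrent t x u : current gamma u (phi t x) = \sum_l u 0 l * pcurrent l t x.
Proof.
rewrite /current /aslash mulmx_suml (_ : hdot _ _ = \sum_l (u 0 l)%:C * hdot (phi t x) (alpha gamma l *m phi t x)).
  by rewrite Re_sum; apply: eq_bigr => l _; rewrite Re_mul Im_real mul0r subr0 Re_real.
elim/big_rec2: _ => [|l a b _ <-]; first by rewrite /hdot mulmx0 mxE.
by rewrite hdotDr -scalemxAl hdotZr.
Qed.

Lemma flux_div t x : dpdensity t x + \sum_l dpcurrent l t x = 0.
Proof.
have adj l : adjmx (alpha gamma l) = alpha gamma l by exact: adj_alpha.
have RC (z : R[i]) : complex.Re (cconj z) = complex.Re z by [].
have E l : dpcurrent l t x = 2 * complex.Re (hdot (phi t x) (alpha gamma l *m phix l t x)).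
  rewrite /dpcurrent Re_add (hdot_adj (alpha gamma l) (phix l t x)) adj.
  by rewrite -(hdot_conj (phi t x) (alpha gamma l *m phix l t x)) RC; ring.
have EP : dpdensity t x = 2 * complex.Re (hdot (phi t x) (phit t x)).
  by rewrite /dpdensity Re_add -(hdot_conj (phi t x) (phit t x)) RC; ring.
rewrite EP (eq_bigr _ (fun l _ => E l)) -mulr_sumr -mulrDr.
rewrite dirac_eqn -scaleN1r hdotZr hdotDr hdotZr.
have -> : hdot (phi t x) (\sum_l alpha gamma l *m phix l t x) = \sum_l hdot (phi t x) (alpha gamma l *m phix l t x).
  by elim/big_rec2: _ => [|l a b _ <-]; [rewrite /hdot mulmx0 mxE|rewrite hdotDr].
(* The mass term is [i m] times a real number, so it drops out of the real part. *)
have g0 : complex.Im (hdot (phi t x) (gamma ord0 *m phi t x)) = 0.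
  have := hdot_conj (phi t x) (gamma ord0 *m phi t x).
  rewrite -[in X in _ = X]hg.1 -hdot_adj => /(congr1 (@complex.Im R)) /=.
  by move: (complex.Im _) => u; lra.
rewrite !ReImE/= g0 Re_sum; ring.
Qed.

Lemma is_derive_pdensity (t : R) x : is_derive t 1 (pdensity^~ x) (dpdensity t x).
Proof. exact: (cder_hdot (vder_t t x) (vder_t t x)).1. Qed.

Lemma continuous_dpdensity x : continuous (dpdensity^~ x).
Proof.
move=> t; have h := vder_t t x; have h2' := vder_tt t x.
exact: (is_derive_continuous (cderD (cder_hdot h2' h) (cder_hdot h h2')).1).
Qed.

Lemma is_derive_pcurrent l t (x : 'rV[R]_d) :
  is_derive (0 : R) 1 (fun s => pcurrent l t (x + s *: delta_mx 0 l)) (dpcurrent l t x).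
Proof.
have := (cder_hdot (vder_x l t x) (vder_mulmx (alpha gamma l) (vder_x l t x))).1.
by rewrite /= scale0r addr0.
Qed.

Lemma continuous_dpcurrent l t (x : 'rV[R]_d) : continuous (fun s : R => dpcurrent l t (x + s *: delta_mx 0 l)).
Proof.
move=> s; pose X := x + s *: delta_mx 0 l.
have h := vder_x l t X; have h2' := vder_xx l t X.
have a1 := vder_mulmx (alpha gamma l) h; have a2 := vder_mulmx (alpha gamma l) h2'.
have := (cderD (cder_hdot h2' a1) (cder_hdot h a2)).1.
rewrite (_ : (fun u => _) = (fun u => (fun s : R => dpcurrent l t (x + s *: delta_mx 0 l)) (s + u))); last first.
  by apply/funext => u; rewrite /X scalerDl addrA.
by move=> H; exact: (is_derive_continuous (is_derive_at0 H)).
Qed.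

Let mhdot (u v : R -> 'rV[R]_d -> 'cV[R[i]]_N) :
  (forall i, mcfun (fun p : TX => u p.1 p.2 i 0)) -> (forall i, mcfun (fun p : TX => v p.1 p.2 i 0)) ->
  mcfun (fun p : TX => hdot (u p.1 p.2) (v p.1 p.2)).
Proof.
move=> mu mv; under eq_fun do rewrite hdotE.
by apply: mcfun_sum => i; apply: mcfunM => //; exact: mcfun_conj.
Qed.

Let mmul (B : 'M[R[i]]_N) (u : R -> 'rV[R]_d -> 'cV[R[i]]_N) :
  (forall i, mcfun (fun p : TX => u p.1 p.2 i 0)) -> (forall i, mcfun (fun p : TX => (B *m u p.1 p.2) i 0)).
Proof.
move=> mu i; under eq_fun do rewrite mxE.
by apply: mcfun_sum => j; apply: mcfunM => //; exact: mcfun_cst.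
Qed.

Lemma measurable_pdensity : measurable_fun [set: TX] (fun p => pdensity p.1 p.2).
Proof. exact: (mhdot mcfun_phi mcfun_phi).1. Qed.
Lemma measurable_dpdensity : measurable_fun [set: TX] (fun p => dpdensity p.1 p.2).
Proof. exact: (mcfunD (mhdot mphit mcfun_phi) (mhdot mcfun_phi mphit)).1. Qed.
Lemma measurable_pcurrent l : measurable_fun [set: TX] (fun p => pcurrent l p.1 p.2).
Proof. exact: (@mhdot phi (fun t x => alpha gamma l *m phi t x) mcfun_phi (mmul (alpha gamma l) mcfun_phi)).1. Qed.
Lemma measurable_dpcurrent l : measurable_fun [set: TX] (fun p => dpcurrent l p.1 p.2).
Proof. exact: (mcfunD
  (@mhdot (phix l) (fun t x => alpha gamma l *m phi t x) (mphix l) (mmul (alpha gamma l) mcfun_phi))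
  (@mhdot phi (fun t x => alpha gamma l *m phix l t x) mcfun_phi (mmul (alpha gamma l) (mphix l)))).1. Qed.

Lemma bounded_flux : exists M, [/\ forall t x, pdensity t x <= M, forall t x, `|dpdensity t x| <= M &
  forall l t x, `|dpcurrent l t x| <= M].
Proof.
have pr (u v : 'cV[R[i]]_N) (a b : R) : vnorm u <= a -> vnorm v <= b -> `|complex.Re (hdot u v)| <= a * b.
  by move=> ha hb; apply: le_trans (Re_hdot_le _ _) _; apply: ler_pM; rewrite ?vnorm_ge0.
exists (M1 * M1 + (M2 * M1 + M1 * M2) + (`|M3| * M1 + M1 * `|M3|)).
have M10 : 0 <= M1 by exact: le_trans (vnorm_ge0 _) (h1 0 0).
have M20 : 0 <= M2 by exact: le_trans (vnorm_ge0 _) (h2 0 0).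
have p1 : 0 <= M1 * M1 by exact: mulr_ge0.
have p2 : 0 <= M1 * M2 by exact: mulr_ge0.
have p3 : 0 <= M1 * `|M3| by exact: mulr_ge0.
split.
- move=> t x; have := le_trans (ler_norm _) (pr _ _ _ _ (h1 t x) (h1 t x)); rewrite -/(pdensity t x).
  by move: p1 p2 p3; rewrite [M2 * M1]mulrC [`|M3| * M1]mulrC; lra.
- move=> t x; rewrite /dpdensity Re_add; apply: le_trans (ler_normD _ _) _.
  have := lerD (pr _ _ _ _ (h2 t x) (h1 t x)) (pr _ _ _ _ (h1 t x) (h2 t x)).
  by move: p1 p2 p3; rewrite [M2 * M1]mulrC [`|M3| * M1]mulrC ; lra.
- move=> l t x; rewrite /dpcurrent Re_add; apply: le_trans (ler_normD _ _) _.
  have a1 : vnorm (alpha gamma l *m phi t x) <= M1 by rewrite vnorm_alpha; exact: h1.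
  have a2 : vnorm (alpha gamma l *m phix l t x) <= `|M3| by rewrite vnorm_alpha; exact: le_trans (h3 l t x) (ler_norm _).
  have a3 := le_trans (h3 l t x) (ler_norm _).
  have := lerD (pr _ _ _ _ a3 a1) (pr _ _ _ _ (h1 t x) a2).
  by move: p1 p2 p3; rewrite [M2 * M1]mulrC [`|M3| * M1]mulrC ; lra.
Qed.

Lemma null_density_nullv y (e t : R) x : null_density pdensity pcurrent y (e ^+ 2) t x = vnorm (nullv gamma (e +i* t) (x - y) (phi t x)) ^+ 2.
Proof.
rewrite (vnorm_nullv cg hg) current_pcurrent cmod_sqr/= /null_density pdensityE.
by ring.
Qed.

Hypothesis int_PP : forall t, (\int[vmu d]_x (pdensity t x)%:E <= A%:E)%E.

Lemma flux_phi y (e a T : R) : 0 < a -> 0 < T ->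
  (\int[leb \x vmu d]_p (chi T p.1 * (lorentz a (cone y (e ^+ 2) p.1 p.2) *
     vnorm (nullv gamma (e +i* p.1) (p.2 - y) (phi p.1 p.2)) ^+ 2))%:E <=
  (2 * T * (pi / a * A + (2 * a)^-1 * A))%:E)%E.
Proof.
move=> a0 T0; have [M [b1 b2 b3]] := bounded_flux.
have P0 t x : 0 <= pdensity t x by rewrite pdensityE sqr_ge0.
have N0 t x : 0 <= null_density pdensity pcurrent y (e ^+ 2) t x by rewrite null_density_nullv sqr_ge0.
have := flux P0 b1 b2 pcurrent_le b3 is_derive_pdensity continuous_dpdensity is_derive_pcurrent continuous_dpcurrent flux_div
  measurable_pdensity measurable_dpdensity measurable_pcurrent measurable_dpcurrent int_PP a0 T0 N0.
by under eq_integral do rewrite null_density_nullv.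
Qed.

End FieldFlux.

(** * The Dirac field and its flux *)

Section DiracField.
Context {R : realType} (d N : nat) (gamma : 'I_d.+1 -> 'M[R[i]]_N) (m : R).
Hypotheses (cg : clifford gamma) (hg : hermitian_gammas gamma).
Local Notation TX := (measurableTypeR R * vec (R := R) d)%type.
Variables (g : 'rV[R]_d -> 'cV[R[i]]_N) (rho : R).
Hypotheses (g1 : in_L1 g) (gsupp : fourier_supp_ball g rho) (rho0 : 0 <= rho).
Local Notation symb := (symb rho).

(** One symbol for each half-wave, so that all derivatives of the field are again of this form. *)
Definition wave (b c : 'rV[R]_d -> R[i]) (t : R) (x : 'rV[R]_d) : 'cV[R[i]]_N :=
  mult gamma m (fun xi => phase m (-1 * t) xi * b xi) g x +
  mult (gflip gamma) m (fun xi => phase m (1 * t) xi * c xi) g x.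

Lemma waveE b c t x i : wave b c t x i 0 =
  mult gamma m (fun xi => phase m (-1 * t) xi * b xi) g x i 0 +
  mult (gflip gamma) m (fun xi => phase m (1 * t) xi * c xi) g x i 0.
Proof. by rewrite /wave mxE. Qed.

Lemma vder_wave_t b c t x : symb b -> symb c ->
  vder (wave b c ^~ x) t (wave (fun xi => ii * (-1 * om m xi)%:C * b xi) (fun xi => ii * (1 * om m xi)%:C * c xi) t x).
Proof.
move=> sb sc i.
apply: cder_eq (cderD (cder_mult_t gamma m g1 gsupp rho0 (-1) t x i sb)
  (cder_mult_t (gflip gamma) m g1 gsupp rho0 1 t x i sc)) _ _; first by move=> s; rewrite waveE.
by rewrite waveE.
Qed.

Lemma vder_wave_x b c t x l : symb b -> symb c ->
  vder (fun s => wave b c t (x + s *: delta_mx 0 l)) 0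
   (wave (fun xi => ii * (xi 0 l)%:C * b xi) (fun xi => ii * (xi 0 l)%:C * c xi) t x).
Proof.
move=> sb sc i.
have s1 := symbM (symb_phase d m rho (-1 * t)) sb.
have s2 := symbM (symb_phase d m rho (1 * t)) sc.
apply: cder_eq (cderD (cder_mult_x gamma m g1 gsupp rho0 x l i s1)
  (cder_mult_x (gflip gamma) m g1 gsupp rho0 x l i s2)) _ _; first by move=> s; rewrite waveE.
have X1 : mult gamma m (fun xi => ii * (xi 0 l)%:C * (phase m (-1 * t) xi * b xi)) g x =
   mult gamma m (fun xi => phase m (-1 * t) xi * (ii * (xi 0 l)%:C * b xi)) g x.
  by apply: (mult_eq gamma m gsupp) => xi _; ring.
have X2 : mult (gflip gamma) m (fun xi => ii * (xi 0 l)%:C * (phase m (1 * t) xi * c xi)) g x =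
   mult (gflip gamma) m (fun xi => phase m (1 * t) xi * (ii * (xi 0 l)%:C * c xi)) g x.
  by apply: (mult_eq (gflip gamma) m gsupp) => xi _; ring.
by rewrite waveE X1 X2.
Qed.

Lemma mcfun_wave b c i : symb b -> symb c -> mcfun (fun p : TX => wave b c p.1 p.2 i 0).
Proof.
move=> sb sc; under eq_fun do rewrite waveE.
by apply: mcfunD; [exact: (mcfun_mult_tx gamma m g1 (-1) i sb)|exact: (mcfun_mult_tx (gflip gamma) m g1 1 i sc)].
Qed.

Lemma bounded_wave b c : symb b -> symb c -> exists2 M, 0 <= M & forall t x, vnorm (wave b c t x) <= M.
Proof.
move=> sb sc.
have [M1 h1] := bounded_mult_tx gamma m g1 gsupp rho0 (-1) sb.
have [M2 h2] := bounded_mult_tx (gflip gamma) m g1 gsupp rho0 1 sc.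
have h i t x : cmod (wave b c t x i 0) <= `|M1| + `|M2|.
  rewrite waveE; apply: le_trans (cmodD _ _) _.
  by apply: lerD; [exact: le_trans (h1 _ _ _) (ler_norm _)|exact: le_trans (h2 _ _ _) (ler_norm _)].
exists (N.+1%:R * (`|M1| + `|M2|)); first by rewrite mulr_ge0// addr_ge0.
by move=> t x; apply: vnorm_le_bound => [|i]; [rewrite addr_ge0|exact: h].
Qed.

Let s1 := symb1 d rho.
Definition phi := wave (fun=> 1) (fun=> 1).
Definition phit := wave (fun xi => ii * (-1 * om m xi)%:C * 1) (fun xi => ii * (1 * om m xi)%:C * 1).
Definition phix l := wave (fun xi => ii * (xi 0 l)%:C * 1) (fun xi => ii * (xi 0 l)%:C * 1).

Lemma phiE t x : dirac_prop gamma m t g x = phi t x.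
Proof.
rewrite (dirac_propE cg g1 gsupp rho0) /phi /wave; congr (_ + _).
  by apply: (mult_eq gamma m gsupp) => xi _; rewrite mulr1 mulN1r.
by apply: (mult_eq (gflip gamma) m gsupp) => xi _; rewrite mulr1 mul1r.
Qed.

(** Each half-wave solves the equation by [mult_dirac]; for the second one the opposite frequency
    and the sign of the flipped matrices cancel. *)
Lemma dirac_eq t x : phit t x = - (\sum_l alpha gamma l *m phix l t x + (ii * m%:C) *: (gamma ord0 *m phi t x)).
Proof.
have cg' := gflip_clifford cg.
have sp t' := symb_phase d m rho t'.
have sw := symb_om d m rho0 1.
have E1 : mult gamma m (fun xi => phase m (-1 * t) xi * (ii * (-1 * om m xi)%:C * 1)) g x =
   - mult gamma m (fun xi => ii * (om m xi)%:C * phase m (-1 * t) xi) g x.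
  have h := symbM sw (sp (-1 * t)); have [mh [M hM]] := h.
  have := multZ gamma m g1 gsupp rho0 (-1) x mh hM; rewrite scaleN1r => E.
  transitivity (- mult gamma m (fun xi => ii * (1 * om m xi)%:C * phase m (-1 * t) xi) g x).
    rewrite -E; apply: (mult_eq gamma m gsupp) => xi _.
    have -> : (-1 * om m xi)%:C = - (om m xi)%:C :> R[i] by rewrite mulN1r rmorphN.
    by rewrite [1 * om m xi]mul1r; ring.
  by congr (- _); apply: (mult_eq gamma m gsupp) => xi _; rewrite mul1r.
have E2 : mult (gflip gamma) m (fun xi => phase m (1 * t) xi * (ii * (1 * om m xi)%:C * 1)) g x =
   mult (gflip gamma) m (fun xi => ii * (om m xi)%:C * phase m (1 * t) xi) g x.
  by apply: (mult_eq (gflip gamma) m gsupp) => xi _; rewrite !mul1r; ring.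
have [u uE] : exists u, forall l, mult gamma m (fun xi => ii * (xi 0 l)%:C * phase m (-1 * t) xi) g x = u l.
  by exists (fun l => mult gamma m (fun xi => ii * (xi 0 l)%:C * phase m (-1 * t) xi) g x); move=> l; reflexivity.
have [v vE] : exists v, forall l, mult (gflip gamma) m (fun xi => ii * (xi 0 l)%:C * phase m (1 * t) xi) g x = v l.
  by exists (fun l => mult (gflip gamma) m (fun xi => ii * (xi 0 l)%:C * phase m (1 * t) xi) g x); move=> l; reflexivity.
have [p pE] : exists p, mult gamma m (phase m (-1 * t)) g x = p by exact: (ex_intro _ _ erefl).
have [q qE] : exists q, mult (gflip gamma) m (phase m (1 * t)) g x = q by exact: (ex_intro _ _ erefl).
have X1 l : mult gamma m (fun xi => phase m (-1 * t) xi * (ii * (xi 0 l)%:C * 1)) g x = u l.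
  by rewrite -uE; apply: (mult_eq gamma m gsupp) => xi _; ring.
have X2 l : mult (gflip gamma) m (fun xi => phase m (1 * t) xi * (ii * (xi 0 l)%:C * 1)) g x = v l.
  by rewrite -vE; apply: (mult_eq (gflip gamma) m gsupp) => xi _; ring.
have Y1 : mult gamma m (fun xi => phase m (-1 * t) xi * 1) g x = p.
  by rewrite -pE; apply: (mult_eq gamma m gsupp) => xi _; ring.
have Y2 : mult (gflip gamma) m (fun xi => phase m (1 * t) xi * 1) g x = q.
  by rewrite -qE; apply: (mult_eq (gflip gamma) m gsupp) => xi _; ring.
have XX l : phix l t x = u l + v l by rewrite /phix /wave X1 X2.
have YY : phi t x = p + q by rewrite /phi /wave Y1 Y2.
have D1 : mult gamma m (fun xi => ii * (om m xi)%:C * phase m (-1 * t) xi) g x =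
   \sum_l alpha gamma l *m u l + (ii * m%:C) *: (gamma ord0 *m p).
  rewrite (mult_dirac m g1 gsupp rho0 cg x (sp (-1 * t))) pE; congr (_ + _).
  by apply: eq_bigr => l _; rewrite uE.
have D2 : mult (gflip gamma) m (fun xi => ii * (om m xi)%:C * phase m (1 * t) xi) g x =
   \sum_l alpha (gflip gamma) l *m v l + (ii * m%:C) *: (gflip gamma ord0 *m q).
  rewrite (mult_dirac m g1 gsupp rho0 cg' x (sp (1 * t))) qE; congr (_ + _).
  by apply: eq_bigr => l _; rewrite vE.
have TT : phit t x = - (\sum_l alpha gamma l *m u l + (ii * m%:C) *: (gamma ord0 *m p)) +
  (\sum_l alpha (gflip gamma) l *m v l + (ii * m%:C) *: (gflip gamma ord0 *m q)).
  by rewrite /phit /wave E1 E2 D1 D2.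
rewrite TT YY gflip0 mulNmx scalerN.
have -> : \sum_l alpha gamma l *m phix l t x = \sum_l alpha gamma l *m u l + \sum_l alpha gamma l *m v l.
  by rewrite -big_split/=; apply: eq_bigr => l _; rewrite XX mulmxDr.
have -> : \sum_l alpha (gflip gamma) l *m v l = - \sum_l alpha gamma l *m v l.
  by rewrite -sumrN; apply: eq_bigr => l _; rewrite alpha_gflip mulNmx.
by rewrite mulmxDr scalerDr -opprD -opprD addrACA.
Qed.

(** A bound for the charge, uniform in time: two half-waves in each of the [N] components, and a
    factor two from squaring their sum. *)
Definition mass_bound : R := 4 * N%:R * mult_L2_bound gamma g rho.

Lemma int_phi t : (\int[vmu d]_x (vnorm (phi t x) ^+ 2)%:E <= mass_bound%:E)%E.
Proof.
have s2 (w : R) : mcfun (fun xi : vec (R := R) d => phase m w xi * 1).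
  by apply: mcfunM; [exact: mcfun_phase|exact: mcfun_cst].
have s3 (w : R) (xi : 'rV[R]_d) : cmod (phase m w xi * 1) <= 1 by rewrite mulr1 cmod_phase.
pose u i x := cmod (mult gamma m (fun xi => phase m (-1 * t) xi * 1) g x i 0) ^+ 2.
pose v i x := cmod (mult (gflip gamma) m (fun xi => phase m (1 * t) xi * 1) g x i 0) ^+ 2.
have mu i : measurable_fun [set: vec (R := R) d] (u i).
  by apply: measurable_funX; apply: measurable_cmod; exact: mcfun_mult.
have mv i : measurable_fun [set: vec (R := R) d] (v i).
  by apply: measurable_funX; apply: measurable_cmod; exact: mcfun_mult.
have u0 i x : 0 <= u i x by exact: sqr_ge0.
have v0 i x : 0 <= v i x by exact: sqr_ge0.
have [iu Iu] : (forall i, rintegrable (vmu d) (u i)) /\ forall i, \int[vmu d]_x u i x <= mult_L2_bound gamma g rho.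
  have h i := rintegrable_of_le (mu i) (u0 i) (L2_mult gamma m g1 gsupp rho0 i (s2 (-1 * t)) (s3 (-1 * t))).
  by split=> i; have [] := h i.
have [iv Iv] : (forall i, rintegrable (vmu d) (v i)) /\ forall i, \int[vmu d]_x v i x <= mult_L2_bound gamma g rho.
  have E : mult_L2_bound (gflip gamma) g rho = mult_L2_bound gamma g rho by rewrite /mult_L2_bound gbound_gflip.
  have h i := rintegrable_of_le (mv i) (v0 i) (L2_mult (gflip gamma) m g1 gsupp rho0 i (s2 (1 * t)) (s3 (1 * t))).
  by split=> i; have [] := h i; rewrite ?E.
have iuv i := rintegrableZ 2 (rintegrableD (iu i) (iv i)).
have [iS IS] := Rintegral_sum iuv.
apply: le_trans (integral_le_Rintegral _ _ _ iS) _.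
- under eq_fun do rewrite vnorm_sqr; apply: measurable_sum => i; apply: measurable_funX; apply: measurable_cmod.
  exact: (mcfun_comp (mcfun_wave i s1 s1) (measurable_pair1 t)).
- by move=> x; rewrite sqr_ge0.
- move=> x; rewrite vnorm_sqr; apply: ler_sum => i _; rewrite /phi waveE /u /v.
  apply: le_trans (lerXn2r 2 _ _ (cmodD _ _)) _; rewrite ?nnegrE ?addr_ge0 ?cmod_ge0//.
  exact: sqrD_le2.
rewrite lee_fin IS /mass_bound.
apply: (@le_trans _ _ (\sum_(i < N) (4 * mult_L2_bound gamma g rho))); last first.
  by rewrite sumr_const card_ord -[X in X <= _]mulr_natl; lra.
apply: ler_sum => i _; rewrite (RintegralZl _ measurableT (rintegrableD (iu i) (iv i))).
rewrite (RintegralD measurableT (iu i) (iv i)).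
apply: le_trans (ler_wpM2l (ler0n _ 2) (lerD (Iu i) (Iv i))) _.
rewrite le_eqVlt; apply/orP; left; apply/eqP; move: (mult_L2_bound _ _ _) => a; ring.
Qed.

Lemma flux_dirac y (e a T : R) : 0 < a -> 0 < T ->
  (\int[leb \x vmu d]_p (chi T p.1 * (lorentz a (cone y (e ^+ 2) p.1 p.2) *
     vnorm (nullv gamma (e +i* p.1) (p.2 - y) (phi p.1 p.2)) ^+ 2))%:E <=
  (2 * T * (pi / a * mass_bound + (2 * a)^-1 * mass_bound))%:E)%E.
Proof.
have sX l : symb (fun xi : 'rV[R]_d => ii * (xi 0 l)%:C * 1) by exact: (symbM (symb_coord rho l) s1).
have sW (s : R) : symb (fun xi : 'rV[R]_d => ii * (s * om m xi)%:C * 1).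
  exact: (symbM (symb_om d m rho0 s) s1).
have [M1 _ h1] := bounded_wave s1 s1.
have [M2 _ h2] := bounded_wave (sW (-1)) (sW 1).
(* One bound for all directions, as a sum over the finitely many [l]. *)
have [M3 h3] : exists M3, forall l t x, vnorm (phix l t x) <= M3.
  have : forall n (F : 'I_n -> R -> 'rV[R]_d -> R), (forall l, exists2 M, 0 <= M & forall t x, F l t x <= M) ->
     exists2 M, 0 <= M & forall l t x, F l t x <= M.
    elim=> [|n IH] F hF; first by exists 0 => // -[].
    have [K K0 hK] := hF ord0; have [L L0 hL] := IH (fun l => F (lift ord0 l)) (fun l => hF _).
    exists (K + L); first exact: addr_ge0.
    move=> l t x; case: (unliftP ord0 l) => [k ->|->].
      by apply: le_trans (hL k t x) _; rewrite lerDr.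
    by apply: le_trans (hK t x) _; rewrite lerDl.
  move=> /(_ d (fun l t x => vnorm (phix l t x))) [l|M3 _ h3]; first exact: bounded_wave (sX l) (sX l).
  by exists M3.
apply: (@flux_phi _ d N gamma m cg hg phi phit _ phix _ M1 M2 M3 mass_bound).
- by move=> t x; exact: (vder_wave_t t x s1 s1).
- by move=> t x; exact: (vder_wave_t t x (sW (-1)) (sW 1)).
- by move=> l t x; exact: (vder_wave_x t x l s1 s1).
- by move=> l t x; exact: (vder_wave_x t x l (sX l) (sX l)).
- exact: dirac_eq.
- by move=> i; exact: (mcfun_wave i s1 s1).
- by move=> i; exact: (mcfun_wave i (sW (-1)) (sW 1)).
- by move=> l i; exact: (mcfun_wave i (sX l) (sX l)).
- exact: h1.
- exact: h2.
- exact: h3.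
- by move=> t; have := int_phi t; under eq_integral do rewrite -pdensityE.
Qed.

End DiracField.

(** * The null form in dimension two *)

Section ConvDbar.
Context {R : realType} (d N : nat) (gamma gam : 'I_d.+1 -> 'M[R[i]]_N) (m : R) (z : R[i]) (e : R).
Hypotheses (e0 : 0 < e) (e1 : e <= 1) (ez : e <= complex.Re z).
Hypothesis m1 : `|m| <= 1.
Hypothesis d1 : (1 < d)%N.
Let z0 : 0 < complex.Re z := lt_le_trans e0 ez.
Variables (f : 'rV[R]_d -> 'cV[R[i]]_N) (f1 : in_L1 f).

Lemma mcfun_Kmx i j : mcfun (fun v : vec (R := R) d => Kmx gam m z v i j).
Proof.
under eq_fun do rewrite mxE.
apply: mcfunM; first exact: mcfun_cst.
apply: mcfun_cint; apply: mcfunM; first by apply: mcfun_cexpi; exact: measurable_dotv.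
have mK : mcfun (fun xi : vec d => damp m z xi * dproj gam m xi i j).
  by apply: mcfunM; [exact: mcfun_damp|exact: mcfun_dproj].
exact: (mcfun_comp mK (@measurable_snd _ _ _ _)).
Qed.

(** [gamma] defines the form and [gam] the kernel. They are kept apart because both half-waves are
    paired by one form, while the kernel of the second is that of the flipped matrices. *)
Lemma dbar_conv x (p : 'cV[R[i]]_N) :
  cintegrable (vmu d) (fun y => dbar gamma (Kmx gam m z (x - y) *m f y) p) /\
  dbar gamma (mult gam m (damp m z) f x) p = cint (vmu d) (fun y => dbar gamma (Kmx gam m z (x - y) *m f y) p).
Proof.
have iK i j : cintegrable (vmu d) (fun y => Kmx gam m z (x - y) i j * f y j 0).
  apply: (cintegrable_le _ (rintegrableZ (kernel_const gam * decay d z e) (rintegrable_L1 f1))).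
    apply: mcfunM; last exact: mcfun_L1.
    apply: (mcfun_comp (mcfun_Kmx i j)).
    by apply: measurable_vecB; [exact: measurable_cst|exact: measurable_id].
  by move=> y; rewrite cmodM ler_pM ?cmod_ge0 ?cmod_Kmx ?cmod_le_vnorm.
pose q := gamma ord0 *m p.
have iS i := cintegrable_sum (index_enum 'I_N) xpredT (iK i).
have icc (u : vec (R := R) d -> R[i]) : cintegrable (vmu d) u -> cintegrable (vmu d) (fun y => cconj (u y)).
  by move=> iu; apply: cintegrableP; [exact: mcfun_conj (cintegrable_mcfun iu)|
    apply: eq_rintegrable (rintegrable_cmod iu) => y; rewrite cmod_conj].
have iT i : cintegrable (vmu d) (fun y => q i 0 * cconj (\sum_j Kmx gam m z (x - y) i j * f y j 0)).
  exact: cintegrableZ (icc _ (iS i)).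
have E y : \sum_i q i 0 * cconj (\sum_j Kmx gam m z (x - y) i j * f y j 0) =
   dbar gamma (Kmx gam m z (x - y) *m f y) p.
  rewrite dbarE hdotE; apply: eq_bigr => i _; rewrite mulrC; congr (cconj _ * _).
  by rewrite mxE.
split; first by apply: eq_cintegrable (cintegrable_sum (index_enum 'I_N) xpredT iT) => y.
transitivity (cint (vmu d) (fun y => \sum_i q i 0 * cconj (\sum_j Kmx gam m z (x - y) i j * f y j 0))); last first.
  by apply: eq_cint => y; exact: E.
rewrite (cint_sum (index_enum 'I_N) xpredT iT) dbarE hdotE; apply: eq_bigr => i _.
rewrite (cintZ _ (icc _ (iS i))) (cint_conj (iS i)) mulrC; congr (_ * cconj _).
rewrite (mult_conv gam m z0 d1 x i f1) (cint_sum (index_enum 'I_N) xpredT (iK i)) //.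
Qed.

(* Cauchy-Schwarz with the weight |f|, obtained by optimising AM-GM *)
Lemma dbar_conv_sqr x (p : 'cV[R[i]]_N) (H : 'rV[R]_d -> R) : 0 < nL1 f ->
  measurable_fun [set: vec (R := R) d] H -> (forall y, 0 <= H y) ->
  (forall y v, cmod (dbar gamma (Kmx gam m z (x - y) *m v) p) ^+ 2 <= vnorm v ^+ 2 * H y) ->
  ((cmod (dbar gamma (mult gam m (damp m z) f x) p) ^+ 2)%:E <=
   (nL1 f)%:E * \int[vmu d]_y (vnorm (f y) * H y)%:E)%E.
Proof.
move=> F0 mH H0 hH.
have [ib ->] := dbar_conv x p.
have mfH : measurable_fun [set: vec (R := R) d] (fun y => vnorm (f y) * H y).
  by apply: measurable_funM => //; exact: measurable_vnorm_L1.
have fH0 y : 0 <= vnorm (f y) * H y by apply: mulr_ge0 => //; exact: vnorm_ge0.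
have I0 : (0 <= \int[vmu d]_y (vnorm (f y) * H y)%:E)%E by apply: integral_ge0 => y _; rewrite lee_fin.
have [oo|fin] := eqVneq (\int[vmu d]_y (vnorm (f y) * H y)%:E)%E +oo%E.
  by rewrite oo gt0_muley ?lte_fin// leey.
have [I IE] : exists I : R, (\int[vmu d]_y (vnorm (f y) * H y)%:E = I%:E)%E.
  move: I0 fin; case: (\int[vmu d]_y (vnorm (f y) * H y)%:E)%E => [r _ _|//|//].
  by exists r.
rewrite IE in I0 *; rewrite lee_fin in I0.
have [ir Ir] : rintegrable (vmu d) (fun y => vnorm (f y) * H y) /\ \int[vmu d]_y (vnorm (f y) * H y) <= I.
  by apply: rintegrable_of_le => //; rewrite IE.
set S := cmod _; have S0 : 0 <= S by exact: cmod_ge0.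
rewrite -EFinM lee_fin.
have key k : 0 < k -> S <= k / 2 * nL1 f + (2 * k)^-1 * I.
  move=> k0; have k2 : 0 <= (2 * k)^-1 by rewrite invr_ge0 mulr_ge0// ltW.
  apply: le_trans (le_cmod_cint ib) _.
  have iR := rintegrableD (rintegrableZ (k / 2) (rintegrable_L1 f1)) (rintegrableZ ((2 * k)^-1) ir).
  apply: le_trans (le_Rintegral measurableT (rintegrable_cmod ib) iR _) _.
    move=> y _ /=; have := hH y (f y); have vy := vnorm_ge0 (f y).
    move: (cmod _) (cmod_ge0 (dbar gamma (Kmx gam m z (x - y) *m f y) p)) (H y) (H0 y) => c c0 h h0 chh.
    have : (c * (2 * k)) ^+ 2 <= (vnorm (f y) * (k ^+ 2 + h)) ^+ 2.
      rewrite exprMn; apply: le_trans (ler_wpM2r (sqr_ge0 _) chh) _.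
      rewrite [X in _ <= X]exprMn -mulrA ler_wpM2l ?sqr_ge0//.
      by have := sqr_ge0 (k ^+ 2 - h); nra.
    rewrite ler_pXn2r ?nnegrE ?mulr_ge0 ?addr_ge0 ?sqr_ge0 ?(ltW k0)// => hc.
    rewrite -(ler_pM2r (_ : 0 < 2 * k)) ?mulr_gt0//; apply: le_trans hc _.
    rewrite le_eqVlt; apply/orP; left; apply/eqP; field; rewrite gt_eqF//.
  rewrite (RintegralD measurableT (rintegrableZ (k / 2) (rintegrable_L1 f1)) (rintegrableZ ((2 * k)^-1) ir)).
  rewrite (RintegralZl _ measurableT (rintegrable_L1 f1)) (RintegralZl _ measurableT ir) -nL1E//.
  by rewrite lerD2l ler_wpM2l.
have [Sp|Sp] := ltP 0 S; last first.
  have -> : S = 0 by apply/eqP; rewrite eq_le S0 Sp.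
  by rewrite expr0n mulr_ge0// ltW.
have := key (S / nL1 f) (divr_gt0 Sp F0).
have -> : S / nL1 f / 2 * nL1 f + (2 * (S / nL1 f))^-1 * I = S / 2 + nL1 f * I / (2 * S).
  by field; rewrite !gt_eqF.
rewrite -lerBlDl ler_pdivlMr ?mulr_gt0// => h; rewrite expr2; lra.
Qed.

End ConvDbar.

Section WBound.
Context {R : realType}.

(** [D] is the modulus of the cone symbol, [N] the null density and [P] the density. The free
    threshold [lam] separates a neighbourhood of the cone, where [N] is controlled by the flux, from
    its complement, where [P] suffices. *)
Lemma kernel_weight (e t T lam r2 D N P C s : R) : 0 < e -> 0 < T -> T <= t -> t <= 2 * T -> 0 < lam -> 0 <= r2 ->
  s = t ^+ 2 - r2 - e ^+ 2 -> 0 <= D -> D ^+ 2 = s ^+ 2 + (2 * e * t) ^+ 2 -> 0 <= P -> 0 <= N ->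
  N <= 2 * (e ^+ 2 + t ^+ 2 + r2) * P ->
  16 * ((D ^+ 3)^-1 + (D * (e * t) ^+ 2)^-1) * N + 8 * ((e * t) ^+ 2)^-1 * P <=
  (16 / (2 * e * T) + 64 * lam / (2 * e * T) ^+ 2) * (lorentz (2 * e * T) s * N) +
  4 / (2 * e * T) ^+ 2 * (32 * (8 * T ^+ 2 / lam + 1) + 8) * P.
Proof.
move=> e0 T0 Tt tT lam0 r0 sE D0 DE P0 N0 NP.
have [a aE] : exists a, a = 2 * e * T by exists (2 * e * T).
rewrite -aE.
have a0 : 0 < a by rewrite aE !mulr_gt0.
have t0 : 0 < t by exact: lt_le_trans Tt.
have aet : a <= 2 * e * t by rewrite aE ler_wpM2l// mulr_ge0// ltW.
have Da : a <= D.
  rewrite -(ler_pXn2r (n := 2)) ?nnegrE ?(ltW a0)// DE.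
  have : a ^+ 2 <= (2 * e * t) ^+ 2 by apply: lerXn2r; rewrite ?nnegrE ?(ltW a0) ?mulr_ge0 ?(ltW e0) ?(ltW t0).
  by have := sqr_ge0 s; lra.
have Dp : 0 < D by exact: lt_le_trans Da.
have bD : (D ^+ 2)^-1 <= lorentz a s.
  rewrite lef_pV2 ?posrE ?lorentz_den ?exprn_gt0// DE lerD2l.
  by apply: lerXn2r; rewrite ?nnegrE ?(ltW a0) ?mulr_ge0 ?(ltW e0) ?(ltW t0).
have e2 : ((e * t) ^+ 2)^-1 <= 4 / a ^+ 2.
  rewrite -[4]invrK -invfM lef_pV2 ?posrE ?exprn_gt0 ?mulr_gt0 ?invr_gt0//.
  have : a ^+ 2 <= (2 * e * t) ^+ 2 by apply: lerXn2r; rewrite ?nnegrE ?(ltW a0) ?mulr_ge0 ?(ltW e0) ?(ltW t0).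
  by move=> h; rewrite exprMn; move: h; rewrite !exprMn; lra.
have e2p : 0 <= ((e * t) ^+ 2)^-1 by rewrite invr_ge0 sqr_ge0.
have b0 := lorentz_ge0 a0 s.
have h1 : (D ^+ 3)^-1 * N <= a^-1 * (lorentz a s * N).
  rewrite mulrA ler_wpM2r// exprS invfM; apply: ler_pM => //; rewrite ?invr_ge0 ?(ltW Dp) ?sqr_ge0//.
  by rewrite lef_pV2.
have h2 : D^-1 * N <= lam * (lorentz a s * N) + 2 * (8 * T ^+ 2 / lam + 1) * P.
  (* For [D <= lam], [1 / D <= lam / D^2] leads to the flux term; for [D > lam] the trivial bound of
     [N] by [P] is divided by [D]. *)
  have [Dl|lD] := leP D lam.
    apply: (@le_trans _ _ (lam * (lorentz a s * N))); last first.
      by rewrite lerDl mulr_ge0// mulr_ge0// addr_ge0// divr_ge0 ?(ltW lam0)// mulr_ge0// sqr_ge0.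
    rewrite mulrA ler_wpM2r//; apply: (@le_trans _ _ (lam * (D ^+ 2)^-1)).
      rewrite expr2 invfM mulrA ler_peMl ?invr_ge0 ?(ltW Dp)// ler_pdivlMr// mul1r//.
    by rewrite ler_wpM2l// ltW.
  apply: (@le_trans _ _ (2 * (8 * T ^+ 2 / lam + 1) * P)); last first.
    by rewrite lerDr mulr_ge0 ?(ltW lam0)// mulr_ge0.
  have sD : - s <= D.
    apply: le_trans (_ : `|s| <= _); first by rewrite -normrN ler_norm.
    by rewrite -(ler_pXn2r (n := 2)) ?nnegrE// DE real_normK ?num_real// lerDl sqr_ge0.
  have t2 : t ^+ 2 <= 4 * T ^+ 2.
    have : t ^+ 2 <= (2 * T) ^+ 2 by apply: lerXn2r; rewrite ?nnegrE ?mulr_ge0 ?(ltW t0) ?(ltW T0).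
    by rewrite exprMn; lra.
  (* Because [e^2 + t^2 + r2 = 2 t^2 - s]. *)
  have N2 : N <= 2 * (8 * T ^+ 2 + D) * P.
    by apply: le_trans NP _; rewrite ler_wpM2r//; lra.
  apply: le_trans (ler_wpM2l _ N2) _; first by rewrite invr_ge0 ltW.
  rewrite mulrA ler_wpM2r// mulrCA ler_wpM2l// mulrDr mulVf ?gt_eqF// lerD2r mulrC ler_wpM2l//.
    by rewrite mulr_ge0// sqr_ge0.
  by rewrite lef_pV2 ?posrE// ltW.
have h3 : (D * (e * t) ^+ 2)^-1 * N <= 4 / a ^+ 2 * (lam * (lorentz a s * N) + 2 * (8 * T ^+ 2 / lam + 1) * P).
  have a4 : 0 <= 4 / a ^+ 2 by exact: le_trans e2p e2.
  have DN : 0 <= D^-1 * N by rewrite mulr_ge0// invr_ge0 ltW.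
  apply: le_trans (ler_wpM2l a4 h2); apply: le_trans (ler_wpM2r DN e2).
  by rewrite invfM mulrAC mulrC.
have h4 := ler_wpM2r P0 e2.
have -> : 16 * ((D ^+ 3)^-1 + (D * (e * t) ^+ 2)^-1) * N + 8 * ((e * t) ^+ 2)^-1 * P =
  16 * ((D ^+ 3)^-1 * N) + 16 * ((D * (e * t) ^+ 2)^-1 * N) + 8 * (((e * t) ^+ 2)^-1 * P) by ring.
apply: (@le_trans _ _ (16 * (a^-1 * (lorentz a s * N)) + 16 * (4 / a ^+ 2 * (lam * (lorentz a s * N) + 2 * (8 * T ^+ 2 / lam + 1) * P))
  + 8 * (4 / a ^+ 2 * P))).
  by apply: lerD; [apply: lerD; rewrite ler_wpM2l|rewrite ler_wpM2l].
rewrite le_eqVlt; apply/orP; left; apply/eqP.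
by move: (a ^+ 2)^-1 (a^-1) (lam^-1) (lorentz a s) => u v w b; ring.
Qed.

End WBound.

Section GammaSign.
Context {R : realType} (d N : nat) (gamma : 'I_d.+1 -> 'M[R[i]]_N) (b : bool).

(** [true] selects the half-wave of opposite frequency: it is the first half-wave for the flipped
    matrices with time reversed, the reversal being [tsign]. *)
Definition gsign := if b then gflip gamma else gamma.
Definition tsign : R := if b then -1 else 1.

Lemma dbar_gsign u v : cmod (dbar gamma u v) = cmod (dbar gsign u v).
Proof.
rewrite /gsign; case: b; last by [].
rewrite !dbarE gflip0 mulNmx -scaleN1r hdotZr [RHS]cmodM.
by rewrite [cmod (-1)]cmodN cmod1 mul1r.
Qed.

Lemma gsign_clifford : clifford gamma -> clifford gsign.
Proof. by rewrite /gsign; case: b => // h; exact: gflip_clifford. Qed.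

Lemma gsign_hermitian : hermitian_gammas gamma -> hermitian_gammas gsign.
Proof. by rewrite /gsign; case: b => // h; exact: gflip_hermitian. Qed.

(** The flip negates the current and the reversal of time compensates for it in the cross term, so
    one flux bound serves both half-waves. *)
Lemma nullv_gsign (e t : R) x phi : clifford gamma -> hermitian_gammas gamma ->
  vnorm (nullv gsign (e +i* (tsign * t)) x phi) ^+ 2 = vnorm (nullv gamma (e +i* t) x phi) ^+ 2.
Proof.
move=> cg hg; rewrite /gsign /tsign; case: b; last by rewrite mul1r.
have h1 := vnorm_nullv (gflip_clifford cg) (gflip_hermitian hg) (e +i* (-1 * t)) x phi.
have h2 := vnorm_nullv cg hg (e +i* t) x phi.
apply: (etrans h1 (etrans _ (esym h2))); rewrite !cmod_sqr/=.
have -> : current (gflip gamma) x phi = - current gamma x phi.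
  by rewrite /current aslash_gflip mulNmx -scaleN1r hdotZr mulN1r Re_opp.
by ring.
Qed.

Lemma gbound_gsign : gbound gsign = gbound gamma.
Proof. by rewrite /gsign; case: b => //; exact: gbound_gflip. Qed.
Lemma kernel_const_gsign : kernel_const gsign = kernel_const gamma.
Proof. by rewrite /gsign; case: b => //; exact: kernel_const_gflip. Qed.

End GammaSign.

Section TonelliTX.
Context {R : realType} (n k : nat).
Local Notation X := (vec (R := R) n).
Local Notation V := (vec (R := R) k).
Local Notation TX := (measurableTypeR R * vec (R := R) n)%type.
Variable K : TX -> V -> \bar R.
Hypothesis mK : measurable_fun [set: (TX * V)%type] (fun q => K q.1 q.2).
Hypothesis K0 : forall p y, (0 <= K p y)%E.

Lemma measurable_TX_G : measurable_fun [set: V] (fun y => (\int[leb \x vmu n]_p K p y)%E).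
Proof.
have E y : (\int[leb \x vmu n]_p K p y = \int[leb]_t \int[vmu n]_x K (t, x) y)%E.
  apply: (@fubini_tonelli1 _ _ _ _ R leb (vmu n) (fun p => K p y)) => //.
  exact: (measurableT_comp mK (measurable_pair2 y)).
under eq_fun do rewrite E.
have m1 : measurable_fun [set: ((measurableTypeR R * V) * X)%type] (fun q => K (q.1.1, q.2) q.1.2).
  have h : measurable_fun [set: ((measurableTypeR R * V) * X)%type]
     (fun q : (measurableTypeR R * V) * X => ((q.1.1, q.2), q.1.2) : (TX * V)%type).
    apply/measurable_fun_pairP; split => /=; last exact: (measurableT_comp measurable_snd measurable_fst).
    apply/measurable_fun_pairP; split => /=; last exact: measurable_snd.
    exact: (measurableT_comp measurable_fst measurable_fst).
  exact: (measurableT_comp mK h).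
have m2 : measurable_fun [set: (measurableTypeR R * V)%type] (fun q => (\int[vmu n]_x K (q.1, x) q.2)%E).
  by apply: (@measurable_fun_fubini_tonelli_F _ _ _ _ R (vmu n) (fun q : (measurableTypeR R * V) * X => K (q.1.1, q.2) q.1.2) m1).
apply: (@measurable_fun_fubini_tonelli_G _ _ _ _ R leb (fun q : measurableTypeR R * V => (\int[vmu n]_x K (q.1, x) q.2)%E) m2).
by move=> q; apply: integral_ge0 => x _.
Qed.

(** The space-time integral is split into time and space, and each is exchanged with [y] in turn. *)
Lemma tonelli_TX : (\int[leb \x vmu n]_p \int[vmu k]_y K p y = \int[vmu k]_y \int[leb \x vmu n]_p K p y)%E.
Proof.
have E y : (\int[leb \x vmu n]_p K p y = \int[leb]_t \int[vmu n]_x K (t, x) y)%E.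
  apply: (@fubini_tonelli1 _ _ _ _ R leb (vmu n) (fun p => K p y)) => //.
  exact: (measurableT_comp mK (measurable_pair2 y)).
under [RHS]eq_integral do rewrite E.
have mF : measurable_fun [set: TX] (fun p => (\int[vmu k]_y K p y)%E).
  by apply: (@measurable_fun_fubini_tonelli_F _ _ TX V R (vmu k) (fun q => K q.1 q.2) mK).
have -> : (\int[leb \x vmu n]_p \int[vmu k]_y K p y = \int[leb]_t \int[vmu n]_x \int[vmu k]_y K (t, x) y)%E.
  apply: (@fubini_tonelli1 _ _ _ _ R leb (vmu n) (fun p => \int[vmu k]_y K p y)%E) => //.
  by move=> p; apply: integral_ge0 => y _.
have m1 : measurable_fun [set: ((measurableTypeR R * V) * X)%type] (fun q => K (q.1.1, q.2) q.1.2).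
  have h : measurable_fun [set: ((measurableTypeR R * V) * X)%type]
     (fun q : (measurableTypeR R * V) * X => ((q.1.1, q.2), q.1.2) : (TX * V)%type).
    apply/measurable_fun_pairP; split => /=; last exact: (measurableT_comp measurable_snd measurable_fst).
    apply/measurable_fun_pairP; split => /=; last exact: measurable_snd.
    exact: (measurableT_comp measurable_fst measurable_fst).
  exact: (measurableT_comp mK h).
have m2 : measurable_fun [set: (measurableTypeR R * V)%type] (fun q => (\int[vmu n]_x K (q.1, x) q.2)%E).
  by apply: (@measurable_fun_fubini_tonelli_F _ _ _ _ R (vmu n) (fun q : (measurableTypeR R * V) * X => K (q.1.1, q.2) q.1.2) m1).
transitivity (\int[leb]_t \int[vmu k]_y \int[vmu n]_x K (t, x) y)%E.
  apply: eq_integral => t _.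
  apply: (@fubini_tonelli _ _ X V R (vmu n) (vmu k) (fun q => K (t, q.1) q.2)) => //.
  have h : measurable_fun [set: (X * V)%type] (fun q : X * V => ((t, q.1), q.2) : (TX * V)%type).
    apply/measurable_fun_pairP; split => /=; last exact: measurable_snd.
    by apply/measurable_fun_pairP; split => /=; [exact: measurable_cst|exact: measurable_fst].
  exact: (measurableT_comp mK h).
apply: (@fubini_tonelli _ _ _ V R leb (vmu k) (fun q => \int[vmu n]_x K (q.1, x) q.2)%E) => //.
by move=> q; apply: integral_ge0 => x _.
Qed.

End TonelliTX.

Section Flux2.
Context {R : realType} (N : nat) (gamma : 'I_3 -> 'M[R[i]]_N) (m : R) (b : bool).
Hypotheses (cg : clifford gamma) (hg : hermitian_gammas gamma) (m1 : `|m| <= 1).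
Local Notation V := (vec (R := R) 2).
Local Notation TX := (measurableTypeR R * vec (R := R) 2)%type.
Variables (f g : 'rV[R]_2 -> 'cV[R[i]]_N) (rho : R).
Hypotheses (f1 : in_L1 f) (F0 : 0 < nL1 f).
Hypotheses (g1 : in_L1 g) (gsupp : fourier_supp_ball g rho) (rho0 : 0 <= rho).
Variables (e T lam : R).
Hypotheses (e0 : 0 < e) (T0 : 0 < T) (lam0 : 0 < lam).
Local Notation phi := (phi gamma m g).
Local Notation P := (pdensity phi).
Local Notation J := (pcurrent gamma phi).
Local Notation a := (2 * e * T).

(** [cw1] multiplies the null density and [cw2] the plain density; they are the coefficients in
    [kernel_weight]. *)
Definition cw1 : R := 16 / a + 64 * lam / a ^+ 2.
Definition cw2 : R := 4 / a ^+ 2 * (32 * (8 * T ^+ 2 / lam + 1) + 8).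
Definition null_weight (t : R) (x y : 'rV[R]_2) : R :=
  cw1 * (lorentz a (cone y (e ^+ 2) t x) * null_density P J y (e ^+ 2) t x) + cw2 * P t x.

Let a0 : 0 < a. Proof. by rewrite !mulr_gt0. Qed.
Let c10 : 0 <= cw1.
Proof.
apply: addr_ge0; apply: divr_ge0 => //; first exact: ltW.
  by apply: mulr_ge0 => //; exact: ltW.
exact: sqr_ge0.
Qed.
Let c20 : 0 <= cw2.
Proof.
apply: mulr_ge0; first by apply: divr_ge0 => //; exact: sqr_ge0.
apply: addr_ge0 => //; apply: mulr_ge0 => //; apply: addr_ge0 => //; apply: divr_ge0; last exact: ltW.
by apply: mulr_ge0 => //; exact: sqr_ge0.
Qed.

Let P0 t x : 0 <= P t x. Proof. by rewrite pdensityE; exact: sqr_ge0. Qed.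
Let N0 y t x : 0 <= null_density P J y (e ^+ 2) t x.
Proof. by rewrite (null_density_nullv cg hg); exact: sqr_ge0. Qed.

Lemma null_weight_ge0 t x y : 0 <= null_weight t x y.
Proof.
apply: addr_ge0; last exact: mulr_ge0.
by apply: mulr_ge0 => //; apply: mulr_ge0 => //; exact: lorentz_ge0.
Qed.

Lemma dbar_null_weight t x y v : T <= t -> t <= 2 * T ->
  cmod (dbar gamma (Kmx (gsign gamma b) m (e +i* (tsign b * t)) (x - y) *m v) (phi t x)) ^+ 2 <=
  vnorm v ^+ 2 * null_weight t x y.
Proof.
move=> Tt tT; have t0 : 0 < t by exact: lt_le_trans Tt.
rewrite (dbar_gsign gamma b).
have zt : complex.Im (e +i* (tsign b * t)) != 0 :> R.
  by rewrite /= mulf_neq0 ?(gt_eqF t0)// /tsign; case: b; rewrite ?oppr_eq0 oner_neq0.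
have z0 : 0 < complex.Re (e +i* (tsign b * t)) :> R by [].
apply: le_trans (dbar_kernel2 (gsign_clifford b cg) (gsign_hermitian b hg) m (x - y) z0 zt v (phi t x)) _.
apply: ler_wpM2l; first exact: sqr_ge0.
rewrite (nullv_gsign b e t (x - y) (phi t x) cg hg) -(null_density_nullv cg hg) -pdensityE.
have ts : `|tsign b * t| = t.
  by rewrite normrM (gtr0_norm t0) /tsign; case: b; rewrite ?normrN normr1 mul1r.
have ts2 : (tsign b * t) ^+ 2 = t ^+ 2.
  by rewrite exprMn /tsign; case: b; rewrite ?sqrrN expr1n mul1r.
have -> : complex.Re (e +i* (tsign b * t)) * `|complex.Im (e +i* (tsign b * t))| = e * t by rewrite /= ts.
rewrite /null_weight /cw1 /cw2.
apply: (@kernel_weight R e t T lam (dotv (x - y) (x - y)) _ _ _ 0 _) => //.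
- exact: dotv_ge0.
- exact: cmod_ge0.
- rewrite cmod_sqr Im_cone_symbol.
  have -> : complex.Re (cone_symbol (e +i* (tsign b * t)) (x - y)) = - cone y (e ^+ 2) t x.
    by rewrite /cone_symbol /cone expr2 !ReImE/= -[_ * t * _]expr2 ts2; ring.
  by rewrite sqrrN /= [in X in _ + X = _]exprMn ts2 -exprMn.
have -> : e ^+ 2 + t ^+ 2 + dotv (x - y) (x - y) = cmod (e +i* t) ^+ 2 + dotv (x - y) (x - y).
  by rewrite cmod_sqr.
rewrite (null_density_nullv cg hg) (vnorm_nullv cg hg) pdensityE /=.
have E2 : eucl (x - y) ^+ 2 = dotv (x - y) (x - y) by rewrite sqr_sqrtr ?dotv_ge0.
(* By Cauchy-Schwarz the current is at most [r P] with [r = |x - y|], and [2 t r <= t^2 + r^2] then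
   gives the last hypothesis of [kernel_weight]. *)
have cur : `|current gamma (x - y) (phi t x)| <= eucl (x - y) * vnorm (phi t x) ^+ 2.
  apply: le_trans (Re_hdot_le _ _) _.
  have -> : vnorm (aslash gamma (x - y) *m phi t x) = eucl (x - y) * vnorm (phi t x).
    apply/eqP; rewrite -(@eqrXn2 _ 2) ?mulr_ge0 ?vnorm_ge0 ?sqrtr_ge0//.
    apply/eqP; apply: (etrans (vnorm_aslash cg hg (x - y) (phi t x))).
    by rewrite [RHS]exprMn E2.
  by rewrite mulrCA expr2.
rewrite cmod_sqr/= -E2; move: cur; have := sqr_ge0 (vnorm (phi t x)).
have := sqrtr_ge0 (dotv (x - y) (x - y)); rewrite -/(eucl (x - y)).
move: (vnorm _ ^+ 2) (eucl _) (current _ _ _) => p r c r0 p0 hc.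
have hc' : - c <= r * p by apply: le_trans hc; rewrite -normrN ler_norm.
have h1 : 0 <= (t - r) ^+ 2 * p by rewrite mulr_ge0// sqr_ge0.
have h2 : 0 <= e ^+ 2 * p by rewrite mulr_ge0// sqr_ge0.
have h3 : t * - c <= t * (r * p) by rewrite ler_wpM2l// ltW.
by nra.
Qed.

Local Notation A := (mass_bound gamma g rho).
Local Notation mu2 := (leb \x vmu 2)%E.

Let mphi i : mcfun (fun p : TX => phi p.1 p.2 i 0).
Proof. exact: (mcfun_wave gamma m g1 i (symb1 2 rho) (symb1 2 rho)). Qed.

Let mP : measurable_fun [set: TX] (fun p => P p.1 p.2). Proof. exact: (measurable_pdensity mphi). Qed.
Let mJ l : measurable_fun [set: TX] (fun p => J l p.1 p.2). Proof. exact: (measurable_pcurrent gamma mphi l). Qed.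

Lemma measurable_null_weight : measurable_fun [set: (TX * V)%type] (fun q => null_weight q.1.1 q.1.2 q.2).
Proof.
have mt : measurable_fun [set: (TX * V)%type] (fun q : TX * V => q.1.1 : measurableTypeR R).
  exact: (measurableT_comp measurable_fst measurable_fst).
have mxy : measurable_fun [set: (TX * V)%type] (fun q : TX * V => (q.1.2 : 'rV[R]_2) - q.2 : V).
  apply: measurable_vecB; last exact: measurable_snd.
  exact: (measurableT_comp measurable_snd measurable_fst).
have md := measurable_dotv mxy mxy.
have mP' : measurable_fun [set: (TX * V)%type] (fun q : TX * V => P q.1.1 q.1.2).
  exact: (measurableT_comp mP measurable_fst).
have msg : measurable_fun [set: (TX * V)%type] (fun q : TX * V => cone q.2 (e ^+ 2) q.1.1 q.1.2).
  apply: measurable_funB; last exact: measurable_cst.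
  by apply: measurable_funB; [exact: (measurable_funX 2 mt)|exact: md].
apply: measurable_funD; last by apply: measurable_funM; [exact: measurable_cst|exact: mP'].
apply: measurable_funM; first exact: measurable_cst.
apply: measurable_funM.
  by apply: (measurableT_comp _ msg); apply: continuous_measurable_fun; exact: continuous_lorentz.
apply: measurable_funB.
  apply: measurable_funM; last exact: mP'.
  apply: measurable_funD; last exact: md.
  by apply: measurable_funD; [exact: measurable_cst|exact: (measurable_funX 2 mt)].
apply: measurable_funM; first by apply: measurable_funM; [exact: measurable_cst|exact: mt].
apply: measurable_sum => l; apply: measurable_funM.
  exact: (measurableT_comp (@measurable_vec_coord R 2 l) mxy).
exact: (measurableT_comp (mJ l) measurable_fst).
Qed.

Definition null_weight_const : R := cw1 * (2 * T * (pi / a * A + (2 * a)^-1 * A)) + cw2 * (T * A).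

Let mchi : measurable_fun [set: TX] (fun p => chi T p.1).
Proof. exact: (measurableT_comp (rintegrable_measurable (rintegrable_chi T)) measurable_fst). Qed.

Let intP t : (\int[vmu 2]_x (P t x)%:E <= A%:E)%E.
Proof. by have := int_phi gamma m g1 gsupp rho0 t; under eq_integral do rewrite -pdensityE. Qed.

Lemma integral_chi_null_weight (y : 'rV[R]_2) : (\int[mu2]_p (chi T p.1 * null_weight p.1 p.2 y)%:E <= null_weight_const%:E)%E.
Proof.
have m2 : measurable_fun [set: TX] (fun p => chi T p.1 * P p.1 p.2) by exact: measurable_funM.
have m1' : measurable_fun [set: TX] (fun p => chi T p.1 * (lorentz a (cone y (e ^+ 2) p.1 p.2) * null_density P J y (e ^+ 2) p.1 p.2)).
  apply: measurable_funM; first exact: mchi.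
  apply: measurable_funM; last exact: (measurable_null_density mP mJ).
  by apply: (measurableT_comp _ (measurable_cone y (e ^+ 2))); apply: continuous_measurable_fun; exact: continuous_lorentz.
have q1 p : 0 <= chi T p.1 * (lorentz a (cone y (e ^+ 2) p.1 p.2) * null_density P J y (e ^+ 2) p.1 p.2).
  by apply: mulr_ge0; [exact: chi_ge0|apply: mulr_ge0 => //; exact: lorentz_ge0].
have q2 p : 0 <= chi T p.1 * P p.1 p.2 by apply: mulr_ge0 => //; exact: chi_ge0.
apply: (@le_trans _ _ (\int[mu2]_p (cw1%:E * (chi T p.1 * (lorentz a (cone y (e ^+ 2) p.1 p.2) * null_density P J y (e ^+ 2) p.1 p.2))%:E +
   cw2%:E * (chi T p.1 * P p.1 p.2)%:E))%E).
  rewrite le_eqVlt; apply/orP; left; apply/eqP; apply: eq_integral => p _.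
  by rewrite -!EFinM -EFinD /null_weight; congr (_%:E); ring.
rewrite ge0_integralD//; last 4 first.
- by move=> p _; rewrite -EFinM lee_fin; exact: mulr_ge0.
- by apply/measurable_EFinP; apply: measurable_funM; [exact: measurable_cst|exact: m1'].
- by move=> p _; rewrite -EFinM lee_fin; exact: mulr_ge0.
- by apply/measurable_EFinP; apply: measurable_funM; [exact: measurable_cst|exact: m2].
rewrite ge0_integralZl; [|exact: measurableT|by apply/measurable_EFinP|by move=> p _; rewrite lee_fin|by rewrite lee_fin].
rewrite ge0_integralZl; [|exact: measurableT|by apply/measurable_EFinP|by move=> p _; rewrite lee_fin|by rewrite lee_fin].
have -> : (null_weight_const%:E = cw1%:E * (2 * T * (pi / a * A + (2 * a)^-1 * A))%:E + cw2%:E * (T * A)%:E)%E.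
  by rewrite -!EFinM -EFinD.
apply: leeD.
  apply: lee_wpmul2l; first by rewrite lee_fin.
  have := flux_dirac m cg hg g1 gsupp rho0 y e a0 T0.
  by move=> h; under eq_integral do rewrite (null_density_nullv cg hg); exact: h.
apply: lee_wpmul2l; first by rewrite lee_fin.
have [i I] := chiP P0 mP intP T0.
apply: le_trans (_ : (\int[mu2]_p (chi T p.1 * P p.1 p.2))%:E <= _)%E; last by rewrite lee_fin.
by rewrite /Rintegral fineK//; exact: (integrable_fin_num measurableT i).
Qed.

Definition psi (t : R) (x : 'rV[R]_2) := mult (gsign gamma b) m (damp m (e +i* (tsign b * t))) f x.

Lemma mcfun_psi i : mcfun (fun p : TX => psi p.1 p.2 i 0).
Proof.
under eq_fun do rewrite mxE.
apply: mcfunM; first exact: mcfun_cst.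
apply: (@mcfun_cint _ _ _ TX V (vmu 2)); apply: mcfunM.
  apply: mcfun_cexpi; apply: measurable_dotv; last exact: measurable_snd.
  exact: (measurableT_comp measurable_snd measurable_fst).
apply: mcfunM; last exact: (mcfun_comp (mcfun_projfourier (gsign gamma b) m f1 i) measurable_snd).
apply: mcfun_cexp; apply: mcfunN; apply: mcfunM; last first.
  by apply: mcfun_real; exact: (measurableT_comp (measurable_om m) measurable_snd).
split => /=; first exact: measurable_cst.
apply: measurable_funM; first exact: measurable_cst.
exact: (measurableT_comp measurable_fst measurable_fst).
Qed.

Lemma mcfun_dbar (u v : R -> 'rV[R]_2 -> 'cV[R[i]]_N) : (forall i, mcfun (fun p : TX => u p.1 p.2 i 0)) ->
  (forall i, mcfun (fun p : TX => v p.1 p.2 i 0)) -> mcfun (fun p : TX => dbar gamma (u p.1 p.2) (v p.1 p.2)).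
Proof.
move=> mu mv; under eq_fun do rewrite dbarE hdotE.
apply: mcfun_sum => i; apply: mcfunM; first exact: mcfun_conj.
under eq_fun do rewrite mxE.
by apply: mcfun_sum => j; apply: mcfunM => //; exact: mcfun_cst.
Qed.

(** The flux bound is uniform in the apex [y] of the cone, so after [dbar_conv_sqr] and Tonelli the
    integral against [|f|] costs only another factor [nL1 f]. *)
Lemma conv_flux : (\int[mu2]_p (chi T p.1 * cmod (dbar gamma (psi p.1 p.2) (phi p.1 p.2)) ^+ 2)%:E <=
  (nL1 f ^+ 2 * null_weight_const)%:E)%E.
Proof.
pose K (p : TX) (y : V) : \bar R := (chi T p.1 * (vnorm (f y) * null_weight p.1 p.2 y))%:E.
have mK : measurable_fun [set: (TX * V)%type] (fun q => K q.1 q.2).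
  apply/measurable_EFinP; apply: measurable_funM; first exact: (measurableT_comp mchi measurable_fst).
  apply: measurable_funM; last exact: measurable_null_weight.
  exact: (measurableT_comp (measurable_vnorm_L1 f1) measurable_snd).
have K0 p y : (0 <= K p y)%E.
  by rewrite lee_fin; apply: mulr_ge0; [exact: chi_ge0|apply: mulr_ge0; [exact: vnorm_ge0|exact: null_weight_ge0]].
have mF : measurable_fun [set: TX] (fun p => (\int[vmu 2]_y K p y)%E).
  apply: (@measurable_fun_fubini_tonelli_F _ _ TX V R (vmu 2) (fun q => K q.1 q.2) mK) => q; exact: K0.
apply: (@le_trans _ _ (\int[mu2]_p ((nL1 f)%:E * \int[vmu 2]_y K p y))%E).
  apply: ge0_le_integral => //.
  - by move=> p _; rewrite lee_fin; apply: mulr_ge0; [exact: chi_ge0|exact: sqr_ge0].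
  - apply/measurable_EFinP; apply: measurable_funM; first exact: mchi.
    by apply: measurable_funX; apply: measurable_cmod; apply: mcfun_dbar; [exact: mcfun_psi|exact: mphi].
  - by apply: measurable_funeM.
  move=> [t x] _ /=; rewrite /K /=.
  have E : (\int[vmu 2]_y (chi T t * (vnorm (f y) * null_weight t x y))%:E =
     (chi T t)%:E * \int[vmu 2]_y (vnorm (f y) * null_weight t x y)%:E)%E.
    under eq_integral do rewrite EFinM.
    rewrite ge0_integralZl//.
    + apply/measurable_EFinP; apply: measurable_funM; first exact: measurable_vnorm_L1.
      exact: (measurableT_comp measurable_null_weight (measurable_pair1 (t, x))).
    + by move=> y _; rewrite lee_fin; apply: mulr_ge0; [exact: vnorm_ge0|exact: null_weight_ge0].
    + by rewrite lee_fin; exact: chi_ge0.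
  rewrite E muleCA EFinM /chi indicE; case: (boolP (t \in _)); last by rewrite !mul0e.
  rewrite inE/= in_itv/= => /andP[h1 h2]; rewrite !mul1e.
  (* The lemma asks for a lower bound of the damping that is at most one, and [e] may exceed one. *)
  apply: (dbar_conv_sqr (e := Num.min e 1)) => //.
  - by rewrite lt_min e0 ltr01.
  - by rewrite ge_min lexx orbT.
  - by rewrite /= ge_min lexx.
  - exact: (measurableT_comp measurable_null_weight (measurable_pair1 (t, x))).
  - by move=> y; exact: null_weight_ge0.
  - by move=> y v; exact: dbar_null_weight.
rewrite ge0_integralZl//; last 2 first.
- by move=> p _; apply: integral_ge0 => y _; exact: K0.
- by rewrite lee_fin ltW.
have -> : (\int[mu2]_p \int[vmu 2]_y K p y = \int[vmu 2]_y \int[mu2]_p K p y)%E.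
  exact: tonelli_TX.
rewrite expr2 -mulrA EFinM; apply: lee_wpmul2l; first by rewrite lee_fin ltW.
apply: (@le_trans _ _ (\int[vmu 2]_y ((vnorm (f y))%:E * null_weight_const%:E))%E).
  apply: ge0_le_integral => //.
  - by move=> y _; apply: integral_ge0 => p _; exact: K0.
  - exact: measurable_TX_G.
  - under eq_fun do rewrite -EFinM; apply/measurable_EFinP; apply: measurable_funM; last exact: measurable_cst.
    exact: measurable_vnorm_L1.
  move=> y _; rewrite /K.
  have E : (\int[mu2]_p (chi T p.1 * (vnorm (f y) * null_weight p.1 p.2 y))%:E =
     (vnorm (f y))%:E * \int[mu2]_p (chi T p.1 * null_weight p.1 p.2 y)%:E)%E.
    under eq_integral do rewrite mulrCA EFinM.
    rewrite ge0_integralZl//.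
    + apply/measurable_EFinP; apply: measurable_funM; first exact: mchi.
      exact: (measurableT_comp measurable_null_weight (measurable_pair2 y)).
    + by move=> p _; rewrite lee_fin; apply: mulr_ge0; [exact: chi_ge0|exact: null_weight_ge0].
    + by rewrite lee_fin; exact: vnorm_ge0.
  rewrite E; apply: lee_wpmul2l; first by rewrite lee_fin; exact: vnorm_ge0.
  exact: integral_chi_null_weight.
rewrite ge0_integralZr//.
- by rewrite -L1normE// L1norm_fin.
- by apply/measurable_EFinP; exact: measurable_vnorm_L1.
- by move=> y _; rewrite lee_fin; exact: vnorm_ge0.
- apply: le_trans (integral_chi_null_weight 0); apply: integral_ge0 => p _; rewrite lee_fin.
  by apply: mulr_ge0; [exact: chi_ge0|exact: null_weight_ge0].
Qed.

End Flux2.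

(** * Dyadic time blocks *)

Section Block.
Context {R : realType} (d N : nat) (gamma : 'I_d.+1 -> 'M[R[i]]_N) (J : nat).
Hypotheses (cg : clifford gamma) (hg : hermitian_gammas gamma) (d1 : (1 < d)%N) (J0 : (0 < J)%N).
Local Notation TX := (measurableTypeR R * vec (R := R) d)%type.

(** With [1 / rho] as unit of time, the dispersive decay on block [k] is [dyscale k ^+ d.-1] and the
    block has length [dyscale k ^- 2]. *)
Definition dyscale (k : nat) : R := Num.sqrt (2 ^- k).
(** Chosen so that [2 * theta = 2 ^- (d * J)]: with [(k %/ J).+1] terms the binomial error
    [(2 * theta) ^+ (k %/ J).+1] is at most [2 ^- (d * k)], while the coefficients cost only
    [2 ^+ (k %/ J).+1]. *)
Definition theta : R := 2 ^- (d * J).+1.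

Lemma dyscale_gt0 k : 0 < dyscale k.
Proof. by rewrite sqrtr_gt0 invr_gt0 exprn_gt0. Qed.
Lemma dyscale_le1 k : dyscale k <= 1.
Proof. by rewrite -[X in _ <= X]sqrtr1 ler_wsqrtr// invf_le1 ?exprn_gt0// exprn_ege1// ler1n. Qed.
Lemma dyscale_sqr k : dyscale k ^+ 2 = 2 ^- k.
Proof. by rewrite sqr_sqrtr// invr_ge0 exprn_ge0. Qed.
Lemma theta_gt0 : 0 < theta.
Proof. by rewrite invr_gt0 exprn_gt0. Qed.
Lemma theta_le1 : theta <= 1.
Proof. by rewrite invf_le1 ?exprn_gt0// exprn_ege1// ler1n. Qed.

Lemma theta_pow2 k : (2 * theta) ^+ (k %/ J).+1 <= dyscale k ^+ (2 * d).
Proof.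
have -> : 2 * theta = 2 ^- (d * J).
  by rewrite /theta exprS invfM mulrA divff ?mul1r.
rewrite exprVn -exprM.
apply: (@le_trans _ _ (2 ^- (d * k))).
  rewrite lef_pV2 ?posrE ?exprn_gt0// ler_eXn2l ?ltr1n// -mulnA leq_mul2l.
  by rewrite mulnC [X in (_ <= X)%N]mulnC ltnW ?orbT// mulnC ltn_ceil.
have -> : 2 ^- (d * k) = dyscale k ^+ (2 * d) :> R by rewrite [RHS]exprM dyscale_sqr exprVn -exprM mulnC.
by [].
Qed.

Lemma theta_pow k : (2 * theta) ^+ (k %/ J).+1 <= dyscale k ^+ d.-1.
Proof.
apply: le_trans (theta_pow2 k) _.
apply: ler_wiXn2l; rewrite ?(ltW (dyscale_gt0 k)) ?dyscale_le1//.
by rewrite mulSn mul1n; apply: leq_trans (leq_pred d) (leq_addr _ _).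
Qed.

Section data.
Variables (m rho : R) (f : 'rV[R]_d -> 'cV[R[i]]_N).
Hypotheses (m1 : `|m| <= 1) (rho1 : 1 <= rho) (f1 : in_L1 f) (fsupp : fourier_supp_ball f rho).
Let rho0 : 0 < rho := lt_le_trans ltr01 rho1.

Definition block_eps : R := theta / rho.
Lemma block_eps_gt0 : 0 < block_eps. Proof. by rewrite divr_gt0// theta_gt0. Qed.
Lemma block_eps_le1 : block_eps <= 1.
Proof. by rewrite ler_pdivrMr// mul1r (le_trans theta_le1). Qed.
Lemma block_eps_rho : block_eps * rho = theta.
Proof. by rewrite /block_eps divfK// gt_eqF. Qed.

(** The first summand comes from the damped terms, the second from the binomial error. *)
Definition sup_const : R := 2 * (N%:R * kernel_const gamma * (Num.sqrt pi ^+ d.-1 * (2 / Num.sqrt theta) ^+ d.+1)) +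
  (2 * pi) ^- d * (N%:R * gbound gamma * 2 ^+ d).

Lemma sup_const_ge0 : 0 <= sup_const.
Proof.
have p0 := @pi_ge0 R; have gb := le_trans ler01 (gbound_ge1 gamma); have kc := kernel_const_ge0 gamma.
apply: addr_ge0; repeat (first [exact: gb | exact: kc | apply: mulr_ge0 | apply: exprn_ge0 | apply: sqrtr_ge0 | rewrite invr_ge0 | exact: ler0n | exact: p0]).
Qed.

Lemma binom_rest_block k b t x i :
  cmod (mult (gsign gamma b) m (binom_rest m block_eps (tsign b * t) (k %/ J).+1) f x i 0) <=
  sup_const * (rho ^+ d * dyscale k ^+ (2 * d)) * nL1 f.
Proof.
have ge := block_eps_gt0.
apply: (@le_trans _ _ (multbound (gsign gamma b) f rho (dyscale k ^+ (2 * d)))).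
  apply: (cmod_mult _ _ f1 fsupp (ltW rho0)); first exact: mcfun_binom_rest.
  move=> xi xr; apply: le_trans (cmod_binom_rest rho1 m1 _ _ ge xr) _.
  by rewrite block_eps_rho theta_pow2.
rewrite /multbound gbound_gsign.
have p0 := @pi_ge0 R; have gb := le_trans ler01 (gbound_ge1 gamma); have kc := kernel_const_ge0 gamma.
have n0 := nL1_ge0 f1; have s0 := ltW (dyscale_gt0 k).
have -> : (2 * pi) ^- d * (dyscale k ^+ (2 * d) * (N%:R * gbound gamma * nL1 f) * (2 * rho) ^+ d) =
  (2 * pi) ^- d * (N%:R * gbound gamma * 2 ^+ d) * (rho ^+ d * dyscale k ^+ (2 * d)) * nL1 f.
  by rewrite [(2 * rho) ^+ d]exprMn; move: ((2 * pi) ^- d) (dyscale k ^+ _) => u1 u2; ring.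
apply: ler_wpM2r => //; apply: ler_wpM2r; first by apply: mulr_ge0; apply: exprn_ge0 => //; exact: ltW.
rewrite /sup_const lerDr.
by repeat (first [exact: kc | apply: mulr_ge0 | apply: exprn_ge0 | apply: sqrtr_ge0 | rewrite invr_ge0 | exact: ler0n]).
Qed.

Lemma sup_block k b t x i : 2 ^+ k / rho <= t ->
  cmod (mult (gsign gamma b) m (phase m (- (tsign b * t))) f x i 0) <=
  sup_const * (2 ^+ (k %/ J) * (rho ^+ d * dyscale k ^+ d.-1)) * nL1 f.
Proof.
move=> Tt; have ge := block_eps_gt0; have gl := block_eps_le1.
have t0 : 0 < t by apply: lt_le_trans Tt; rewrite divr_gt0// exprn_gt0.
have ts : `|tsign b * t| = t.
  by rewrite normrM (gtr0_norm t0) /tsign; case: (b); rewrite ?normrN normr1 mul1r.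
have st0 : tsign b * t != 0.
  by rewrite mulf_neq0 ?(gt_eqF t0)// /tsign; case: (b); rewrite ?oppr_eq0 oner_neq0.
apply: le_trans (sup_mult (gsign gamma b) f1 fsupp rho1 m1 d1 (k %/ J).+1 x i ge gl st0) _.
rewrite block_eps_rho kernel_const_gsign /multbound gbound_gsign.
have p0 := @pi_ge0 R; have gb := le_trans ler01 (gbound_ge1 gamma); have kc := kernel_const_ge0 gamma.
have n0 := nL1_ge0 f1; have s0 := ltW (dyscale_gt0 k).
have sr : sdecay d block_eps (tsign b * t) <= (Num.sqrt pi ^+ d.-1 * (2 / Num.sqrt theta) ^+ d.+1) * (rho ^+ d * dyscale k ^+ d.-1).
  rewrite /sdecay ts.
  have h1 : Num.sqrt (pi / t) <= Num.sqrt pi * (Num.sqrt rho * dyscale k).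
    rewrite /dyscale -sqrtrM ?(ltW rho0)// -sqrtrM// ler_wsqrtr//.
    rewrite ler_wpM2l// -[X in _ <= X]invrK lef_pV2 ?posrE ?invr_gt0 ?divr_gt0 ?exprn_gt0//.
    by rewrite invfM invrK mulrC.
  have h2 : 2 / Num.sqrt block_eps = 2 / Num.sqrt theta * Num.sqrt rho.
    rewrite /block_eps; move: theta_gt0; move: theta => th th0.
    by rewrite sqrtrM ?(ltW th0)// sqrtrV ?(ltW rho0)// invfM invrK mulrA.
  rewrite h2; apply: (@le_trans _ _ ((Num.sqrt pi * (Num.sqrt rho * dyscale k)) ^+ d.-1 * (2 / Num.sqrt theta * Num.sqrt rho) ^+ d.+1)).
    apply: ler_wpM2r; first by apply: exprn_ge0; rewrite !mulr_ge0 ?invr_ge0 ?sqrtr_ge0.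
    by apply: lerXn2r => //; rewrite nnegrE ?sqrtr_ge0// !mulr_ge0 ?sqrtr_ge0.
  (* Of the half powers of [rho], [d - 1] come from the unit of time and [d + 1] from the
     damping. *)
  have E : rho ^+ d = Num.sqrt rho ^+ d.-1 * Num.sqrt rho ^+ d.+1.
    rewrite -exprD (_ : (d.-1 + d.+1 = 2 * d)%N); first by rewrite exprM sqr_sqrtr ?(ltW rho0).
    by rewrite addnS -addSn prednK ?(ltnW d1)// mulSn mul1n.
  rewrite E !exprMn le_eqVlt; apply/orP; left; apply/eqP.
  by move: (Num.sqrt pi ^+ _) (Num.sqrt rho ^+ _) (Num.sqrt rho ^+ _) (dyscale k ^+ _) (_ ^+ d.+1) (_ ^+ d.+1) => v1 v2 v3 v4 v5 v6; ring.
have w0 : 0 <= rho ^+ d * dyscale k ^+ d.-1 by apply: mulr_ge0; apply: exprn_ge0 => //; exact: ltW.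
have tw1 : 1 <= 2 ^+ (k %/ J) :> R by rewrite exprn_ege1// ler1n.
have dist (u v w n : R) : (u + v) * w * n = u * w * n + v * w * n by rewrite !mulrDl.
rewrite /sup_const [X in _ <= X]dist; apply: lerD.
  rewrite exprS; apply: (@le_trans _ _ (2 * 2 ^+ (k %/ J) * (N%:R * (kernel_const gamma * ((Num.sqrt pi ^+ d.-1 * (2 / Num.sqrt theta) ^+ d.+1) * (rho ^+ d * dyscale k ^+ d.-1))) * nL1 f))).
    apply: ler_wpM2l; first by rewrite mulr_ge0// exprn_ge0.
    by apply: ler_wpM2r => //; apply: ler_wpM2l => //; apply: ler_wpM2l.
  rewrite le_eqVlt; apply/orP; left; apply/eqP.
  by move: (Num.sqrt pi ^+ _ * _) (rho ^+ d * _) (2 ^+ (k %/ J)) => v1 v2 v3; ring.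
have h3 := theta_pow k.
apply: (@le_trans _ _ ((2 * pi) ^- d * (N%:R * gbound gamma * 2 ^+ d) * (rho ^+ d * (2 * theta) ^+ (k %/ J).+1) * nL1 f)).
  rewrite [(2 * rho) ^+ d]exprMn le_eqVlt; apply/orP; left; apply/eqP.
  by move: ((2 * pi) ^- d) ((2 * theta) ^+ _) => u1 u2; ring.
apply: ler_wpM2r => //; apply: ler_wpM2l.
  by repeat (first [exact: gb | apply: mulr_ge0 | apply: exprn_ge0 | rewrite invr_ge0 | exact: ler0n | exact: p0]).
apply: (@le_trans _ _ (rho ^+ d * dyscale k ^+ d.-1)); last by rewrite ler_peMl.
by apply: ler_wpM2l => //; apply: exprn_ge0; exact: ltW.
Qed.

Lemma phi_gsign t x : phi gamma m f t x =
  mult (gsign gamma false) m (phase m (- (tsign false * t))) f x +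
  mult (gsign gamma true) m (phase m (- (tsign true * t))) f x.
Proof.
rewrite /phi /wave /gsign /tsign.
have -> : mult gamma m (fun xi => phase m (-1 * t) xi * 1) f x = mult gamma m (phase m (- (1 * t))) f x.
  by apply: (mult_eq gamma m fsupp) => xi _; rewrite mulr1 mulN1r mul1r.
have -> : mult (gflip gamma) m (fun xi => phase m (1 * t) xi * 1) f x = mult (gflip gamma) m (phase m (- (-1 * t))) f x.
  by apply: (mult_eq (gflip gamma) m fsupp) => xi _; rewrite mulr1 mulN1r mul1r opprK.
by [].
Qed.

End data.
End Block.

Section BlockIntegral.
Context {R : realType} (d N : nat) (gamma : 'I_d.+1 -> 'M[R[i]]_N).
Hypotheses (cg : clifford gamma) (hg : hermitian_gammas gamma).
Local Notation TX := (measurableTypeR R * vec (R := R) d)%type.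
Variables (m rho : R) (g : 'rV[R]_d -> 'cV[R[i]]_N).
Hypotheses (g1 : in_L1 g) (gsupp : fourier_supp_ball g rho) (rho0 : 0 < rho).
Local Notation phi := (phi gamma m g).
Local Notation mu2 := (leb \x vmu d)%E.

Lemma mcfun_phi i : mcfun (fun p : TX => phi p.1 p.2 i 0).
Proof. exact: (mcfun_wave gamma m g1 i (symb1 d rho) (symb1 d rho)). Qed.

Lemma mcfun_dbar_TX (u v : R -> 'rV[R]_d -> 'cV[R[i]]_N) : (forall i, mcfun (fun p : TX => u p.1 p.2 i 0)) ->
  (forall i, mcfun (fun p : TX => v p.1 p.2 i 0)) -> mcfun (fun p : TX => dbar gamma (u p.1 p.2) (v p.1 p.2)).
Proof.
move=> mu mv; under eq_fun do rewrite dbarE hdotE.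
apply: mcfun_sum => i; apply: mcfunM; first exact: mcfun_conj.
under eq_fun do rewrite mxE.
by apply: mcfun_sum => j; apply: mcfunM => //; exact: mcfun_cst.
Qed.

Lemma cmod_dbar (u v : 'cV[R[i]]_N) : cmod (dbar gamma u v) <= vnorm u * vnorm v.
Proof. by rewrite dbarE; apply: le_trans (cmod_hdot _ _) _; rewrite (vnorm_gamma0 cg hg). Qed.

Lemma intPP t : (\int[vmu d]_x (pdensity phi t x)%:E <= (mass_bound gamma g rho)%:E)%E.
Proof. by have := int_phi gamma m g1 gsupp (ltW rho0) t; under eq_integral do rewrite -pdensityE. Qed.

Lemma sup_block_integral (u : R -> 'rV[R]_d -> 'cV[R[i]]_N) (S T : R) : 0 < T -> 0 <= S ->
  (forall i, mcfun (fun p : TX => u p.1 p.2 i 0)) ->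
  (forall t x, T <= t -> t <= 2 * T -> vnorm (u t x) <= S) ->
  (\int[mu2]_p (chi T p.1 * cmod (dbar gamma (u p.1 p.2) (phi p.1 p.2)) ^+ 2)%:E <=
   (S ^+ 2 * (T * mass_bound gamma g rho))%:E)%E.
Proof.
move=> T0 S0 mu uS.
have P0 t x : 0 <= pdensity phi t x by rewrite pdensityE; exact: sqr_ge0.
have [i I] := chiP P0 (measurable_pdensity mcfun_phi) intPP T0.
apply: le_trans (integral_le_Rintegral _ _ _ (rintegrableZ (S ^+ 2) i)) _.
- apply: measurable_funM.
    exact: (measurableT_comp (rintegrable_measurable (rintegrable_chi T)) measurable_fst).
  by apply: measurable_funX; apply: measurable_cmod; apply: mcfun_dbar_TX; [exact: mu|exact: mcfun_phi].
- by move=> p; apply: mulr_ge0; [exact: chi_ge0|exact: sqr_ge0].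
- move=> [t x] /=; rewrite [X in _ <= X]mulrCA; apply: chi_le => h1 h2.
  rewrite pdensityE -exprMn; apply: lerXn2r; rewrite ?nnegrE ?cmod_ge0//.
    by apply: mulr_ge0 => //; exact: vnorm_ge0.
  apply: le_trans (cmod_dbar _ _) _; apply: ler_wpM2r; first exact: vnorm_ge0.
  exact: uS.
rewrite lee_fin (RintegralZl _ measurableT i); apply: ler_wpM2l => //; exact: sqr_ge0.
Qed.

Definition mass_const : R := 4 * N%:R * ((2 * pi) ^- d * ((N%:R * gbound gamma) ^+ 2 * 2 ^+ d)).

Lemma mass_boundE : mass_bound gamma g rho = mass_const * rho ^+ d * nL1 g ^+ 2.
Proof.
rewrite /mass_bound /mult_L2_bound /mass_const [(2 * rho) ^+ d]exprMn [(_ * nL1 g) ^+ 2]exprMn.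
by move: ((2 * pi) ^- d) => u; ring.
Qed.

Lemma mass_const_ge0 : 0 <= mass_const.
Proof.
have p0 := @pi_ge0 R.
apply: mulr_ge0; first by apply: mulr_ge0.
apply: mulr_ge0; first by rewrite invr_ge0; apply: exprn_ge0; apply: mulr_ge0.
by apply: mulr_ge0; [exact: sqr_ge0|exact: exprn_ge0].
Qed.

End BlockIntegral.

(** * Blocks in dimension at least three *)

Section Block3.
Context {R : realType} (d N : nat) (gamma : 'I_d.+1 -> 'M[R[i]]_N) (J : nat).
Hypotheses (cg : clifford gamma) (hg : hermitian_gammas gamma) (d2 : (2 < d)%N) (J0 : (0 < J)%N).
Local Notation TX := (measurableTypeR R * vec (R := R) d)%type.
Variables (m rho : R) (f g : 'rV[R]_d -> 'cV[R[i]]_N).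
Hypotheses (m1 : `|m| <= 1) (rho1 : 1 <= rho) (f1 : in_L1 f) (fsupp : fourier_supp_ball f rho).
Hypotheses (g1 : in_L1 g) (gsupp : fourier_supp_ball g rho).
Let rho0 : 0 < rho := lt_le_trans ltr01 rho1.
Let d1 : (1 < d)%N := ltnW d2.

(** The common target in all dimensions; [4 ^+ (k %/ J)] is the squared loss of the binomial
    expansion. *)
Definition block_weight k : R := 4 ^+ (k %/ J) * dyscale k ^+ d.-1 * (rho ^+ (3 * d) / rho) * (nL1 f * nL1 g) ^+ 2.

Definition block3_const : R := (N.+1%:R * (2 * sup_const gamma J)) ^+ 2 * mass_const gamma.

Lemma block3 k : (\int[leb \x vmu d]_p (chi (2 ^+ k / rho) p.1 *
    cmod (dbar gamma (phi gamma m f p.1 p.2) (phi gamma m g p.1 p.2)) ^+ 2)%:E <= (block3_const * block_weight k)%:E)%E.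
Proof.
have T0 : 0 < 2 ^+ k / rho by rewrite divr_gt0// exprn_gt0.
set B := sup_const gamma J * (2 ^+ (k %/ J) * (rho ^+ d * dyscale k ^+ d.-1)) * nL1 f.
have B0 : 0 <= B.
  apply: mulr_ge0; last exact: nL1_ge0.
  apply: mulr_ge0; first exact: sup_const_ge0.
  apply: mulr_ge0; first exact: exprn_ge0.
  by apply: mulr_ge0; apply: exprn_ge0; [exact: ltW|exact: ltW (dyscale_gt0 k)].
have S0 : 0 <= N.+1%:R * (2 * B) by apply: mulr_ge0 => //; exact: mulr_ge0.
apply: le_trans (sup_block_integral cg hg m g1 gsupp rho0 T0 S0 (mcfun_phi gamma m rho f1) _) _.
  move=> t x h1 h2; apply: vnorm_le_bound => [|i]; first exact: mulr_ge0.
  rewrite (phi_gsign gamma m fsupp) mxE; apply: le_trans (cmodD _ _) _.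
  have b1 := sup_block gamma d1 J0 m1 rho1 f1 fsupp false x i h1.
  have b2 := sup_block gamma d1 J0 m1 rho1 f1 fsupp true x i h1.
  by apply: le_trans (lerD b1 b2) _; rewrite -/B [2 * B]mulr_natl mulr2n lexx.
rewrite lee_fin mass_boundE /B /block3_const /block_weight.
have s0 : 0 < dyscale k :> R by exact: dyscale_gt0.
have s1 : dyscale k <= 1 :> R by exact: dyscale_le1.
have -> : 2 ^+ k = (dyscale k ^+ 2)^-1 :> R by rewrite dyscale_sqr invrK.
have -> : (4 : R) ^+ (k %/ J) = (2 ^+ (k %/ J)) ^+ 2 by rewrite -exprM mulnC exprM; congr (_ ^+ _); ring.
have -> : rho ^+ (3 * d) = (rho ^+ d) ^+ 3 by rewrite mulnC exprM.
(* Squared decay against the length of the block: [2 (d - 1) - 2 >= d - 1] holds from dimension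
   three on. *)
have ss : (dyscale k ^+ d.-1) ^+ 2 / dyscale k ^+ 2 <= dyscale k ^+ d.-1 :> R.
  rewrite ler_pdivrMr ?exprn_gt0// -exprM -exprD; apply: ler_wiXn2l; rewrite ?(ltW s0)//.
  by case: d d2 => [|[|[|d']]]// _; rewrite /= muln2 -addnn leq_add2l.
have K0 : 0 <= (N.+1%:R * (2 * sup_const gamma J)) ^+ 2 * mass_const gamma * ((2 ^+ (k %/ J)) ^+ 2 * ((rho ^+ d) ^+ 3 / rho) * (nL1 f * nL1 g) ^+ 2).
  apply: mulr_ge0; first by apply: mulr_ge0; [exact: sqr_ge0|exact: mass_const_ge0].
  apply: mulr_ge0; last exact: sqr_ge0.
  apply: mulr_ge0; first exact: sqr_ge0.
  by apply: divr_ge0; [do 2!apply: exprn_ge0|]; exact: ltW.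
have h := ler_wpM2l K0 ss.
rewrite [X in X <= _](_ : _ = (N.+1%:R * (2 * sup_const gamma J)) ^+ 2 * mass_const gamma *
  ((2 ^+ (k %/ J)) ^+ 2 * ((rho ^+ d) ^+ 3 / rho) * (nL1 f * nL1 g) ^+ 2) * ((dyscale k ^+ d.-1) ^+ 2 / dyscale k ^+ 2)); last first.
  by move: (dyscale k ^+ d.-1) (dyscale k ^+ 2)^-1 (rho ^+ d) (2 ^+ (k %/ J)) => v1 v2 v3 v4; ring.
apply: le_trans h _; rewrite le_eqVlt; apply/orP; left; apply/eqP.
by move: (dyscale k ^+ d.-1) (rho ^+ d) (2 ^+ (k %/ J)) => v1 v3 v4; ring.
Qed.

End Block3.

Section ChiIntegral.
Context {R : realType} (d : nat) (T : R).
Local Notation TX := (measurableTypeR R * vec (R := R) d)%type.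
Local Notation mu2 := (leb \x vmu d)%E.

Definition block_int (h : TX -> R) : \bar R := (\int[mu2]_p (chi T p.1 * h p)%:E)%E.

Let mchi : measurable_fun [set: TX] (fun p => chi T p.1).
Proof. exact: (measurableT_comp (rintegrable_measurable (rintegrable_chi T)) measurable_fst). Qed.

Let rchi (h : TX -> R) (B : R) : measurable_fun [set: TX] h -> (forall p, 0 <= h p) -> (block_int h <= B%:E)%E ->
  rintegrable mu2 (fun p => chi T p.1 * h p) /\ \int[mu2]_p (chi T p.1 * h p) <= B.
Proof.
move=> mh h0 hB; apply: rintegrable_of_le hB; first exact: measurable_funM.
by move=> p; apply: mulr_ge0 => //; exact: chi_ge0.
Qed.

Lemma block_int_sum n (c : 'I_n -> R) (h_ : 'I_n -> TX -> R) (B : 'I_n -> R) (h : TX -> R) :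
  measurable_fun [set: TX] h -> (forall p, 0 <= h p) ->
  (forall i, measurable_fun [set: TX] (h_ i)) -> (forall i p, 0 <= h_ i p) -> (forall i, 0 <= c i) ->
  (forall p, h p <= \sum_i c i * h_ i p) -> (forall i, (block_int (h_ i) <= (B i)%:E)%E) ->
  (block_int h <= (\sum_i c i * B i)%:E)%E.
Proof.
move=> mh h0 mh_ h_0 c0 hle hB.
have r i := rchi (mh_ i) (h_0 i) (hB i).
have [iS IS] := Rintegral_sum (fun i => rintegrableZ (c i) (r i).1).
apply: le_trans (integral_le_Rintegral _ _ _ iS) _.
- exact: measurable_funM.
- by move=> p; apply: mulr_ge0 => //; exact: chi_ge0.
- move=> p; apply: (@le_trans _ _ (chi T p.1 * \sum_i c i * h_ i p)).
    by apply: ler_wpM2l => //; exact: chi_ge0.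
  by rewrite mulr_sumr; apply: ler_sum => i _; rewrite mulrCA.
rewrite lee_fin IS; apply: ler_sum => i _; rewrite (RintegralZl _ measurableT (r i).1).
by apply: ler_wpM2l => //; exact: (r i).2.
Qed.

Lemma block_int_two (h1 h2 h : TX -> R) (B1 B2 : R) :
  measurable_fun [set: TX] h -> (forall p, 0 <= h p) ->
  measurable_fun [set: TX] h1 -> (forall p, 0 <= h1 p) -> measurable_fun [set: TX] h2 -> (forall p, 0 <= h2 p) ->
  (forall p, h p <= 2 * (h1 p + h2 p)) -> (block_int h1 <= B1%:E)%E -> (block_int h2 <= B2%:E)%E ->
  (block_int h <= (2 * (B1 + B2))%:E)%E.
Proof.
move=> mh h0 m1 h10 m2 h20 hle c1 c2.
have [r1 R1] := rchi m1 h10 c1; have [r2 R2] := rchi m2 h20 c2.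
have iS := rintegrableZ 2 (rintegrableD r1 r2).
apply: le_trans (integral_le_Rintegral _ _ _ iS) _.
- exact: measurable_funM.
- by move=> p; apply: mulr_ge0 => //; exact: chi_ge0.
- by move=> p; rewrite -mulrDr mulrCA; apply: ler_wpM2l => //; exact: chi_ge0.
rewrite lee_fin (RintegralZl _ measurableT (rintegrableD r1 r2)) (RintegralD measurableT r1 r2).
by apply: ler_wpM2l => //; exact: lerD.
Qed.

End ChiIntegral.

(** * Blocks in dimension two *)

Lemma block2_algebra {R : realType} (s q cd cs ca nn rho F G : R) : 0 < s -> s <= 1 -> 1 <= q -> 0 <= ca -> 0 < rho ->
  2 * (2 * (4 * q * (F ^+ 2 * (cd * (rho ^+ 3 * s) * (ca * rho ^+ 2 * G ^+ 2))) +
   (nn * (cs * (rho ^+ 2 * s ^+ (2 * 2)) * F)) ^+ 2 * ((rho * s ^+ 2)^-1 * (ca * rho ^+ 2 * G ^+ 2))) +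
   2 * (4 * q * (F ^+ 2 * (cd * (rho ^+ 3 * s) * (ca * rho ^+ 2 * G ^+ 2))) +
   (nn * (cs * (rho ^+ 2 * s ^+ (2 * 2)) * F)) ^+ 2 * ((rho * s ^+ 2)^-1 * (ca * rho ^+ 2 * G ^+ 2)))) <=
  4 * (8 * cd + 2 * (nn * cs) ^+ 2) * ca * (q * s * (rho ^+ (3 * 2) / rho) * (F * G) ^+ 2).
Proof.
move=> s0 s1 q1 ca0 r0.
have e1 : rho ^+ (3 * 2) / rho = rho ^+ 5 by rewrite (exprSr rho 5) mulfK// gt_eqF.
have e2 : (s ^+ (2 * 2)) ^+ 2 * (rho * s ^+ 2)^-1 = s ^+ 6 / rho by field; rewrite !gt_eqF.
have -> : (nn * (cs * (rho ^+ 2 * s ^+ (2 * 2)) * F)) ^+ 2 * ((rho * s ^+ 2)^-1 * (ca * rho ^+ 2 * G ^+ 2)) =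
  (nn * cs) ^+ 2 * (rho ^+ (3 * 2) / rho) * s ^+ 6 * ca * (F * G) ^+ 2.
  rewrite [LHS](_ : _ = (nn * cs) ^+ 2 * rho ^+ 6 * ((s ^+ (2 * 2)) ^+ 2 * (rho * s ^+ 2)^-1) * ca * (F * G) ^+ 2).
    by rewrite e2; move: (rho^-1) (s ^+ 6) => u v; ring.
  by move: (s ^+ (2 * 2)) (rho * s ^+ 2)^-1 => u v; ring.
rewrite e1.
rewrite [X in X <= _](_ : _ = 4 * (8 * cd * q * s + 2 * (nn * cs) ^+ 2 * s ^+ 6) * (ca * rho ^+ 5 * (F * G) ^+ 2)); last by ring.
rewrite [X in _ <= X](_ : _ = 4 * (8 * cd * q * s + 2 * (nn * cs) ^+ 2 * (q * s)) * (ca * rho ^+ 5 * (F * G) ^+ 2)); last by ring.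
apply: ler_wpM2r.
  apply: mulr_ge0; last exact: sqr_ge0.
  by apply: mulr_ge0 => //; apply: exprn_ge0; exact: ltW.
rewrite ler_wpM2l// lerD2l; apply: ler_wpM2l; first by rewrite mulr_ge0// sqr_ge0.
apply: (@le_trans _ _ s); last by rewrite ler_peMl// ltW.
by rewrite -[X in _ <= X]expr1; apply: ler_wiXn2l => //; exact: ltW.
Qed.

Section Block2.
Context {R : realType} (N : nat) (gamma : 'I_3 -> 'M[R[i]]_N) (J : nat).
Hypotheses (cg : clifford gamma) (hg : hermitian_gammas gamma) (J0 : (0 < J)%N).
Local Notation TX := (measurableTypeR R * vec (R := R) 2)%type.
Variables (m rho : R) (f g : 'rV[R]_2 -> 'cV[R[i]]_N).
Hypotheses (m1 : `|m| <= 1) (rho1 : 1 <= rho) (f1 : in_L1 f) (fsupp : fourier_supp_ball f rho).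
Hypotheses (g1 : in_L1 g) (gsupp : fourier_supp_ball g rho) (F0 : 0 < nL1 f).
Let rho0 : 0 < rho := lt_le_trans ltr01 rho1.
Local Notation A := (mass_bound gamma g rho).
Local Notation th := (theta (R := R) 2 J).
Local Notation eps := (block_eps (R := R) 2 J rho).

Let A0 : 0 <= A.
Proof.
rewrite mass_boundE; apply: mulr_ge0; last exact: sqr_ge0.
by apply: mulr_ge0; [exact: mass_const_ge0|apply: exprn_ge0; exact: ltW].
Qed.

(** [(2 * th)^-1] is [1 / a] for the smallest damping, up to its scaling in [rho] and [dyscale k].
    The number 1184 is [1024 + 160], the two parts of [cw2] once [dyscale k <= 1] is used. *)
Definition flux_const : R := (16 * ((2 * th)^-1) ^+ 2 + 64 * ((2 * th)^-1) ^+ 3) * (2 * pi + 1) + 1184 * ((2 * th)^-1) ^+ 2.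

Lemma flux_const_ge0 : 0 <= flux_const.
Proof.
have p0 := @pi_ge0 R; have k0 : 0 <= (2 * th)^-1 by rewrite invr_ge0 mulr_ge0// ltW// theta_gt0.
rewrite /flux_const; move: (2 * th)^-1 (pi : R) k0 p0 => ka p k0 p0.
apply: addr_ge0; last exact: mulr_ge0 (ler0n _ _) (sqr_ge0 _).
apply: mulr_ge0; last by lra.
by apply: addr_ge0; apply: mulr_ge0 => //; exact: exprn_ge0.
Qed.

(** Here [r] is [rho], [s] is [dyscale k], [ia] is [1 / a], [(r * s ^+ 2)^-1] is [T] and
    [(r ^+ 2 * s ^+ 3)^-1] is [lam]. With the upper bound for [ia] inserted, each term is a constant
    times at most [r ^+ 3 * s]. *)
Lemma null_weight_const_algebra (ia s r ka P : R) : 0 <= ia -> 0 < s -> s <= 1 -> 0 < r -> 0 <= P -> 0 <= ka ->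
  ia <= r ^+ 2 * s ^+ 2 * ka ->
  (r * s ^+ 2)^-1 * ((16 * ia + 64 * (r ^+ 2 * s ^+ 3)^-1 * ia ^+ 2) * (2 * (P * ia + ia / 2)) +
    4 * ia ^+ 2 * (32 * (8 * s^-1 + 1) + 8)) <=
  ((16 * ka ^+ 2 + 64 * ka ^+ 3) * (2 * P + 1) + 1184 * ka ^+ 2) * (r ^+ 3 * s).
Proof.
move=> ia0 s0 s1 r0 P0 k0 iw.
set w := r ^+ 2 * s ^+ 2 * ka.
have r2 := ltW r0; have s2 := ltW s0.
have w0 : 0 <= w by exact: le_trans ia0 iw.
have l0 : 0 <= (r ^+ 2 * s ^+ 3)^-1 by rewrite invr_ge0 mulr_ge0 ?exprn_ge0.
have i2 : ia ^+ 2 <= w ^+ 2 by apply: lerXn2r; rewrite ?nnegrE.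
have si : 0 <= s^-1 by rewrite invr_ge0.
have t0 : 0 <= (r * s ^+ 2)^-1 by rewrite invr_ge0 mulr_ge0 ?exprn_ge0.
apply: (@le_trans _ _ ((r * s ^+ 2)^-1 * ((16 * w + 64 * (r ^+ 2 * s ^+ 3)^-1 * w ^+ 2) * (2 * (P * w + w / 2)) +
    4 * w ^+ 2 * (32 * (8 * s^-1 + 1) + 8)))).
  apply: ler_wpM2l => //; apply: lerD.
    apply: ler_pM.
    - by apply: addr_ge0; apply: mulr_ge0 => //; [apply: mulr_ge0|exact: sqr_ge0].
    - by apply: mulr_ge0 => //; apply: addr_ge0; [exact: mulr_ge0|rewrite divr_ge0].
    - by apply: lerD; [rewrite ler_wpM2l|apply: ler_wpM2l => //; apply: mulr_ge0].
    - by rewrite ler_wpM2l//; apply: lerD; [rewrite ler_wpM2l|rewrite ler_wpM2r// invr_ge0].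
  by apply: ler_wpM2r; [lra|rewrite ler_wpM2l].
have -> : (r * s ^+ 2)^-1 * ((16 * w + 64 * (r ^+ 2 * s ^+ 3)^-1 * w ^+ 2) * (2 * (P * w + w / 2)) +
    4 * w ^+ 2 * (32 * (8 * s^-1 + 1) + 8)) =
  ((16 * ka ^+ 2 * s + 64 * ka ^+ 3) * (2 * P + 1) + (1024 + 160 * s) * ka ^+ 2) * (r ^+ 3 * s).
  by rewrite /w; field; rewrite !gt_eqF.
apply: ler_wpM2r; first by rewrite mulr_ge0 ?exprn_ge0.
apply: lerD.
  apply: ler_wpM2r; first lra.
  by rewrite lerD2r ler_piMr// mulr_ge0// sqr_ge0.
by apply: ler_wpM2r; [exact: sqr_ge0|lra].
Qed.

(** The third argument after [rho] is [lam], chosen to balance the flux term [lam / a ^+ 3] against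
    the term [T ^+ 2 / (lam * a ^+ 2)] away from the cone. As [a] is of order [T ^+ 2 * 2 ^- k],
    they agree for [lam] of order [T ^+ 2 * dyscale k]. A larger [j] only increases the damping, so
    [j = 0] is the worst case. *)
Lemma null_weight_const_le k (j : nat) (T := 2 ^+ k / rho) :
  null_weight_const gamma g rho (j.+1%:R * eps) T (T ^+ 2 * dyscale k) <= flux_const * (rho ^+ 3 * dyscale k) * A.
Proof.
have s0 : 0 < dyscale k :> R by exact: dyscale_gt0.
have s1 : dyscale k <= 1 :> R by exact: dyscale_le1.
have t0 : 0 < th by exact: theta_gt0.
have TE : T = (rho * dyscale k ^+ 2)^-1 by rewrite /T invfM dyscale_sqr invrK mulrC.
have j1 : 1 <= j.+1%:R :> R by rewrite ler1n.
have e0 : 0 < j.+1%:R * eps by rewrite mulr_gt0// divr_gt0.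
have T0 : 0 < T by rewrite divr_gt0// exprn_gt0.
have [ia iaE] : exists ia, ia = (2 * (j.+1%:R * eps) * T)^-1 by eexists.
have ia0 : 0 <= ia by rewrite iaE invr_ge0; apply: mulr_ge0; [apply: mulr_ge0 => //|]; exact: ltW.
have iw : ia <= rho ^+ 2 * dyscale k ^+ 2 * (2 * th)^-1.
  rewrite iaE TE /block_eps -[X in _ <= X]invrK lef_pV2 ?posrE; last 2 first.
  - by rewrite !(mulr_gt0, divr_gt0, invr_gt0, exprn_gt0).
  - by rewrite !(mulr_gt0, divr_gt0, invr_gt0, exprn_gt0).
  rewrite [X in _ <= X](_ : _ = j.+1%:R * (rho ^+ 2 * dyscale k ^+ 2 / (2 * th))^-1); last by field; rewrite !gt_eqF.
  by rewrite ler_peMl// invr_ge0 ltW// !(mulr_gt0, divr_gt0, invr_gt0, exprn_gt0).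
have k0 : 0 <= (2 * th)^-1 by rewrite invr_ge0 mulr_ge0// ltW.
have h := null_weight_const_algebra ia0 s0 s1 rho0 (pi_ge0 R) k0 iw.
have := ler_wpM2r A0 h; rewrite -/flux_const; apply: le_trans.
rewrite /null_weight_const /cw1 /cw2 -exprVn.
have E1 : T ^+ 2 * dyscale k = (rho ^+ 2 * dyscale k ^+ 3)^-1.
  by rewrite TE; move: (dyscale k) s0 => s s0; field; rewrite !gt_eqF.
have E2 : 8 * T ^+ 2 / (T ^+ 2 * dyscale k) = 8 * (dyscale k)^-1.
  have gen (x y : R) : 0 < x -> 0 < y -> 8 * x ^+ 2 / (x ^+ 2 * y) = 8 * y^-1.
    by move=> x0 y0; field; rewrite !gt_eqF.
  exact: gen.
have E3 : (2 * (2 * (j.+1%:R * eps) * T))^-1 = ia / 2 by rewrite iaE invfM mulrC.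
rewrite E2 E1 E3 -iaE TE le_eqVlt; apply/orP; left; apply/eqP.
by move: (dyscale k)^-1 (rho ^+ 2 * _)^-1 (rho * _)^-1 => v1 v2 v3; ring.
Qed.

Section fixk.
Variable k : nat.
Let T : R := 2 ^+ k / rho.
Let n := (k %/ J).+1.
Let T0 : 0 < T. Proof. by rewrite divr_gt0// exprn_gt0. Qed.
Let lam0 : 0 < T ^+ 2 * dyscale k. Proof. by apply: mulr_gt0; [exact: exprn_gt0|exact: dyscale_gt0]. Qed.
Let ej0 (j : nat) : 0 < j.+1%:R * eps. Proof. by rewrite mulr_gt0//; exact: block_eps_gt0. Qed.
Local Notation ph := (phi gamma m g).
Local Notation sq u := (fun p : TX => cmod (dbar gamma (u p.1 p.2) (ph p.1 p.2)) ^+ 2).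

Let msq (u : R -> 'rV[R]_2 -> 'cV[R[i]]_N) : (forall i, mcfun (fun p : TX => u p.1 p.2 i 0)) ->
  measurable_fun [set: TX] (sq u).
Proof.
move=> mu; apply: measurable_funX; apply: measurable_cmod; apply: mcfun_dbar_TX; first exact: mu.
by move=> i; exact: (mcfun_phi gamma m rho g1).
Qed.

Let BC : R := nL1 f ^+ 2 * (flux_const * (rho ^+ 3 * dyscale k) * A).

Let psij b (j : nat) := psi gamma m b f (j.+1%:R * eps).

Lemma block_int_psi b j : (block_int T (sq (psij b j)) <= BC%:E)%E.
Proof.
apply: le_trans (conv_flux b cg hg m1 f1 F0 g1 gsupp (ltW rho0) (ej0 j) T0 lam0) _.
rewrite lee_fin; apply: ler_wpM2l; [exact: sqr_ge0|exact: null_weight_const_le].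
Qed.

Definition bin_part b (t : R) (x : 'rV[R]_2) : 'cV[R[i]]_N :=
  \sum_(j < n) ((-1) ^+ j * 'C(n, j.+1)%:R) *: psij b j t x.
Definition binom_rest_part b (t : R) (x : 'rV[R]_2) : 'cV[R[i]]_N :=
  mult (gsign gamma b) m (binom_rest m eps (tsign b * t) n) f x.

Let mpsij b j i : mcfun (fun p : TX => psij b j p.1 p.2 i 0).
Proof. exact: mcfun_psi. Qed.

Let mbin b i : mcfun (fun p : TX => bin_part b p.1 p.2 i 0).
Proof.
rewrite /bin_part; under eq_fun do rewrite summxE.
apply: mcfun_sum => j; under eq_fun do rewrite mxE.
by apply: mcfunM; [exact: mcfun_cst|exact: mpsij].
Qed.

Let mrmd b i : mcfun (fun p : TX => binom_rest_part b p.1 p.2 i 0).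
Proof.
pose c (xi : 'rV[R]_2) : R[i] := ((1 - expR (- (eps * om m xi))) ^+ n)%:C.
have sc : symb rho c.
  split.
    apply: mcfun_real; apply: measurable_funX; apply: measurable_funB; first exact: measurable_cst.
    apply: measurableT_comp => //; apply: measurable_funN.
    by apply: measurable_funM; [exact: measurable_cst|exact: measurable_om].
  exists ((2 * (eps * rho)) ^+ n) => xi xr.
  have := cmod_binom_rest rho1 m1 0 n (block_eps_gt0 2 J rho1) xr.
  by rewrite /binom_rest cmodM cmod_phase mul1r.
have E p : binom_rest_part b p.1 p.2 = mult (gsign gamma b) m (fun xi => phase m (- tsign b * p.1) xi * c xi) f p.2.
  by apply: (mult_eq (gsign gamma b) m fsupp) => xi _; rewrite /binom_rest mulNr.
under eq_fun do rewrite E.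
exact: (mcfun_mult_tx (gsign gamma b) m f1 (- tsign b) i sc).
Qed.

(** Cauchy-Schwarz with the binomial coefficients as weights. Their sum, at most [2 ^+ n], enters
    once through Cauchy-Schwarz and once through the sum of the bounds, whence [4 ^+ n]. *)
Lemma block_int_bin b : (block_int T (sq (bin_part b)) <= (4 ^+ n * BC)%:E)%E.
Proof.
have B0 : 0 <= BC.
  apply: mulr_ge0; first exact: sqr_ge0.
  apply: mulr_ge0 => //; apply: mulr_ge0; first exact: flux_const_ge0.
  by apply: mulr_ge0; [apply: exprn_ge0; exact: ltW|exact: ltW (dyscale_gt0 k)].
apply: (@le_trans _ _ (\sum_(j < n) (2 ^+ n * 'C(n, j.+1)%:R) * BC)%:E); last first.
  rewrite lee_fin -mulr_suml -mulr_sumr; apply: ler_wpM2r => //.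
  have -> : (4 : R) ^+ n = 2 ^+ n * 2 ^+ n by rewrite -exprMn; congr (_ ^+ _); ring.
  by apply: ler_wpM2l; [exact: exprn_ge0|exact: sum_bin_le].
apply: (block_int_sum (h_ := fun j => sq (psij b j))).
- exact: (msq (mbin b)).
- by move=> p; exact: sqr_ge0.
- by move=> j; apply: msq => i; exact: mpsij.
- by move=> j p; exact: sqr_ge0.
- by move=> j; apply: mulr_ge0 => //; exact: exprn_ge0.
- move=> p.
  have -> : dbar gamma (bin_part b p.1 p.2) (ph p.1 p.2) =
    \sum_(j < n) cconj ((-1) ^+ j * 'C(n, j.+1)%:R) * dbar gamma (psij b j p.1 p.2) (ph p.1 p.2).
    rewrite dbarE /bin_part; under [RHS]eq_bigr do rewrite dbarE -hdotZl.
    elim/big_rec2: _ => [|j u v _ <-]; last by rewrite hdotDl.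
    by rewrite hdotE big1// => i _; rewrite mxE cconj0 mul0r.
  pose c (j : 'I_n) : R := 'C(n, j.+1)%:R.
  have c0 j : 0 <= c j by exact: ler0n.
  pose x (j : 'I_n) := cmod (dbar gamma (psij b j p.1 p.2) (ph p.1 p.2)).
  have h1 : cmod (\sum_(j < n) cconj ((-1) ^+ j * 'C(n, j.+1)%:R) * dbar gamma (psij b j p.1 p.2) (ph p.1 p.2)) <= \sum_j c j * x j.
    apply: le_trans (cmod_sum _ _ _) _; apply: ler_sum => j _.
    by rewrite cmodM cmod_conj cmod_bin.
  have x0 j : 0 <= x j by exact: cmod_ge0.
  have s0 : 0 <= \sum_j c j * x j by apply: sumr_ge0 => j _; exact: mulr_ge0.
  apply: (@le_trans _ _ ((\sum_j c j * x j) ^+ 2)).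
    by apply: lerXn2r; rewrite ?nnegrE ?cmod_ge0.
  have h2 := cauchy_schwarz_sum (fun j => Num.sqrt (c j)) (fun j => Num.sqrt (c j) * x j).
  rewrite (eq_bigr (fun j => c j * x j)) in h2; last by move=> j _; rewrite mulrA -expr2 sqr_sqrtr.
  apply: le_trans h2 _.
  rewrite (eq_bigr c); last by move=> j _; rewrite sqr_sqrtr.
  rewrite [X in _ * X](eq_bigr (fun j => c j * x j ^+ 2)); last by move=> j _; rewrite exprMn sqr_sqrtr.
  apply: (@le_trans _ _ (2 ^+ n * \sum_j c j * x j ^+ 2)).
    apply: ler_wpM2r; last exact: sum_bin_le.
    by apply: sumr_ge0 => j _; apply: mulr_ge0 => //; exact: sqr_ge0.
  by rewrite mulr_sumr; apply: ler_sum => j _; rewrite mulrA.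
- by move=> j; exact: block_int_psi.
Qed.

Let BR : R := (N.+1%:R * (sup_const gamma J * (rho ^+ 2 * dyscale k ^+ (2 * 2)) * nL1 f)) ^+ 2 * (T * A).

(** The null structure is not called upon here: the error carries [dyscale k ^+ 4], whose square
    outweighs the length of the block. *)
Lemma block_int_binom_rest b : (block_int T (sq (binom_rest_part b)) <= BR%:E)%E.
Proof.
have s0 := dyscale_gt0 (R := R) k.
have B0 : 0 <= sup_const gamma J * (rho ^+ 2 * dyscale k ^+ (2 * 2)) * nL1 f.
  apply: mulr_ge0; last exact: nL1_ge0.
  apply: mulr_ge0; first exact: sup_const_ge0.
  by apply: mulr_ge0; apply: exprn_ge0; exact: ltW.
apply: (sup_block_integral cg hg m g1 gsupp rho0 T0) => //.
- by apply: mulr_ge0.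
- move=> t x _ _; apply: vnorm_le_bound => // i.
  exact: (binom_rest_block gamma J0 m1 rho1 f1 fsupp).
Qed.

Definition block2_const : R := 4 * (8 * flux_const + 2 * (N.+1%:R * sup_const gamma J) ^+ 2) * mass_const gamma.

Lemma block2 : (block_int T (sq (phi gamma m f)) <= (block2_const * block_weight J rho f g k)%:E)%E.
Proof.
have mph i : mcfun (fun p : TX => phi gamma m f p.1 p.2 i 0) by exact: (mcfun_phi gamma m rho f1).
pose ub b (t : R) (x : 'rV[R]_2) := bin_part b t x + binom_rest_part b t x.
have mub b i : mcfun (fun p : TX => ub b p.1 p.2 i 0).
  by rewrite /ub; under eq_fun do rewrite mxE; apply: mcfunD; [exact: mbin|exact: mrmd].
have dD (u v w : 'cV[R[i]]_N) : cmod (dbar gamma (u + v) w) ^+ 2 <= 2 * (cmod (dbar gamma u w) ^+ 2 + cmod (dbar gamma v w) ^+ 2).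
  rewrite !dbarE hdotDl; apply: le_trans (sqrD_le2 _ _).
  by apply: lerXn2r; rewrite ?nnegrE ?addr_ge0 ?cmod_ge0// cmodD.
have hub b : (block_int T (sq (ub b)) <= (2 * (4 ^+ n * BC + BR))%:E)%E.
  apply: (block_int_two _ _ _ _ _ _ _ (block_int_bin b) (block_int_binom_rest b)).
  - exact: (msq (mub b)).
  - by move=> p; exact: sqr_ge0.
  - exact: (msq (mbin b)).
  - by move=> p; exact: sqr_ge0.
  - exact: (msq (mrmd b)).
  - by move=> p; exact: sqr_ge0.
  - by move=> p; exact: dD.
have hub2 : (block_int T (sq (phi gamma m f)) <= (2 * (2 * (4 ^+ n * BC + BR) + 2 * (4 ^+ n * BC + BR)))%:E)%E.
  apply: (block_int_two _ _ _ _ _ _ _ (hub false) (hub true)).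
  - exact: (msq mph).
  - by move=> p; exact: sqr_ge0.
  - exact: (msq (mub false)).
  - by move=> p; exact: sqr_ge0.
  - exact: (msq (mub true)).
  - by move=> p; exact: sqr_ge0.
  - move=> [t x] /=; rewrite (phi_gsign gamma m fsupp).
    have E b : mult (gsign gamma b) m (phase m (- (tsign b * t))) f x = ub b t x.
      exact: (mult_binomial (gsign gamma b) f1 fsupp rho1 m1 (tsign b * t) n x (block_eps_gt0 2 J rho1)).
    rewrite (E false) (E true); exact: dD.
apply: le_trans hub2 _; rewrite lee_fin /BC /BR mass_boundE /block_weight /block2_const.
have s0 := dyscale_gt0 (R := R) k; have s1 := dyscale_le1 (R := R) k.
have -> : T = (rho * dyscale k ^+ 2)^-1 by rewrite /T invfM dyscale_sqr invrK mulrC.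
have -> : (4 : R) ^+ n = 4 * 4 ^+ (k %/ J) by rewrite /n exprS.
have q1 : 1 <= (4 : R) ^+ (k %/ J) by rewrite exprn_ege1// ler1n.
have c0 : 0 <= mass_const gamma by exact: mass_const_ge0.
rewrite /= expr1.
exact: block2_algebra.
Qed.

End fixk.
End Block2.

Lemma block_all {R : realType} (d N J : nat) (gamma : 'I_d.+1 -> 'M[R[i]]_N) :
  clifford gamma -> hermitian_gammas gamma -> (1 < d)%N -> (0 < J)%N ->
  exists2 C : R, 0 <= C & forall (m rho : R) (f g : 'rV[R]_d -> 'cV[R[i]]_N) (k : nat), `|m| <= 1 -> 1 <= rho ->
   in_L1 f -> fourier_supp_ball f rho -> in_L1 g -> fourier_supp_ball g rho -> 0 < nL1 f ->
   (block_int (d := d) (2 ^+ k / rho)%R (fun p => (cmod (dbar gamma (phi gamma m f p.1 p.2) (phi gamma m g p.1 p.2)) ^+ 2)%R)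
     <= (C * block_weight J rho f g k)%:E)%E.
Proof.
move=> cg hg d1 J0; have [d2|] := ltnP 2 d.
  exists (block3_const gamma J); first by apply: mulr_ge0; [exact: sqr_ge0|exact: mass_const_ge0].
  move=> m rho f g k m1 rho1 f1 fs g1 gs _.
  exact: (block3 cg hg d2 J0 m1 rho1 f1 fs g1 gs k).
case: d gamma cg hg d1 => [//|[//|[|//]]] gamma cg hg _ _.
exists (block2_const gamma J).
  apply: mulr_ge0; last exact: mass_const_ge0.
  apply: mulr_ge0 => //; apply: addr_ge0; apply: mulr_ge0 => //; [exact: flux_const_ge0|exact: sqr_ge0].
move=> m rho f g k m1 rho1 f1 fs g1 gs F0.
exact: (block2 cg hg J0 m1 rho1 f1 fs g1 gs F0 k).
Qed.

(** * The space integral at fixed time *)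

Section TimeFunction.
Context {R : realType} (d N : nat) (m rho : R) (f g : 'rV[R]_d -> 'cV[R[i]]_N).
Hypotheses (rho0 : 0 < rho) (f1 : in_L1 f) (fsupp : fourier_supp_ball f rho).
Hypotheses (g1 : in_L1 g) (gsupp : fourier_supp_ball g rho).
Local Notation TX := (measurableTypeR R * vec (R := R) d)%type.

Section onegamma.
Variable gamma : 'I_d.+1 -> 'M[R[i]]_N.
Hypotheses (cg : clifford gamma) (hg : hermitian_gammas gamma).

Definition dbar_sqr (t : R) (x : 'rV[R]_d) : R :=
  cmod (dbar gamma (phi gamma m f t x) (phi gamma m g t x)) ^+ 2.
Definition slice_int (t : R) : \bar R := (\int[vmu d]_x (dbar_sqr t x)%:E)%E.
Definition slice_energy (t : R) : R := fine (slice_int t).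

Lemma measurable_dbar_sqr : measurable_fun [set: TX] (fun p => dbar_sqr p.1 p.2).
Proof.
apply: measurable_funX; apply: measurable_cmod; apply: mcfun_dbar_TX => i.
  exact: (mcfun_phi gamma m rho f1).
exact: (mcfun_phi gamma m rho g1).
Qed.

Lemma dbar_sqr_ge0 t x : 0 <= dbar_sqr t x. Proof. exact: sqr_ge0. Qed.

Definition slice_const : R := (N.+1%:R * (2 * ((2 * pi) ^- d * (N%:R * gbound gamma * 2 ^+ d)))) ^+ 2 * mass_const gamma.

Lemma slice_const_ge0 : 0 <= slice_const.
Proof. by apply: mulr_ge0; [exact: sqr_ge0|exact: mass_const_ge0]. Qed.

Lemma vnorm_phi_le t x : vnorm (phi gamma m f t x) <=
  N.+1%:R * (2 * ((2 * pi) ^- d * (N%:R * gbound gamma * 2 ^+ d))) * (rho ^+ d * nL1 f).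
Proof.
have p0 := @pi_ge0 R; have gb := le_trans ler01 (gbound_ge1 gamma); have n0 := nL1_ge0 f1.
have b0 : 0 <= (2 * pi) ^- d * (N%:R * gbound gamma * 2 ^+ d) * (rho ^+ d * nL1 f).
  apply: mulr_ge0; last by apply: mulr_ge0 => //; apply: exprn_ge0; exact: ltW.
  apply: mulr_ge0; first by rewrite invr_ge0; apply: exprn_ge0; apply: mulr_ge0.
  by apply: mulr_ge0; [apply: mulr_ge0|apply: exprn_ge0].
have b (t' : R) b' i : cmod (mult (gsign gamma b') m (phase m t') f x i 0) <=
   (2 * pi) ^- d * (N%:R * gbound gamma * 2 ^+ d) * (rho ^+ d * nL1 f).
  apply: (@le_trans _ _ (multbound (gsign gamma b') f rho 1)).
    apply: (cmod_mult _ _ f1 fsupp (ltW rho0)); first exact: mcfun_phase.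
    by move=> xi _; rewrite cmod_phase.
  rewrite /multbound gbound_gsign [(2 * rho) ^+ d]exprMn le_eqVlt; apply/orP; left; apply/eqP.
  by move: ((2 * pi) ^- d) => u; ring.
rewrite -[X in _ <= X]mulrA -[X in _ <= _ * X]mulrA; apply: vnorm_le_bound => [|i]; first exact: mulr_ge0.
rewrite (phi_gsign gamma m fsupp) mxE; apply: le_trans (cmodD _ _) _.
by apply: le_trans (lerD (b _ false i) (b _ true i)) _; rewrite [X in _ <= X]mulr_natl mulr2n.
Qed.

(** Serves the times [|t| <= 1 / rho], which lie in no block, and the finiteness of every slice. *)
Lemma slice_int_le t : (slice_int t <= (slice_const * (rho ^+ (3 * d) * (nL1 f * nL1 g) ^+ 2))%:E)%E.
Proof.
have P0 x : 0 <= pdensity (phi gamma m g) t x by rewrite pdensityE; exact: sqr_ge0.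
have mP : measurable_fun [set: vec (R := R) d] (pdensity (phi gamma m g) t).
  exact: (measurableT_comp (measurable_pdensity (mcfun_phi gamma m rho g1)) (measurable_pair1 t)).
have [iP IP] := rintegrable_of_le mP P0 (intPP gamma m g1 gsupp rho0 t).
pose S := N.+1%:R * (2 * ((2 * pi) ^- d * (N%:R * gbound gamma * 2 ^+ d))) * (rho ^+ d * nL1 f).
have S0 : 0 <= S by exact: le_trans (vnorm_ge0 _) (vnorm_phi_le 0 0).
apply: le_trans (integral_le_Rintegral _ _ _ (rintegrableZ (S ^+ 2) iP)) _.
- exact: (measurableT_comp measurable_dbar_sqr (measurable_pair1 t)).
- by move=> x; exact: dbar_sqr_ge0.
- move=> x; rewrite pdensityE -exprMn; apply: lerXn2r; rewrite ?nnegrE ?cmod_ge0//.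
    by apply: mulr_ge0 => //; exact: vnorm_ge0.
  apply: le_trans (cmod_dbar cg hg _ _) _; apply: ler_wpM2r; first exact: vnorm_ge0.
  exact: vnorm_phi_le.
rewrite lee_fin (RintegralZl _ measurableT iP).
apply: le_trans (ler_wpM2l (sqr_ge0 S) IP) _.
rewrite mass_boundE /slice_const /S (_ : rho ^+ (3 * d) = (rho ^+ d) ^+ 3); last by rewrite mulnC exprM.
rewrite le_eqVlt; apply/orP; left; apply/eqP.
by move: (N.+1%:R * _) (rho ^+ d) => u v; ring.
Qed.

Lemma slice_int_ge0 t : (0 <= slice_int t)%E.
Proof. by apply: integral_ge0 => x _; rewrite lee_fin; exact: dbar_sqr_ge0. Qed.

Lemma slice_intE t : slice_int t = (slice_energy t)%:E.
Proof.
rewrite /slice_energy fineK// ge0_fin_numE ?slice_int_ge0//.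
exact: le_lt_trans (slice_int_le t) (ltry _).
Qed.

Lemma slice_energy_ge0 t : 0 <= slice_energy t.
Proof. by rewrite -lee_fin -slice_intE slice_int_ge0. Qed.

Lemma slice_energy_le t : slice_energy t <= slice_const * (rho ^+ (3 * d) * (nL1 f * nL1 g) ^+ 2).
Proof. by rewrite -lee_fin -slice_intE slice_int_le. Qed.

Lemma measurable_slice_int : measurable_fun [set: measurableTypeR R] slice_int.
Proof.
apply: (@measurable_fun_fubini_tonelli_F _ _ _ _ R (vmu d) (fun p : TX => (dbar_sqr p.1 p.2)%:E)).
  by apply/measurable_EFinP; exact: measurable_dbar_sqr.
by move=> p; rewrite lee_fin; exact: dbar_sqr_ge0.
Qed.

Lemma measurable_slice_energy : measurable_fun [set: measurableTypeR R] slice_energy.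
Proof. by apply/measurable_EFinP; apply: eq_measurable_fun measurable_slice_int => t _ /=; rewrite slice_intE. Qed.

Lemma block_int_slice_energy T : block_int (d := d) T (fun p => dbar_sqr p.1 p.2) = (\int[leb]_t (chi T t * slice_energy t)%:E)%E.
Proof.
rewrite /block_int (fubini_tonelli1 (m1 := leb) (m2 := vmu d) (fun p : TX => (chi T p.1 * dbar_sqr p.1 p.2)%:E)); last 2 first.
- apply/measurable_EFinP; apply: measurable_funM; last exact: measurable_dbar_sqr.
  exact: (measurableT_comp (rintegrable_measurable (rintegrable_chi T)) measurable_fst).
- by move=> p; rewrite lee_fin; apply: mulr_ge0; [exact: chi_ge0|exact: dbar_sqr_ge0].
apply: eq_integral => t _; rewrite /fubini_F/=; under eq_integral do rewrite EFinM.
rewrite ge0_integralZl; [|exact: measurableT| |by move=> x _; rewrite lee_fin; exact: dbar_sqr_ge0|by rewrite lee_fin; exact: chi_ge0].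
  by rewrite EFinM -slice_intE.
by apply/measurable_EFinP; exact: (measurableT_comp measurable_dbar_sqr (measurable_pair1 t)).
Qed.

End onegamma.

Lemma slice_energy_opp (gamma : 'I_d.+1 -> 'M[R[i]]_N) t : slice_energy gamma (- t) = slice_energy (gflip gamma) t.
Proof.
have gg : gflip (gflip gamma) = gamma.
  by apply/funext => i; rewrite /gflip; case: (val i == 0%N); rewrite ?opprK.
have E u (us : fourier_supp_ball u rho) x : phi gamma m u (- t) x = phi (gflip gamma) m u t x.
  have E1 : mult (gflip gamma) m (fun xi => phase m (1 * - t) xi * 1) u x =
     mult (gflip gamma) m (fun xi => phase m (-1 * t) xi * 1) u x.
    by apply: (mult_eq (gflip gamma) m us) => xi _; rewrite mulrN mulNr.
  have E2 : mult gamma m (fun xi => phase m (-1 * - t) xi * 1) u x =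
     mult gamma m (fun xi => phase m (1 * t) xi * 1) u x.
    by apply: (mult_eq gamma m us) => xi _; rewrite mulrN mulNr opprK.
  rewrite /phi /wave gg; exact: (etrans (congr2 +%R E2 E1) (addrC _ _)).
have S x : dbar_sqr gamma (- t) x = dbar_sqr (gflip gamma) t x.
  rewrite /dbar_sqr (E f fsupp x) (E g gsupp x); congr (_ ^+ 2).
  exact: (dbar_gsign gamma true).
have H : slice_int gamma (- t) = slice_int (gflip gamma) t by apply: eq_integral => x _; rewrite S.
by rewrite /slice_energy H.
Qed.

End TimeFunction.

(** * Summation over the dyadic blocks *)

Section Dyadic.
Context {R : realType}.

(** Below [a] the power is at most [a ^ p], above it [(u / a) ^ p <= u / a]. The power is thereby
    linearised: on a block only its length and the integral of [u] are needed. *)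
Lemma powR_le_affine (u a p : R) : 0 <= u -> 0 < a -> 0 < p -> p <= 1 ->
  powR u p <= powR a p * (1 + u / a).
Proof.
move=> u0 a0 p0 p1.
have E : powR u p = powR a p * powR (u / a) p.
  by rewrite -powRM ?divr_ge0 ?(ltW a0)// mulrC divfK// gt_eqF.
rewrite E; apply: ler_wpM2l; first exact: powR_ge0.
have v0 : 0 <= u / a by rewrite divr_ge0// ltW.
have [v1|v1] := leP (u / a) 1.
  apply: (@le_trans _ _ 1); last by rewrite lerDl.
  apply: (@le_trans _ _ (powR 1 p)); last by rewrite powR1.
  by apply: (ge0_ler_powR (ltW p0)); rewrite ?nnegrE.
apply: (@le_trans _ _ (powR (u / a) 1)); last by rewrite powRr1// lerDr.
by apply: ler_powR => //; exact: ltW.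
Qed.

Variables (r : R -> R) (M c0 cB rho p xi : R) (w : nat -> R).
Hypotheses (mr : measurable_fun [set: measurableTypeR R] r) (r0 : forall t, 0 <= r t).
Hypotheses (M0 : 0 < M) (c00 : 0 <= c0) (cB0 : 0 <= cB) (rho0 : 0 < rho) (p0 : 0 < p) (p1 : p <= 1).
Hypothesis rM : forall t, r t <= c0 * M.
Hypothesis w0 : forall k, 0 < w k.
Hypothesis rB : forall k, (\int[leb]_t (chi (2 ^+ k / rho) t * r t)%:E <= (cB * (w k * M * (2 ^+ k / rho)))%:E)%E.
Hypothesis rB' : forall k, (\int[leb]_t (chi (2 ^+ k / rho) t * r (- t))%:E <= (cB * (w k * M * (2 ^+ k / rho)))%:E)%E.
Hypotheses (xi0 : 0 <= xi) (xi1 : xi < 1).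
Hypothesis wxi : forall k, 2 ^+ k * powR (w k) p <= xi ^+ k.

Let mopp : measurable_fun [set: measurableTypeR R] (fun t : measurableTypeR R => - t : measurableTypeR R).
Proof. by apply: measurable_funN; exact: measurable_id. Qed.

Let mchi T : measurable_fun [set: measurableTypeR R] (chi T).
Proof. exact: rintegrable_measurable (rintegrable_chi T). Qed.

Let block1 (s : R -> R) k : measurable_fun [set: measurableTypeR R] s -> (forall t, 0 <= s t) ->
  (\int[leb]_t (chi (2 ^+ k / rho) t * s t)%:E <= (cB * (w k * M * (2 ^+ k / rho)))%:E)%E ->
  rintegrable leb (fun t => chi (2 ^+ k / rho) t * powR (s t) p) /\
  \int[leb]_t (chi (2 ^+ k / rho) t * powR (s t) p) <= (1 + cB) * (powR M p / rho) * xi ^+ k.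
Proof.
move=> ms s0 sB.
have T0 : 0 < 2 ^+ k / rho by rewrite divr_gt0// exprn_gt0.
set T := 2 ^+ k / rho in T0 sB *.
(* By [sB] the mean of [s] over the block is at most [cB] times [w k * M], which is therefore the
   scale for [powR_le_affine]. *)
have a0 : 0 < w k * M by exact: mulr_gt0.
have m1 : measurable_fun [set: measurableTypeR R] (fun t => chi T t * s t) by exact: measurable_funM.
have [i1 I1] : rintegrable leb (fun t => chi T t * s t) /\ \int[leb]_t (chi T t * s t) <= cB * (w k * M * T).
  by apply: rintegrable_of_le => // t; apply: mulr_ge0 => //; exact: chi_ge0.
have iD := rintegrableD (rintegrable_chi T) (rintegrableZ ((w k * M)^-1) i1).
have iZ := rintegrableZ (powR (w k * M) p) iD.
apply: rintegrable_of_le.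
- apply: measurable_funM => //; exact: (measurableT_comp (measurable_powR p) ms).
- by move=> t; apply: mulr_ge0; [exact: chi_ge0|exact: powR_ge0].
apply: le_trans (integral_le_Rintegral _ _ _ iZ) _.
- apply: measurable_funM => //; exact: (measurableT_comp (measurable_powR p) ms).
- by move=> t; apply: mulr_ge0; [exact: chi_ge0|exact: powR_ge0].
- move=> t; rewrite [X in _ <= X](_ : _ = chi T t * (powR (w k * M) p * (1 + s t / (w k * M)))); last by ring.
  by apply: ler_wpM2l; [exact: chi_ge0|exact: powR_le_affine].
rewrite lee_fin (RintegralZl _ measurableT iD).
rewrite (RintegralD measurableT (rintegrable_chi T) (rintegrableZ ((w k * M)^-1) i1)).
rewrite (RintegralZl _ measurableT i1) (Rintegral_chi T0).
have h : T + (w k * M)^-1 * \int[leb]_t (chi T t * s t) <= (1 + cB) * T.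
  have := ler_wpM2l (_ : 0 <= (w k * M)^-1) I1; rewrite invr_ge0 (ltW a0) => /(_ isT).
  have -> : (w k * M)^-1 * (cB * (w k * M * T)) = cB * T.
    by move: (w k * M) a0 => a a0; field; rewrite gt_eqF.
  by move: (\int[_]_t _) => u; lra.
apply: le_trans (ler_wpM2l (powR_ge0 _ _) h) _.
rewrite powRM ?(ltW (w0 k)) ?(ltW M0)// /T.
rewrite [X in X <= _](_ : _ = (1 + cB) * (powR M p / rho) * (2 ^+ k * powR (w k) p)); last by ring.
apply: ler_wpM2l => //; apply: mulr_ge0; first by rewrite addr_ge0.
by apply: divr_ge0; [exact: powR_ge0|exact: ltW].
Qed.

Let u t := powR (r t) p.
Let mu_ : measurable_fun [set: measurableTypeR R] u.
Proof. exact: (measurableT_comp (measurable_powR p) mr). Qed.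
Let u0 t : 0 <= u t. Proof. exact: powR_ge0. Qed.

Let block_pos k := @block1 r k mr r0 (rB k).

Let block_neg k : rintegrable leb (fun t => chi (2 ^+ k / rho) (- t) * u t) /\
  \int[leb]_t (chi (2 ^+ k / rho) (- t) * u t) <= (1 + cB) * (powR M p / rho) * xi ^+ k.
Proof.
have mr' : measurable_fun [set: measurableTypeR R] (fun t => r (- t)) by exact: (measurableT_comp mr mopp).
have [i I] := @block1 (fun t => r (- t)) k mr' (fun t => r0 (- t)) (rB' k).
apply: rintegrable_of_le.
- by apply: measurable_funM => //; exact: (measurableT_comp (mchi _) mopp).
- by move=> t; apply: mulr_ge0 => //; exact: chi_ge0.
have mE : measurable_fun [set: measurableTypeR R] (fun t => (chi (2 ^+ k / rho) t * powR (r (- t)) p)%:E).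
  apply/measurable_EFinP; apply: measurable_funM; first exact: mchi.
  exact: (measurableT_comp (measurable_powR p) mr').
have := ge0_integral_opp (f := fun t => (chi (2 ^+ k / rho) t * powR (r (- t)) p)%:E).
move=> h; rewrite [X in (X <= _)%E](_ : _ = \int[leb]_t (chi (2 ^+ k / rho) t * powR (r (- t)) p)%:E)%E; last first.
  rewrite -h.
  - by apply: eq_integral => t _; rewrite opprK.
  - exact: mE.
  - by move=> t; rewrite lee_fin; apply: mulr_ge0; [exact: chi_ge0|exact: powR_ge0].
apply: le_trans (_ : ((\int[leb]_t (chi (2 ^+ k / rho) t * powR (r (- t)) p))%:E <= _)%E); last by rewrite lee_fin.
by rewrite /Rintegral fineK//; exact: (integrable_fin_num measurableT i).
Qed.

Definition ball_ind (n : nat) (t : R) : R := \1_(`[- (2 ^+ n / rho), 2 ^+ n / rho]%classic : set R) t.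

Let ball_indE n t : ball_ind n t = (`|t| <= 2 ^+ n / rho)%R%:R.
Proof.
rewrite /ball_ind indicE.
have -> : (t \in (`[- (2 ^+ n / rho), 2 ^+ n / rho]%classic : set R)) = (`|t| <= 2 ^+ n / rho); last by [].
by apply/idP/idP => [|h]; [rewrite inE/= in_itv/= -ler_norml|rewrite inE/= in_itv/= -ler_norml].
Qed.

(** Doubling the radius adds the block of index [n] in both time directions. *)
Let ball_ind_le n t : ball_ind n t <= ball_ind 0 t + \sum_(k < n) (chi (2 ^+ k / rho) t + chi (2 ^+ k / rho) (- t)).
Proof.
elim: n => [|n IH]; first by rewrite big_ord0 addr0.
rewrite big_ord_recr/= addrA; have [tn|tn] := leP `|t| (2 ^+ n / rho).
  apply: (@le_trans _ _ (ball_ind n t)); first by rewrite (ball_indE n.+1) (ball_indE n) tn ler_nat leq_b1.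
  by apply: le_trans IH _; rewrite lerDl addr_ge0// chi_ge0.
have S0 : 0 <= ball_ind 0 t + \sum_(k < n) (chi (2 ^+ k / rho) t + chi (2 ^+ k / rho) (- t)).
  apply: addr_ge0; first by rewrite ball_indE.
  by apply: sumr_ge0 => k _; rewrite addr_ge0// chi_ge0.
apply: le_trans (_ : chi (2 ^+ n / rho) t + chi (2 ^+ n / rho) (- t) <= _); last by rewrite lerDr.
rewrite ball_indE exprS -mulrA; have [tn2|_] := leP `|t| (2 * (2 ^+ n / rho)); last by rewrite addr_ge0// chi_ge0.
have [t0|t0] := leP 0 t.
  rewrite (ger0_norm t0) in tn tn2.
  have -> : chi (2 ^+ n / rho) t = 1.
    by rewrite /chi indicE mem_set//= in_itv/= (ltW tn) tn2.
  by rewrite lerDl chi_ge0.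
rewrite (ltr0_norm t0) in tn tn2.
have -> : chi (2 ^+ n / rho) (- t) = 1.
  by rewrite /chi indicE mem_set//= in_itv/= (ltW tn) tn2.
by rewrite lerDr chi_ge0.
Qed.

(** The first term stems from the interval [|t| <= 1 / rho] of length [2 / rho], the second from the
    geometric series over the blocks of both time directions. *)
Definition dyadic_const : R := 2 * powR c0 p + 2 * (1 + cB) / (1 - xi).

Let i0 n : rintegrable leb (ball_ind n). Proof. exact: integrable_indic_itv. Qed.

Let I0 : \int[leb]_t ball_ind 0 t = 2 / rho.
Proof.
have q0 : 0 < rho^-1 by rewrite invr_gt0.
rewrite /Rintegral integral_indic// setIT /leb /= lebesgue_measure_itv/= lte_fin expr0 mul1r.
have -> : - rho^-1 < rho^-1 by lra.
by rewrite /= opprK; lra.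
Qed.

Let part n : (\int[leb]_t (ball_ind n t * u t)%:E <= (powR M p / rho * dyadic_const)%:E)%E.
Proof.
have uM t : u t <= powR c0 p * powR M p.
  by rewrite -powRM ?(ltW M0)//; apply: (ge0_ler_powR (ltW p0)); rewrite ?nnegrE// mulr_ge0// ltW.
have d0 n' t : 0 <= ball_ind n' t by rewrite ball_indE.
have iB (k : 'I_n) := rintegrableD (block_pos k).1 (block_neg k).1.
have [iS IS] := Rintegral_sum iB.
have iA := rintegrableZ (powR c0 p * powR M p) (i0 0).
apply: le_trans (integral_le_Rintegral _ _ _ (rintegrableD iA iS)) _.
- by apply: measurable_funM => //; exact: rintegrable_measurable (i0 n).
- by move=> t; apply: mulr_ge0.
- move=> t; apply: le_trans (ler_wpM2r (u0 t) (ball_ind_le n t)) _.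
  rewrite mulrDl; apply: lerD; first by rewrite mulrC; apply: ler_wpM2r.
  by rewrite mulr_suml; apply: ler_sum => k _; rewrite mulrDl.
rewrite lee_fin (RintegralD measurableT iA iS) (RintegralZl _ measurableT (i0 0)) I0 IS.
have Mr : 0 <= powR M p / rho by apply: divr_ge0; [exact: powR_ge0|exact: ltW].
apply: (@le_trans _ _ (powR c0 p * powR M p * (2 / rho) + \sum_(k < n) 2 * ((1 + cB) * (powR M p / rho) * xi ^+ k))).
  rewrite lerD2l; apply: ler_sum => k _.
  rewrite (RintegralD measurableT (block_pos k).1 (block_neg k).1).
  by apply: le_trans (lerD (block_pos k).2 (block_neg k).2) _; rewrite mulr_natl mulr2n.
have geo : \sum_(k < n) xi ^+ k <= (1 - xi)^-1.
  have x1 : 0 < 1 - xi by rewrite subr_gt0.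
  rewrite -[X in _ <= X]mul1r ler_pdivlMr// mulrC.
  by rewrite -opprB mulNr -subrX1 opprB gerBl exprn_ge0.
rewrite (eq_bigr (fun k : 'I_n => 2 * (1 + cB) * (powR M p / rho) * xi ^+ k)); last by move=> k _; ring.
rewrite -mulr_sumr.
rewrite [X in _ <= X](_ : _ = powR c0 p * powR M p * (2 / rho) + 2 * (1 + cB) * (powR M p / rho) * (1 - xi)^-1); last first.
  by rewrite /dyadic_const; move: (1 - xi)^-1 (powR M p) (powR c0 p) rho^-1 => z1 z2 z3 z4; ring.
rewrite lerD2l; apply: ler_wpM2l => //.
by apply: mulr_ge0 => //; rewrite mulr_ge0// addr_ge0.
Qed.

Lemma dyadic_bound : (\int[leb]_t (powR (r t) p)%:E <= (powR M p / rho * dyadic_const)%:E)%E.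
Proof.
pose F n : set (measurableTypeR R) := `[- (2 ^+ n / rho), 2 ^+ n / rho]%classic.
have FE n t : F n t = (`|t| <= 2 ^+ n / rho).
  by rewrite /F /= in_itv/= ler_norml.
have UF : \bigcup_n F n = setT.
  rewrite -subTset => t _; exists (Num.truncn (`|t| * rho)).+1 => //.
  rewrite FE ler_pdivlMr//; apply: ltW; apply: lt_le_trans (truncnS_gt _) _.
  by rewrite -natrX ler_nat; apply: ltnW; exact: ltn_expl.
rewrite -UF.
have := @ge0_nondecreasing_set_cvg_integral _ _ R F (fun t => (u t)%:E) leb.
move=> /(_ _ _ _ _)/lee_cvg_to; apply.
- move=> n k nk; apply/subsetPset => t; rewrite !FE => h; apply: le_trans h _.
  by rewrite ler_wpM2r ?invr_ge0 ?(ltW rho0)// ler_eXn2l ?ltr1n.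
- by move=> n; exact: measurable_itv.
- by move=> n; apply: measurable_funTS; apply/measurable_EFinP.
- by move=> n t _; rewrite lee_fin.
- exact: cvg_cst.
- apply: nearW => n; rewrite integral_mkcond; apply: le_trans (part n).
  rewrite le_eqVlt; apply/orP; left; apply/eqP; apply: eq_integral => t _.
  by rewrite patchE /ball_ind indicE; case: (t \in _); rewrite ?mul1r ?mul0r.
Qed.

End Dyadic.

(** * Exponents and conclusion *)

Section Exponents.
Context {R : realType}.

Lemma dyscale_powR k : dyscale k = powR (2 : R) (- (k%:R / 2)).
Proof.
rewrite /dyscale -powR12_sqrt ?invr_ge0 ?exprn_ge0// -powR_mulrn//.
by rewrite -powRN -powRrM mulNr.
Qed.

(** Everything is written as a power of two; the one inequality used is that the integer quotient
    [k %/ J] is at most [k / J]. *)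
Lemma weight_powR (d J k : nat) (q : R) : (0 < J)%N -> 0 < q ->
  2 ^+ k * powR (4 ^+ (k %/ J) * dyscale k ^+ d.+1) (q / 2) <=
  powR 2 (1 + q / J%:R - q * (d%:R + 1) / 4) ^+ k.
Proof.
move=> J0 q0.
have J0' : 0 < J%:R :> R by rewrite ltr0n.
have s0 : 0 <= dyscale k :> R by exact: sqrtr_ge0.
have E2 : (2 : R) ^+ k = powR 2 k%:R by rewrite powR_mulrn.
have E4 : (4 : R) ^+ (k %/ J) = powR 2 (2 * (k %/ J)%:R).
  by rewrite powRrM -[X in powR (powR _ X) _]/(2%:R) powR_mulrn// powR_mulrn ?exprn_ge0//; congr (_ ^+ _); ring.
have Es : (dyscale k : R) ^+ d.+1 = powR 2 (- (k%:R / 2) * d.+1%:R).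
  by rewrite powRrM -dyscale_powR powR_mulrn.
have two0 (a : R) : (a == 0) ==> ((2 : R) != 0) by rewrite pnatr_eq0 implybT.
rewrite E2 E4 Es -powRD//.
rewrite -powRrM -powRD//.
rewrite -powR_mulrn ?powR_ge0// -powRrM; apply: ler_powR; first by rewrite ler1n.
have hk : (k %/ J)%:R <= k%:R / J%:R :> R.
  by rewrite ler_pdivlMr// -natrM ler_nat leq_divM.
have h2 := ler_wpM2l (ltW q0) hk.
rewrite -[d.+1%:R]natr1.
rewrite [X in X <= _](_ : _ = k%:R + q * (k %/ J)%:R - k%:R * (q * (d%:R + 1) / 4)); last first.
  by field.
rewrite [X in _ <= X](_ : _ = k%:R + q * (k%:R / J%:R) - k%:R * (q * (d%:R + 1) / 4)); last first.
  by ring.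
by rewrite lerD2r lerD2l.
Qed.

Lemma powR_final (rho q X Ct F : R) n : 0 < rho -> 0 < q -> 0 <= Ct -> 0 <= F -> X = n%:R / 2 - q^-1 ->
  powR (powR (rho ^+ n * F ^+ 2) (q / 2) / rho * Ct) q^-1 = powR Ct q^-1 * powR rho X * F.
Proof.
move=> r0 q0 c0 F0 ->; have r0' := ltW r0.
have M0 : 0 <= rho ^+ n * F ^+ 2 by apply: mulr_ge0; [exact: exprn_ge0|exact: sqr_ge0].
rewrite powRM//; last by rewrite mulr_ge0 ?powR_ge0// invr_ge0.
rewrite powRM ?powR_ge0 ?invr_ge0// -powRrM.
have -> : q / 2 * q^-1 = 2^-1 by field; rewrite gt_eqF.
rewrite powR12_sqrt// sqrtrM ?exprn_ge0// sqrtr_sqr (ger0_norm F0).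
have -> : Num.sqrt (rho ^+ n) = powR rho (n%:R / 2).
  by rewrite powRrM powR_mulrn// powR12_sqrt// exprn_ge0.
have -> : powR rho^-1 q^-1 = powR rho (- q^-1).
  by rewrite -(powR_inv1 r0') -powRrM mulN1r.
rewrite powRD; last by apply/implyP => _; rewrite gt_eqF.
by ring.
Qed.

End Exponents.

Theorem theorem4p5 (R : realType) (d N : nat) (gamma : 'I_d.+1 -> 'M[R[i]]_N) :
  (2 <= d)%N -> clifford gamma -> hermitian_gammas gamma ->
  forall q : R, 1 / 2 <= q^-1 -> q^-1 < (d%:R + 1) / 4 ->
  exists C : R, 0 < C /\
    forall (rho : R) (f g : 'rV[R]_d -> 'cV[R[i]]_N),
      2 < rho -> in_L1 f -> in_L1 g ->
      fourier_supp_ball f rho -> fourier_supp_ball g rho ->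
      forall m : R, `|m| <= 1 ->
        (LqL2 q (fun t x => dbar gamma (dirac_prop gamma m t f x)
                                       (dirac_prop gamma m t g x))
         <= (C * powR rho (3 * d%:R / 2 - q^-1))%:E * L1norm f * L1norm g)%E.
Proof.
move=> d2 cg hg q q1 q2.
have qi : 0 < q^-1 by apply: lt_le_trans q1; rewrite divr_gt0.
have q0 : 0 < q by rewrite -invr_gt0.
have qle : q <= 2 by rewrite -[q]invrK -[2]invrK lef_pV2 ?posrE ?invr_gt0// -div1r.
(* The gap in the strict hypothesis, scaled by [q]: the decay exponent per block before the binomial
   loss. *)
pose kap := q * (d%:R + 1) / 4 - 1.
have kap0 : 0 < kap.
  have := q2; rewrite -(ltr_pM2l q0) divff ?gt_eqF// mulrA => h.
  by rewrite /kap subr_gt0.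
(* Large enough for the binomial loss [q / J] to use up less than the gap. *)
pose J := (Num.truncn (q / kap)).+1.
have J0 : (0 < J)%N by [].
have qJ : q / J%:R < kap.
  rewrite ltr_pdivrMr ?ltr0n// mulrC -ltr_pdivrMr//; exact: truncnS_gt.
pose xi : R := powR 2 (1 + q / J%:R - q * (d%:R + 1) / 4).
have xi1 : xi < 1.
  rewrite /xi /powR pnatr_eq0/= -[X in _ < X]expR0 ltr_expR pmulr_llt0 ?ln_gt0 ?ltr1n//.
  by move: qJ; rewrite /kap; lra.
have xi0 : 0 <= xi by exact: powR_ge0.
have cg' := gflip_clifford cg; have hg' := gflip_hermitian hg.
have [CB1 CB10 B1] := block_all cg hg d2 J0.
(* Negative times are positive times for the flipped matrices, with their own block constant. *)
have [CB2 CB20 B2] := block_all cg' hg' d2 J0.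
have p0 : 0 < q / 2 by rewrite divr_gt0.
have p1 : q / 2 <= 1 by rewrite ler_pdivrMr// mul1r.
pose Ct := dyadic_const (slice_const gamma) (CB1 + CB2) (q / 2) xi.
have Ct0 : 0 < Ct.
  rewrite /Ct /dyadic_const ltr_wpDl ?mulr_ge0 ?powR_ge0// divr_gt0 ?subr_gt0// mulr_gt0//.
  by rewrite ltr_wpDr ?ltr01// addr_ge0.
exists (powR Ct q^-1); split; first exact: powR_gt0.
move=> rho f g rho2 f1 g1 fs gs m m1.
have rho1 : 1 <= rho by move: rho2; lra.
have rho0 : 0 < rho by exact: lt_le_trans rho1.
rewrite (L1norm_fin f1) (L1norm_fin g1) -!EFinM.
have F0 := nL1_ge0 f1; have G0 := nL1_ge0 g1.
have E t : iint (fun x => (cmod (dbar gamma (dirac_prop gamma m t f x) (dirac_prop gamma m t g x)) ^+ 2)%:E) =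
   (slice_energy m f g gamma t)%:E.
  rewrite -(slice_intE m rho0 f1 fs g1 gs cg hg) /slice_int.
  rewrite (_ : (fun x => _) = (fun x => (dbar_sqr m f g gamma t x)%:E)); last first.
    by apply/funext => x; rewrite (phiE m cg f1 fs (ltW rho0)) (phiE m cg g1 gs (ltW rho0)).
  apply: iintE.
    by apply/measurable_EFinP; exact: (measurableT_comp (measurable_dbar_sqr m rho f1 g1 gamma) (measurable_pair1 t)).
  by move=> x; rewrite lee_fin; exact: dbar_sqr_ge0.
rewrite /LqL2; under eq_integral do rewrite E poweR_EFin.
have r0 t : 0 <= slice_energy m f g gamma t by exact: (slice_energy_ge0 m rho0 f1 fs g1 gs cg hg).
have rM t := slice_energy_le m rho0 f1 fs g1 gs cg hg t.
have X0 : 0 <= powR rho (3 * d%:R / 2 - q^-1) by exact: powR_ge0.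
(* [dyadic_bound] needs a positive [M]; if one of the norms is zero, every slice vanishes. *)
have [FG|FG] := eqVneq (nL1 f * nL1 g) 0.
  rewrite (_ : (fun t => _) = cst 0%E); last first.
    apply/funext => t; have := rM t; rewrite FG expr0n/= mulr0 mulr0 => h.
    have -> : slice_energy m f g gamma t = 0 by apply/eqP; rewrite eq_le h r0.
    by rewrite powR0// gt_eqF.
  rewrite integral0 poweR0r ?gt_eqF// lee_fin.
  by rewrite !mulr_ge0// powR_ge0.
have F1 : 0 < nL1 f by rewrite lt_neqAle F0 andbT eq_sym; apply: contra_neq FG => ->; rewrite mul0r.
have FG0 : 0 < nL1 f * nL1 g by rewrite lt_neqAle eq_sym FG mulr_ge0.
pose M := rho ^+ (3 * d) * (nL1 f * nL1 g) ^+ 2.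
have M0 : 0 < M by rewrite mulr_gt0// exprn_gt0.
(* [block_weight] divided by [M] and by the length [2 ^+ k / rho] of the block; this division raises
   the power of [dyscale k] by two. *)
pose w k : R := 4 ^+ (k %/ J) * dyscale k ^+ d.+1.
have w0 k : 0 < w k by rewrite mulr_gt0 ?exprn_gt0 ?dyscale_gt0.
have WE k : block_weight J rho f g k = w k * M * (2 ^+ k / rho).
  have -> : (2 : R) ^+ k = (dyscale k ^+ 2)^-1 by rewrite dyscale_sqr invrK.
  rewrite /block_weight /w /M (_ : dyscale k ^+ d.+1 = dyscale k ^+ d.-1 * dyscale k ^+ 2); last first.
    by rewrite -exprD; congr (_ ^+ _); rewrite addn2 prednK// ltnW.
  have s2 : 0 < (dyscale k : R) ^+ 2 by rewrite exprn_gt0// dyscale_gt0.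
  move: (dyscale k ^+ 2) s2 (dyscale k ^+ d.-1) (rho ^+ (3 * d)) (4 ^+ _) => s s0 v1 v2 v3.
  by field; rewrite !gt_eqF.
have W0 k : 0 <= block_weight J rho f g k.
  by rewrite WE; apply: mulr_ge0; [apply: mulr_ge0; exact: ltW|apply: divr_ge0; [exact: exprn_ge0|exact: ltW]].
have K := @dyadic_bound R (slice_energy m f g gamma) M (slice_const gamma) (CB1 + CB2) rho (q / 2) xi w.
have {}K : (\int[leb]_t (powR (slice_energy m f g gamma t) (q / 2))%:E <= (powR M (q / 2) / rho * Ct)%:E)%E.
  apply: K => //.
  - exact: (measurable_slice_energy m rho0 f1 fs g1 gs cg hg).
  - exact: slice_const_ge0.
  - exact: addr_ge0.
  - move=> k; rewrite -(block_int_slice_energy m rho0 f1 fs g1 gs cg hg).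
    apply: le_trans (B1 m rho f g k m1 rho1 f1 fs g1 gs F1) _.
    by rewrite -WE lee_fin ler_wpM2r// lerDl.
  - move=> k; under eq_integral do rewrite (slice_energy_opp m fs gs).
    rewrite -(block_int_slice_energy m rho0 f1 fs g1 gs cg' hg').
    apply: le_trans (B2 m rho f g k m1 rho1 f1 fs g1 gs F1) _.
    by rewrite -WE lee_fin ler_wpM2r// lerDr.
  - by move=> k; exact: weight_powR.
have qi0 := ltW qi.
apply: le_trans (gt0_ler_poweR qi0 _ _ K) _.
- by rewrite in_itv/= leey andbT; apply: integral_ge0 => t _; rewrite lee_fin powR_ge0.
- rewrite in_itv/= leey andbT lee_fin mulr_ge0 ?(ltW Ct0)// divr_ge0 ?powR_ge0// ltW//.
(* The square root of [M] contributes [rho ^ (3 d / 2)], and the unit of time [1 / rho], raised to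
   [1 / q], the rest. *)
rewrite poweR_EFin lee_fin (@powR_final _ rho q (3 * d%:R / 2 - q^-1) Ct (nL1 f * nL1 g) (3 * d)) ?(ltW Ct0) ?(ltW FG0)//.
  by rewrite mulrA.
by rewrite natrM.
Qed.
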